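(* Let $M_{n,k,m}=\sum_{\alpha=1}^m\tau_\alpha Y_\alpha Y_\alpha^*$ be the random $n^k\times n^k$ Hermitian matrix defined in the context, with $|\xi_1|=1$. Suppose that for all $q\in\mathbb N$, $$\frac1m\sum_{j=1}^m\tau_j^q\to m_q^{(\tau)},\qquad m\to+\infty,$$ for some numbers $m_q^{(\tau)}\in\mathbb R$, and that $m,n,k$ tend to infinity with $m/n^k\to c$ for some constant $c\in(0,\infty)$. Suppose that there exists a positive constant $A$ such that $|m_q^{(\tau)}|\le A^q q^q$ for all $q\in\mathbb N$. Then there exists a probability measure $\mu$ on $\mathbb R$ whose moment sequence is $$\int_{\mathbb R}x^p\,\mu(dx)=\sum_{s=1}^p c^s\sum_{\alpha\in\mathcal C_{s,p}^{(1)}}\left(\prod_{t=1}^s m^{(\tau)}_{\deg_t(\alpha)}\right)\qquad\text{for all integers }p\ge1.$$ Moreover, suppose that $k=k(n)$ is a function of $n$ that tends to infinity as $n\to\infty$. Then the empirical spectral distribution (ESD) of $M_{n,k,m}$ converges almost surely to $\mu$. In particular, if $\tau_\alpha=1$ for all $1\le\alpha\le m$, then the ESD of $M_{n,k,m}$ converges almost surely to the Marčenko–Pastur law with parameter $c$.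
   Context: **Matrix model.** Let $\xi_1,\dots,\xi_n$ be i.i.d. complex-valued centered random variables with unit variance (the law of $\xi_1$ does not depend on $n$), and let $\mathbf y=\frac1{\sqrt n}(\xi_1,\dots,\xi_n)\in\mathbb C^n$. Let $\{\mathbf y_\alpha^{(l)}:1\le\alpha\le m,\,1\le l\le k\}$ be i.i.d. copies of $\mathbf y$, and let $Y_\alpha=\mathbf y_\alpha^{(1)}\otimes\cdots\otimes\mathbf y_\alpha^{(k)}$, viewed as an $n^k$-dimensional column vector. Let $(\tau_1,\tau_2,\dots)$ be a fixed sequence of real numbers, and $M_{n,k,m}=\sum_{\alpha=1}^m\tau_\alpha Y_\alpha Y_\alpha^*$, where $^*$ is conjugate transpose. The hypothesis $|\xi_1|=1$ means almost surely. For $k=k(n)$, $m=m(n)$ the matrices for different $n$ are defined on a common probability space. The convention $0^0=1$ is used if $q=0$ is included. **ESD.** The ESD of an $N\times N$ Hermitian matrix with eigenvalues $\lambda_1,\dots,\lambda_N$ is $\frac1N\sum_{j=1}^N\delta_{\lambda_j}$; almost sure convergence of the ESD to $\mu$ means that almost surely it converges weakly to $\mu$. **Marčenko–Pastur law** with parameter $c>0$: the probability measure $$\frac{\sqrt{((1+\sqrt c)^2-x)(x-(1-\sqrt c)^2)}}{2\pi x}\mathbf 1_{[(1-\sqrt c)^2,(1+\sqrt c)^2]}(x)\,dx+(1-c)\mathbf 1_{0<c<1}\,\delta_0(dx).$$ **Sequences.** Write $[s]=\{1,\dots,s\}$. A sequence $\alpha=(\alpha_1,\dots,\alpha_p)$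 of positive integers is canonical if $\alpha_1=1$ and $\alpha_u\le\max\{\alpha_1,\dots,\alpha_{u-1}\}+1$ for $u\ge2$. $\mathcal C_{s,p}$ is the set of canonical sequences of length $p$ with exactly $s$ distinct values (the set of values is then $[s]$). $\deg_t(\alpha)=\#\{j\in[p]:\alpha_j=t\}$. **Graphs.** For sequences $\alpha=(\alpha_1,\dots,\alpha_p)$ and $i=(i^{(1)},\dots,i^{(p)})$, with the convention $\alpha_{p+1}=\alpha_1$, $g(i,\alpha)$ is the directed bipartite multigraph whose vertices are the distinct values of $\alpha$ (''$\alpha$-vertices'', placed on one line) and the distinct values of $i$ (''$i$-vertices'', placed on another line; an $\alpha$-vertex and an $i$-vertex are always different vertices even if they have the same numerical value), with $p$ down edges $\alpha_u\to i^{(u)}$ and $p$ up edges $i^{(u)}\to\alpha_{u+1}$, $1\le u\le p$, counted with multiplicity. Two edges coincide if they join the same two vertices, irrespective of orientation. $g(i,\alpha)$ is a $\Delta_1(p,s;\alpha)$-graph (where $s$ is the number of distinct values of $\alpha$) if each down edge coincides with exactly one up edge and, after gluing each pair of coincident edges and removing orientation, the resulting graph is a tree with $p$ edges and $p+1$ vertices. $\mathcal C_{s,p}^{(1)}$ is the set of $\alpha\in\mathcal C_{s,p}$ for which there exists $i\in\mathcal C_{p+1-s,p}$ such that $g(i,\alpha)$ is a $\Delta_1(p,s;\alpha)$-graph. *)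

(* Defs.v *)
(* Families indexed by 1, 2, ... in the mathematics (tau_alpha, y_alpha^(l),
   xi_j) are indexed from 0 here; the combinatorial sequences alpha and i keep
   positive integer values. *)
From HB Require Import structures.
From mathcomp Require Import all_boot all_order all_algebra.
From mathcomp Require Import all_classical all_reals all_analysis.
From mathcomp Require Import measurable_realfun complex mxtens.

Set Implicit Arguments.
Unset Strict Implicit.
Unset Printing Implicit Defensive.

Import Order.TTheory GRing.Theory Num.Theory.
Import numFieldNormedType.Exports.

Local Open Scope classical_set_scope.
Local Open Scope ring_scope.
Local Open Scope complex_scope.

(* The Borel sigma-algebra of the complex plane, transported from R * R. *)
Section complex_measurable.
Context {R : realType}.

Definition complex_pair (z : R[i]) : measurableTypeR R * measurableTypeR R :=
  (complex.Re z, complex.Im z).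

Definition complex_measurable : set (set R[i]) :=
  preimage_set_system [set: R[i]] complex_pair measurable.

Let sigma_algebra_complex : sigma_algebra [set: R[i]] complex_measurable.
Proof.
by apply: sigma_algebra_preimage; exact: sigma_algebra_measurable.
Qed.

Let complex_measurable0 : complex_measurable set0.
Proof. by case: sigma_algebra_complex. Qed.

Let complex_measurableC A :
  complex_measurable A -> complex_measurable (~` A).
Proof.
by case: sigma_algebra_complex => _ + _ mA => /(_ _ mA); rewrite setTD.
Qed.

Let complex_measurable_bigcup (F : (set R[i])^nat) :
  (forall i, complex_measurable (F i)) -> complex_measurable (\bigcup_i F i).
Proof. by case: sigma_algebra_complex => _ _; apply. Qed.

HB.instance Definition _ := isPointed.Build R[i] (0 : R[i]).
HB.instance Definition _ := isMeasurable.Build default_measure_display R[i]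
  complex_measurable0 complex_measurableC complex_measurable_bigcup.

End complex_measurable.

Section random_variables.
Context {d : measure_display} {T : measurableType d} {R : realType}.
Variable P : probability T R.

Definition centered_unit_variance (xi : {RV P >-> R[i]}) : Prop :=
  [/\ ('E_P[fun w => complex.Re (xi w)] = 0)%E,
      ('E_P[fun w => complex.Im (xi w)] = 0)%E &
      ('E_P[fun w => (complex.Re (xi w) ^+ 2 + complex.Im (xi w) ^+ 2)%R] = 1)%E].

(* Product rule over the whole finite family; the rule for a subfamily is the
   case where E i is the whole space outside it. *)
Definition mutually_independent (I : finType) (X : I -> {RV P >-> R[i]}) :=
  forall E : I -> set R[i], (forall i, measurable (E i)) ->
    P [set w | forall i, E i (X i w)] = (\prod_(i : I) P (X i @^-1` E i))%E.

Definition same_law (X Y : {RV P >-> R[i]}) : Prop :=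
  forall E : set R[i], measurable E -> distribution P X E = distribution P Y E.

Definition iid_copies (xi : {RV P >-> R[i]})
    (I : finType) (X : I -> {RV P >-> R[i]}) : Prop :=
  mutually_independent X /\ forall i, same_law (X i) xi.

End random_variables.

Section matrix_model.
Context {R : realType}.

Definition yvec (n : nat) (x : 'I_n -> R[i]) : 'cV[R[i]]_n :=
  \col_(j < n) ((Num.sqrt (n%:R : R))^-1%:C * x j).

(* y 0 (x) y 1 (x) ... (x) y (k - 1), with Kronecker products. *)
Fixpoint tensor_vec (n k : nat) : ('I_k -> 'cV[R[i]]_n) -> 'cV[R[i]]_(n ^ k) :=
  match k with
  | 0 => fun _ => 1%:M
  | k'.+1 => fun y =>
      castmx (esym (expnSr n k'), muln1 1)
        (tensor_vec (fun l => y (widen_ord (leqnSn k') l)) *t y ord_max)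
  end.

Definition conj_transpose (p q : nat) (A : 'M[R[i]]_(p, q)) : 'M[R[i]]_(q, p) :=
  map_mx Num.conj A^T.

Definition Mmx (n k m : nat) (tau : nat -> R)
    (x : 'I_m -> 'I_k -> 'I_n -> R[i]) : 'M[R[i]]_(n ^ k) :=
  \sum_(a < m) let Y := tensor_vec (fun l => yvec (x a l)) in
    (tau a)%:C *: (Y *m conj_transpose Y).

(* Listed with algebraic multiplicity, see eigenvaluesP. *)
Definition eigenvalues (N : nat) (A : 'M[R[i]]_N) : seq R[i] :=
  sval (closed_field_poly_normal (char_poly A)).

Lemma eigenvaluesP (N : nat) (A : 'M[R[i]]_N) :
  size (eigenvalues A) = N /\ char_poly A = \prod_(z <- eigenvalues A) ('X - z%:P).
Proof.
rewrite /eigenvalues; case: (closed_field_poly_normal _) => r /= h.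
rewrite (monicP (char_poly_monic A)) scale1r in h; split => //.
by have := size_char_poly A; rewrite h size_prod_XsubC; case.
Qed.

(* The eigenvalues of a Hermitian matrix being real, Re only changes the type. *)
Definition esd (N : nat) (A : 'M[R[i]]_N) :
    {measure set (measurableTypeR R) -> \bar R} :=
  mscale (N%:R^-1)%:nng
    (msum (fun j => \d_(complex.Re (eigenvalues A)`_j : measurableTypeR R)) N).

Definition weak_cvg (nu : {measure set (measurableTypeR R) -> \bar R}^nat)
    (mu : {measure set (measurableTypeR R) -> \bar R}) : Prop :=
  forall f : R -> R, continuous f -> (exists B : R, forall x, `|f x| <= B) ->
    (\int[nu n]_x (f x)%:E)%E @[n --> \oo] --> (\int[mu]_x (f x)%:E)%E.

End matrix_model.

Section marchenko_pastur.
Context {R : realType}.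
Implicit Type c : R.

Definition mp_left c : R := (1 - Num.sqrt c) ^+ 2.
Definition mp_right c : R := (1 + Num.sqrt c) ^+ 2.

Definition mp_pdf c (x : R) : R :=
  Num.sqrt ((mp_right c - x) * (x - mp_left c)) / (2 * pi * x)
  * \1_`[mp_left c, mp_right c] x.

Definition mp_ac c (V : set (measurableTypeR R)) : \bar R :=
  (\int[lebesgue_measure]_(x in V) (mp_pdf c x)%:E)%E.

Let mp_pdf_ge0 c x : 0 <= mp_pdf c x.
Proof.
rewrite /mp_pdf indicE; case: (boolP (x \in _)) => [|_]; last by rewrite mulr0.
rewrite inE/= in_itv/= mulr1 => /andP[lex _].
rewrite divr_ge0 ?sqrtr_ge0// !mulr_ge0 ?pi_ge0//.
exact: le_trans (sqr_ge0 _) lex.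
Qed.

Let measurable_inv : measurable_fun [set: R] (fun x : R => x^-1).
Proof.
rewrite -(setUv [set (0 : R)]); apply/measurable_funU => //.
  exact: measurableC.
split; first exact: measurable_fun_set1.
apply: open_continuous_measurable_fun.
  exact/closed_openC/closed_eq.
by move=> x; rewrite inE/= => /eqP x0; exact: inv_continuous.
Qed.

Let measurable_mp_pdf c : measurable_fun [set: R] (mp_pdf c).
Proof.
apply: measurable_funM; last exact: measurable_indic.
apply: measurable_funM.
  apply: continuous_measurable_fun => x; apply: continuous_comp.
    by apply: cvgM; apply: cvgB; (exact: cvg_cst || exact: cvg_id).
  exact: sqrt_continuous.
by apply: (@measurableT_comp _ _ _ _ _ _ (fun x : R => x^-1)).
Qed.

Let mp_ac0 c : mp_ac c set0 = 0%E.
Proof. by rewrite /mp_ac integral_set0. Qed.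

Let mp_ac_ge0 c A : (0 <= mp_ac c A)%E.
Proof. by apply: integral_ge0 => x _; rewrite lee_fin. Qed.

Let mp_ac_sigma_additive c : semi_sigma_additive (mp_ac c).
Proof.
move=> /= F mF tF mUF; rewrite /mp_ac; apply: cvg_toP.
  apply: ereal_nondecreasing_is_cvgn => m n mn.
  apply: lee_sum_nneg_natr => // k _ _; apply: integral_ge0 => /= x Fkx.
  by rewrite lee_fin.
rewrite ge0_integral_bigcup//=.
- by apply/measurable_funTS/measurable_EFinP; exact: measurable_mp_pdf.
- by move=> x _; rewrite lee_fin.
Qed.

HB.instance Definition _ c := isMeasure.Build _ _ _
  (mp_ac c) (mp_ac0 c) (mp_ac_ge0 c) (@mp_ac_sigma_additive c).

Definition mp_atom c : R := if 0 < c < 1 then 1 - c else 0.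

Lemma mp_atom_ge0 c : 0 <= mp_atom c.
Proof.
by rewrite /mp_atom; case: ifP => // /andP[_ c1]; rewrite subr_ge0 ltW.
Qed.

Definition marchenko_pastur c : {measure set (measurableTypeR R) -> \bar R} :=
  measure_add (mp_ac c)
    (mscale (NngNum (mp_atom_ge0 c)) \d_(0 : measurableTypeR R)).

End marchenko_pastur.

Section combinatorics.
Local Open Scope nat_scope.

Definition canonical_seq (a : seq nat) : bool :=
  [&& all (leq 1) a, nth 0 a 0 == 1 &
      all (fun u => nth 0 a u <= (\max_(v <- take u a) v) + 1)
          (iota 1 (size a).-1)].

Definition vals (q : nat) (a : seq 'I_q) : seq nat := map val a.

(* C_{s,p}; the entries of a canonical sequence with s distinct values lie
   in [s], whence the range 'I_s.+1. *)
Definition Cseq (s p : nat) : {set p.-tuple 'I_s.+1} :=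
  [set a : p.-tuple 'I_s.+1 |
    canonical_seq (vals a) & size (undup (vals a)) == s].

Definition deg (t : nat) (a : seq nat) : nat := count_mem t a.

(* inl : alpha-vertices, inr : i-vertices. *)
Definition vertex : Type := (nat + nat)%type.

Definition alpha_vertex (x : nat) : vertex := inl x.
Definition i_vertex (x : nat) : vertex := inr x.

Definition gvertices (i a : seq nat) : seq vertex :=
  undup (map alpha_vertex a ++ map i_vertex i).

Definition down_edges (i a : seq nat) : seq (vertex * vertex) :=
  zip (map alpha_vertex a) (map i_vertex i).

(* rot 1 a is (alpha_2, ..., alpha_p, alpha_1). *)
Definition up_edges (i a : seq nat) : seq (vertex * vertex) :=
  zip (map i_vertex i) (map alpha_vertex (rot 1 a)).

Definition reverse_edge (e : vertex * vertex) : vertex * vertex := (e.2, e.1).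

Definition coincide (e f : vertex * vertex) : bool :=
  (f == e) || (f == reverse_edge e).

(* Up edges are reversed, so that all edges point from the alpha-line to the
   i-line; undup then glues exactly the coincident ones. *)
Definition glued_edges (i a : seq nat) : seq (vertex * vertex) :=
  undup (down_edges i a ++ map reverse_edge (up_edges i a)).

Definition glued_adj (i a : seq nat) : rel vertex :=
  fun v w => has (coincide (v, w)) (glued_edges i a).

Definition is_tree (V : seq vertex) (e : rel vertex) : Prop :=
  (forall v w, v \in V -> w \in V ->
     exists2 q : seq vertex, path e v q & last v q = w) /\
  (forall c : seq vertex, 2 < size c -> ~ ucycle e c).

Definition Delta1 (i a : seq nat) : Prop :=
  [/\ all (fun e => count (coincide e) (up_edges i a) == 1) (down_edges i a),
      size (glued_edges i a) = size a,
      size (gvertices i a) = (size a).+1 &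
      is_tree (gvertices i a) (glued_adj i a)].

Definition Cseq1 (s p : nat) : {set p.-tuple 'I_s.+1} :=
  [set a in Cseq s p |
    `[< exists2 i : p.-tuple 'I_(p + 1 - s).+1,
          i \in Cseq (p + 1 - s) p & Delta1 (vals i) (vals a) >]].

End combinatorics.

(* Main.v *)
Require Import Defs.
From HB Require Import structures.
From mathcomp Require Import all_boot all_order all_algebra.
From mathcomp Require Import all_classical all_reals all_analysis.
From mathcomp Require Import measurable_realfun complex spectral mxtens.
From mathcomp Require Import zify ring lra.

Set Implicit Arguments.
Unset Strict Implicit.
Unset Printing Implicit Defensive.

Import Order.TTheory GRing.Theory Num.Theory.
Import numFieldNormedType.Exports.

Local Open Scope classical_set_scope.
Local Open Scope ring_scope.

(** The proof is the method of moments. Write z(a, l, j) for the j-th entry of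
    sqrt n times the l-th factor of Y_a. The trace of M^p is a sum over words w
    of length p in the indices of the rank-one terms; since inner products of
    tensors are products of inner products, the summand of w is a product over
    the k tensor levels of sums over closed walks that alternate between the
    letters of w and values in [n] (trace_Mmx). The levels are independent, so
    the expectation of the summand is the k-th power of one number, the
    normalised walk sum of w.

    For unimodular centred entries this number is computed by reducing w. A
    repeated adjacent letter gives a free value (a factor n), a letter that
    occurs once forces two adjacent values to be equal, and rotations change
    nothing. A word that cannot be reduced in this way has few walks with a
    nonzero moment, because each value must be visited at least twice. Hence a
    noncrossing word with s letters has normalised walk sum exactly n^(1-s)
    (walk_sum_noncrossing), and a crossing word loses a factor C/n against this
    (walk_sum_crossing). After the k-th power and multiplication by the m^s
    labellings of the letters, with m of the order of n^k, crossing words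
    disappear as soon as k tends to infinity. The limit of the p-th mean moment
    is the sum of c^s times the product of the m_(deg_t) over canonical
    noncrossing words (mean_moment_cvg), and these are exactly the sequences
    that carry a tree in the definition of C^(1) (Cseq1P): a noncrossing word is
    the order in which the traversal of a plane tree meets one of its two
    vertex classes.

    In the variance, the only pairs of words that survive share a letter; two
    walks that share a letter glue to one walk, which saves a factor (C/n)^k.
    So the variance is O(n^-2) (variance_bound), which is summable, and each
    moment converges almost surely.

    To pass from moments to weak convergence, note that a noncrossing word is
    counted by the moments of the Marchenko-Pastur law, hence there are at most
    exponentially many, and |m_q| <= A^q q^q bounds the weights: the limit
    moments are at most K^p p! (limit_moment_growth). Under this bound,
    sin (t x) can be replaced by Taylor polynomials for t small, uniformly
    against the moments, so the moments determine the limits of the expectations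
    of polynomials in sin (t x), and by Bernstein approximation those of all
    bounded continuous functions (moment_cvg_weak).

    The measure mu is the limit of spectral distributions of matrices of the
    model with random signs as entries, averaged over all signs. The average
    spectra define positive functionals with converging moments; a limit along
    an ultrafilter is a positive functional on functions of polynomial growth,
    and its distribution function gives a Stieltjes measure with the right
    moments (moment_limit_measure, law_exists).

    For constant weights 1 the limit moments are the sums of c^s over noncrossing
    words, which satisfy the Narayana recursion (narayanaS: cut a noncrossing
    word at the second occurrence of its first letter). The Stieltjes transform
    of the Marchenko-Pastur law, an explicit integral, satisfies a quadratic
    equation; letting its argument tend to 0 gives total mass 1, and the
    expansion at infinity turns the equation into the same recursion for the
    moments (mp_moment_narayana). *)

(** * Noncrossing words *)

Section words.
Local Open Scope nat_scope.
Context {L : eqType}.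
Implicit Types (a b t x : L) (u v w : seq L).

(** Two letters never alternate as a b a b; as this pattern is invariant under
    cyclic shifts, words are treated as if they were written on a circle. *)
Definition noncrossing w : bool :=
  all (fun a => all (fun b => (a != b) ==> ~~ subseq [:: a; b; a; b] w) w) w.

Lemma noncrossingP w :
  reflect (forall a b, a != b -> ~~ subseq [:: a; b; a; b] w) (noncrossing w).
Proof.
apply: (iffP allP) => [h a b ab|h a _]; last first.
  by apply/allP => b _; apply/implyP => ab; exact: h.
apply/negP => s; have /mem_subseq sw := s.
have aw : a \in w by apply: sw; rewrite inE eqxx.
have bw : b \in w by apply: sw; rewrite !inE eqxx orbT.
by have /allP/(_ _ bw) := h _ aw; rewrite ab s.
Qed.

Lemma noncrossing_subseq v w : subseq v w -> noncrossing w -> noncrossing v.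
Proof.
move=> vw /noncrossingP h; apply/noncrossingP => a b ab.
by apply: contra (h _ _ ab) => s; exact: subseq_trans vw.
Qed.

Lemma subseq_consE x y u w :
  subseq (x :: u) (y :: w) = if x == y then subseq u w else subseq (x :: u) w.
Proof. by rewrite /=; case: eqP. Qed.

Lemma subseq_rconsE x y u w :
  subseq (rcons u x) (rcons w y) =
  if x == y then subseq u w else subseq (rcons u x) w.
Proof. by rewrite -subseq_rev !rev_rcons subseq_consE -rev_rcons !subseq_rev. Qed.

Lemma noncrossing_cons_rcons x w : noncrossing (x :: w) = noncrossing (rcons w x).
Proof.
have ss (y z : L) : subseq [:: y] w = (y \in w) by rewrite sub1seq.
apply/noncrossingP/noncrossingP => h a b ab.
- apply/negP; rewrite -[[:: a; b; a; b]]/(rcons [:: a; b; a] b) subseq_rconsE.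
  case: eqP => [bx|_] s.
    have := h b a; rewrite eq_sym ab => /(_ isT)/negP; apply.
    by rewrite subseq_consE bx eqxx -bx.
  have := h a b ab => /negP; apply.
  exact: subseq_trans s (subseq_cons _ _).
- apply/negP; rewrite subseq_consE; case: eqP => [ax|_] s.
    have := h b a; rewrite eq_sym ab => /(_ isT)/negP; apply.
    by rewrite -[[:: b; a; b; a]]/(rcons [:: b; a; b] a) subseq_rconsE ax eqxx -ax.
  have := h a b ab => /negP; apply.
  exact: subseq_trans s (subseq_rcons _ _).
Qed.

Lemma noncrossing_rot1 w : noncrossing (rot 1 w) = noncrossing w.
Proof. by case: w => [//|x w]; rewrite rot1_cons -noncrossing_cons_rcons. Qed.

Lemma rot_ind (P : seq L -> Prop) : (forall w, P w -> P (rot 1 w)) ->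
  forall n w, P w -> P (rot n w).
Proof.
move=> h n w Pw; have [nw|nw] := leqP n (size w); last by rewrite rot_oversize // ltnW.
elim: n nw => [|n IH] nw; first by rewrite rot0.
by rewrite -add1n rotD // ; apply: h; apply: IH; exact: ltnW.
Qed.

Lemma rot_indV (P : seq L -> Prop) : (forall w, P w -> P (rot 1 w)) ->
  forall n w, P (rot n w) -> P w.
Proof. by move=> h n w Pw; rewrite -(rotK n w) /rotr; exact: rot_ind. Qed.

(** Rotation moves the alternation a b a b to b a b a. *)
Lemma noncrossing_rot n w : noncrossing (rot n w) = noncrossing w.
Proof.
by apply/idP/idP; [apply: (rot_indV (P := noncrossing)) |
  apply: (rot_ind (P := noncrossing))] => v; rewrite noncrossing_rot1.
Qed.

Lemma noncrossing_dup a w : noncrossing (a :: w) -> noncrossing (a :: a :: w).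
Proof.
move=> /noncrossingP h; apply/noncrossingP => x y xy.
apply: contra (h _ _ xy); rewrite subseq_consE; case: eqP => // xa.
by rewrite subseq_consE eq_sym -xa (negbTE xy) xa subseq_consE eqxx.
Qed.

Lemma noncrossing_new t w : t \notin w -> noncrossing w -> noncrossing (t :: w).
Proof.
move=> tw /noncrossingP h; apply/noncrossingP => x y xy.
apply: contra (h _ _ xy); rewrite subseq_consE; case: eqP => // xt s.
by move/mem_subseq: s => /(_ t); rewrite !inE xt eqxx orbT (negbTE tw) => /(_ isT).
Qed.

(** A letter enclosed between two occurrences of a and repeated outside would
    alternate with a. *)
Lemma noncrossing_block a u v b : noncrossing (a :: u ++ a :: v) -> a \notin u ->
  b \in u -> b \notin a :: v.
Proof.
move=> /noncrossingP h au bu; rewrite inE negb_or.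
have ba : b != a by apply: contraNneq au => <-.
rewrite ba /=; apply/negP => bv.
have := h a b; rewrite eq_sym ba => /(_ isT)/negP; apply.
rewrite subseq_consE eqxx -[[:: b; a; b]]/([:: b] ++ [:: a; b]).
by apply: cat_subseq; rewrite ?sub1seq// subseq_consE eqxx sub1seq.
Qed.

Lemma split_first a w : a \in w -> exists u v, w = u ++ a :: v /\ a \notin u.
Proof.
elim: w => // x w IH; rewrite inE; case: eqP => [<- _|ax /= /IH[u [v [-> au]]]].
  by exists [::], w.
by exists (x :: u), v; split => //; rewrite inE negb_or au andbT; apply/eqP.
Qed.

(** Take an innermost block between two equal letters: it is empty, and the
    letter is doubled, or its letters are confined to it and occur once. *)
Lemma noncrossing_leaf w : noncrossing w -> 1 < size w ->
  (exists u a v, w = u ++ a :: a :: v) \/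
  (exists u t v, w = u ++ t :: v /\ t \notin u ++ v).
Proof.
have [n] := ubnP (size w); elim: n w => // n IH [//|a w] /= wn ncw w1.
case: (boolP (a \in w)) => [|aw]; last by right; exists [::], a, w.
move=> /split_first [u [v [E au]]]; rewrite {}E in wn ncw w1 *.
have blk b : b \in u -> b \notin a :: v by exact: noncrossing_block.
case: u => [|b [|b' u]] in wn ncw w1 au blk *.
- by left; exists [::], a, v.
- right; exists [:: a], b, (a :: v); split => //.
  rewrite cat1s inE negb_or blk ?inE ?eqxx// andbT.
  by apply: contraNneq au => ->; rewrite inE eqxx.
- set u' := b :: b' :: u in wn ncw w1 au blk *.
  have ncu : noncrossing u'.
    apply: noncrossing_subseq ncw; apply: subseq_trans (subseq_cons _ _).
    exact: prefix_subseq.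
  have [||[x [c [y Eu]]]|[x [t [y [Eu txy]]]]] := IH _ _ ncu => //.
  + by move: wn; rewrite size_cat /=; lia.
  + by left; exists (a :: x), c, (y ++ a :: v); rewrite Eu /= -catA.
  + right; exists (a :: x), t, (y ++ a :: v); split; first by rewrite Eu /= -catA.
    have tu : t \in u' by rewrite Eu mem_cat inE eqxx orbT.
    rewrite cat_cons catA in_cons (mem_cat t (x ++ y)) (negbTE txy).
    rewrite (negbTE (blk _ tu)) !orbF.
    by apply: contraNneq au => <-.
Qed.

(** Neither of the two reductions, merging equal cyclic neighbours and deleting
    a letter that occurs once, applies. *)
Definition irreducible_word w :=
  [&& 1 < size w, all (fun x => 1 < count_mem x w) w &
      all (fun e => e.1 != e.2) (zip w (rot 1 w))].

Lemma zip_rot_size n (V : Type) w (s : seq V) : size w = size s ->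
  zip (rot n w) (rot n s) = rot n (zip w s).
Proof.
move=> ws; rewrite /rot zip_cat ?size_drop ?ws//.
congr (_ ++ _); elim: w s n ws => [|x w IH] [|y s] [|n] //= [] ws.
  exact: IH.
by rewrite IH.
Qed.

Lemma word_reduction w : 1 < size w -> ~~ irreducible_word w ->
  (exists n a v, rot n w = a :: a :: v) \/
  (exists n t v, [/\ rot n w = t :: v, t \notin v & v != [::]]).
Proof.
move=> w1; rewrite /irreducible_word w1 /= negb_and => /orP[/allPn|/allPn].
- move=> [t tw ct]; right.
  have [n v E] := rot_to tw; exists n, t, v; split => //.
    have /permP/(_ (pred1 t)) : perm_eq (rot n w) w by rewrite perm_rot.
    move: ct; rewrite -leqNgt E /= eqxx add1n => + Ec; rewrite -Ec ltnS leqn0.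
    by move=> /eqP c0; apply/count_memPn.
  by move: w1; rewrite -(size_rot n) E; case: (v).
- move=> [[a b] /[swap] /= /negbNE/eqP <- {b} aa]; left.
  have [n v E] := rot_to aa; exists n, a.
  have := zip_rot_size n (esym (size_rot 1 w)); rewrite E.
  rewrite -rot_rot //.
  have := size_rot n w; case: (rot n w) => [|x [|y u]] /=; [by lia|by lia|].
  by move=> _ [<- <- _]; exists u.
Qed.

(** Each word is reduced by rotations, merging of equal neighbours and deletion
    of single letters to one letter or to an irreducible word; both the
    combinatorics and the moments of a word follow these reductions. *)
Lemma word_ind (P : seq L -> Prop) :
  (forall a, P [:: a]) ->
  (forall a w, P (a :: w) -> P (a :: a :: w)) ->
  (forall t w, w != [::] -> t \notin w -> P w -> P (t :: w)) ->
  (forall w, P w -> P (rot 1 w)) ->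
  (forall w, irreducible_word w -> P w) ->
  forall w, w != [::] -> P w.
Proof.
move=> P1 Pd Pn Pr Pi w; have [n] := ubnP (size w); elim: n w => // n IH w wn w0.
case: (leqP (size w) 1) => [|w1].
  by case: w w0 {wn} => [|a [|]].
have [/Pi//|/word_reduction[//|[r [a [v E]]]|[r [t [v [E tv v0]]]]]] :=
  boolP (irreducible_word w).
- apply: (rot_indV Pr (n := r)); rewrite E; apply: Pd; apply: IH => //.
  by move: wn; rewrite -(size_rot r) E.
- apply: (rot_indV Pr (n := r)); rewrite E; apply: Pn => //; apply: IH => //.
  by move: wn; rewrite -(size_rot r) E.
Qed.

(** A noncrossing word has a leaf, hence admits a reduction. *)
Lemma noncrossing_reducible w : noncrossing w -> ~~ irreducible_word w.
Proof.
move=> ncw; apply/negP => /and3P[w1 /allP cw /allP aw].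
have [[u [a [v E]]]|[u [t [v [E tuv]]]]] := noncrossing_leaf ncw w1.
- suff /aw/= : (a, a) \in zip w (rot 1 w) by rewrite eqxx.
  rewrite -(mem_rot (size u)) -zip_rot_size ?size_rot// rot_rot E rot_size_cat.
  by rewrite inE eqxx.
- have := cw t; rewrite E mem_cat inE eqxx orbT => /(_ isT).
  rewrite count_cat /= eqxx addnCA -count_cat.
  by rewrite (count_memPn tuv).
Qed.

(** Induction on reductions, where the irreducible words cannot occur. *)
Lemma noncrossing_ind (P : seq L -> Prop) :
  (forall a, P [:: a]) ->
  (forall a w, P (a :: w) -> P (a :: a :: w)) ->
  (forall t w, w != [::] -> t \notin w -> P w -> P (t :: w)) ->
  (forall w, P w -> P (rot 1 w)) ->
  forall w, w != [::] -> noncrossing w -> P w.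
Proof.
move=> P1 Pd Pn Pr; apply: word_ind => // [a w IH ncw|t w w0 tw IH ncw|w IH ncw|w iw].
- by apply: Pd; apply: IH; apply: noncrossing_subseq ncw; exact: subseq_cons.
- by apply: Pn => //; apply: IH; apply: noncrossing_subseq ncw; exact: subseq_cons.
- by apply: Pr; apply: IH; rewrite -noncrossing_rot1.
- by move=> /noncrossing_reducible; rewrite iw.
Qed.

End words.

(** * Closed walks and noncrossing words *)

Section traversals.
Local Open Scope nat_scope.
Context {L V : eqType}.
Implicit Types (w : seq L) (i : seq V).

(** In the closed walk w_1 i_1 w_2 i_2 ... w_p i_p w_1, the down edges join w_u
    to i_u and the up edges join i_u to w_(u+1); both are recorded as pairs
    (letter, value), so that coincidence of edges is equality of pairs. *)
Definition downs w i := zip w i.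
Definition ups w i := zip (rot 1 w) i.

Lemma downs_rot n w i : size i = size w -> downs (rot n w) (rot n i) = rot n (downs w i).
Proof. by move=> iw; rewrite /downs zip_rot_size. Qed.

Lemma ups_rot n w i : size i = size w -> ups (rot n w) (rot n i) = rot n (ups w i).
Proof. by move=> iw; rewrite /ups rot_rot zip_rot_size ?size_rot. Qed.

Lemma ups_cons a b w v i : ups (a :: b :: w) (v :: i) = (b, v) :: zip (rcons w a) i.
Proof. by rewrite /ups rot1_cons. Qed.

Lemma ups_new t b w v i : size i = size w ->
  ups (t :: b :: w) (v :: rcons i v) = (b, v) :: rcons (zip w i) (t, v).
Proof. by move=> iw; rewrite ups_cons zip_rcons. Qed.

Lemma size_undup_rot (T : eqType) n (s : seq T) : size (undup (rot n s)) = size (undup s).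
Proof. by apply/eqP; rewrite eqn_leq !uniq_leq_size ?undup_uniq// => x; rewrite !mem_undup mem_rot. Qed.

Lemma size_undup_count (T : eqType) (s : seq T) :
  (forall x, x \in s -> 1 < count_mem x s) -> (size (undup s)).*2 <= size s.
Proof.
move=> h; rewrite -(perm_size (perm_count_undup s)) size_flatten /shape -map_comp.
rewrite sumnE big_map -mul2n -sum1_size big_distrr /= big_seq [leqRHS]big_seq.
by apply: leq_sum => x; rewrite mem_undup size_nseq muln1; exact: h.
Qed.

Lemma mem_zip (S T : eqType) (s : seq S) (t : seq T) e :
  e \in zip s t -> (e.1 \in s) && (e.2 \in t).
Proof.
elim: s t => [|x s IH] [|y t] //=; rewrite !inE.
by case/orP => [/eqP ->/=|/IH/andP[-> ->]]; rewrite ?eqxx ?orbT.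
Qed.

Lemma rot_singleton (T : eqType) (x : T) (s : seq T) : x \in s -> ~~ (1 < count_mem x s) ->
  exists n s', rot n s = x :: s' /\ x \notin s'.
Proof.
move=> xs cx; have [n s' E] := rot_to xs; exists n, s'; split => //.
have /permP/(_ (pred1 x)) : perm_eq (rot n s) s by rewrite perm_rot.
move: cx; rewrite -leqNgt E /= eqxx add1n => + Ec; rewrite -Ec ltnS leqn0.
by move=> /eqP c0; apply/count_memPn.
Qed.

(** Induction on the length. A letter that occurs once lies between equal values,
    since its down edge can only coincide with its own up edge, and is deleted.
    If each letter occurs twice, the count forces a value that occurs once; its
    two edges coincide, so its neighbouring letters are equal and are merged. *)
Lemma downs_sub_ups_noncrossing w i : size i = size w ->
  {subset downs w i <= ups w i} -> size w < size (undup w) + size (undup i) ->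
  noncrossing w.
Proof.
have [n] := ubnP (size w); elim: n w i => // n IH w i wn iw sub sz.
case: (leqP (size w) 1) => [|w1].
  case: w {IH wn iw sub sz} => [//|a [|//] _].
  by rewrite noncrossing_new.
case: (boolP (all (fun x => 1 < count_mem x w) w)) => [/allP cw|/allPn[t tw ct]]; last first.
- have [k [w' [E tw']]] := rot_singleton tw ct.
  have Ei : size (rot k i) = size (rot k w) by rewrite !size_rot.
  rewrite -(noncrossing_rot k); move: sub sz wn w1.
  rewrite -(size_undup_rot k w) -(size_undup_rot k i) -(size_rot k w) => sub sz wn w1.
  have {}sub : {subset downs (rot k w) (rot k i) <= ups (rot k w) (rot k i)}.
    by rewrite downs_rot// ups_rot// => e; rewrite !mem_rot; exact: sub.
  move: (rot k i) (rot k w) E Ei sub sz wn w1 => {iw tw ct w}i _ ->.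
  case: w' tw' => [//|b w]; case: i => [//|v].
  case/lastP => [//|i z] tw /= [] + sub sz wn w1.
  rewrite size_rcons => -[iw].
  (* the edge (t, v) is also an up edge, and the only one at t ends the word *)
  have Ez : z = v.
    have : (t, v) \in downs (t :: b :: w) (v :: rcons i z) by rewrite inE eqxx.
    move=> /sub; rewrite ups_cons zip_rcons// inE mem_rcons inE.
    case/or3P => [/eqP[tb]|/eqP[]//|/mem_zip/andP[]]; move: tw; rewrite inE.
      by rewrite tb eqxx.
    by rewrite negb_or => /andP[_ /negbTE ->].
  subst z; apply: noncrossing_new => //; apply: (IH _ (rcons i v)) => //.
  + by rewrite /= size_rcons iw.
  + move=> [x y] xy; have := sub (x, y); rewrite ups_new//.
    rewrite /downs/= inE xy orbT => /(_ isT).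
    rewrite /ups rot1_cons zip_rcons// !mem_rcons !inE mem_rcons inE.
    case/or3P => [->//|/eqP[xt _]|->]; last by rewrite orbT.
    by have /mem_zip/andP[] := xy; rewrite xt (negbTE tw).
  + move: sz; rewrite /= (negbTE tw) mem_rcons inE eqxx /=.
    by rewrite addSn ltnS.
case: (boolP (all (fun x => 1 < count_mem x i) i)) => [/allP ci|/allPn[v vi cv]].
  by have := size_undup_count cw; have := size_undup_count ci; lia.
have [k [i' [E vi']]] := rot_singleton vi cv.
have Ei : size (rot k i) = size (rot k w) by rewrite !size_rot.
rewrite -(noncrossing_rot k); move: sub sz wn w1.
rewrite -(size_undup_rot k w) -(size_undup_rot k i) -(size_rot k w) => sub sz wn w1.
have {}sub : {subset downs (rot k w) (rot k i) <= ups (rot k w) (rot k i)}.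
  by rewrite downs_rot// ups_rot// => e; rewrite !mem_rot; exact: sub.
move: (rot k w) (rot k i) E Ei sub sz wn w1 => {iw vi cv cw i w} w _ ->.
case: w => [//|a [//|b w]] /= [iw] sub sz wn w1.
have ab : a = b.
  have : (a, v) \in downs (a :: b :: w) (v :: i') by rewrite inE eqxx.
  move=> /sub; rewrite ups_cons inE; case/orP => [/eqP[]//|/mem_zip/andP[]].
  by rewrite (negbTE vi').
subst b; apply: noncrossing_dup; apply: (IH _ i') => //.
+ move=> [x y] xy; have := sub (x, y); rewrite ups_cons /downs/= inE xy orbT => /(_ isT).
  rewrite inE /ups rot1_cons => /orP[/eqP[_ yv]|//].
  by have /mem_zip/andP[_] := xy; rewrite yv (negbTE vi').
+ move: sz; rewrite /= (negbTE vi') inE eqxx /=.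
  by rewrite addnS ltnS.
Qed.

End traversals.

(** * Tree traversals of noncrossing words *)

Section trees.
Local Open Scope nat_scope.

Definition acyclic (T : eqType) (e : rel T) : Prop :=
  forall s : seq T, 2 < size s -> ~ ucycle e s.

(** A cycle cannot enter and leave a vertex that has one neighbour. *)
Lemma acyclic_leaf (T : eqType) (e e' : rel T) (x y : T) : acyclic e ->
  (forall u v, u != x -> v != x -> e' u v -> e u v) ->
  (forall u, e' x u -> u = y) -> (forall u, e' u x -> u = y) -> acyclic e'.
Proof.
move=> ace sub xr xl s s2 /andP[cy un]; have [xs|xs] := boolP (x \in s); last first.
  apply: (ace s s2); apply/andP; split => //.
  apply: (@sub_in_cycle _ (predC1 x) e' e) cy.
    by move=> u v /= ux vx; apply: sub.
  by apply/allP => u us /=; apply: contraNneq xs => <-.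
have [n s' E] := rot_to xs.
move: cy un s2; rewrite -(rot_cycle n) -(rot_uniq n) -(size_rot n) E.
case: s' {E} => [//|y1 s'] /=; case/lastP: s' => [//|s' z].
rewrite rcons_path last_rcons => /andP[/xr -> /andP[_ /xl ->]].
by case/and3P => _; rewrite mem_rcons inE eqxx.
Qed.

Definition incidence (E : seq (nat * nat)) : rel vertex := fun x y =>
  match x, y with
  | inl a, inr v | inr v, inl a => (a, v) \in E
  | _, _ => false
  end.

Lemma acyclic_incidence_eq (E F : seq (nat * nat)) : E =i F ->
  acyclic (incidence E) -> acyclic (incidence F).
Proof.
move=> EF ac s s2 /andP[cy un]; apply: (ac s s2); apply/andP; split => //.
by rewrite (@eq_cycle _ _ (incidence F)) // => -[a|v] [b|u] //=; rewrite EF.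
Qed.

(** The walk goes once down and once up along each edge of an acyclic graph, and
    the number of its vertices is that of a tree. *)
Record tree_traversal (w i : seq nat) : Prop := TreeTraversal {
  traversal_size : size i = size w;
  traversal_perm : perm_eq (downs w i) (ups w i);
  traversal_uniq : uniq (downs w i);
  traversal_order : size (undup w) + size (undup i) = (size w).+1;
  traversal_acyclic : acyclic (incidence (downs w i)) }.

Lemma fresh_value (s : seq nat) : exists v, v \notin s.
Proof.
exists (\max_(x <- s) x).+1; apply/negP => vs.
by have := @leq_bigmax_seq _ s xpredT id _ vs isT; rewrite ltnn.
Qed.

(** The reductions of w are inverse to attaching a leaf: a doubled letter is a
    detour to a new value, and a single letter t is a detour from the value
    before it to a new vertex t. *)
Lemma noncrossing_traversal (w : seq nat) : w != [::] -> noncrossing w ->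
  exists i, tree_traversal w i.
Proof.
move: w; apply: noncrossing_ind.
- move=> a; exists [:: 0]; split => // s s2 /andP[cy un].
  have sub : {subset s <= [:: inl a; inr 0 : vertex]}.
    move=> x xs; have := next_cycle cy xs.
    by case: x {xs} => [b|u]; case: (next _ _) => [b'|u'] //=;
      rewrite /downs /= inE => /eqP[] *; subst; rewrite !inE eqxx ?orbT.
  by have := uniq_leq_size un sub; rewrite leqNgt s2.
- move=> a w [i [iw pe un sz ac]]; have [v vi] := fresh_value i.
  exists (v :: i); split => //=.
  + by rewrite iw.
  + by rewrite ups_cons /downs /= perm_cons -[zip (rcons _ _) _]/(zip (rcons w a) i) -rot1_cons.
  + rewrite un andbT; apply/negP => /mem_zip/andP[_].
    by rewrite (negbTE vi).
  + by rewrite inE eqxx (negbTE vi) /= addnS; move: sz => /= ->.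
  + apply: (@acyclic_leaf _ (incidence (downs (a :: w) i)) _ (inr v) (inl a)) => //.
    * move=> [b|u] [b'|u'] //= ux vx; rewrite /downs /= inE => /orP[/eqP[_]|//].
        by move=> uv; move: vx; rewrite uv eqxx.
      by move=> uv; move: ux; rewrite uv eqxx.
    * move=> [b|u] //=; rewrite /downs /= inE => /orP[/eqP[-> //]|/mem_zip/andP[_]].
      by rewrite (negbTE vi).
    * move=> [b|u] //=; rewrite /downs /= inE => /orP[/eqP[-> //]|/mem_zip/andP[_]].
      by rewrite (negbTE vi).
- move=> t w w0 tw [i [iw pe un sz ac]].
  case: w => [//|b w] in w0 tw iw pe un sz ac *.
  case/lastP: i => [//|i v] in iw pe un sz ac *.
  have {}iw : size i = size w by move: iw; rewrite size_rcons => -[].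
  exists (v :: rcons i v); split => //=.
  + by rewrite size_rcons iw.
  + rewrite ups_new// /downs/= -[zip (b :: w) _]/(downs (b :: w) (rcons i v)).
    rewrite -rcons_cons perm_sym perm_rcons perm_cons perm_sym.
    apply: perm_trans pe _; rewrite /ups rot1_cons zip_rcons//.
    by rewrite perm_rcons.
  + rewrite un andbT; apply/negP => /mem_zip/andP[].
    by rewrite (negbTE tw).
  + rewrite (negbTE tw) mem_rcons inE eqxx /=; move: sz => /=.
    by rewrite addSn => ->.
  + apply: (@acyclic_leaf _ (incidence (downs (b :: w) (rcons i v))) _ (inl t) (inr v)) => //.
    * move=> [c|u] [c'|u'] //= ux vx; rewrite /downs /= inE => /orP[/eqP[]|//].
        by move=> uv; move: ux; rewrite uv eqxx.
      by move=> uv; move: vx; rewrite uv eqxx.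
    * move=> [c|u] //=; rewrite /downs /= inE => /orP[/eqP[-> //]|/mem_zip/andP[]].
      by rewrite (negbTE tw).
    * move=> [c|u] //=; rewrite /downs /= inE => /orP[/eqP[-> //]|/mem_zip/andP[]].
      by rewrite (negbTE tw).
- move=> w [i [iw pe un sz ac]]; exists (rot 1 i); split.
  + by rewrite !size_rot.
  + rewrite downs_rot// ups_rot//; apply: perm_trans (_ : perm_eq (downs w i) _).
      by rewrite perm_rot.
    by rewrite perm_sym perm_rot perm_sym.
  + by rewrite downs_rot// rot_uniq.
  + by rewrite !size_undup_rot size_rot.
  + by apply: acyclic_incidence_eq ac => e; rewrite downs_rot// mem_rot.
Qed.

End trees.

(** * Trees obtained by gluing edges *)

Section delta1.
Local Open Scope nat_scope.
Implicit Types a i : seq nat.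

Let down_pair (q : nat * nat) : vertex * vertex := (inl q.1, inr q.2).

Let down_pair_inj : injective down_pair.
Proof. by move=> [x v] [y u] [-> ->]. Qed.

Lemma down_edgesE i a : down_edges i a = map down_pair (downs a i).
Proof. by rewrite /down_edges /downs; elim: a i => [|x a IH] [|v i] //=; rewrite IH. Qed.

Lemma up_edgesE i a :
  up_edges i a = map (fun q => reverse_edge (down_pair q)) (ups a i).
Proof.
rewrite /up_edges /ups; elim: (rot 1 a) i => [|x b IH] [|v i] //=.
by rewrite -IH.
Qed.

Lemma glued_edgesE i a : glued_edges i a = map down_pair (undup (downs a i ++ ups a i)).
Proof.
rewrite /glued_edges down_edgesE up_edgesE -map_comp.
by rewrite -(undup_map_inj down_pair_inj) map_cat.
Qed.

Lemma size_gvertices i a : size (gvertices i a) = size (undup a) + size (undup i).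
Proof.
rewrite /gvertices undup_cat size_cat; congr (_ + _).
  rewrite (_ : [seq _ <- _ | _] = undup (map alpha_vertex a)).
    by rewrite undup_map_inj ?size_map// => x y [].
  apply/all_filterP/allP => x; rewrite mem_undup => /mapP[y _ ->].
  by apply/negP => /mapP[].
by rewrite undup_map_inj ?size_map// => x y [].
Qed.

Lemma glued_adjE i a : glued_adj i a =2 incidence (downs a i ++ ups a i).
Proof.
move=> x y; rewrite /glued_adj glued_edgesE has_map.
apply/hasP/idP => [[[b v]]|].
  rewrite mem_undup => bv /=; rewrite /coincide /down_pair /reverse_edge /=.
  by case/orP => /eqP[] *; subst.
by case: x y => [b|v] [c|u] //= bu; [exists (b, u)|exists (c, v)] => //;
  rewrite ?mem_undup// /coincide /down_pair /reverse_edge /= !xpair_eqE ?eqxx //.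
Qed.

Lemma count_coincide i a q :
  count (coincide (down_pair q)) (up_edges i a) = count_mem q (ups a i).
Proof.
rewrite up_edgesE count_map; apply: eq_count => -[x v] /=.
rewrite /coincide /reverse_edge /down_pair /=; case: q => y u.
by rewrite !xpair_eqE /= andbC.
Qed.

(** In a tree graph the vertices number p + 1, and each down edge coincides with
    an up edge, so the counting criterion applies. *)
Lemma Delta1_noncrossing i a : size i = size a -> Delta1 i a -> noncrossing a.
Proof.
move=> ia [/allP cnt _ sz _]; apply: (downs_sub_ups_noncrossing ia).
  move=> q qd; have := cnt (down_pair q).
  rewrite down_edgesE (mem_map down_pair_inj) => /(_ qd).
  by rewrite count_coincide => /eqP c1; rewrite -has_pred1 has_count c1.
by rewrite -size_gvertices sz.
Qed.

(** Reachability through explicit paths, since the vertices form an infinite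
    type. *)
Definition linked (T : eqType) (e : rel T) (x y : T) :=
  exists2 q : seq T, path e x q & last x q = y.

Lemma linked1 (T : eqType) (e : rel T) x y : e x y -> linked e x y.
Proof. by move=> xy; exists [:: y] => //=; rewrite xy. Qed.

Lemma linked_trans (T : eqType) (e : rel T) y x z :
  linked e x y -> linked e y z -> linked e x z.
Proof.
move=> [p pp <-] [q qq <-]; exists (p ++ q); first by rewrite cat_path pp.
by rewrite last_cat.
Qed.

Lemma linked_sym (T : eqType) (e : rel T) x y : symmetric e ->
  linked e x y -> linked e y x.
Proof.
move=> es [p pp <-]; exists (rev (belast x p)).
  by rewrite rev_path (eq_path (e' := e)) // => u v; rewrite es.
by case/lastP: p {pp} => // p z; rewrite belast_rcons last_rcons rev_cons last_rcons.
Qed.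

Lemma incidence_sym E : symmetric (incidence E).
Proof. by move=> [x|x] [y|y]. Qed.

Lemma traversal_linked i a : size i = size a -> a != [::] ->
  forall x y, x \in gvertices i a -> y \in gvertices i a -> linked (glued_adj i a) x y.
Proof.
move=> ia a0; set e := glued_adj i a.
have es : symmetric e by move=> x y; rewrite /e !glued_adjE incidence_sym.
have dn k : k < size a -> e (inl (nth 0 a k)) (inr (nth 0 i k)).
  move=> ka; rewrite /e glued_adjE /= mem_cat.
  by rewrite -nth_zip// mem_nth ?size_zip// ia minnn.
have up k : k.+1 < size a -> e (inr (nth 0 i k)) (inl (nth 0 a k.+1)).
  move=> ka; rewrite /e glued_adjE /= mem_cat; apply/orP; right.
  have -> : nth 0 a k.+1 = nth 0 (rot 1 a) k.
    by case: (a) ka => // x b /=; rewrite ltnS rot1_cons nth_rcons => ->.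
  by rewrite -nth_zip ?size_rot// mem_nth ?size_zip// ?size_rot ia minnn ltnW.
have root k : k < size a -> linked e (inl (nth 0 a 0)) (inl (nth 0 a k)).
  elim: k => [|k IH] ka; first by exists [::].
  apply: linked_trans (IH (ltnW ka)) _.
  apply: (@linked_trans _ _ (inr (nth 0 i k))); apply: linked1; first exact/dn/ltnW.
  exact: up.
have root' x : x \in gvertices i a -> linked e (inl (nth 0 a 0)) x.
  rewrite mem_undup mem_cat => /orP[/mapP[b ba ->]|/mapP[v vi ->]].
    by rewrite -(nth_index 0 ba); apply: root; rewrite index_mem.
  rewrite -(nth_index 0 vi); have vl : index v i < size a by rewrite -ia index_mem.
  exact: linked_trans (root _ vl) (linked1 (dn _ vl)).
move=> x y /root' xr /root' yr; apply: linked_trans yr.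
exact: linked_sym.
Qed.

(** The traversal itself connects any two vertices, and the other conditions of
    a tree graph are the fields of the traversal. *)
Lemma traversal_Delta1 i a : a != [::] -> tree_traversal a i -> Delta1 i a.
Proof.
move=> a0 [ia pe un sz ac].
have duE : downs a i ++ ups a i =i downs a i.
  by move=> e; rewrite mem_cat -(perm_mem pe) orbb.
split.
- apply/allP => e; rewrite down_edgesE => /mapP[q qd ->].
  rewrite count_coincide -(permP pe) count_uniq_mem//.
  by rewrite qd.
- rewrite glued_edgesE size_map.
  have /perm_size -> : perm_eq (undup (downs a i ++ ups a i)) (downs a i).
    by apply: uniq_perm; rewrite ?undup_uniq// => e; rewrite mem_undup duE.
  by rewrite size_zip ia minnn.
- by rewrite size_gvertices sz.
- split; first exact: traversal_linked.
  move=> s s2 /andP[cy un']; apply: (ac s s2); apply/andP; split => //.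
  rewrite (@eq_cycle _ _ (glued_adj i a)) // => x y; rewrite glued_adjE.
  by case: x y => [x|x] [y|y] //=; rewrite duE.
Qed.

End delta1.

(** * Relabelling by order of first appearance *)

Section relabelling.
Local Open Scope nat_scope.

(** Double reversal, because undup keeps the last occurrence of each entry. *)
Definition firsts (T : eqType) (w : seq T) : seq T := rev (undup (rev w)).

(** The canonical sequence in the relabelling class of w: the t-th letter to
    appear becomes t, starting from 1. *)
Definition canon (T : eqType) (w : seq T) : seq nat :=
  [seq (index x (firsts w)).+1 | x <- w].

Section canon.
Context {T : eqType}.
Implicit Types (w : seq T).

Lemma mem_firsts w : firsts w =i w.
Proof. by move=> x; rewrite mem_rev mem_undup mem_rev. Qed.

Lemma firsts_uniq w : uniq (firsts w).
Proof. by rewrite rev_uniq undup_uniq. Qed.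

Lemma firsts_rcons w x :
  firsts (rcons w x) = if x \in w then firsts w else rcons (firsts w) x.
Proof. by rewrite /firsts rev_rcons /= mem_rev; case: ifP => //; rewrite rev_cons. Qed.

Lemma size_firsts w : size (firsts w) = size (undup w).
Proof.
apply: perm_size; apply: uniq_perm; rewrite ?firsts_uniq ?undup_uniq// => x.
by rewrite mem_firsts mem_undup.
Qed.

Lemma size_canon w : size (canon w) = size w.
Proof. by rewrite size_map. Qed.

Definition canon_letter w (x : T) := (index x (firsts w)).+1.

Lemma canon_letter_inj w : {in w &, injective (canon_letter w)}.
Proof.
move=> x y xw yw []; rewrite -mem_firsts in xw; rewrite -mem_firsts in yw => xy.
by rewrite -(nth_index x xw) xy nth_index.
Qed.

Lemma canonE w : canon w = map (canon_letter w) w.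
Proof. by []. Qed.

(** Letters appended later do not change the labels of the previous ones. *)
Lemma canon_rcons w x : canon (rcons w x) = rcons (canon w) (canon_letter (rcons w x) x).
Proof.
rewrite canonE map_rcons; congr rcons; apply/eq_in_map => y yw.
rewrite /canon_letter firsts_rcons; case: ifP => // xw.
by rewrite -cats1 index_cat mem_firsts yw.
Qed.

End canon.

Lemma undup_map_in (T T' : eqType) (f : T -> T') (w : seq T) :
  {in w &, injective f} -> undup (map f w) = map f (undup w).
Proof.
elim: w => //= x w IH fi; rewrite IH; last first.
  by move=> y z yw zw; apply: fi; rewrite inE (yw, zw) orbT.
suff -> : (f x \in map f w) = (x \in w) by case: ifP.
apply/mapP/idP => [[y yw fxy]|xw]; last by exists x.
by rewrite (fi x y) // inE ?eqxx ?yw ?orbT.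
Qed.

Lemma index_map_in (T T' : eqType) (f : T -> T') (w : seq T) x :
  {in w &, injective f} -> x \in w -> index (f x) (map f w) = index x w.
Proof.
elim: w => //= y w IH fi; rewrite inE => xyw.
have [->|yx] := eqVneq y x; first by rewrite eqxx.
case: eqP => [/fi|_]; first by rewrite !inE eqxx => /(_ isT xyw) yx'; rewrite yx' eqxx in yx.
rewrite IH //; last by move: xyw; rewrite eq_sym (negbTE yx).
by move=> u v uw vw; apply: fi; rewrite inE (uw, vw) orbT.
Qed.

Lemma canon_map (T T' : eqType) (f : T -> T') (w : seq T) :
  {in w &, injective f} -> canon (map f w) = canon w.
Proof.
move=> fi; rewrite /canon -map_comp; apply/eq_in_map => x xw /=.
rewrite /firsts -map_rev undup_map_in; last by move=> u v; rewrite !mem_rev; exact: fi.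
rewrite -map_rev -/(firsts w) index_map_in // ?mem_firsts//.
by move=> u v; rewrite !mem_firsts; exact: fi.
Qed.

Lemma size_undup_map_in (T T' : eqType) (f : T -> T') (w : seq T) :
  {in w &, injective f} -> size (undup (map f w)) = size (undup w).
Proof. by move=> fi; rewrite undup_map_in// size_map. Qed.

Lemma size_undup_canon (T : eqType) (w : seq T) : size (undup (canon w)) = size (undup w).
Proof. by rewrite canonE size_undup_map_in//; exact: canon_letter_inj. Qed.

Lemma noncrossing_map (T T' : eqType) (f : T -> T') (w : seq T) :
  {in w &, injective f} -> noncrossing (map f w) = noncrossing w.
Proof.
move=> fi; apply/allP/allP => h.
- move=> a aw; apply/allP => b bw; apply/implyP => ab.
  have /allP/(_ _ (map_f f bw))/implyP := h _ (map_f f aw).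
  have -> : f a != f b by apply: contra ab => /eqP/fi ->.
  move=> /(_ isT); apply: contra => s.
  by rewrite -[[:: _; _; _; _]]/(map f [:: a; b; a; b]) map_subseq.
- move=> _ /mapP[a aw ->]; apply/allP => _ /mapP[b bw ->]; apply/implyP => fab.
  have /allP/(_ _ bw)/implyP := h _ aw.
  have -> : a != b by apply: contra fab => /eqP ->.
  move=> /(_ isT); apply: contra.
  move=> /subseqP[m sm E]; apply/subseqP; exists m; first by rewrite sm size_map.
  have zw : {subset mask m w <= w} by move=> x; exact: mem_mask.
  rewrite -map_mask in E; move: zw.
  case: (mask m w) E => [|z1 [|z2 [|z3 [|z4 [|]]]]] //= [e1 e2 e3 e4] zw.
  by congr [:: _; _; _; _]; apply: fi => //; apply: zw; rewrite !inE eqxx ?orbT.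
Qed.

Lemma noncrossing_canon (T : eqType) (w : seq T) : noncrossing (canon w) = noncrossing w.
Proof. by rewrite canonE noncrossing_map//; exact: canon_letter_inj. Qed.

Lemma canonical_seqP (a : seq nat) : reflect
  [/\ a != [::], nth 0 a 0 = 1, {in a, forall x, 0 < x} &
     forall u, 0 < u < size a -> nth 0 a u <= (\max_(v <- take u a) v).+1]
  (canonical_seq a).
Proof.
apply: (iffP and3P) => [[/allP a1 /eqP a0 /allP au]|[a0 an a1 au]]; split => //.
- by case: (a) a0.
- move=> u /andP[u0 ua]; rewrite -addn1; apply: au.
  by rewrite mem_iota u0 add1n prednK// (ltn_trans u0).
- exact/allP.
- exact/eqP.
- apply/allP => u; rewrite mem_iota => /andP[u0 ua]; rewrite addn1; apply: au.
  by move: ua; rewrite u0 add1n prednK//; case: (a) a0.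
Qed.

Lemma canonical_rcons (s : seq nat) (x : nat) : s != [::] ->
  canonical_seq (rcons s x) = [&& canonical_seq s, 0 < x & x <= (\max_(v <- s) v).+1].
Proof.
move=> s0; have ss : 0 < size s by case: (s) s0.
apply/canonical_seqP/and3P => [[_ a0 a1 au]|[/canonical_seqP[_ a0 a1 au] x0 xs]]; split.
- apply/canonical_seqP; split => //.
  + by move: a0; rewrite nth_rcons ss.
  + by move=> y ys; apply: a1; rewrite mem_rcons inE ys orbT.
  + move=> u /andP[u0 us]; have := au u; rewrite u0 size_rcons ltnS (ltnW us) => /(_ isT).
    by rewrite nth_rcons us -cats1 takel_cat// ltnW.
- by apply: a1; rewrite mem_rcons inE eqxx.
- have := au (size s); rewrite ss size_rcons leqnn => /(_ isT).
  by rewrite nth_rcons ltnn eqxx -cats1 take_size_cat.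
- by case: (s).
- by rewrite nth_rcons ss.
- by move=> y; rewrite mem_rcons inE => /predU1P[->//|]; exact: a1.
- move=> u; rewrite size_rcons ltnS => /andP[u0]; rewrite leq_eqVlt => /predU1P[->|us].
    by rewrite nth_rcons ltnn eqxx -cats1 take_size_cat.
  by rewrite nth_rcons us -cats1 takel_cat ?(ltnW us)//; apply: au; rewrite u0.
Qed.

Lemma canonical_firsts (a : seq nat) : canonical_seq a ->
  firsts a = iota 1 (\max_(v <- a) v).
Proof.
elim/last_ind: a => // a x IH; have [->|a0] := eqVneq a [::].
  case/canonical_seqP => _ /= -> _ _.
  by rewrite big_seq1.
rewrite canonical_rcons// => /and3P[ca x0 xm]; rewrite firsts_rcons.
rewrite -mem_firsts IH// mem_iota x0 add1n ltnS big_rcons /=.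
case: leqP => // mx; rewrite -(prednK x0) -cats1.
have -> : \max_(v <- a) v = x.-1 by apply/eqP; rewrite eqn_leq; lia.
by rewrite -[in RHS](addn1 x.-1) iotaD add1n.
Qed.

Lemma canon_id (a : seq nat) : canonical_seq a -> canon a = a.
Proof.
move=> ca; rewrite -[RHS]map_id; apply/eq_in_map => x xa.
have := xa; rewrite -mem_firsts canonical_firsts// mem_iota => /andP[x1 xm].
set m := \max_(v <- a) v in xm *; have xm1 : x.-1 < m by lia.
have xE : nth 0 (iota 1 m) x.-1 = x by rewrite nth_iota//; lia.
by rewrite -{1}xE index_uniq ?iota_uniq ?size_iota// prednK.
Qed.

Lemma canonical_max (a : seq nat) : canonical_seq a ->
  \max_(v <- a) v = size (undup a).
Proof. by move=> /canonical_firsts E; rewrite -size_firsts E size_iota. Qed.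

Lemma canonical_le (a : seq nat) x : canonical_seq a -> x \in a ->
  0 < x <= size (undup a).
Proof.
move=> ca; rewrite -mem_firsts canonical_firsts// mem_iota canonical_max//.
Qed.

Lemma canon_canonical (T : eqType) (w : seq T) : w != [::] -> canonical_seq (canon w).
Proof.
elim/last_ind: w => // w x IH _; have [->|w0] := eqVneq w [::].
  by apply/canonical_seqP; rewrite /canon /= /firsts /= eqxx; split => //; case.
have cw := IH w0; rewrite canon_rcons canonical_rcons ?cw /=; last by case: (w) w0.
rewrite canonical_max// size_undup_canon /canon_letter ltnS -size_firsts.
rewrite firsts_rcons; case: ifP => xw; first by rewrite ltnW// index_mem mem_firsts.
by rewrite -cats1 index_cat mem_firsts xw /= eqxx addn0.
Qed.

End relabelling.

(** * Sums over canonical words *)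

Section canonical_words.
Local Open Scope nat_scope.

Lemma traversal_map (g : nat -> nat) (w i : seq nat) : injective g ->
  tree_traversal w i -> tree_traversal w (map g i).
Proof.
move=> gi [iw pe un sz ac].
pose gq (q : nat * nat) := (q.1, g q.2).
have gqi : injective gq by move=> [a v] [b u] [-> /gi ->].
have zE (b : seq nat) : zip b (map g i) = map gq (zip b i).
  by elim: b (i) => [|x b IH] [|v j] //=; rewrite IH.
split.
- by rewrite size_map.
- by rewrite /downs /ups !zE perm_map.
- by rewrite /downs zE map_inj_uniq.
- by rewrite undup_map_inj// size_map.
- pose G (x : vertex) : vertex := match x with inl a => inl a | inr v => inr (g v) end.
  have Gi : injective G by move=> [a|v] [b|u] //= [] E; rewrite ?E// (gi _ _ E).
  move=> s s2 /andP[cy us].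
  have [s' Es] : exists s', s = map G s'.
    have {cy us s2} : {in s, forall x, exists y, x = G y}.
      move=> x xs; have := next_cycle cy xs.
      case: x {xs} => [a|v]; first by exists (inl a).
      case: (next _ _) => // b /=; rewrite /downs zE => /mapP[[b' u] _ [_ ->]].
      by exists (inr u).
    elim: s => [|x s IH] h; first by exists [::].
    have [y ->] := h x (mem_head _ _); have [|s' ->] := IH.
      by move=> z zs; apply: h; rewrite inE zs orbT.
    by exists (y :: s').
  move: s2 cy us; rewrite {}Es size_map map_inj_uniq// => s2 cy us.
  apply: (ac s' s2); apply/andP; split => //; move: cy; rewrite cycle_map.
  rewrite (@eq_cycle _ _ (incidence (downs w i))) // => -[a|v] [b|u] //=;
    by rewrite /downs zE -[(_, g _)]/(gq (_, _)) mem_map.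
Qed.

Lemma noncrossing_Delta1 (w : seq nat) : w != [::] -> noncrossing w ->
  exists i, [/\ size i = size w, canonical_seq i,
    size (undup w) + size (undup i) = (size w).+1 & Delta1 i w].
Proof.
move=> w0 /(noncrossing_traversal w0)[i ti].
pose g v := if v \in i then (index v (firsts i)).+1 else v + (size (firsts i)).+1.
have gi : injective g.
  move=> u v; rewrite /g; case: (boolP (u \in i)) => ui; case: (boolP (v \in i)) => vi.
  - exact: canon_letter_inj.
  - by have := ui; rewrite -mem_firsts -index_mem; lia.
  - by have := vi; rewrite -mem_firsts -index_mem; lia.
  - lia.
have Ei : canon i = map g i by apply/eq_in_map => v vi; rewrite /g vi.
have i0 : i != [::] by case: ti => iw _ _ _ _; case: (w) (i) w0 iw => [|? ?] [|? ?].
exists (canon i); rewrite size_canon size_undup_canon canon_canonical//.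
split; [by case: ti| by []| by case: ti|].
by apply: traversal_Delta1 => //; rewrite Ei; exact: traversal_map.
Qed.

Lemma vals_inj q : injective (@vals q).
Proof. by apply: inj_map; exact: val_inj. Qed.

Lemma size_vals q p (a : p.-tuple 'I_q) : size (vals a) = p.
Proof. by rewrite size_map size_tuple. Qed.

Lemma vals_surj q p (w : seq nat) : size w = p -> {in w, forall x, x < q.+1} ->
  exists a : p.-tuple 'I_q.+1, vals a = w.
Proof.
move=> wp wq; have sw : size (map (@inord q) w) == p by rewrite size_map wp.
exists (Tuple sw); rewrite /vals /= -map_comp -[RHS]map_id.
by apply/eq_in_map => x xw /=; rewrite inordK ?wq.
Qed.

(** A tree graph forces the word to be noncrossing; conversely a noncrossing word
    has a traversal, and relabelling its values in order of appearance makes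
    them canonical, with p + 1 - s distinct values because of the tree count. *)
Lemma Cseq1P s p (a : p.-tuple 'I_s.+1) : 0 < p ->
  (a \in Cseq1 s p) = [&& canonical_seq (vals a), size (undup (vals a)) == s
                        & noncrossing (vals a)].
Proof.
move=> p0; rewrite !inE -andbA; apply: andb_id2l => ca; apply: andb_id2l => sa.
apply/asboolP/idP => [[i _]|nca].
  by apply: Delta1_noncrossing; rewrite !size_vals.
have a0 : vals a != [::] by rewrite -size_eq0 size_vals -lt0n.
have [i [si ci su D]] := noncrossing_Delta1 a0 nca.
rewrite size_vals (eqP sa) in si su.
have sui : size (undup i) = p + 1 - s by lia.
have [|j Ej] := @vals_surj (p + 1 - s) p i si.
  by move=> x /(canonical_le ci) /andP[_]; rewrite sui ltnS.
exists j; last by rewrite Ej.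
by rewrite inE Ej ci sui eqxx.
Qed.

Definition canonical_words p : seq (seq nat) :=
  [seq w <- map (fun a : p.-tuple 'I_p.+1 => vals a) (enum {: p.-tuple 'I_p.+1}) | canonical_seq w].

Lemma canonical_words_uniq p : uniq (canonical_words p).
Proof.
rewrite filter_uniq// map_inj_uniq ?enum_uniq// => a b /vals_inj E.
exact: val_inj.
Qed.

Lemma mem_canonical_words p w :
  (w \in canonical_words p) = (size w == p) && canonical_seq w.
Proof.
rewrite mem_filter andbC; case: (boolP (canonical_seq w)) => cw; rewrite ?andbF// !andbT.
apply/mapP/eqP => [[a _ ->]|sw]; first exact: size_vals.
have [|a Ea] := @vals_surj p p w sw.
  move=> x /(canonical_le cw)/andP[_ xw]; rewrite ltnS (leq_trans xw)//.
  by rewrite -sw size_undup.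
by exists a; rewrite ?mem_enum.
Qed.

End canonical_words.

Section canonical_sums.
Context {Z : nmodType}.

(** Words are grouped by the equality pattern of their letters. *)
Lemma sum_canonical (T : finType) p (F : p.-tuple T -> Z) : (0 < p)%N ->
  \sum_(w : p.-tuple T) F w =
  \sum_(a <- canonical_words p) \sum_(w : p.-tuple T | canon w == a) F w.
Proof.
move=> p0; rewrite (exchange_big_dep xpredT)//=; apply: eq_bigr => w _.
rewrite (big_rem (canon w)) /=; last first.
  rewrite mem_canonical_words size_canon size_tuple eqxx canon_canonical//.
  by rewrite -size_eq0 size_tuple -lt0n.
rewrite eqxx big_seq_cond big1 ?addr0// => a /andP[+ /eqP wa].
by rewrite mem_rem_uniq ?canonical_words_uniq// inE wa eqxx.
Qed.

Lemma sum_Cseq1 p (F : nat -> seq nat -> Z) : (0 < p)%N ->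
  \sum_(1 <= s < p.+1) \sum_(a in Cseq1 s p) F s (vals a) =
  \sum_(w <- canonical_words p | noncrossing w) F (size (undup w)) w.
Proof.
move=> p0; transitivity (\sum_(1 <= s < p.+1)
    \sum_(w <- canonical_words p | noncrossing w && (size (undup w) == s))
      F (size (undup w)) w).
  apply: eq_bigr => s _; rewrite -big_enum -[RHS]big_filter /=.
  rewrite -(big_map (fun a : p.-tuple 'I_s.+1 => vals a) xpredT (F s)).
  rewrite (perm_big [seq w <- canonical_words p | noncrossing w & size (undup w) == s]).
    by rewrite big_seq [RHS]big_seq; apply: eq_bigr => w; rewrite mem_filter => /andP[/andP[_ /eqP->]].
  apply: uniq_perm.
  - by rewrite map_inj_uniq ?enum_uniq// => a b /vals_inj E; exact: val_inj.
  - by rewrite filter_uniq// canonical_words_uniq.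
  move=> w; rewrite mem_filter mem_canonical_words.
  apply/mapP/idP => [[a]|/andP[/andP[nw sw] /andP[/eqP pw cw]]].
    by rewrite mem_enum Cseq1P// => /and3P[ca sa na] ->; rewrite na sa size_vals eqxx.
  have [|a Ea] := @vals_surj s p w pw.
    by move=> x /(canonical_le cw)/andP[_]; rewrite (eqP sw) ltnS.
  by exists a; rewrite // mem_enum Cseq1P// Ea cw sw.
rewrite (exchange_big_dep noncrossing) /=; last by move=> s w _ /andP[].
rewrite big_seq_cond [RHS]big_seq_cond; apply: eq_bigr => w /andP[wp nw].
rewrite (big_rem (size (undup w))) /=; last first.
  move: wp; rewrite mem_canonical_words => /andP[/eqP sw cw].
  rewrite mem_index_iota ltnS -sw size_undup andbT.
  by rewrite lt0n size_eq0; apply: contraTneq p0 => /undup_nil w0; rewrite -sw w0.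
rewrite nw eqxx /= big_seq_cond big1 ?addr0// => s /andP[+ /eqP ws].
by rewrite mem_rem_uniq ?iota_uniq// inE ws eqxx.
Qed.

End canonical_sums.

(** * The Narayana recursion *)

Section narayana_words.
Local Open Scope nat_scope.

(** If a recurs, the part enclosed between its first two occurrences shares no
    letter with the rest, so no alternation involves both. *)
Lemma noncrossing_glue (L : eqType) (a : L) (u v : seq L) :
  (forall x, x \in u -> x \notin a :: v) -> noncrossing u -> noncrossing (a :: v) ->
  noncrossing (a :: u ++ a :: v).
Proof.
move=> dis ncu ncv; apply/noncrossingP => x y xy; apply/negP => s.
have au : a \notin u by apply/negP => /dis; rewrite inE eqxx.
have filt (P : pred L) : P x -> P y ->
    subseq [:: x; y; x; y] (seq.filter P (a :: u ++ a :: v)).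
  by move=> Px Py; rewrite subseq_filter /= Px Py.
case: (boolP (x \in u)) => xu; case: (boolP (y \in u)) => yu.
- have := filt (mem u) xu yu; rewrite /= (negbTE au) filter_cat.
  rewrite (all_filterP (introT allP (fun z zu => zu))).
  rewrite [seq.filter _ (a :: v)](_ : _ = [::]); last first.
    rewrite (@eq_in_filter _ _ pred0) ?filter_pred0// => z zv.
    by apply/negP => /dis; rewrite zv.
  by rewrite cats0; apply/negP; exact: (noncrossingP _ ncu).
- move: s => /subseqP[m sm]; rewrite -(cat_take_drop (size (a :: u)) m) -cat_cons.
  rewrite mask_cat; last by rewrite size_takel// sm -cat_cons size_cat leq_addr.
  set m1 := take _ _; set m2 := drop _ _.
  have s1 : subseq (mask m1 (a :: u)) (a :: u) by exact: mask_subseq.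
  have s2 z : z \in mask m2 (a :: v) -> z \notin u.
    by move=> /mem_mask; apply: contraTN => /dis.
  have xa : x == a = false by apply: contraNF au => /eqP <-.
  case: (mask m1 _) s1 => [|x1 [|x2 [|x3 x4]]] s1.
  + by move=> /= E; have := s2 x; rewrite -E !inE eqxx xu => /(_ isT).
  + by move=> [_ E]; have := s2 x; rewrite -E !inE eqxx xu ?orbT => /(_ isT).
  + by move=> [_ _ E]; have := s2 x; rewrite -E !inE eqxx xu ?orbT => /(_ isT).
  + move=> [e1 e2 e3 _]; move: s1; rewrite -e1 -e2 subseq_consE xa.
    by move=> /mem_subseq/(_ y); rewrite !inE eqxx orbT (negbTE yu) => /(_ isT).
- move: s => /subseqP[m sm]; rewrite -(cat_take_drop (size (a :: u)) m) -cat_cons.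
  rewrite mask_cat; last by rewrite size_takel// sm -cat_cons size_cat leq_addr.
  set m1 := take _ _; set m2 := drop _ _.
  have s1 : subseq (mask m1 (a :: u)) (a :: u) by exact: mask_subseq.
  have s2 z : z \in mask m2 (a :: v) -> z \notin u.
    by move=> /mem_mask; apply: contraTN => /dis.
  case: (mask m1 _) s1 => [|x1 [|x2 [|x3 [|x4 x5]]]] s1.
  + by move=> /= E; have := s2 y; rewrite -E !inE eqxx yu ?orbT => /(_ isT).
  + by move=> [_ E]; have := s2 y; rewrite -E !inE eqxx yu ?orbT => /(_ isT).
  + by move=> [_ _ E]; have := s2 y; rewrite -E !inE eqxx yu ?orbT => /(_ isT).
  + by move=> [_ _ _ E]; have := s2 y; rewrite -E !inE eqxx yu ?orbT => /(_ isT).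
  + move=> [e1 e2 e3 e4 _]; move: s1; rewrite -e1 -e2 -e3 -e4 subseq_consE.
    case: eqP => _.
      by move=> /mem_subseq/(_ x); rewrite !inE eqxx orbT (negbTE xu) => /(_ isT).
    by move=> /mem_subseq/(_ x); rewrite !inE eqxx (negbTE xu) => /(_ isT).
- have := filt (predC (mem u)) xu yu.
  have -> : seq.filter (predC (mem u)) (a :: u ++ a :: v) = a :: a :: v.
    rewrite /= au filter_cat /= au (@eq_in_filter _ _ pred0) ?filter_pred0//=; last first.
      by move=> z zu /=; apply/negP; rewrite zu.
    congr [:: _, _ & _]; apply/all_filterP/allP => z zv /=; apply/negP => /dis.
    by rewrite inE zv orbT.
  by apply/negP; exact: (noncrossingP _ (noncrossing_dup ncv)).
Qed.

Definition noncrossing_words p : seq (seq nat) :=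
  if p is 0 then [:: [::]] else [seq w <- canonical_words p | noncrossing w].

Lemma noncrossing_words_uniq p : uniq (noncrossing_words p).
Proof. by case: p => // p; rewrite filter_uniq// canonical_words_uniq. Qed.

Lemma mem_noncrossing_words p w : (w \in noncrossing_words p) =
  [&& noncrossing w, size w == p & (w == [::]) || canonical_seq w].
Proof.
case: p => [|p] /=.
  by rewrite inE size_eq0; case: eqP => [->|_]; rewrite ?andbF.
rewrite mem_filter mem_canonical_words; case: eqP => //= sw; rewrite ?andbF//.
by case: w sw.
Qed.

#[local] Arguments noncrossing_words : simpl never.

Lemma mem_canon_noncrossing (T : eqType) (w : seq T) : noncrossing w ->
  canon w \in noncrossing_words (size w).
Proof.
move=> nw; rewrite mem_noncrossing_words noncrossing_canon nw size_canon eqxx /=.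
by case: (eqVneq w [::]) => [->//|/canon_canonical ->]; rewrite orbT.
Qed.

Lemma noncrossing_words_canon p w : w \in noncrossing_words p -> canon w = w.
Proof.
by rewrite mem_noncrossing_words => /and3P[_ _ /orP[/eqP->//|/canon_id]].
Qed.

Lemma canon_behead_take (T : eqType) n (x : T) w :
  canon (take n (behead (canon (x :: w)))) = canon (take n w).
Proof.
rewrite (canonE (x :: w)) /= -map_take canon_map// => y z yw zw.
by apply: canon_letter_inj; rewrite inE (mem_take yw, mem_take zw) orbT.
Qed.

Lemma canon_behead_drop (T : eqType) n (x : T) w :
  canon (drop n (behead (canon (x :: w)))) = canon (drop n w).
Proof.
rewrite (canonE (x :: w)) /= -map_drop canon_map// => y z yw zw.
by apply: canon_letter_inj; rewrite inE (mem_drop yw, mem_drop zw) orbT.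
Qed.

Lemma canon_letter_head (T : eqType) (x : T) w : canon_letter (x :: w) x = 1.
Proof.
by have /canonical_seqP[] := @canon_canonical _ (x :: w) isT.
Qed.

Lemma noncrossing_inl (u : seq nat) : noncrossing (map (@inl nat nat) u) = noncrossing u.
Proof. by rewrite noncrossing_map// => x y _ _ []. Qed.

Lemma noncrossing_inr (u : seq nat) : noncrossing (map (@inr nat nat) u) = noncrossing u.
Proof. by rewrite noncrossing_map// => x y _ _ []. Qed.

Lemma canon_inl (u : seq nat) : canon (map (@inl nat nat) u) = canon u.
Proof. by rewrite canon_map// => x y _ _ []. Qed.

Lemma canon_inr (u : seq nat) : canon (map (@inr nat nat) u) = canon u.
Proof. by rewrite canon_map// => x y _ _ []. Qed.

(** The letters of u are enclosed between a new first letter and the first letter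
    of v, which is identified with it (when v is empty the letter does not
    recur); the two sides of the sum type keep the alphabets apart. *)
Definition join_words (u v : seq nat) : seq nat :=
  canon (inr 1 :: map (@inl nat nat) u ++ map (@inr nat nat) v).

Lemma index_behead_canon (T : eqType) (x : T) w :
  index 1 (behead (canon (x :: w))) = index x w.
Proof.
rewrite canonE; set f := canon_letter (x :: w).
have f1 : f x = 1 by exact: canon_letter_head.
have fi : {in x :: w &, injective f} by exact: canon_letter_inj.
rewrite map_cons -f1; move: (f) fi => g {f f1}; rewrite -[behead _]/(map g w).
elim: w => //= y w IH gi; rewrite IH; last first.
  by move=> z t; rewrite !inE => zw tw; apply: gi; rewrite !inE orbCA (zw, tw) orbT.
congr (if _ then _ else _); apply/eqP/eqP => [/gi ->//|->//]; rewrite !inE ?eqxx ?orbT//.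
Qed.

Lemma size_undup_join (u v : seq nat) :
  size (undup (map (@inl nat nat) u ++ map (@inr nat nat) v)) =
  size (undup u) + size (undup v).
Proof.
rewrite undup_cat size_cat (@eq_in_filter _ _ xpredT) ?filter_predT; last first.
  by move=> x; rewrite mem_undup => /mapP[y _ ->]; apply/negP => /mapP[].
by rewrite !undup_map_inj ?size_map// => x y [].
Qed.

Lemma size_undup_join_words u v : size (undup (join_words u v)) =
  size (undup u) + size (undup (1 :: v)).
Proof.
rewrite size_undup_canon -size_undup_join; apply/eqP.
by rewrite eqn_leq !uniq_leq_size ?undup_uniq// => x;
  rewrite !mem_undup !(inE, mem_cat); case/or3P => ->; rewrite ?orbT.
Qed.

(** The parse at the second occurrence of the first letter recovers both parts
    from the position of that occurrence. *)
Lemma join_wordsK r q u v : u \in noncrossing_words q -> v \in noncrossing_words r ->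
  (canon (take q (behead (join_words u v))), canon (drop q (behead (join_words u v)))) = (u, v).
Proof.
move=> uq vq; have su : size u = q by move: uq; rewrite mem_noncrossing_words => /and3P[_ /eqP].
rewrite canon_behead_take canon_behead_drop.
rewrite take_size_cat ?size_map// drop_size_cat ?size_map// canon_inl canon_inr.
by rewrite (noncrossing_words_canon uq) (noncrossing_words_canon vq).
Qed.

Lemma noncrossing_words_cons p w : w \in noncrossing_words p.+1 ->
  exists w', w = 1 :: w'.
Proof.
rewrite mem_noncrossing_words => /and3P[_ /eqP sw].
case: w sw => // x w _ /= /canonical_seqP[_ /= -> _ _]; by exists w.
Qed.

(** The words whose first letter occurs once. *)
Lemma join_words_nil p : perm_eq
  [seq join_words u [::] | u <- noncrossing_words p]
  [seq w <- noncrossing_words p.+1 | index 1 (behead w) == p].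
Proof.
apply: uniq_perm.
- rewrite map_inj_in_uniq ?noncrossing_words_uniq// => u u' uq uq' E.
  have n0 : [::] \in noncrossing_words 0 by [].
  by have := join_wordsK uq n0; rewrite E (join_wordsK uq' n0) => -[].
- by rewrite filter_uniq// noncrossing_words_uniq.
move=> w; rewrite mem_filter; apply/mapP/andP => [[u uq ->]|[/eqP iw wp]].
  have := uq; rewrite mem_noncrossing_words => /and3P[nu /eqP su _].
  have i1 : inr 1 \notin map (@inl nat nat) u by apply/negP => /mapP[].
  rewrite /join_words /= cats0; split.
    rewrite index_behead_canon memNindex// size_map.
    by rewrite su.
  rewrite -su -(size_map (@inl nat nat) u) -[(size _).+1]/(size (inr 1 :: map (@inl nat nat) u)).
  by apply: mem_canon_noncrossing; apply: noncrossing_new => //; rewrite noncrossing_inl.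
have [w' E] := noncrossing_words_cons wp; rewrite {w}E in iw wp *.
have := wp; rewrite mem_noncrossing_words => /and3P[nw /eqP[sw] _].
have w1 : 1 \notin w' by rewrite -index_mem -[index _ _]/(index 1 (behead (1 :: w'))) iw sw ltnn.
exists (canon w').
  by rewrite -sw; apply: mem_canon_noncrossing; apply: noncrossing_subseq nw; exact: subseq_cons.
rewrite -(noncrossing_words_canon wp) /join_words cats0.
pose h x : nat + nat := if x \in w' then inl (canon_letter w' x) else inr x.
have -> : inr 1 :: map (@inl nat nat) (canon w') = map h (1 :: w').
  rewrite /= {1}/h (negbTE w1); congr (_ :: _); rewrite canonE -map_comp.
  by apply/eq_in_map => x xw /=; rewrite /h xw.
rewrite canon_map// => x y _ _; rewrite /h; case: ifP => xw; case: ifP => yw // -[] // xy.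
by apply: (canon_letter_inj xw yw); rewrite /canon_letter xy.
Qed.

(** The words whose first letter occurs again after the q letters of u. *)
Lemma join_words_cons p q : q <= p -> perm_eq
  [seq join_words u v | u <- noncrossing_words q, v <- noncrossing_words (p - q).+1]
  [seq w <- noncrossing_words p.+2 | index 1 (behead w) == q].
Proof.
move=> qp; apply: uniq_perm.
- apply: allpairs_uniq; rewrite ?noncrossing_words_uniq// => -[u v] [u' v'].
  move=> /allpairsP[[x y] /= [uq vq [-> ->]]] /allpairsP[[x' y'] /= [uq' vq' [-> ->]]] E.
  by rewrite -(join_wordsK uq vq) E (join_wordsK uq' vq').
- by rewrite filter_uniq// noncrossing_words_uniq.
move=> w; rewrite mem_filter; apply/allpairsP/andP => [[[u v] /= [uq vq ->]]|[/eqP iw wp]].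
  have := uq; rewrite mem_noncrossing_words => /and3P[nu /eqP su _].
  have := vq; rewrite mem_noncrossing_words => /and3P[nv /eqP sv _].
  have [v' Ev] := noncrossing_words_cons vq; rewrite {v}Ev in vq nv sv *.
  have i1 : inr 1 \notin map (@inl nat nat) u by apply/negP => /mapP[].
  rewrite /join_words; split.
    by rewrite index_behead_canon index_cat (negbTE i1) /= ?eqxx addn0 size_map su.
  have <- : size (inr 1 :: map (@inl nat nat) u ++ map (@inr nat nat) (1 :: v')) = p.+2.
    by move: sv => /= [sv]; rewrite size_cat /= !size_map su sv; lia.
  apply: mem_canon_noncrossing; apply: noncrossing_glue.
  + move=> _ /mapP[x _ ->]; apply/negP; rewrite -[_ :: _]/(map (@inr nat nat) (1 :: v')).
    by case/mapP.
  + by rewrite noncrossing_inl.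
  + by rewrite -[_ :: _]/(map (@inr nat nat) (1 :: v')) noncrossing_inr.
have [w' E] := noncrossing_words_cons wp; rewrite {w}E /= in iw wp *.
have := wp; rewrite mem_noncrossing_words => /and3P[nw /eqP[sw] _].
have w1 : 1 \in w' by rewrite -index_mem iw sw ltnS.
have [u [v [Ew u1]]] := split_first w1.
have su : size u = q by rewrite -iw Ew index_cat (negbTE u1) /= ?eqxx addn0.
have sv : size (1 :: v) = (p - q).+1 by move: sw; rewrite Ew size_cat /= su; lia.
rewrite Ew in nw wp *.
have dis x : x \in u -> x \notin 1 :: v by exact: noncrossing_block.
exists (canon u, canon (1 :: v)); split => /=.
- rewrite -su; apply: mem_canon_noncrossing; apply: noncrossing_subseq nw.
  by apply: subseq_trans (subseq_cons _ _); exact: prefix_subseq.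
- rewrite -sv; apply: mem_canon_noncrossing; apply: noncrossing_subseq nw.
  by apply: subseq_trans (subseq_cons _ _); exact: suffix_subseq.
rewrite -(noncrossing_words_canon wp) /join_words.
pose h x : nat + nat := if x \in u then inl (canon_letter u x) else inr (canon_letter (1 :: v) x).
have -> : inr 1 :: map (@inl nat nat) (canon u) ++ map (@inr nat nat) (canon (1 :: v)) =
    map h (1 :: u ++ 1 :: v).
  rewrite [RHS]/= [in RHS]map_cat {1}/h (negbTE u1) canon_letter_head; congr (_ :: _ ++ _).
    by rewrite canonE -map_comp; apply/eq_in_map => x xu /=; rewrite /h xu.
  rewrite canonE -map_comp; apply/eq_in_map => x xv /=; rewrite /h.
  by case: ifP => // /dis; rewrite xv.
rewrite canon_map// => x y xw yw; rewrite /h; case: ifP => xu; case: ifP => yu // -[] // xy.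
  by apply: (canon_letter_inj xu yu); rewrite /canon_letter xy.
apply: (@canon_letter_inj _ (1 :: v)); last by rewrite /canon_letter xy.
  by move: xw; rewrite !(inE, mem_cat) xu /= orbA orbb.
by move: yw; rewrite !(inE, mem_cat) yu /= orbA orbb.
Qed.

End narayana_words.

Section narayana.
Context {R : comPzRingType}.
Variable c : R.

(** The coefficient of c^s is the Narayana number of p and s. *)
Definition narayana p : R := \sum_(w <- noncrossing_words p) c ^+ size (undup w).

Lemma narayana0 : narayana 0 = 1.
Proof. by rewrite /narayana big_seq1. Qed.

(** The first term comes from the words whose first letter occurs once, the
    product with index q from those in which it recurs after q letters. *)
Lemma narayanaS p : narayana p.+1 =
  c * narayana p + \sum_(q < p) narayana q * narayana (p - q).
Proof.
have ib w : w \in noncrossing_words p.+1 -> (index 1%N (behead w) < p.+1)%N.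
  move=> wp; have := wp; rewrite mem_noncrossing_words => /and3P[_ /eqP sw _].
  by rewrite ltnS (leq_trans (index_size _ _))// size_behead sw.
rewrite {1}/narayana big_seq.
rewrite (partition_big (fun w => inord (index 1%N (behead w)) : 'I_p.+1) xpredT)//=.
rewrite big_ord_recr /= addrC; congr (_ + _).
  transitivity (\sum_(w <- [seq w <- noncrossing_words p.+1 | index 1%N (behead w) == p])
     c ^+ size (undup w)).
    rewrite [RHS]big_filter [RHS]big_seq_cond; apply: eq_bigl => w; apply: andb_id2l => wp.
    by rewrite -val_eqE /= inordK// ib.
  rewrite -(perm_big _ (join_words_nil p)) big_map big_distrr; apply: eq_bigr => u _.
  by rewrite size_undup_join_words addn1 exprS.
apply: eq_bigr => q _.
transitivity (\sum_(w <- [seq w <- noncrossing_words p.+1 | index 1%N (behead w) == q])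
     c ^+ size (undup w)).
  rewrite [RHS]big_filter [RHS]big_seq_cond; apply: eq_bigl => w; apply: andb_id2l => wp.
  by rewrite -val_eqE /= inordK// ib.
case: p q {ib} => [[]//|p] [q qp] /=.
rewrite -(perm_big _ (join_words_cons (qp : (q <= p)%N))) subSn//.
rewrite big_allpairs_dep /narayana big_distrl; apply: eq_bigr => u _.
rewrite big_distrr big_seq [RHS]big_seq; apply: eq_bigr => v vq.
rewrite size_undup_join_words exprD; have [v' ->] := noncrossing_words_cons vq.
by [].
Qed.

End narayana.

(** * Joint moments of closed walks *)

Section tuple_sums.
Context {Z : nmodType} {T : finType}.

Lemma sum_tuple0 (F : seq T -> Z) : \sum_(i : 0.-tuple T) F i = F [::].
Proof.
rewrite (bigD1 [tuple]) //= big1 ?addr0// => i /eqP[].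
exact: tuple0.
Qed.

Lemma sum_tuple_cons p (F : seq T -> Z) :
  \sum_(i : p.+1.-tuple T) F i = \sum_(v : T) \sum_(i : p.-tuple T) F (v :: i).
Proof.
rewrite pair_big_dep /= (reindex (fun vi : T * p.-tuple T => [tuple of vi.1 :: vi.2])) //=.
exists (fun i : p.+1.-tuple T => (thead i, [tuple of behead i])).
  by move=> [v i] _; congr (_, _); apply: val_inj.
by move=> i _; rewrite -tuple_eta.
Qed.

Lemma sum_tuple_cat p q (F : seq T -> Z) :
  \sum_(i : (p + q).-tuple T) F i =
  \sum_(i : p.-tuple T) \sum_(j : q.-tuple T) F (i ++ j).
Proof.
elim: p F => [|p IH] F.
  by rewrite (sum_tuple0 (fun i => \sum_(j : q.-tuple T) F (i ++ j))).
rewrite addSn sum_tuple_cons (sum_tuple_cons _ (fun i => \sum_(j : q.-tuple T) F (i ++ j))).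
by apply: eq_bigr => v _; rewrite (IH (fun i => F (v :: i))).
Qed.

Lemma sum_tuple_rot p n (F : seq T -> Z) :
  \sum_(i : p.-tuple T) F i = \sum_(i : p.-tuple T) F (rot n i).
Proof.
rewrite (reindex (fun i : p.-tuple T => [tuple of rot n i])) //=.
exists (fun i : p.-tuple T => [tuple of rotr n i]) => i _; apply: val_inj => /=.
  exact: rotK.
exact: rotrK.
Qed.

End tuple_sums.

Section few_letters.
Local Open Scope nat_scope.

(** Such a tuple is a choice of h values followed by a word in them. *)
Lemma card_few_letters n p h : 0 < n -> 0 < h ->
  #|[pred i : p.-tuple 'I_n | size (undup i) <= h]| <= n ^ h * h ^ p.
Proof.
case: n h => [//|n] [//|h] _ _.
have <- : #|{: h.+1.-tuple 'I_n.+1 * p.-tuple 'I_h.+1}| = n.+1 ^ h.+1 * h.+1 ^ p.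
  by rewrite card_prod !card_tuple !card_ord.
pose f (tj : h.+1.-tuple 'I_n.+1 * p.-tuple 'I_h.+1) : p.-tuple 'I_n.+1 :=
  [tuple of map (tnth tj.1) tj.2].
apply: leq_trans (leq_imset_card f _); apply/fintype.subset_leq_card/fintype.subsetP => i.
rewrite inE => ih.
have st : size (undup i ++ nseq (h.+1 - size (undup i)) ord0) == h.+1.
  by rewrite size_cat size_nseq subnKC.
apply/imsetP; exists (Tuple st, [tuple of map (fun x => inord (index x (undup i))) i]) => //.
apply: val_inj => /=; rewrite -map_comp -[LHS]map_id; apply/eq_in_map => x xi /=.
have ix : index x (undup i) < size (undup i) by rewrite index_mem mem_undup.
rewrite (tnth_nth ord0) /= inordK; last exact: leq_trans ih.
by rewrite nth_cat ix nth_index// mem_undup.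
Qed.

End few_letters.

(** The properties of mu p q = E (conj(x)^p x^q) for a centred variable x of
    modulus 1; cancellation of conj(x) x is the second one. *)
Record unimodular_moments (C : numDomainType) (mu : nat -> nat -> C) : Prop :=
  UnimodularMoments {
    moment00 : mu 0 0 = 1;
    momentSS : forall p q, mu p.+1 q.+1 = mu p q;
    moment10 : mu 1 0 = 0;
    moment01 : mu 0 1 = 0;
    moment_le1 : forall p q, `|mu p q| <= 1 }.

Section edge_moments.
Context {C : numDomainType} (mu : nat -> nat -> C).
Hypothesis hmu : unimodular_moments mu.

Let mu00 := moment00 hmu.
Let muSS := momentSS hmu.
Let mu10 := moment10 hmu.
Let mu01 := moment01 hmu.
Let mu_le1 := moment_le1 hmu.

(** The expectation of the product of conj(x_e) over the entries of D and x_e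
    over those of U, for independent x_e with joint moments mu. *)
Definition edge_moment (T : eqType) (D U : seq T) : C :=
  \prod_(e <- undup (D ++ U)) mu (count_mem e D) (count_mem e U).

Section edge_moment.
Context {T : eqType}.
Implicit Types (D U S : seq T) (e : T).

Lemma edge_moment_sup D U S : uniq S -> {subset D ++ U <= S} ->
  edge_moment D U = \prod_(e <- S) mu (count_mem e D) (count_mem e U).
Proof.
move=> uS sub; rewrite (bigID (fun e => e \in D ++ U)) /= [X in _ * X]big1 ?mulr1; last first.
  move=> e; rewrite mem_cat negb_or => /andP[/count_memPn -> /count_memPn ->].
  exact: mu00.
rewrite -big_filter; apply: perm_big; apply: uniq_perm; rewrite ?undup_uniq ?filter_uniq//.
move=> e; rewrite mem_undup mem_filter; case: (boolP (e \in D ++ U)) => // /sub ->.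
by [].
Qed.

Lemma edge_moment_perm D D' U U' : perm_eq D D' -> perm_eq U U' ->
  edge_moment D U = edge_moment D' U'.
Proof.
move=> pD pU; rewrite (@edge_moment_sup D U (undup (D' ++ U'))) ?undup_uniq//.
  by apply: eq_bigr => e _; rewrite (permP pD) (permP pU).
by move=> e; rewrite mem_undup !mem_cat (perm_mem pD) (perm_mem pU).
Qed.

Lemma edge_moment_cons e D U : edge_moment (e :: D) (e :: U) = edge_moment D U.
Proof.
set S := undup (e :: D ++ U).
rewrite !(@edge_moment_sup _ _ S) ?undup_uniq//; first 1 last.
- by move=> f fU; rewrite mem_undup inE fU orbT.
- by move=> f; rewrite mem_undup inE !mem_cat !inE => /orP[] /orP[] ->; rewrite ?orbT.
apply: eq_bigr => f _ /=; case: eqP => _ //; rewrite !add1n; exact: muSS.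
Qed.

Lemma edge_moment_single e D U : (count_mem e D + count_mem e U = 1)%N -> edge_moment D U = 0.
Proof.
move=> ce; have eS : e \in undup (D ++ U).
  by rewrite mem_undup -has_pred1 has_count count_cat; move: ce => /= ->.
rewrite /edge_moment (big_rem e eS) /=.
suff -> : mu (count_mem e D) (count_mem e U) = 0 by rewrite mul0r.
by move: ce; case: (count_mem e D) (count_mem e U) => [|[|?]] [|[|?]].
Qed.

Lemma edge_moment_le1 D U : `|edge_moment D U| <= 1.
Proof.
rewrite normr_prod; suff /andP[] : 0 <= \prod_(e <- undup (D ++ U))
  `|mu (count_mem e D) (count_mem e U)| <= 1 by [].
apply: (big_ind (fun x : C => 0 <= x <= 1)) => [|x y /andP[x0 x1] /andP[y0 y1]|e _].
- by rewrite ler01 lexx.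
- by rewrite mulr_ge0// mulr_ile1.
- by rewrite normr_ge0 mu_le1.
Qed.

Lemma edge_moment_nil : edge_moment (T := T) [::] [::] = 1.
Proof. by rewrite /edge_moment big_nil. Qed.

Lemma edge_moment_catM D U D' U' : {in D ++ U, forall e, e \notin D' ++ U'} ->
  edge_moment (D ++ D') (U ++ U') = edge_moment D U * edge_moment D' U'.
Proof.
move=> dis; rewrite (@edge_moment_sup _ _ (undup (D ++ U) ++ undup (D' ++ U'))).
- rewrite big_cat; congr (_ * _); rewrite /edge_moment big_seq [RHS]big_seq;
    apply: eq_bigr => e; rewrite mem_undup => eDU.
    have := dis _ eDU; rewrite mem_cat negb_or => /andP[/count_memPn h1 /count_memPn h2].
    by rewrite !count_cat h1 h2 !addn0.
  have : e \notin D ++ U by apply/negP => /dis; rewrite eDU.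
  rewrite mem_cat negb_or => /andP[/count_memPn h1 /count_memPn h2].
  by rewrite !count_cat h1 h2 !add0n.
- rewrite cat_uniq !undup_uniq andbT /=; apply/hasPn => e; rewrite !mem_undup.
  by apply: contraTN => /dis.
- move=> e; rewrite !mem_cat !mem_undup !mem_cat.
  by case/orP => /orP[] ->; rewrite ?orbT.
Qed.

End edge_moment.

Lemma edge_moment_map (T T' : eqType) (f : T -> T') (D U : seq T) :
  {in D ++ U &, injective f} -> edge_moment (map f D) (map f U) = edge_moment D U.
Proof.
move=> fi; rewrite /edge_moment -map_cat undup_map_in// big_map.
rewrite big_seq [RHS]big_seq; apply: eq_bigr => e; rewrite mem_undup => eDU.
have cf s : {subset s <= D ++ U} -> count_mem (f e) (map f s) = count_mem e s.
  move=> sub; rewrite count_map; apply: eq_in_count => x /sub xs /=.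
  by apply/eqP/eqP => [/fi->|->].
by congr mu; apply: cf => x xs; rewrite mem_cat xs ?orbT.
Qed.

(** The sum over all walks with values in [n] along the word w. *)
Definition walk_sum (n p : nat) (L : eqType) (w : seq L) : C :=
  \sum_(i : p.-tuple 'I_n) edge_moment (downs w i) (ups w i).

Section walk_sum.
Context {L : eqType} (n : nat).
Implicit Types (w : seq L) (a t : L).

Lemma edge_moment_rot k w (i : seq 'I_n) : size i = size w ->
  edge_moment (downs (rot k w) (rot k i)) (ups (rot k w) (rot k i)) =
  edge_moment (downs w i) (ups w i).
Proof.
move=> iw; rewrite downs_rot// ups_rot//.
by apply: edge_moment_perm; rewrite perm_rot.
Qed.

Lemma walk_sum_rot k p w : size w = p -> walk_sum n p (rot k w) = walk_sum n p w.
Proof.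
move=> wp; rewrite /walk_sum.
rewrite (sum_tuple_rot p k (fun i => edge_moment (downs (rot k w) i) (ups (rot k w) i))).
by apply: eq_bigr => i _; rewrite edge_moment_rot ?size_tuple.
Qed.

Lemma walk_sum1 a : walk_sum n 1 [:: a] = n%:R.
Proof.
rewrite /walk_sum (sum_tuple_cons _ (fun i => edge_moment (downs [:: a] i) (ups [:: a] i))).
under eq_bigr do rewrite (sum_tuple0 (fun i => edge_moment (downs [:: a] (_ :: i)) (ups [:: a] (_ :: i)))).
rewrite (eq_bigr (fun=> 1)) ?sumr_const ?card_ord// => v _.
by rewrite /downs /ups /= edge_moment_cons edge_moment_nil.
Qed.

(** The value between the two equal letters is free: its edge is traversed down
    and up, and the two factors cancel. *)
Lemma walk_sum_dup p a w : size (a :: w) = p ->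
  walk_sum n p.+1 (a :: a :: w) = n%:R * walk_sum n p (a :: w).
Proof.
move=> wp; rewrite /walk_sum.
rewrite (sum_tuple_cons _ (fun i => edge_moment (downs [:: a, a & w] i) (ups [:: a, a & w] i))).
rewrite (eq_bigr (fun=> walk_sum n p (a :: w))) ?sumr_const ?card_ord ?mulr_natl// => v _.
apply: eq_bigr => i _; rewrite ups_cons /downs /= edge_moment_cons.
by rewrite /ups rot1_cons.
Qed.

(** The two edges at the single letter t are met once each, so centring forces
    them to coincide; the two values are equal and the factors cancel. *)
Lemma walk_sum_new p t w : size w = p -> w != [::] -> t \notin w ->
  walk_sum n p.+1 (t :: w) = walk_sum n p w.
Proof.
case: w p => [//|b w] [//|p] [wp] _ tw; rewrite /walk_sum.
rewrite (sum_tuple_cons _ (fun i => edge_moment (downs (t :: b :: w) i) (ups (t :: b :: w) i))).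
rewrite exchange_big; apply: eq_bigr => i _.
case/lastP: (tval i) (size_tuple i) => // j z; rewrite size_rcons => -[jp].
rewrite (bigD1 z) //= big1 ?addr0 => [|v vz].
- rewrite ups_new ?jp// /downs /= /ups rot1_cons zip_rcons ?jp//.
  transitivity (edge_moment ((t, z) :: zip (b :: w) (rcons j z)) ((t, z) :: (b, z) :: zip w j)).
    apply: edge_moment_perm => //; rewrite -rcons_cons perm_rcons.
    exact: perm_refl.
  rewrite edge_moment_cons; apply: edge_moment_perm => //.
  by rewrite perm_sym perm_rcons.
- apply: (@edge_moment_single _ (t, v)); rewrite ups_cons zip_rcons ?jp//.
  have tw' : t \notin w by move: tw; rewrite inE negb_or => /andP[].
  have ct (s : seq 'I_n) u : t \notin u -> count_mem (t, v) (zip u s) = 0%N.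
    by move=> tu; apply/count_memPn/negP => /mem_zip/andP[]; rewrite (negbTE tu).
  rewrite /downs /= eqxx (ct _ (b :: w))// addn0 -cats1 count_cat ct//=.
  have bt : (b == t) = false.
    by apply/negbTE; rewrite eq_sym; move: tw; rewrite inE negb_or => /andP[].
  have zv : (z == v) = false by rewrite eq_sym; exact/negbTE.
  by rewrite !xpair_eqE bt zv andbF.
Qed.

Lemma walk_sum_map (L' : eqType) (f : L -> L') p w : size w = p ->
  {in w &, injective f} -> walk_sum n p (map f w) = walk_sum n p w.
Proof.
move=> wp fi; apply: eq_bigr => i _.
pose f2 (e : L * 'I_n) := (f e.1, e.2).
have zE u s : zip (map f u) s = map f2 (zip u s).
  by elim: u s => [|x u IH] [|y s] //=; rewrite IH.
rewrite /downs /ups -map_rot !zE edge_moment_map// => -[x v] [y u].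
rewrite !mem_cat => /orP xv /orP yu [xy ->]; congr (_, _); apply: fi xy.
  by case: xv => /mem_zip/andP[]//=; rewrite mem_rot.
by case: yu => /mem_zip/andP[]//=; rewrite mem_rot.
Qed.

(** An edge traversed once makes the moment vanish, and neighbouring letters
    differ, so a value visited once would have two edges traversed once. *)
Lemma irreducible_edge_moment w (i : seq 'I_n) : irreducible_word w -> size i = size w ->
  edge_moment (downs w i) (ups w i) != 0 -> ((size (undup i)).*2 <= size w)%N.
Proof.
move=> /and3P[w1 _ /allP adj] iw m0; rewrite -iw; apply: size_undup_count => v vi.
apply: contraNT m0 => cv; have [k [i' [E vi']]] := rot_singleton vi cv.
have wk : size (rot k w) = size (v :: i') by rewrite -E !size_rot.
rewrite -(edge_moment_rot k iw) E.
have : {in zip (rot k w) (rot 1 (rot k w)), forall e, e.1 != e.2}.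
  by move=> e; rewrite rot_rot zip_rot_size ?size_rot// mem_rot; exact: adj.
case: (rot k w) wk w1 (size_rot k w) => [//|a [|b u]] wk w1 sw.
  by move: w1; rewrite -sw.
move=> /(_ (a, b)); rewrite rot1_cons /= inE eqxx => /(_ isT) /= ab.
rewrite (@edge_moment_single _ (a, v)) ?eqxx// ups_cons /downs.
have cz (u' : seq L) : count_mem (a, v) (zip u' i') = 0%N.
  by apply/count_memPn/negP => /mem_zip/andP[_]; rewrite (negbTE vi').
move: (cz (b :: u)) (cz (rcons u a)); move: (zip _ _) (zip _ _) => D U cD cU.
by rewrite /= cD cU eqxx xpair_eqE [b == a]eq_sym (negbTE ab).
Qed.

(** At most p/2 letters and at most p/2 values occur, so the exponents of n add
    up to at most p instead of the p + 1 of a noncrossing word. *)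
Lemma walk_sum_irreducible p w : (0 < n)%N -> irreducible_word w -> size w = p ->
  `|walk_sum n p w| * n%:R ^+ size (undup w) <= (p ^ p)%:R * n%:R ^+ p.
Proof.
move=> n0 iw wp; have /and3P[w1 /allP cw _] := iw.
set h := p./2; have h0 : (0 < h)%N by rewrite /h -wp half_gt0.
have hp : (h + h <= p)%N by rewrite addnn -[leqRHS]odd_double_half leq_addl.
have sh : (size (undup w) <= h)%N.
  by rewrite -(doubleK (size _)) half_leq// -wp; exact: size_undup_count.
have : `|walk_sum n p w| <= (n ^ h * h ^ p)%:R.
  apply: le_trans (ler_norm_sum _ _ _) _.
  rewrite (bigID (fun i : p.-tuple 'I_n => (size (undup i) <= h)%N)) /=.
  rewrite [X in _ + X]big1 ?addr0; last first.
    move=> i; apply: contraNeq; rewrite normr_eq0 => m0.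
    rewrite -(doubleK (size _)) half_leq//.
    by have := irreducible_edge_moment iw _ m0; rewrite size_tuple wp; apply.
  apply: le_trans (_ : (#|[pred i : p.-tuple 'I_n | (size (undup i) <= h)%N]|)%:R <= _).
    rewrite -sum1_card natr_sum; apply: ler_sum => i _; exact: edge_moment_le1.
  by rewrite ler_nat card_few_letters.
move=> /(ler_wpM2r (exprn_ge0 (size (undup w)) (ler0n C n))) /le_trans; apply.
rewrite -!natrX -!natrM ler_nat mulnAC -expnD mulnC; apply: leq_mul.
  by rewrite leq_exp2r; lia.
by rewrite leq_pexp2l//; lia.
Qed.

(** Both sides change by the same power of n under each reduction. *)
Lemma walk_sum_noncrossing w : w != [::] -> noncrossing w ->
  walk_sum n (size w) w * n%:R ^+ size (undup w) = n%:R ^+ (size w).+1.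
Proof.
move: w; apply: noncrossing_ind => [a|a w IH|t w w0 tw IH|w IH].
- by rewrite walk_sum1.
- rewrite [size (_ :: _)]/= walk_sum_dup// -mulrA.
  have -> : undup (a :: a :: w) = undup (a :: w) by rewrite /= inE eqxx.
  by rewrite IH -exprS.
- by rewrite [size (_ :: _)]/= walk_sum_new//= (negbTE tw) /= exprS mulrCA IH -exprS.
- by rewrite size_rot walk_sum_rot// size_undup_rot.
Qed.

Lemma leq_expnn p : (p ^ p <= p.+1 ^ p.+1)%N.
Proof.
case: p => // p; rewrite (leq_trans (_ : _ <= p.+2 ^ p.+1)%N)//.
  by rewrite leq_exp2r.
by rewrite leq_pexp2l.
Qed.

(** The reductions lead to an irreducible word, where one factor n is lost. *)
Lemma walk_sum_crossing w : (0 < n)%N -> w != [::] -> ~~ noncrossing w ->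
  `|walk_sum n (size w) w| * n%:R ^+ size (undup w) <=
  (size w ^ size w)%:R * n%:R ^+ size w.
Proof.
move=> n0; move: w; apply: word_ind => [a|a w IH|t w w0 tw IH|w IH|w iw].
- by rewrite noncrossing_new.
- move=> cr; rewrite [size (_ :: _)]/= walk_sum_dup//.
  have -> : undup (a :: a :: w) = undup (a :: w) by rewrite /= inE eqxx.
  rewrite normrM normr_nat -mulrA [n%:R ^+ (size w).+2]exprS [leRHS]mulrCA ler_wpM2l//.
  apply: le_trans (IH _) _.
    by apply: contra cr; exact: noncrossing_dup.
  by rewrite ler_wpM2r// ?exprn_ge0// ler_nat leq_expnn.
- move=> cr; rewrite [size (_ :: _)]/= walk_sum_new//= (negbTE tw) /=.
  rewrite [n%:R ^+ (size (undup w)).+1]exprS [leLHS]mulrCA.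
  rewrite [n%:R ^+ (size w).+1]exprS [leRHS]mulrCA ler_wpM2l//.
  apply: le_trans (IH _) _.
    by apply: contra cr; exact: noncrossing_new.
  by rewrite ler_wpM2r// ?exprn_ge0// ler_nat leq_expnn.
- by rewrite noncrossing_rot1 size_rot walk_sum_rot// size_undup_rot.
- by move=> _; exact: walk_sum_irreducible.
Qed.

Lemma walk_sum_bound w : (0 < n)%N -> w != [::] ->
  `|walk_sum n (size w) w| * n%:R ^+ size (undup w) <=
  (size w ^ size w)%:R * n%:R ^+ (size w).+1.
Proof.
move=> n0 w0; case: (boolP (noncrossing w)) => [nw|cw].
  rewrite -[n%:R ^+ size (undup w)]ger0_norm ?exprn_ge0// -normrM walk_sum_noncrossing//.
  rewrite ger0_norm ?exprn_ge0// ler_peMl ?exprn_ge0// ler1n expn_gt0.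
  by rewrite lt0n size_eq0 w0.
apply: le_trans (walk_sum_crossing n0 w0 cw) _.
rewrite [n%:R ^+ (size w).+1]exprS [leRHS]mulrCA.
by rewrite ler_peMl ?mulr_ge0 ?exprn_ge0// ler1n.
Qed.

(** The joint moment of two closed walks, summed over both. *)
Definition walk_pair_sum (p q : nat) (w w' : seq L) : C :=
  \sum_(i : p.-tuple 'I_n) \sum_(j : q.-tuple 'I_n)
    edge_moment (downs w i ++ downs w' j) (ups w i ++ ups w' j).

Lemma walk_pair_sum_rot k l p q w w' : size w = p -> size w' = q ->
  walk_pair_sum p q (rot k w) (rot l w') = walk_pair_sum p q w w'.
Proof.
move=> wp wq; rewrite /walk_pair_sum.
rewrite (sum_tuple_rot p k (fun i => \sum_(j : q.-tuple 'I_n)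
  edge_moment (downs (rot k w) i ++ downs (rot l w') j) (ups (rot k w) i ++ ups (rot l w') j))).
apply: eq_bigr => i _.
rewrite (sum_tuple_rot q l (fun j =>
  edge_moment (downs (rot k w) (rot k i) ++ downs (rot l w') j) (ups (rot k w) (rot k i) ++ ups (rot l w') j))).
apply: eq_bigr => j _; rewrite !downs_rot ?ups_rot ?size_tuple//.
by apply: edge_moment_perm; apply: perm_cat; rewrite perm_rot.
Qed.

(** Two closed walks based at the same letter form one closed walk. *)
Lemma walk_pair_sum_join p q a w w' : size (a :: w) = p -> size (a :: w') = q ->
  walk_pair_sum p q (a :: w) (a :: w') = walk_sum n (p + q) ((a :: w) ++ (a :: w')).
Proof.
move=> wp wq; rewrite /walk_sum (sum_tuple_cat _ _ (fun i =>
  edge_moment (downs ((a :: w) ++ (a :: w')) i) (ups ((a :: w) ++ (a :: w')) i))).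
apply: eq_bigr => i _; apply: eq_bigr => j _.
rewrite /downs /ups zip_cat ?size_tuple// cat_cons !rot1_cons.
have -> : rcons (w ++ a :: w') a = rcons w a ++ rcons w' a.
  by rewrite -cat_rcons rcons_cat.
rewrite zip_cat//.
by rewrite size_rcons size_tuple -wp.
Qed.

(** Walks without common letters have no common edge, hence are independent. *)
Lemma walk_pair_sum_disjoint p q w w' : size w = p -> size w' = q ->
  {in w, forall x, x \notin w'} ->
  walk_pair_sum p q w w' = walk_sum n p w * walk_sum n q w'.
Proof.
move=> wp wq dis; rewrite /walk_sum [RHS]mulr_suml; apply: eq_bigr => i _.
rewrite [RHS]mulr_sumr; apply: eq_bigr => j _; rewrite -edge_moment_catM// => -[x v].
have zE (u : seq L) (s : seq 'I_n) :
    (x, v) \in downs u s ++ ups u s -> x \in u.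
  by rewrite mem_cat => /orP[] /mem_zip/andP[]//=; rewrite mem_rot.
by move=> /zE /dis; apply: contra => /zE.
Qed.

(** After rotation the common letter is the base point of both walks, and the
    bound for the single walk of length p + q applies. *)
Lemma walk_pair_sum_bound p q w w' x : (0 < n)%N -> size w = p -> size w' = q ->
  x \in w -> x \in w' ->
  `|walk_pair_sum p q w w'| * n%:R ^+ size (undup (w ++ w')) <=
  ((p + q) ^ (p + q))%:R * n%:R ^+ (p + q).+1.
Proof.
move=> n0 wp wq xw xw'; have [k u E] := rot_to xw; have [l u' E'] := rot_to xw'.
rewrite -(walk_pair_sum_rot k l)// E E'.
have su : size (x :: u) = p by rewrite -E size_rot.
have su' : size (x :: u') = q by rewrite -E' size_rot.
have -> : size (undup (w ++ w')) = size (undup ((x :: u) ++ (x :: u'))).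
  rewrite -E -E'; apply: perm_size; apply: perm_undup => y.
  by rewrite [LHS]mem_cat [RHS]mem_cat !mem_rot.
rewrite walk_pair_sum_join// -{1 2 3 4}su -{1 2 3 4}su' -size_cat.
exact: walk_sum_bound.
Qed.

End walk_sum.
End edge_moments.

(** * Sums of weights with distinct indices *)

Lemma cvg_natV {R : realType} : (n%:R^-1 : R) @[n --> \oo] --> (0 : R).
Proof. by rewrite -cvg_shiftS; exact: cvg_harmonic. Qed.

Lemma cvg_bigsum {R : realType} {I : Type} (r : seq I) (F : I -> nat -> R) (l : I -> R) :
  (forall i, F i n @[n --> \oo] --> l i) ->
  \sum_(i <- r) F i n @[n --> \oo] --> \sum_(i <- r) l i.
Proof. by move=> h; apply: cvg_big => // ; exact: add_continuous. Qed.

Section weight_sums.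
Context {R : realType}.
Implicit Types (tau : nat -> R) (ds : seq nat).

Definition weight_prod tau ds (f : seq nat) : R :=
  \prod_(i < size ds) tau (nth 0%N f i) ^+ nth 0%N ds i.

Definition power_sum tau m d : R := \sum_(j < m) tau j ^+ d.

(** The sum over the labellings of the positions of ds by distinct indices. *)
Definition injective_sum tau m ds : R :=
  \sum_(f : (size ds).-tuple 'I_m | uniq f) weight_prod tau ds (vals f).

Definition add_at ds k d : seq nat := set_nth 0%N ds k (nth 0%N ds k + d)%N.

Lemma size_add_at ds k d : (k < size ds)%N -> size (add_at ds k d) = size ds.
Proof. by move=> kd; rewrite size_set_nth; apply/maxn_idPr. Qed.

Lemma weight_prod_cons tau d ds x f :
  weight_prod tau (d :: ds) (x :: f) = tau x ^+ d * weight_prod tau ds f.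
Proof. by rewrite /weight_prod big_ord_recl. Qed.

Lemma weight_prod_add_at tau ds k d f : (k < size ds)%N ->
  weight_prod tau (add_at ds k d) f = tau (nth 0%N f k) ^+ d * weight_prod tau ds f.
Proof.
move=> kd; rewrite /weight_prod size_add_at//.
rewrite (bigD1 (Ordinal kd)) //= [in RHS](bigD1 (Ordinal kd)) //=.
rewrite nth_set_nth /= eqxx exprD [in RHS]mulrCA -mulrA; do 2 congr (_ * _).
apply: eq_bigr => i ik; rewrite nth_set_nth /=.
by move: ik; rewrite -val_eqE /= => /negbTE ->.
Qed.

Lemma injective_sum_nil tau m : injective_sum tau m [::] = 1.
Proof.
rewrite /injective_sum big_mkcond
  (sum_tuple0 (fun f : seq 'I_m => if uniq f then weight_prod tau [::] (vals f) else 0)).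
by rewrite /weight_prod /= big_ord0.
Qed.

(** The first label is arbitrary, minus the cases in which it equals a later one;
    then the two degrees add up. *)
Lemma injective_sum_cons tau m d ds : injective_sum tau m (d :: ds) =
  power_sum tau m d * injective_sum tau m ds -
  \sum_(k < size ds) injective_sum tau m (add_at ds k d).
Proof.
have Ek (k : 'I_(size ds)) : injective_sum tau m (add_at ds k d) =
    \sum_(f : (size ds).-tuple 'I_m | uniq f)
      tau (nth 0%N (vals f) k) ^+ d * weight_prod tau ds (vals f).
  rewrite /injective_sum size_add_at//; apply: eq_bigr => f _.
  by rewrite weight_prod_add_at.
rewrite (eq_bigr _ (fun k _ => Ek k)) {Ek} exchange_big /=.
rewrite [injective_sum tau m ds]/injective_sum mulr_sumr -sumrB.
rewrite {1}/injective_sum big_mkcond (sum_tuple_cons _ (fun f : seq 'I_m =>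
  if uniq f then weight_prod tau (d :: ds) (vals f) else 0)).
rewrite exchange_big [RHS]big_mkcond /=; apply: eq_bigr => f _.
case: ifP => uf; last by rewrite big1 // => x _; rewrite andbF.
under eq_bigr => x _ do rewrite andbT weight_prod_cons.
rewrite -big_mkcond -mulr_suml -mulr_suml -mulrBl; congr (_ * _).
rewrite /power_sum [X in _ = X - _](bigID (fun x => x \in tval f)) /=.
rewrite [X in _ = X + _ - _](_ : _ = \sum_(i < size ds) tau (nth 0%N (vals f) i) ^+ d).
  by rewrite addrAC subrr add0r.
transitivity (\sum_(x <- f) tau x ^+ d); first by rewrite big_uniq.
rewrite big_tuple; apply: eq_bigr => i _.
by rewrite (nth_map (tnth f i)) ?size_tuple// -tnth_nth.
Qed.

(** In the recursion the merged terms have one label less, hence vanish after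
    division by the power of m. *)
Lemma injective_sum_cvg tau (mq : nat -> R) ds :
  (forall q : nat, (0 < q)%N -> (m%:R)^-1 * power_sum tau m q @[m --> \oo] --> mq q) ->
  all (leq 1) ds ->
  (m%:R ^+ size ds)^-1 * injective_sum tau m ds @[m --> \oo] --> \prod_(d <- ds) mq d.
Proof.
move=> ht; have [n] := ubnP (size ds); elim: n ds => // n IH [|d ds] dsn.
  move=> _; rewrite big_nil; under eq_fun do rewrite injective_sum_nil expr0 invr1 mul1r.
  exact: cvg_cst.
move=> /= /andP[d0 ds0]; rewrite big_cons.
have -> : (fun m => (m%:R ^+ (size ds).+1)^-1 * injective_sum tau m (d :: ds)) =
    (fun m => (m%:R^-1 * power_sum tau m d) * ((m%:R ^+ size ds)^-1 * injective_sum tau m ds)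
     - m%:R^-1 * \sum_(k < size ds) ((m%:R ^+ size (add_at ds k d))^-1 * injective_sum tau m (add_at ds k d))).
  apply/funext => m; rewrite injective_sum_cons exprS invfM mulrBr; congr (_ - _).
    by rewrite mulrACA.
  rewrite -mulrA mulr_sumr; congr (_ * _); apply: eq_bigr => k _.
  by rewrite size_add_at.
rewrite -[X in _ --> X]subr0; apply: cvgB.
  by apply: cvgM; [exact: ht|exact: IH].
have Hs : \sum_(k < size ds) ((m%:R ^+ size (add_at ds k d))^-1 *
    injective_sum tau m (add_at ds k d)) @[m --> \oo] -->
    \sum_(k < size ds) \prod_(e <- add_at ds k d) mq e.
  apply: cvg_bigsum => k; apply: IH; first by rewrite size_add_at.
  apply/allP => x /(nthP 0%N)[l]; rewrite size_add_at// => lk <-.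
  rewrite nth_set_nth /=; have dpos j : (j < size ds)%N -> (0 < nth 0%N ds j)%N.
    by move=> jk; apply: (allP ds0); rewrite mem_nth.
  by case: eqP => _; rewrite ?ltn_addr ?dpos.
by have := cvgM cvg_natV Hs; rewrite mul0r => H; exact: H.
Qed.

(** The words with canonical form a are the injective labellings of its letters. *)
Lemma sum_canon_fiber tau m p a : size a = p -> canonical_seq a ->
  \sum_(w : p.-tuple 'I_m | canon w == a) \prod_(x <- w) tau x =
  injective_sum tau m [seq deg t a | t <- iota 1 (size (undup a))].
Proof.
move=> ap ca; case: m => [|m].
  have a0 : a != [::] by case/canonical_seqP: ca.
  have s0 : (0 < size (undup a))%N.
    by rewrite lt0n size_eq0; apply: contra a0 => /eqP/undup_nil ->.
  rewrite /injective_sum [LHS]big1; last first.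
    move=> w _; have : (0 < p)%N by rewrite -ap lt0n size_eq0.
    by case: p w {ap} => // p w; case: (thead w).
  rewrite big1// => f _; move: f; rewrite size_map size_iota => f; case: (size _) s0 f => // s _ f.
  by case: (thead f).
set s := size (undup a).
rewrite /injective_sum size_map size_iota.
have aL j : (j < p)%N -> (0 < nth 0%N a j <= s)%N.
  by move=> jp; apply: canonical_le => //; rewrite mem_nth// ap.
have [h hE] : exists h : s.-tuple 'I_m.+1 -> p.-tuple 'I_m.+1,
    forall f, tval (h f) = map (fun t => nth ord0 f t.-1) a.
  exists (fun f => [tuple nth ord0 f (nth 0%N a (j : 'I_p)).-1 | j < p]) => f.
  apply: (@eq_from_nth _ ord0); rewrite ?size_tuple ?size_map ?ap// => j jp.
  by rewrite (nth_map 0%N) ?ap// -[LHS](tnth_nth ord0 _ (Ordinal jp)) tnth_mktuple.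
have [h' h'E] : exists h' : p.-tuple 'I_m.+1 -> s.-tuple 'I_m.+1,
    forall w : p.-tuple 'I_m.+1, canon w = a -> tval (h' w) = firsts w.
  exists (fun w => [tuple nth ord0 (firsts w) (i : 'I_s) | i < s]) => w wa.
  have sf : size (firsts w) = s by rewrite size_firsts -size_undup_canon wa.
  apply: (@eq_from_nth _ ord0); rewrite ?size_tuple ?sf// => j js.
  by rewrite -[LHS](tnth_nth ord0 _ (Ordinal js)) tnth_mktuple.
rewrite (reindex_onto h h'); last first.
  move=> w /eqP wa; apply: val_inj; rewrite -[LHS]/(tval (h (h' w))) hE (h'E _ wa) -{1}wa /canon -map_comp.
  rewrite -[RHS]map_id; apply/eq_in_map => x xw /=.
  by rewrite nth_index// mem_firsts.
have gi (f : s.-tuple 'I_m.+1) : uniq f ->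
    {in a &, injective (fun t => nth ord0 f t.-1)}.
  move=> uf x y /(canonical_le ca)/andP[x0 xs] /(canonical_le ca)/andP[y0 ys] /eqP.
  by rewrite nth_uniq ?size_tuple//; lia.
have fa : firsts a = iota 1 s by rewrite canonical_firsts// canonical_max.
apply: eq_big => [f|f _].
  apply/andP/idP => [[/eqP ca' /eqP hf]|uf].
    by rewrite -hf (h'E _ ca') firsts_uniq.
  have E : canon (h f) = a by rewrite hE canon_map ?canon_id//; exact: gi.
  rewrite E eqxx; split=> //; apply/eqP/val_inj.
  rewrite -[LHS]/(tval (h' (h f))) (h'E _ E) hE.
  rewrite /firsts -map_rev undup_map_in -?map_rev -/(firsts a); last first.
    by move=> x y; rewrite !mem_rev; exact: gi.
  rewrite fa; apply: (@eq_from_nth _ ord0); rewrite ?size_tuple ?size_map ?size_iota// => j js.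
  by rewrite (nth_map 0%N) ?size_iota// nth_iota// add1n.
rewrite hE big_map /weight_prod size_map size_iota.
rewrite -prodr_undup_exp_count (perm_big (iota 1 s)); last first.
  apply: uniq_perm; rewrite ?undup_uniq ?iota_uniq// => x.
  by rewrite mem_undup -mem_firsts fa.
rewrite -[X in iota X _]addn0 iotaDl big_map -[X in iota _ X]subn0 big_mkord.
apply: eq_bigr => i _ /=; rewrite (nth_map ord0) ?size_tuple// add1n /=.
by rewrite add0n subn0 -iotaDl (nth_map 0%N) ?size_iota// nth_iota.
Qed.

Lemma injective_sum_ge0 tau m ds : (forall j, 0 <= tau j) -> 0 <= injective_sum tau m ds.
Proof.
by move=> t0; apply: sumr_ge0 => f _; apply: prodr_ge0 => i _; rewrite exprn_ge0.
Qed.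

Lemma injective_sum_le tau m ds : (forall j, 0 <= tau j) ->
  injective_sum tau m ds <= \prod_(d <- ds) power_sum tau m d.
Proof.
move=> t0; elim: ds => [|d ds IH]; first by rewrite injective_sum_nil big_nil.
rewrite injective_sum_cons big_cons lerBlDr (le_trans (y := power_sum tau m d * \prod_(d0 <- ds) power_sum tau m d0))//.
  by rewrite ler_wpM2l// sumr_ge0// => j _; rewrite exprn_ge0.
by rewrite lerDl sumr_ge0// => k _; exact: injective_sum_ge0.
Qed.

(** The absolute value disappears in the even power: |x|^d <= 1 + x^(2 d). *)
Lemma abs_power_sum_bound tau (mq : nat -> R) d :
  (forall q : nat, (0 < q)%N -> (m%:R)^-1 * power_sum tau m q @[m --> \oo] --> mq q) ->
  (0 < d)%N ->
  exists2 B, 0 <= B & forall m, power_sum (fun j => `|tau j|) m d <= B * m%:R.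
Proof.
move=> ht d0; have /ht cv : (0 < d.*2)%N by rewrite double_gt0.
have /cvg_seq_bounded[B [_ HB]] : cvgn (fun m => (m%:R)^-1 * power_sum tau m d.*2).
  by apply/cvg_ex; exists (mq d.*2).
(* the bound B of a sequence is only reached up to an excess, here 1 *)
exists (1 + (`|B| + 1)); first by rewrite !addr_ge0.
move=> [|m]; first by rewrite mulr0 /power_sum big_ord0.
have := HB (`|B| + 1) (ltr_pwDr ltr01 (ler_norm _)) m.+1 I => /= /ler_normlW.
rewrite mulrC ler_pdivrMr ?ltr0n// => Hm; rewrite mulrDl mul1r.
apply: le_trans (_ : \sum_(j < m.+1) (1 + tau j ^+ d.*2) <= _).
  apply: ler_sum => j _; rewrite -addnn exprD -normrX -expr2 -real_normK ?num_real//.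
  by have : 0 <= `|tau j ^+ d| by []; nra.
by rewrite big_split /= sumr_const card_ord lerD2l.
Qed.

Lemma sum_canon_fiber_abs_bound tau (mq : nat -> R) p a : size a = p -> canonical_seq a ->
  (forall q : nat, (0 < q)%N -> (m%:R)^-1 * power_sum tau m q @[m --> \oo] --> mq q) ->
  exists2 B, 0 <= B & forall m,
  \sum_(w : p.-tuple 'I_m | canon w == a) `|\prod_(x <- w) tau x| <=
    B * m%:R ^+ size (undup a).
Proof.
move=> ap ca ht; set ds := [seq deg t a | t <- iota 1 (size (undup a))].
have ds0 : all (leq 1) ds.
  apply/allP => x /mapP[t]; rewrite -canonical_max// -canonical_firsts// mem_firsts => ta ->.
  by rewrite /deg -has_count has_pred1.
have -> : size (undup a) = size ds by rewrite size_map size_iota.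
have [B B0 HB] : exists2 B, 0 <= B & forall m,
    \prod_(d <- ds) power_sum (fun j => `|tau j|) m d <= B * m%:R ^+ size ds.
  elim: ds ds0 => [_|d ds IH /= /andP[d0 /IH[B B0 HB]]].
    by exists 1 => // m; rewrite big_nil expr0 mulr1.
  have [B' B'0 HB'] := abs_power_sum_bound ht d0.
  exists (B' * B); first by rewrite mulr_ge0.
  move=> m; rewrite big_cons exprS mulrACA ler_pM//.
    by apply: sumr_ge0 => j _; rewrite exprn_ge0.
  by apply: prodr_ge0 => e _; apply: sumr_ge0 => j _; rewrite exprn_ge0.
exists B => // m; apply: le_trans (HB m).
rewrite (eq_bigr (fun w : p.-tuple 'I_m => \prod_(x <- w) `|tau x|)); last first.
  by move=> w _; exact: normr_prod.
by rewrite (sum_canon_fiber (fun j => `|tau j|))//; exact: injective_sum_le.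
Qed.

Lemma sum_canon_fiber_cvg tau (mq : nat -> R) p a : size a = p -> canonical_seq a ->
  (forall q : nat, (0 < q)%N -> (m%:R)^-1 * power_sum tau m q @[m --> \oo] --> mq q) ->
  (m%:R ^+ size (undup a))^-1 *
    (\sum_(w : p.-tuple 'I_m | canon w == a) \prod_(x <- w) tau x) @[m --> \oo] -->
  \prod_(1 <= t < (size (undup a)).+1) mq (deg t a).
Proof.
move=> ap ca ht; set ds := [seq deg t a | t <- iota 1 (size (undup a))].
have ds0 : all (leq 1) ds.
  apply/allP => x /mapP[t]; rewrite -canonical_max// -canonical_firsts// mem_firsts => ta ->.
  by rewrite /deg -has_count has_pred1.
have := injective_sum_cvg ht ds0; rewrite big_map /index_iota subSS subn0.
rewrite size_map size_iota; under [X in X -> _]eq_cvg do rewrite -(sum_canon_fiber _ _ ap ca).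
by [].
Qed.

End weight_sums.

(** * Trace expansion *)

Section eigenvalue_moments.
Context {R : realType}.
Local Notation C := R[i].
Local Open Scope complex_scope.

Lemma char_poly_similar N (P Q A : 'M[C]_N) : Q *m P = 1%:M ->
  char_poly (Q *m A *m P) = char_poly A.
Proof.
move=> QP; rewrite /char_poly.
have E : char_poly_mx (Q *m A *m P) =
    map_mx polyC Q *m char_poly_mx A *m map_mx polyC P.
  rewrite /char_poly_mx mulmxBr mulmxBl !map_mxM; congr (_ - _).
  by rewrite -scalemx1 -!scalemxAr mulmx1 -scalemxAl -map_mxM QP map_mx1.
rewrite E !det_mulmx mulrAC -det_mulmx -map_mxM QP map_mx1 det1.
by rewrite mul1r.
Qed.

Lemma mxpow_similar N (P Q D : 'M[C]_N) p : P *m Q = 1%:M -> Q *m P = 1%:M ->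
  (Q *m D *m P) ^+ p = Q *m D ^+ p *m P.
Proof.
move=> PQ QP; elim: p => [|p IH]; first by rewrite !expr0 -[1]/(1%:M) mulmx1 QP.
rewrite !exprS IH -!mulmxE !mulmxA; congr (_ *m _).
by rewrite -(mulmxA _ P Q) PQ mulmx1.
Qed.

Lemma diag_mxX N (d : 'rV[C]_N) p : diag_mx d ^+ p = diag_mx (\row_i (d 0 i) ^+ p).
Proof.
elim: p => [|p IH].
  by rewrite expr0; apply/matrixP => i j; rewrite !mxE expr0.
rewrite exprS IH -mulmxE mulmx_diag; congr diag_mx.
by apply/rowP => i; rewrite !mxE exprS.
Qed.

(** A Hermitian matrix is unitarily diagonalisable, and conjugation preserves
    both the characteristic polynomial and the traces of powers. *)
Lemma eigenvalue_moments N (A : 'M[C]_N) p : conj_transpose A = A ->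
  (\sum_(j < N) complex.Re (eigenvalues A)`_j ^+ p)%:C = \tr (A ^+ p).
Proof.
move=> hA; have Ah : A \is hermsymmx.
  by apply/is_hermitianmxP; rewrite expr0 scale1r -[LHS]hA.
have Areal := hermitian_spectral_diag_real Ah.
have /hermitian_normalmx/orthomx_spectralP := Ah.
set P := spectralmx A; set d := spectral_diag A; move=> EA.
have Pu : P \in unitmx by exact: spectral_unit.
have PQ : P *m invmx P = 1%:M by exact: mulmxV.
have QP : invmx P *m P = 1%:M by exact: mulVmx.
have [sz Ech] := eigenvaluesP A.
have pe : perm_eq (eigenvalues A) [seq d 0 i | i <- enum 'I_N].
  apply/prod_XsubC_eq; rewrite -Ech {1}EA char_poly_similar// char_poly_trig; last first.
    by apply/is_trig_mxP => i j ij; rewrite mxE; case: eqP ij => // ->; rewrite ltnn.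
  by rewrite big_map big_enum; apply: eq_bigr => i _; rewrite mxE eqxx.
rewrite {2}EA mxpow_similar// diag_mxX mxtrace_mulC mulmxA PQ mul1mx mxtrace_diag.
transitivity (\sum_(z <- eigenvalues A) (complex.Re z ^+ p)%:C).
  by rewrite raddf_sum (big_nth 0) sz big_mkord.
rewrite (perm_big _ pe) big_map big_enum; apply: eq_bigr => i _; rewrite mxE.
rewrite rmorphXn /=; congr (_ ^+ p).
have /mxOverP/(_ 0 i) : d \is a realmx by [].
by move=> /complex_realP[x ->].
Qed.

End eigenvalue_moments.

Section trace_expansion.
Context {R : realType}.
Local Notation C := R[i].
Local Open Scope complex_scope.

Lemma conj_real (x : R) : Num.conj (x%:C) = x%:C.
Proof. by apply: CrealP; apply/complex_realP; exists x. Qed.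

Definition inner N (u v : 'cV[C]_N) : C := (conj_transpose u *m v) 0 0.

Lemma inner_cast N N' (e : N = N') e1 (u v : 'M[C]_(N, 1 * 1)) :
  inner (castmx (e, e1) u) (castmx (e, e1) v) = (conj_transpose u *m v) 0 0.
Proof. by case: N' / e; rewrite (eq_irrelevance e1 (erefl 1%N)). Qed.

Lemma inner_tens N N' (u v : 'cV[C]_N) (u' v' : 'cV[C]_N') :
  (conj_transpose (u *t u') *m (v *t v')) 0 0 = inner u v * inner u' v'.
Proof.
rewrite /conj_transpose trmx_tens map_mxT tensmx_mul mxE /inner.
by rewrite !(ord1 (_.1)) !(ord1 (_.2)).
Qed.

Lemma inner_tensor_vec n k (y z : 'I_k -> 'cV[C]_n) :
  inner (tensor_vec y) (tensor_vec z) = \prod_(l < k) inner (y l) (z l).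
Proof.
elim: k y z => [|k IH] y z /=.
  by rewrite big_ord0 /inner mxE big_ord1 !mxE eqxx rmorph1 mulr1.
rewrite inner_cast inner_tens IH big_ord_recr /=; congr (_ * _).
Qed.

Lemma inner_yvec n (x z : 'I_n -> C) :
  inner (yvec x) (yvec z) = (n%:R)^-1 * \sum_(j < n) Num.conj (x j) * z j.
Proof.
rewrite /inner mxE mulr_sumr; apply: eq_bigr => j _; rewrite !mxE rmorphM.
rewrite mulrACA; congr (_ * _).
rewrite [X in X * _](_ : _ = (Num.sqrt (n%:R : R))^-1%:C); last exact: conj_real.
by rewrite -rmorphM -invfM -expr2 sqr_sqrtr// fmorphV rmorph_nat.
Qed.

Section rank_one_sum.
Context {N m : nat} (t : 'I_m -> C) (Y : 'I_m -> 'cV[C]_N).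

Let M : 'M[C]_N := \sum_a t a *: (Y a *m conj_transpose (Y a)).

Fixpoint inner_chain (a : 'I_m) (w : seq 'I_m) : C :=
  if w is b :: w' then inner (Y a) (Y b) * inner_chain b w' else 1.

Let M_exp p : M ^+ p.+1 = \sum_(w : p.+1.-tuple 'I_m)
  ((\prod_(a <- w) t a) * inner_chain (thead w) (behead w)) *:
    (Y (thead w) *m conj_transpose (Y (last (thead w) w))).
Proof.
pose F (w : seq 'I_m) : 'M[C]_N := if w is a :: w' then
  ((\prod_(a <- w) t a) * inner_chain a w') *: (Y a *m conj_transpose (Y (last a w'))) else 0.
have FE q (w : q.+1.-tuple 'I_m) : F w = ((\prod_(a <- w) t a) * inner_chain (thead w) (behead w)) *:
    (Y (thead w) *m conj_transpose (Y (last (thead w) w))).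
  by case/tupleP: w => a w; rewrite theadE /=.
rewrite -(eq_bigr _ (fun w _ => FE p w)) sum_tuple_cons.
elim: p => [|p IH].
  rewrite expr1; apply: eq_bigr => a _; rewrite (sum_tuple0 (fun i => F (a :: i))) /=.
  by rewrite big_seq1 mulr1.
rewrite exprS IH -mulmxE mulmx_suml; apply: eq_bigr => a _.
rewrite (sum_tuple_cons p (fun i => F (a :: i))) mulmx_sumr; apply: eq_bigr => b _.
rewrite mulmx_sumr; apply: eq_bigr => w _ /=.
rewrite -scalemxAl -scalemxAr scalerA.
rewrite -[Y a *m _ *m _]mulmxA [conj_transpose _ *m _]mulmxA.
have -> : conj_transpose (Y a) *m Y b = (inner (Y a) (Y b))%:M.
  by apply/matrixP => i j; rewrite !ord1 [RHS]mxE eqxx mulr1n.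
rewrite mul_scalar_mx -scalemxAr scalerA !big_cons; congr (_ *: _).
by ring.
Qed.

Lemma inner_chain_close a w b : inner_chain a w * inner (Y (last a w)) (Y b) =
  \prod_(e <- zip (a :: w) (rcons w b)) inner (Y e.1) (Y e.2).
Proof.
elim: w a => [|c w IH] a /=; first by rewrite mul1r big_seq1.
by rewrite big_cons -mulrA IH.
Qed.

(** Expanding the power and closing the chain of inner products cyclically. *)
Lemma trace_rank_one_sum p : (0 < p)%N -> \tr (M ^+ p) =
  \sum_(w : p.-tuple 'I_m) (\prod_(a <- w) t a) *
     \prod_(e <- zip w (rot 1 w)) inner (Y e.1) (Y e.2).
Proof.
case: p => // p _; rewrite M_exp raddf_sum; apply: eq_bigr => w _.
rewrite /= mxtraceZ mxtrace_mulC -mulrA; congr (_ * _).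
case/tupleP: w => a w; rewrite theadE /= rot1_cons -inner_chain_close.
by congr (_ * _); rewrite /mxtrace big_ord1.
Qed.

End rank_one_sum.

Lemma prod_sum_tuple (T : Type) (I : finType) (s : seq T) (F : T -> I -> C) :
  \prod_(e <- s) \sum_(j : I) F e j =
  \sum_(i : (size s).-tuple I) \prod_(q <- zip s i) F q.1 q.2.
Proof.
elim: s => [|e s IH].
  by rewrite big_nil (sum_tuple0 (fun i : seq I => \prod_(q <- zip [::] i) F q.1 q.2)) /= big_nil.
rewrite big_cons IH (sum_tuple_cons _ (fun i : seq I => \prod_(q <- zip (e :: s) i) F q.1 q.2)).
rewrite mulr_suml; apply: eq_bigr => j _; rewrite mulr_sumr; apply: eq_bigr => i _.
by rewrite big_cons.
Qed.

Definition monomial (T : Type) (z : T -> C) (D U : seq T) : C :=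
  (\prod_(q <- D) Num.conj (z q)) * \prod_(q <- U) z q.

(** The inner product of two tensors is the product over the levels; on each level
    the cyclic product of inner products expands into closed walks. *)
Lemma trace_Mmx n k m (tau : nat -> R) (x : 'I_m -> 'I_k -> 'I_n -> C) p : (0 < p)%N ->
  \tr (Mmx tau x ^+ p) =
  \sum_(w : p.-tuple 'I_m) (\prod_(a <- w) tau a)%:C *
    \prod_(l < k) ((n%:R)^-1 ^+ p * \sum_(i : p.-tuple 'I_n)
       monomial (fun q : 'I_m * 'I_n => x q.1 l q.2) (downs w i) (ups w i)).
Proof.
move=> p0; rewrite (@trace_rank_one_sum _ _ (fun a => (tau a)%:C)
  (fun a => tensor_vec (fun l => yvec (x a l))))//.
apply: eq_bigr => w _; congr (_ * _).
  by rewrite rmorph_prod.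
under eq_bigr => e _ do rewrite inner_tensor_vec.
rewrite exchange_big; apply: eq_bigr => l _ /=.
under eq_bigr => e _ do rewrite inner_yvec.
have sz : size (zip w (rot 1 w)) = p by rewrite size_zip size_rot size_tuple minnn.
rewrite big_split big_const_seq count_predT sz iter_mulr_1; congr (_ * _).
rewrite prod_sum_tuple sz; apply: eq_bigr => i _; rewrite big_split /monomial; congr (_ * _).
  rewrite -(big_map (fun q => (q.1.1, q.2)) xpredT (fun q => Num.conj (x q.1 l q.2))).
  apply: congr_big => //; rewrite /downs.
  move: (tval w) (rot 1 w) (tval i) (size_tuple w) (size_rot 1 w) (size_tuple i).
  move: p {p0 sz w i} => p w v i; elim: w v i p => [|a w IH] [|b v] [|j i] //= p wp.
  by move: wp => <- [vw] [iw]; rewrite (IH v i _ erefl).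
rewrite -(big_map (fun q => (q.1.2, q.2)) xpredT (fun q => x q.1 l q.2)).
apply: congr_big => //; rewrite /ups.
move: (tval w) (rot 1 w) (tval i) (size_tuple w) (size_rot 1 w) (size_tuple i).
move: p {p0 sz w i} => p w v i; elim: w v i p => [|a w IH] [|b v] [|j i] //= p wp.
by move: wp => <- [vw] [iw]; rewrite (IH v i _ erefl).
Qed.

Lemma Mmx_hermitian n k m (tau : nat -> R) (x : 'I_m -> 'I_k -> 'I_n -> C) :
  conj_transpose (Mmx tau x) = Mmx tau x.
Proof.
rewrite /Mmx /conj_transpose raddf_sum raddf_sum; apply: eq_bigr => a _ /=.
apply/matrixP => i j; rewrite !mxE rmorphM.
rewrite [X in X * _](_ : _ = (tau a)%:C); last exact: conj_real.
congr (_ * _); rewrite rmorph_sum; apply: eq_bigr => r _; rewrite !mxE rmorphM /= mulrC.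
by congr (_ * _); exact: conjCK.
Qed.

Lemma esd_moment n k m (tau : nat -> R) (x : 'I_m -> 'I_k -> 'I_n -> C) p :
  (\sum_(j < n ^ k) complex.Re (eigenvalues (Mmx tau x))`_j ^+ p)%:C = \tr (Mmx tau x ^+ p).
Proof. by apply: eigenvalue_moments; exact: Mmx_hermitian. Qed.

End trace_expansion.

(** * Taylor and Bernstein approximation *)

Section elementary_analysis.
Context {R : realType}.

(** A limit follows from approximations whose errors converge to small limits;
    the error may depend on n, which is needed when it is itself a moment. *)
Lemma cvg_approx (u : nat -> R) (l : R) :
  (forall e : R, 0 < e -> exists (v : nat -> R) (l' : R) (d : nat -> R) (d' : R), [/\ v n @[n --> \oo] --> l', d n @[n --> \oo] --> d',
     (forall n, `|u n - v n| <= d n), `|l' - l| <= e & d' <= e]) ->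
  u n @[n --> \oo] --> l.
Proof.
move=> h; apply/cvgrPdist_le => e e0; have [|v [l' [d [d' [vl dd uv ll de]]]]] := h (e / 4).
  by rewrite divr_gt0.
have e4 : 0 < e / 4 by rewrite divr_gt0.
move/cvgrPdist_le : vl => /(_ _ e4) vl; move/cvgrPdist_le : dd => /(_ _ e4) dd.
near=> n; have vn : `|l' - v n| <= e / 4 by near: n.
have dn : `|d' - d n| <= e / 4 by near: n.
have un := uv n.
move: vn dn un ll; rewrite !ler_norml => /andP[v1 v2] /andP[d1 d2] /andP[u1 u2] /andP[l1 l2].
by apply/andP; split; lra.
Unshelve. all: by end_near. Qed.

Lemma derive_bound (D D' : R -> R) (r : nat) : D 0 = 0 ->
  (forall t : R, is_derive t 1 D (D' t)) ->
  (forall t : R, `|D' t| <= `|t| ^+ r / r`!%:R) ->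
  forall x : R, `|D x| <= `|x| ^+ r.+1 / r.+1`!%:R.
Proof.
have pos (F F' : R -> R) : F 0 = 0 -> (forall t : R, is_derive t 1 F (F' t)) ->
    (forall t : R, 0 <= t -> F' t <= t ^+ r / r`!%:R) ->
    forall x : R, 0 <= x -> F x <= x ^+ r.+1 / r.+1`!%:R.
  move=> F0 dF bF x x0; pose q : {poly R} := r.+1`!%:R^-1 *: 'X^(r.+1).
  have qE t : q.[t] = t ^+ r.+1 / r.+1`!%:R by rewrite hornerZ hornerXn mulrC.
  have dqE t : q^`().[t] = t ^+ r / r`!%:R.
    rewrite derivZ derivXn hornerZ hornerMn hornerXn factS natrM -[X in _ * X]mulr_natl /=.
    by rewrite invfM mulrACA mulVf ?pnatr_eq0// mul1r mulrC.
  pose E := horner q - F.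
  have dE (t : R) : is_derive t 1 E (q^`().[t] - F' t) by exact: is_deriveB.
  have cE : {within `[0, x], continuous E}.
    by apply: derivable_within_continuous => t _; apply: ex_derive.
  have [c] := MVT_segment x0 (fun t _ => dE t) cE.
  rewrite in_itv /= => /andP[c0 _].
  have -> : E x - E 0 = q.[x] - F x by rewrite /E !fctE F0 (qE 0) expr0n /= mul0r !subr0.
  rewrite subr0 dqE => Ex; rewrite -qE -subr_ge0 Ex mulr_ge0// subr_ge0; exact: bF.
move=> D0 dD bD x; wlog x0 : D D' D0 dD bD x / 0 <= x => [H|].
  have [x0|x0] := leP 0 x; first exact: (H D D').
  have dN (t : R) : is_derive t 1 (fun t => D (- t)) (- D' (- t)).
    have dN := dD (- t); have := @is_derive1_comp _ D -%R t (D' (- t)) (-1).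
    by rewrite mulrN1; apply.
  have := H (fun t => D (- t)) (fun t => - D' (- t)) _ dN _ (- x).
  rewrite opprK normrN; apply; rewrite ?oppr0 ?oppr_ge0 ?ltW// => t.
  by rewrite normrN -[`|t|]normrN; exact: bD.
rewrite (ger0_norm x0) ler_norml lerNl; apply/andP; split.
  apply: (pos (fun t => - D t) (fun t => - D' t)) => // [|t t0]; first by rewrite D0 oppr0.
  by rewrite (le_trans (ler_norm _))// normrN; have := bD t; rewrite (ger0_norm t0).
apply: (pos D D') => // t t0.
by rewrite (le_trans (ler_norm _))//; have := bD t; rewrite (ger0_norm t0).
Qed.

Lemma poly_antiderivative (p : {poly R}) (c : R) :
  exists q : {poly R}, q^`()%R = p /\ q.[0] = c.
Proof.
exists (c%:P + \sum_(i < size p) (p`_i / i.+1%:R) *: 'X^(i.+1)); split; last first.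
  rewrite hornerD hornerC horner_sum big1 ?addr0// => i _.
  by rewrite hornerZ hornerXn expr0n mulr0.
rewrite derivD derivC add0r raddf_sum /= -[RHS]coefK poly_def; apply: eq_bigr => i _.
by rewrite derivZ derivXn /= -scalerMnr scalerMnl -(mulr_natr (p`_i / _)) mulfVK// pnatr_eq0.
Qed.

(** The shift b lets one induction on r handle sine and cosine together: an
    antiderivative of the polynomial for the derivative, which is sin (x + b +
    pi/2), is compared with sin by the mean value theorem. *)
Lemma sin_taylor (r : nat) (b : R) : exists p : {poly R},
  forall x, `|sin (x + b) - p.[x]| <= `|x| ^+ r / r`!%:R.
Proof.
elim: r b => [|r IH] b.
  by exists 0 => x; rewrite horner0 subr0 expr0 fact0 divr1 ler_norml sin_geN1 sin_le1.
have [p Hp] := IH (b + pi / 2); have [q [qp q0]] := poly_antiderivative p (sin b).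
exists q; apply: (@derive_bound _ (fun x => sin (x + (b + pi / 2)) - p.[x])) => //.
  by rewrite add0r q0 subrr.
move=> t; rewrite -qp addrA sinDpihalf.
have h1 : is_derive t 1 (fun x => sin (x + b)) (cos (t + b)).
  have := @is_derive1_comp _ sin (fun x => x + b) t (cos (t + b)) 1.
  rewrite mulr1; apply.
  by apply: is_derive_eq; rewrite addr0.
exact: is_deriveB.
Qed.

Lemma increasing_seq_ge_id (f : nat -> nat) : increasing_seq f -> forall n, (n <= f n)%N.
Proof.
move=> /increasing_seqP finc; elim=> // n IH.
by apply: leq_ltn_trans IH _; exact: finc.
Qed.

(** Otherwise the quadratic coefficient n fails for every n, at pairs whose distance
    tends to 0 since F is bounded; at a cluster point this contradicts continuity.
    A bound in this form integrates to a variance. *)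
Lemma unit_interval_modulus (F : R -> R) (B e : R) : continuous F ->
  (forall x, `|F x| <= B) -> 0 < e ->
  exists2 c : R, 0 <= c & forall x y : R, 0 <= x <= 1 -> 0 <= y <= 1 ->
    `|F x - F y| <= e + c * (x - y) ^+ 2.
Proof.
move=> cF bF e0; apply: contrapT => H.
have {H} /choice[xy Hxy] : forall n : nat, exists xy : R * R, [/\ 0 <= xy.1 <= 1, 0 <= xy.2 <= 1 &
    e + n%:R * (xy.1 - xy.2) ^+ 2 < `|F xy.1 - F xy.2|].
  move=> n; apply: contrapT => Hn; apply: H; exists n%:R => // x y x01 y01.
  by rewrite leNgt; apply/negP => lt; apply: Hn; exists (x, y).
have [|f finc /cvg_ex[/= l cl]] := @bolzano_weierstrass _ (fun n => (xy n).1).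
  exists 1; split => // M M1 n _ /=; have [/andP[x0 x1] _ _] := Hxy n.
  by rewrite ger0_norm// (le_trans x1)// ltW.
have cd : ((xy (f n)).1 - (xy (f n)).2) @[n --> \oo] --> (0 : R).
  apply/cvgrPdist_le => d d0; near=> n; rewrite sub0r normrN.
  rewrite -(@ler_pXn2r _ 2)// ?nnegrE ?(ltW d0)// real_normK ?num_real//.
  have [_ _ Hn] := Hxy (f n).
  have Bn : (f n)%:R * ((xy (f n)).1 - (xy (f n)).2) ^+ 2 <= B + B.
    rewrite (le_trans _ (lerD (bF (xy (f n)).1) (bF (xy (f n)).2)))//.
    rewrite (le_trans _ (ler_normB _ _))// ltW// (le_lt_trans _ Hn)//.
    by rewrite lerDr ltW.
  have nB : (B + B) / d ^+ 2 + 1 <= n%:R by near: n; exact: nbhs_infty_ger.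
  have nf : n%:R <= (f n)%:R :> R by rewrite ler_nat increasing_seq_ge_id.
  have B0 : 0 <= B by rewrite (le_trans _ (bF 0)).
  have f0 : 0 < (f n)%:R :> R.
    by rewrite (lt_le_trans _ nf)// (lt_le_trans _ nB)// ltr_wpDl// divr_ge0 ?addr_ge0// sqr_ge0.
  rewrite -(ler_pM2l f0) (le_trans Bn)//.
  rewrite -ler_pdivrMr ?exprn_gt0// (le_trans _ nf)// (le_trans _ nB)//.
  by rewrite lerDl.
have cy : (xy (f n)).2 @[n --> \oo] --> l.
  have -> : (fun n => (xy (f n)).2) = (fun n => (xy (f n)).1 - ((xy (f n)).1 - (xy (f n)).2)).
    by apply/funext => n; rewrite subKr.
  by rewrite -[X in _ --> X]subr0; apply: cvgB => //; exact: cl.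
have cFd : (F (xy (f n)).1 - F (xy (f n)).2) @[n --> \oo] --> (0 : R).
  rewrite -(subrr (F l)); apply: cvgB; first exact: (cvg_comp _ _ cl (cF l)).
  exact: (cvg_comp _ _ cy (cF l)).
move/cvgrPdist_le : cFd => /(_ _ e0)[N _ /(_ N (leqnn N))] /=.
rewrite sub0r normrN leNgt => /negP; apply.
have [_ _ HN] := Hxy (f N); apply: le_lt_trans HN.
by rewrite lerDl mulr_ge0// sqr_ge0.
Unshelve. all: by end_near. Qed.

(** The expectation of g at a binomial variable of parameters N and y, defined by
    conditioning on the first trial. *)
Fixpoint bernstein (N : nat) (g : nat -> R) (y : R) : R :=
  if N is N'.+1 then y * bernstein N' (fun k => g k.+1) y + (1 - y) * bernstein N' g y
  else g 0%N.

Lemma bernstein_le N g h y : 0 <= y <= 1 -> (forall k, (k <= N)%N -> g k <= h k) ->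
  bernstein N g y <= bernstein N h y.
Proof.
move=> /andP[y0 y1]; elim: N g h => [|N IH] g h gh /=; first exact: gh.
apply: lerD; apply: ler_wpM2l; rewrite ?subr_ge0//; apply: IH => k kN; apply: gh => //.
exact: leqW.
Qed.

Lemma bernstein_linear N a g h y :
  bernstein N (fun k => a * g k + h k) y = a * bernstein N g y + bernstein N h y.
Proof. by elim: N g h => [//|N IH] g h /=; rewrite (IH (g \o S) (h \o S)) IH /=; ring. Qed.

Lemma bernstein_cst N a y : bernstein N (fun=> a) y = a.
Proof. by elim: N => //= N ->; ring. Qed.

(** The variance of the binomial distribution. *)
Lemma bernstein_var N a y :
  bernstein N (fun k => (k%:R - a) ^+ 2) y = N%:R * y * (1 - y) + (N%:R * y - a) ^+ 2.
Proof.
elim: N a => [|N IH] a /=; first by ring.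
have -> : (fun k => (k.+1%:R - a) ^+ 2) = (fun k => (k%:R - (a - 1)) ^+ 2) :> (nat -> R).
  by apply/funext => k; rewrite -natr1; ring.
by rewrite !IH -natr1; ring.
Qed.

(** The quadratic modulus is averaged over the binomial law, whose variance after
    division by N is at most 1/N. *)
Lemma bernstein_approx N (F : R -> R) (e c y : R) : (0 < N)%N -> 0 <= c -> 0 <= y <= 1 ->
  (forall x y, 0 <= x <= 1 -> 0 <= y <= 1 -> `|F x - F y| <= e + c * (x - y) ^+ 2) ->
  `|bernstein N (fun k => F (k%:R / N%:R)) y - F y| <= e + c / N%:R.
Proof.
move=> N0 c0 y01 HF; have N0' : 0 < N%:R :> R by rewrite ltr0n.
have kN k : (k <= N)%N -> 0 <= (k%:R / N%:R : R) <= 1.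
  by move=> kN; rewrite divr_ge0//= ler_pdivrMr// mul1r ler_nat.
have bnd d : bernstein N (fun k => c * (k%:R / N%:R - y) ^+ 2 + d) y <= d + c / N%:R.
  have -> : (fun k => c * (k%:R / N%:R - y) ^+ 2 + d) =
      (fun k => (c / N%:R ^+ 2) * (k%:R - N%:R * y) ^+ 2 + d).
    by apply/funext => k; field; rewrite gt_eqF.
  rewrite bernstein_linear bernstein_var bernstein_cst subrr expr0n /= addr0 addrC lerD2l.
  have -> : c / N%:R ^+ 2 * (N%:R * y * (1 - y)) = c / N%:R * (y * (1 - y)).
    by field; rewrite gt_eqF.
  by rewrite ler_piMr ?divr_ge0//; move/andP: y01 => [? ?]; nra.
rewrite ler_norml; apply/andP; split.
  have := bnd (e - F y); set b := bernstein _ _ _ => bE.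
  have : bernstein N (fun k => (-1) * F (k%:R / N%:R) + 0) y <= b.
    apply: bernstein_le => // k /kN k01; have := HF _ _ k01 y01.
    by rewrite ler_norml => /andP[]; lra.
  by rewrite bernstein_linear bernstein_cst; lra.
have := bnd (e + F y); set b := bernstein _ _ _ => bE.
have : bernstein N (fun k => F (k%:R / N%:R)) y <= b.
  apply: bernstein_le => // k /kN k01; have := HF _ _ k01 y01.
  by rewrite ler_norml => /andP[]; lra.
by lra.
Qed.

End elementary_analysis.

(** * Factorial moment growth and weak convergence *)

Section moment_method.
Context {R : realType}.

Definition poly_growth (f : R -> R) : Prop :=
  continuous f /\ exists C k, 0 <= C /\ forall x, `|f x| <= C * (1 + `|x|) ^+ k.

Lemma poly_growth_cst a : poly_growth (fun=> a).
Proof.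
split; first exact: cst_continuous.
by exists `|a|, 0%N; split=> // x; rewrite expr0 mulr1.
Qed.

Lemma poly_growthX k : poly_growth (fun x => x ^+ k).
Proof.
split; first exact: exprn_continuous.
exists 1, k; split => // x; rewrite mul1r normrX lerXn2r// ?nnegrE ?addr_ge0//.
by rewrite lerDr.
Qed.

Lemma poly_growthM f g : poly_growth f -> poly_growth g -> poly_growth (fun x => f x * g x).
Proof.
move=> [cf [C [k [C0 Hf]]]] [cg [C' [k' [C'0 Hg]]]]; split.
  by move=> x; apply: cvgM; [exact: cf|exact: cg].
exists (C * C'), (k + k')%N; split; first exact: mulr_ge0.
by move=> x; rewrite normrM exprD mulrACA ler_pM.
Qed.

Lemma poly_growthD f g : poly_growth f -> poly_growth g -> poly_growth (fun x => f x + g x).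
Proof.
move=> [cf [C [k [C0 Hf]]]] [cg [C' [k' [C'0 Hg]]]]; split.
  by move=> x; apply: cvgD; [exact: cf|exact: cg].
exists (C + C'), (k + k')%N; split; first exact: addr_ge0.
move=> x; rewrite (le_trans (ler_normD _ _))// mulrDl lerD//.
  by rewrite (le_trans (Hf x))// ler_wpM2l// ler_weXn2l ?lerDl ?leq_addr.
by rewrite (le_trans (Hg x))// ler_wpM2l// ler_weXn2l ?lerDl ?leq_addl.
Qed.

Lemma poly_growthZ a f : poly_growth f -> poly_growth (fun x => a * f x).
Proof. by move=> pf; apply: poly_growthM => //; exact: poly_growth_cst. Qed.

Lemma poly_growth_sum (I : Type) (r : seq I) (F : I -> R -> R) :
  (forall i, poly_growth (F i)) -> poly_growth (fun x => \sum_(i <- r) F i x).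
Proof.
move=> h; elim: r => [|i r IH].
  by under eq_fun do rewrite big_nil; exact: poly_growth_cst.
by under eq_fun do rewrite big_cons; exact: poly_growthD.
Qed.

Lemma poly_growth_norm f : poly_growth f -> poly_growth (fun x => `|f x|).
Proof.
move=> [cf [C [k [C0 Hf]]]]; split.
  by move=> x; apply: (cvg_comp _ _ (cf x)); exact: norm_continuous.
by exists C, k; split => // x; rewrite normr_id.
Qed.

(** The properties of f |-> E f(X) for a random variable X with all moments,
    restricted to continuous functions of polynomial growth. *)
Record state (L : (R -> R) -> R) : Prop := State {
  state_linear : forall a f g, poly_growth f -> poly_growth g ->
    L (fun x => a * f x + g x) = a * L f + L g;
  state_le : forall f g, poly_growth f -> poly_growth g ->
    (forall x, f x <= g x) -> L f <= L g;
  state_one : L (fun=> 1) = 1 }.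

Section state.
Variable L : (R -> R) -> R.
Hypothesis sL : state L.

Lemma state_zero : L (fun=> 0) = 0.
Proof.
have := state_linear sL (-1) (poly_growth_cst 0) (poly_growth_cst 0).
under [X in L X]eq_fun do rewrite mulr0 add0r.
by rewrite mulN1r addNr.
Qed.

Lemma stateZ a f : poly_growth f -> L (fun x => a * f x) = a * L f.
Proof.
move=> pf; have := state_linear sL a pf (poly_growth_cst 0).
under [X in L X]eq_fun do rewrite addr0.
by rewrite state_zero addr0.
Qed.

Lemma stateD f g : poly_growth f -> poly_growth g -> L (fun x => f x + g x) = L f + L g.
Proof.
move=> pf pg; have := state_linear sL 1 pf pg.
by under [X in L X]eq_fun do rewrite mul1r; rewrite mul1r.
Qed.

Lemma state_cst a : L (fun=> a) = a.
Proof.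
have := stateZ a (poly_growth_cst 1); under eq_fun do rewrite mulr1.
by rewrite (state_one sL) mulr1.
Qed.

Lemma state_sum (I : Type) (r : seq I) (F : I -> R -> R) :
  (forall i, poly_growth (F i)) -> L (fun x => \sum_(i <- r) F i x) = \sum_(i <- r) L (F i).
Proof.
move=> h; elim: r => [|i r IH].
  by under eq_fun do rewrite big_nil; rewrite big_nil state_zero.
under eq_fun do rewrite big_cons; rewrite big_cons stateD ?IH//.
exact: poly_growth_sum.
Qed.

Lemma state_dist f g h : poly_growth f -> poly_growth g -> poly_growth h ->
  (forall x, `|f x - g x| <= h x) -> `|L f - L g| <= L h.
Proof.
move=> pf pg ph H; rewrite ler_norml; apply/andP; split.
  rewrite lerNl opprB lerBlDr -stateD//; apply: state_le => // [|x].
    exact: poly_growthD.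
  by have := H x; rewrite ler_norml => /andP[]; lra.
rewrite lerBlDr -stateD//; apply: state_le => // [|x]; first exact: poly_growthD.
by have := H x; rewrite ler_norml => /andP[]; lra.
Qed.

End state.

Lemma bin_le_exp n m : ('C(n, m) <= 2 ^ n)%N.
Proof.
elim: n m => [|n IH] [|m] //; first by rewrite bin0 expn_gt0.
by rewrite binS expnS mul2n -addnn leq_add.
Qed.

Lemma fact_add_le j r : ((j + r)`! <= 2 ^ (j + r) * (j`! * r`!))%N.
Proof.
have := @bin_fact (j + r) j (leq_addr _ _); rewrite addKn => <-.
by rewrite leq_mul2r bin_le_exp orbT.
Qed.

Section convergence.
Variables (Ln : nat -> (R -> R) -> R) (L : (R -> R) -> R) (K : R).
Hypotheses (sLn : forall n, state (Ln n)) (sL : state L).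
Hypothesis cvg_moment : forall p, Ln n (fun x => x ^+ p) @[n --> \oo] --> L (fun x => x ^+ p).
Hypothesis moment_growth : forall p, `|L (fun x => x ^+ p)| <= K ^+ p * p`!%:R.
Hypothesis K1 : 1 <= K.

(** The bounded functions whose products with all powers pass to the limit. *)
Definition good (g : R -> R) : Prop := [/\ continuous g,
  exists B, 0 <= B /\ forall x, `|g x| <= B &
  forall j, Ln n (fun x => x ^+ j * g x) @[n --> \oo] --> L (fun x => x ^+ j * g x)].

Lemma good_poly_growth g : good g -> poly_growth g.
Proof.
move=> [cg [B [B0 HB]] _]; split => //.
by exists B, 0%N; split => // x; rewrite expr0 mulr1.
Qed.

Lemma good_cst a : good (fun=> a).
Proof.
split; [exact: cst_continuous|by exists (`|a|)| move=> j].
have E (F : (R -> R) -> R) : state F -> F (fun x => x ^+ j * a) = a * F (fun x => x ^+ j).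
  move=> sF; rewrite -stateZ//; last exact: poly_growthX.
  by congr F; apply/funext => x; rewrite mulrC.
under eq_fun do rewrite E//; rewrite E//; apply: cvgM; first exact: cvg_cst.
exact: cvg_moment.
Qed.

Lemma good_linear a g h : good g -> good h -> good (fun x => a * g x + h x).
Proof.
move=> gg gh; have pg := good_poly_growth gg; have ph := good_poly_growth gh.
case: gg gh => [cg [B [B0 HB]] lg] [ch [B' [B'0 HB']] lh]; split.
- move=> x; apply: cvgD; last exact: ch.
  by apply: cvgM; [exact: cvg_cst|exact: cg].
- exists (`|a| * B + B'); split; first by rewrite addr_ge0// mulr_ge0.
  move=> x; rewrite (le_trans (ler_normD _ _))// lerD// normrM.
  by rewrite ler_wpM2l.
- move=> j; have E (F : (R -> R) -> R) : state F ->
     F (fun x => x ^+ j * (a * g x + h x)) = a * F (fun x => x ^+ j * g x) + F (fun x => x ^+ j * h x).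
    move=> sF; rewrite -state_linear//; try by apply: poly_growthM => //; exact: poly_growthX.
    by congr F; apply/funext => x; ring.
  under eq_fun do rewrite E//; rewrite E//; apply: cvgD; last exact: lh.
  by apply: cvgM; [exact: cvg_cst|exact: lg].
Qed.

(** The product of a Taylor polynomial of sin (t x) with g passes to the limit.
    The remainder is at most |t x|^r / r!, and its moment is at most of order
    (t K)^r (r + j)! / r!, which tends to 0 geometrically when t K is small. *)
Lemma good_mul_sin (t : R) (g : R -> R) : 0 <= t -> t * (4 * K) <= 1 ->
  good g -> good (fun x => sin (t * x) * g x).
Proof.
move=> t0 tK gg; have pg := good_poly_growth gg; case: gg => [cg [B [B0 HB]] lg].
have cs : continuous (fun x : R => sin (t * x)).
  move=> x; apply: (@continuous_comp _ _ _ (fun x => t * x) sin); last exact: continuous_sin.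
  by apply: cvgM; [exact: cvg_cst|exact: cvg_id].
have ps : poly_growth (fun x => sin (t * x)).
  split => //; exists 1, 0%N; split => // x; rewrite expr0 mulr1 ler_norml.
  by rewrite sin_geN1 sin_le1.
split.
- by move=> x; apply: cvgM; [exact: cs|exact: cg].
- exists B; split => // x; rewrite normrM (le_trans _ (HB x))// ler_piMl//.
  by rewrite ler_norml sin_geN1 sin_le1.
move=> j; apply: cvg_approx => e e0.
(* r is chosen so that r + j is even and the Taylor remainder has small moment *)
have [N HN] : exists N : nat, B * (j`!%:R * (2 * K) ^+ j) * (2^-1) ^+ N <= e.
  set b := B * _; have b0 : 0 <= b.
    by rewrite /b !mulr_ge0// exprn_ge0// mulr_ge0// (le_trans _ K1).
  have : b * (2^-1 : R) ^+ n @[n --> \oo] --> (0 : R).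
    rewrite -[X in _ --> X](mulr0 b); apply: cvgM; first exact: cvg_cst.
    by apply: cvg_expr; rewrite ger0_norm// invf_lt1// ltr1n.
  move/cvgrPdist_le => /(_ _ e0)[N _ /(_ N (leqnn N))] /=.
  by rewrite sub0r normrN => /(le_trans (ler_norm _)) ?; exists N.
set r := (j + N.*2)%N.
have [p Hp] := @sin_taylor R r 0.
pose v (F : (R -> R) -> R) := F (fun x => x ^+ j * (p.[t * x] * g x)).
pose d (F : (R -> R) -> R) := B * t ^+ r / r`!%:R * F (fun x => x ^+ (j + r)).
have vE (F : (R -> R) -> R) : state F ->
    v F = \sum_(i < size p) p`_i * t ^+ i * F (fun x => x ^+ (j + i) * g x).
  move=> sF; transitivity (F (fun x => \sum_(i < size p) p`_i * t ^+ i * (x ^+ (j + i) * g x))).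
    congr F; apply/funext => x; rewrite horner_coef mulr_suml mulr_sumr; apply: eq_bigr => i _.
    by rewrite exprMn exprD; ring.
  rewrite state_sum//; last first.
    by move=> i; apply: poly_growthZ; apply: poly_growthM => //; exact: poly_growthX.
  by apply: eq_bigr => i _; rewrite stateZ//; apply: poly_growthM => //; exact: poly_growthX.
have pv : poly_growth (fun x => x ^+ j * (p.[t * x] * g x)).
  have -> : (fun x => x ^+ j * (p.[t * x] * g x)) =
      (fun x => \sum_(i < size p) p`_i * t ^+ i * (x ^+ (j + i) * g x)).
    apply/funext => x; rewrite horner_coef mulr_suml mulr_sumr; apply: eq_bigr => i _.
    by rewrite exprMn exprD; ring.
  by apply: poly_growth_sum => i; apply: poly_growthZ; apply: poly_growthM => //; exact: poly_growthX.
have dv (F : (R -> R) -> R) : state F ->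
    `|F (fun x => x ^+ j * (sin (t * x) * g x)) - v F| <= d F.
  move=> sF; rewrite /d -stateZ; [|exact: sF|exact: poly_growthX].
  apply: (state_dist sF) => //.
  - by apply: poly_growthM; [exact: poly_growthX|exact: poly_growthM].
  - by apply: poly_growthZ; exact: poly_growthX.
  move=> x; have -> : x ^+ j * (sin (t * x) * g x) - x ^+ j * (p.[t * x] * g x) =
      x ^+ j * g x * (sin (t * x + 0) - p.[t * x]) by rewrite addr0; ring.
  rewrite !normrM; apply: le_trans (_ : `|x ^+ j| * B * (`|t * x| ^+ r / r`!%:R) <= _).
    by apply: (ler_pM (mulr_ge0 (normr_ge0 _) (normr_ge0 _)) (normr_ge0 _) _ (Hp _)); exact: ler_wpM2l.
  have -> : x ^+ (j + r) = `|x| ^+ (j + r).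
    rewrite /r addnA addnn -doubleD -muln2 mulnC exprM [RHS]exprM.
    by rewrite real_normK ?num_real.
  rewrite normrX normrM (ger0_norm t0) exprMn exprD.
  by rewrite le_eqVlt; apply/orP; left; apply/eqP; ring.
have dL : d L <= e.
  apply: le_trans HN; rewrite /d.
  have Kj : 0 <= K by exact: le_trans K1.
  have f0 : 0 < r`!%:R :> R by rewrite ltr0n fact_gt0.
  apply: le_trans (_ : B * t ^+ r / r`!%:R * (K ^+ (j + r) * (2 ^+ (j + r) * (j`!%:R * r`!%:R))) <= _).
    rewrite ler_wpM2l ?divr_ge0 ?mulr_ge0 ?exprn_ge0//.
    rewrite (le_trans (ler_norm _))// (le_trans (moment_growth _))//.
    rewrite ler_wpM2l ?exprn_ge0// -natrX -!natrM ler_nat.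
    exact: fact_add_le.
  have -> : B * t ^+ r / r`!%:R * (K ^+ (j + r) * (2 ^+ (j + r) * (j`!%:R * r`!%:R))) =
      B * (j`!%:R * (2 * K) ^+ j) * (t * (2 * K)) ^+ r.
    by rewrite !exprMn !exprD; field; rewrite gt_eqF.
  apply: ler_wpM2l; first by rewrite !mulr_ge0// exprn_ge0// mulr_ge0.
  apply: le_trans (_ : (2^-1) ^+ r <= _).
    by rewrite lerXn2r// ?nnegrE ?mulr_ge0//; lra.
  by rewrite ler_wiXn2l ?invr_ge0// ?invf_le1 ?ler1n// /r -addnn addnA leq_addl.
exists (fun n => v (Ln n)), (v L), (fun n => d (Ln n)), (d L); split => //.
- under eq_fun do rewrite vE//; rewrite vE//.
  apply: cvg_bigsum => i; apply: cvgM; [exact: cvg_cst|exact: lg].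
- by apply: cvgM; [exact: cvg_cst|exact: cvg_moment].
- by move=> n; exact: dv.
- by rewrite distrC (le_trans (dv _ sL)).
Qed.

(** Polynomials in sin (t x) are obtained by repeated multiplication, without
    changing t. *)
Lemma good_bernstein (t : R) N g : 0 <= t -> t * (4 * K) <= 1 ->
  good (fun x => bernstein N g ((1 + sin (t * x)) / 2)).
Proof.
move=> t0 tK; elim: N g => [|N IH] g /=; first exact: good_cst.
have E : (fun x => (1 + sin (t * x)) / 2 * bernstein N (fun k => g k.+1) ((1 + sin (t * x)) / 2) +
     (1 - (1 + sin (t * x)) / 2) * bernstein N g ((1 + sin (t * x)) / 2)) =
  (fun x => 2^-1 * (1 * bernstein N g ((1 + sin (t * x)) / 2) +
     bernstein N (fun k => g k.+1) ((1 + sin (t * x)) / 2)) +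
   (2^-1 * (sin (t * x) * (-1 * bernstein N g ((1 + sin (t * x)) / 2) +
     bernstein N (fun k => g k.+1) ((1 + sin (t * x)) / 2))) + 0)).
  by apply/funext => x; field.
rewrite E; apply: good_linear; first exact: good_linear.
apply: good_linear; last exact: good_cst.
by apply: good_mul_sin => //; exact: good_linear.
Qed.

(** The map y |-> (1 + sin x)/2 is inverted continuously near 0, which turns a
    function of x into one of the argument of Bernstein polynomials. *)
Lemma asin_sin_clamp : exists F : R -> R, [/\ continuous F &
  forall x : R, -1 <= x <= 1 -> F ((1 + sin x) / 2) = x].
Proof.
have pi1 : 1 < pi / 2 :> R.
  have /andP[_ h] := @pihalf_02 R; rewrite lt_neqAle pihalf_ge1 andbT.
  apply/eqP => p1; have := @cos1_gt0 R; rewrite p1 cos_pihalf ltxx.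
  by [].
have s1 : 0 < sin 1 :> R by apply: sin_gt0_pihalf; rewrite ltr01.
have itv1 x : -1 <= x <= 1 -> x \in `[(- (pi / 2)), (pi / 2 : R)].
  by move=> /andP[x0 x1]; rewrite in_itv/=; apply/andP; split; lra.
have one1 : -1 <= (1 : R) <= 1 by apply/andP; split; lra.
have none1 : -1 <= (-1 : R) <= 1 by apply/andP; split; lra.
have s1lt : sin 1 < 1 :> R.
  rewrite -[X in _ < X](@sin_pihalf R) ltr_sin//; first exact: itv1.
  by rewrite in_itv /= lexx andbT; lra.
have lesin x y : -1 <= x <= 1 -> -1 <= y <= 1 -> x <= y -> sin x <= sin y :> R.
  by move=> hx hy xy; rewrite leNgt ltr_sin ?itv1// -leNgt.
pose clamp (z : R) : R := Num.max (- sin 1) (Num.min (sin 1) z).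
have clampb z : - sin 1 <= clamp z <= sin 1.
  rewrite /clamp le_max lexx /= ge_max ge_min lexx andbT.
  by rewrite ge0_cp// ltW.
exists (fun y : R => asin (clamp (2 * y - 1))); split.
  move=> y; apply: (@continuous_comp _ _ _ (fun y : R => clamp (2 * y - 1)) asin).
    apply: (@continuous_max _ _ (fun=> - sin 1) (fun y : R => Num.min (sin 1) (2 * y - 1))).
      exact: cst_continuous.
    apply: (@continuous_min _ _ (fun=> sin 1) (fun y : R => 2 * y - 1)); first exact: cst_continuous.
    apply: cvgB; last exact: cvg_cst.
    by apply: cvgM; [exact: cvg_cst|exact: cvg_id].
  apply: continuous_asin; have /andP[c1 c2] := clampb (2 * y - 1).
  by apply/andP; split; [rewrite (lt_le_trans _ c1)// ltrN2|exact: le_lt_trans s1lt].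
move=> x x1; have -> : 2 * ((1 + sin x) / 2) - 1 = sin x :> R by field.
have /andP[xm xM] := x1.
have -> : clamp (sin x) = sin x.
  rewrite /clamp (min_idPr _) ?(max_idPr _)//.
    by rewrite -sinN; exact: lesin.
  exact: lesin.
by rewrite sinK// itv1.
Qed.

(** For small t, f coincides on [-1/t, 1/t] with a continuous function of
    (1 + sin (t x))/2, which is a uniform limit of Bernstein polynomials; the
    contribution of |x| > 1/t is of order t^2 by the second moments. *)
Theorem moment_cvg_weak (f : R -> R) (B : R) : continuous f -> (forall x, `|f x| <= B) ->
  Ln n f @[n --> \oo] --> L f.
Proof.
move=> cf bf; have B0 : 0 <= B by exact: le_trans (bf 0).
have pf : poly_growth f.
  by split => //; exists B, 0%N; split => // x; rewrite expr0 mulr1.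
apply: cvg_approx => e e0.
pose M2 : R := `|L (fun x => x ^+ 2)|.
have [A0 [A0K A0M]] : exists A0 : R, 4 * K <= A0 /\ (3 * B + e) * M2 <= e / 2 * A0 ^+ 2.
  pose A1 := 4 * K + (3 * B + e) * M2 / (e / 2); exists A1.
  have e3 : 0 < 3 * B + e by move: B0 e0; lra.
  have e2 : 0 <= e / 2 by move: e0; lra.
  have q0 : 0 <= (3 * B + e) * M2 / (e / 2) by rewrite divr_ge0// mulr_ge0 ?normr_ge0// ltW.
  split; first by rewrite lerDl.
  rewrite -ler_pdivrMl ?divr_gt0// mulrC.
  apply: le_trans (_ : A1 <= _); first by rewrite lerDr mulr_ge0// (le_trans _ K1).
  by rewrite expr2 ler_peMl// /A1; move: K1 q0; lra.
have A0pos : 0 < A0 by move: K1 A0K; lra.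
pose t := A0^-1; have t0 : 0 <= t by rewrite invr_ge0 ltW.
have tK : t * (4 * K) <= 1 by rewrite /t mulrC ler_pdivrMr// mul1r.
have [S [cS HS]] := asin_sin_clamp.
pose F (y : R) : R := f (A0 * S y).
have cF : continuous F.
  move=> y; apply: (@continuous_comp _ _ _ (fun y : R => A0 * S y) f); last exact: cf.
  by apply: cvgM; [exact: cvg_cst|exact: cS].
have e4 : 0 < e / 4 by rewrite divr_gt0.
have [c c0 Hc] := unit_interval_modulus cF (fun y => bf _) e4.
have [N N0 HN] : exists2 N : nat, (0 < N)%N & c / N%:R <= e / 4.
  exists (Num.truncn (c / (e / 4))).+1 => //.
  rewrite ler_pdivrMr ?ltr0n// mulrC -ler_pdivrMr// ltW//.
  by have := truncnS_gt (c / (e / 4)).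
pose h (x : R) : R := bernstein N (fun k => F (k%:R / N%:R)) ((1 + sin (t * x)) / 2).
have gh : good h by exact: good_bernstein.
have ph := good_poly_growth gh.
have y01 (x : R) : 0 <= (1 + sin x) / 2 <= 1.
  by have := sin_geN1 x; have := sin_le1 x; move=> ? ?; apply/andP; split; lra.
have hF (x : R) : `|h x - F ((1 + sin (t * x)) / 2)| <= e / 2.
  rewrite (le_trans (bernstein_approx N0 c0 (y01 _) Hc))//.
  by move: HN; lra.
pose q (x : R) : R := e / 2 + (3 * B + e) / A0 ^+ 2 * x ^+ 2.
have fh (x : R) : `|f x - h x| <= q x.
  have [xA|xA] := leP `|x| A0.
    rewrite distrC; have -> : f x = F ((1 + sin (t * x)) / 2).
      rewrite /F HS; first by rewrite /t mulrA divff ?mul1r// gt_eqF.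
      by rewrite -ler_norml normrM (ger0_norm t0) /t mulrC ler_pdivrMr// mul1r.
    rewrite (le_trans (hF x))// lerDl mulr_ge0 ?sqr_ge0// divr_ge0 ?sqr_ge0//.
    by rewrite addr_ge0 ?mulr_ge0// ltW.
  have h1 : `|h x| <= B + e / 2.
    have := hF x; rewrite !ler_norml => /andP[h1 h2].
    have := bf (A0 * S ((1 + sin (t * x)) / 2)); rewrite -/(F _) ler_norml => /andP[F1 F2].
    by apply/andP; split; lra.
  rewrite (le_trans (ler_normB _ _))// (le_trans (lerD (bf x) h1))// /q.
  have : (3 * B + e) <= (3 * B + e) / A0 ^+ 2 * x ^+ 2.
    rewrite mulrAC -mulrA ler_peMr ?addr_ge0 ?mulr_ge0 ?(ltW e0)//.
    rewrite ler_pdivlMr ?exprn_gt0// mul1r -[leRHS]real_normK ?num_real//.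
    by rewrite lerXn2r ?nnegrE ?(ltW A0pos)// ltW.
  by move: B0 e0; lra.
have pq : poly_growth q.
  by apply: poly_growthD; [exact: poly_growth_cst|apply: poly_growthZ; exact: poly_growthX].
have qE (G : (R -> R) -> R) : state G -> G q = e / 2 + (3 * B + e) / A0 ^+ 2 * G (fun x => x ^+ 2).
  move=> sG; rewrite /q stateD//; first by rewrite state_cst// stateZ//; exact: poly_growthX.
    exact: poly_growth_cst.
  by apply: poly_growthZ; exact: poly_growthX.
have Lq : L q <= e.
  rewrite qE// [leRHS](splitr e) lerD2l.
  apply: le_trans (_ : (3 * B + e) / A0 ^+ 2 * M2 <= _).
    rewrite ler_wpM2l ?ler_norm// divr_ge0 ?sqr_ge0//.
    by rewrite addr_ge0 ?mulr_ge0// ltW.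
  by rewrite mulrAC ler_pdivrMr ?exprn_gt0.
have cgh : Ln n h @[n --> \oo] --> L h.
  case: gh => _ _ /(_ 0%N); rewrite (_ : (fun x => x ^+ 0 * h x) = h)//.
  by apply/funext => x; rewrite expr0 mul1r.
exists (fun n => Ln n h), (L h), (fun n => Ln n q), (L q); split => //.
- under eq_fun do rewrite qE//; rewrite qE//; apply: cvgD; first exact: cvg_cst.
  by apply: cvgM; [exact: cvg_cst|exact: cvg_moment].
- by move=> n; exact: state_dist.
- by rewrite distrC (le_trans (state_dist sL pf ph pq fh)).
Qed.

End convergence.

End moment_method.

(** * Limits of expectation functionals *)

Section state_limits.
Context {R : realType}.

Lemma fmap_ultra (S T : Type) (u : S -> T) (U : set_system S) :
  UltraFilter U -> UltraFilter (u @ U).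
Proof.
move=> UU; split; first exact: fmap_proper_filter.
move=> G PG sG; apply/seteqP; split => [A GA|]; last exact: sG.
have [//|UnA] := in_ultra_setVsetC (u @^-1` A) UU.
have GnA : G (~` A) by apply: sG.
have := filterI GA GnA; rewrite setICr => G0.
by have /(_ (G0 _)) := @filter_not_empty _ _ PG.
Qed.

(** The image ultrafilter lives on a compact interval. *)
Lemma ultra_bounded_cvg (U : set_system nat) (u : nat -> R) (B : R) :
  UltraFilter U -> (forall n, `|u n| <= B) -> exists l : R, u n @[n --> U] --> l.
Proof.
move=> UU uB; have := @segment_compact R (- B) B; rewrite compact_ultra.
move=> /(_ (u @ U) (fmap_ultra u UU))[]; last by move=> l [_ ul]; exists l.
have uin (n : nat) : `[- B, B]%classic (u n) by have := uB n; rewrite /= in_itv /= ler_norml.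
apply: (@filterS _ U _ setT (u @^-1` `[- B, B]%classic)) => [n _|]; last exact: filterT.
exact: uin.
Qed.

(** A majorant by even powers only, whose expectations are moments. *)
Lemma growth_majorant (k : nat) (x : R) : (1 + `|x|) ^+ k <=
  \sum_(i < k.+1) 'C(k, i)%:R * 2 ^+ k * x ^+ (2 * i).
Proof.
have -> : \sum_(i < k.+1) 'C(k, i)%:R * 2 ^+ k * x ^+ (2 * i) = (2 * (1 + x ^+ 2)) ^+ k.
  rewrite exprMn (exprDn 1 (x ^+ 2)) mulr_sumr; apply: eq_bigr => i _.
  by rewrite expr1n mul1r -exprM -mulr_natl; ring.
rewrite lerXn2r// ?nnegrE ?addr_ge0// ?mulr_ge0 ?addr_ge0 ?sqr_ge0//.
by rewrite -(real_normK (num_real x)); have : 0 <= `|x| by []; nra.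
Qed.

(** The values L_n f are bounded by moments, hence converge along any
    ultrafilter finer than the convergence at infinity; the axioms of a state
    pass to the limit. *)
Lemma state_limit (Ln : nat -> (R -> R) -> R) (M : nat -> R) :
  (forall n, state (Ln n)) ->
  (forall p, Ln n (fun x => x ^+ p) @[n --> \oo] --> M p) ->
  exists L, state L /\ forall p, L (fun x => x ^+ p) = M p.
Proof.
move=> sL cM; have [U [UU sU]] := ultraFilterLemma (eventually_filter : ProperFilter eventually).
have cU (u : nat -> R) (l : R) : u n @[n --> \oo] --> l -> u n @[n --> U] --> l.
  by move=> ul; apply: cvg_trans ul => A; exact: sU.
have bnd (f : R -> R) : poly_growth f -> exists B : R, forall n, `|Ln n f| <= B.
  move=> [cf [C [k [C0 fC]]]].
  pose h (x : R) : R := \sum_(i < k.+1) 'C(k, i)%:R * 2 ^+ k * x ^+ (2 * i).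
  have ph : poly_growth h.
    by apply: poly_growth_sum => i; apply: poly_growthZ; exact: poly_growthX.
  have hE n : Ln n h = \sum_(i < k.+1) 'C(k, i)%:R * 2 ^+ k * Ln n (fun x => x ^+ (2 * i)).
    rewrite state_sum//; last by move=> i; apply: poly_growthZ; exact: poly_growthX.
    by apply: eq_bigr => i _; rewrite stateZ//; exact: poly_growthX.
  have /cvg_seq_bounded[B [_ HB]] : cvgn (fun n => Ln n h).
    apply/cvg_ex; eexists; under eq_fun do rewrite hE.
    by apply: cvg_bigsum => i; apply: cvgM; [exact: cvg_cst|exact: cM].
  exists (C * (`|B| + 1)) => n.
  have : `|Ln n f - Ln n (fun=> 0)| <= Ln n (fun x => C * h x).
    apply: (state_dist (sL n)) => //; [by split=> //; exists C, k|exact: poly_growth_cst|exact: poly_growthZ|].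
    move=> x; rewrite subr0 (le_trans (fC x))// ler_wpM2l//; exact: growth_majorant.
  rewrite state_zero// subr0 stateZ// => /le_trans; apply; rewrite ler_wpM2l//.
  rewrite (le_trans (ler_norm _))//.
  by have := HB (`|B| + 1) (ltr_pwDr ltr01 (ler_norm _)) n I.
have limP : forall f : R -> R, exists l : R, poly_growth f -> Ln n f @[n --> U] --> l.
  move=> f; have [pf|] := pselect (poly_growth f); last by exists 0.
  by have [B HB] := bnd f pf; have [l Hl] := ultra_bounded_cvg UU HB; exists l.
have [L HL] := choice limP.
have PU : ProperFilter U by exact: ultra_proper.
have uniq (u : nat -> R) (l l' : R) : u n @[n --> U] --> l -> u n @[n --> U] --> l' -> l = l'.
  by move=> h1 h2; apply: (cvg_unique _ h1 h2).
exists L; split; last by move=> p; apply: uniq (cU _ _ (cM p)); apply: HL; exact: poly_growthX.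
split.
- move=> a f g pf pg; apply: (uniq (fun n => Ln n (fun x => a * f x + g x))).
    by apply: HL; apply: poly_growthD => //; exact: poly_growthZ.
  have -> : (fun n => Ln n (fun x => a * f x + g x)) = (fun n => a * Ln n f + Ln n g).
    by apply/funext => n; rewrite state_linear.
  by apply: cvgD; [apply: cvgM; [exact: cvg_cst|exact: HL]|exact: HL].
- move=> f g pf pg fg; apply: (ler_cvg_to (HL f pf) (HL g pg)).
  by apply: filterS filterT => n _; exact: state_le.
- apply: (uniq (fun n => Ln n (fun=> 1))); first by apply: HL; exact: poly_growth_cst.
  have -> : (fun n => Ln n (fun=> 1)) = (fun=> 1) by apply/funext => n; rewrite state_one.
  exact: cvg_cst.
Qed.

End state_limits.

Section measure_states.
Context {R : realType}.

Definition avg (s : seq R) (f : R -> R) : R := (size s)%:R^-1 * \sum_(x <- s) f x.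

Lemma avg_state s : s != [::] -> state (avg s).
Proof.
move=> s0; split => [a f g _ _|f g _ _ fg|].
- by rewrite /avg big_split /= -mulr_sumr mulrDr mulrCA.
- by rewrite /avg ler_wpM2l ?invr_ge0// ler_sum.
- by rewrite /avg big_const_seq count_predT iter_addr_0 mulVf// pnatr_eq0 size_eq0.
Qed.

Variable mu : {measure set (measurableTypeR R) -> \bar R}.
Hypothesis mu1 : mu [set: R] = 1%E.
Hypothesis int_pow : forall p : nat, mu.-integrable [set: R] (fun x : R => (x ^+ p)%:E).

Lemma poly_growth_integrable f : poly_growth f -> mu.-integrable [set: R] (EFin \o f).
Proof.
move=> [cf [C [k [C0 fC]]]].
apply: (@le_integrable _ _ _ mu _ measurableT _
  (fun x => (\sum_(i < k.+1) C%:E * (('C(k, i)%:R * 2 ^+ k)%:E * ((x : R) ^+ (2 * i))%:E))%E)).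
- by apply/measurable_EFinP; exact: continuous_measurable_fun.
- move=> x _ /=.
  have -> : (\sum_(i < k.+1) (C%:E * (('C(k, i)%:R * 2 ^+ k)%:E * ((x : R) ^+ (2 * i))%:E))%E)%R =
      (\sum_(i < k.+1) (C * ('C(k, i)%:R * 2 ^+ k * (x : R) ^+ (2 * i)))%R)%:E.
    by rewrite -sumEFin; apply: eq_bigr => i _; rewrite -!EFinM.
  rewrite lee_fin ger0_norm.
    rewrite (le_trans (fC x))// -mulr_sumr ler_wpM2l//.
    exact: growth_majorant.
  apply: sumr_ge0 => i _; apply: mulr_ge0 => //; apply: mulr_ge0.
    by rewrite mulr_ge0 ?exprn_ge0.
  by rewrite exprM exprn_ge0 ?sqr_ge0.
- apply: integrable_sum => // i _; apply: integrableZl => //; exact: integrableZl.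
Qed.

(** The integral against a measure with all moments is a state. *)
Lemma measure_state : state (fun f => \int[mu]_x f x)%R.
Proof.
split => [a f g pf pg|f g pf pg fg|].
- rewrite RintegralD//; [|exact: poly_growth_integrable (poly_growthZ a pf)|exact: poly_growth_integrable].
  by rewrite RintegralZl//; exact: poly_growth_integrable.
- apply: le_Rintegral => //; exact: poly_growth_integrable.
- by rewrite Rintegral_cst// mul1r mu1.
Qed.

End measure_states.

(** * The distribution function of an expectation functional *)

Section representation.
Context {R : realType}.

(** The Lebesgue-Stieltjes measure of F. *)
Lemma cdf_measure (F : R -> R) : {homo F : x y / x <= y} -> right_continuous F ->
  F @ -oo --> (0 : R) -> F @ +oo --> (1 : R) ->
  exists mu : probability (measurableTypeR R) R,
    forall x, mu `]-oo, x]%classic = (F x)%:E.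
Proof.
move=> nd rc F0 F1.
pose F' : cumulativeBounded (0 : R) (1 : R) := HB.pack F
  (isCumulative.Build R _ R F nd rc) (isCumulativeBounded.Build R 0 1 F F0 F1).
exists (lebesgue_stieltjes_measure F') => x.
exact: (cdf_lebesgue_stieltjes_id F' x).
Qed.

(** A continuous version of the indicator of ]-oo, x]: it descends from 1 at x to
    0 at y. *)
Definition ramp (x y z : R) : R := Num.max 0 (Num.min 1 ((y - z) / (y - x))).

Lemma ramp01 x y z : 0 <= ramp x y z <= 1.
Proof. by rewrite /ramp le_max lexx /= ge_max ler01 ge_min lexx. Qed.

Lemma ramp_left x y z : x < y -> z <= x -> ramp x y z = 1.
Proof.
move=> xy zx; have yx : 0 < y - x by rewrite subr_gt0.
rewrite /ramp (min_idPl _) ?(max_idPr _)//.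
by rewrite ler_pdivlMr// mul1r; lra.
Qed.

Lemma ramp_right x y z : x < y -> y <= z -> ramp x y z = 0.
Proof.
move=> xy zx; have yx : 0 < y - x by rewrite subr_gt0.
apply/max_idPl; rewrite ge_min; apply/orP; right.
by rewrite ler_pdivrMr// mul0r; lra.
Qed.

Lemma ramp_mid x y z : x < y -> x <= z <= y -> ramp x y z = (y - z) / (y - x).
Proof.
move=> xy /andP[xz zy]; have yx : 0 < y - x by rewrite subr_gt0.
rewrite /ramp (min_idPr _) ?(max_idPr _)//.
  by rewrite divr_ge0 ?(ltW yx)//; lra.
by rewrite ler_pdivrMr// mul1r; lra.
Qed.

Lemma ramp_le x y x' y' z : x < y -> x' < y' -> x <= x' -> y <= y' ->
  ramp x y z <= ramp x' y' z.
Proof.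
move=> xy xy' xx yy; have [zx|xz] := leP z x'.
  by rewrite (ramp_left xy')//; case/andP: (ramp01 x y z).
have [yz|zy] := leP y z.
  by rewrite (ramp_right xy)//; case/andP: (ramp01 x' y' z).
rewrite !ramp_mid//; [|by apply/andP; split; lra..].
by rewrite ler_pdivrMr ?subr_gt0// mulrAC ler_pdivlMr ?subr_gt0//; nra.
Qed.

Lemma ramp_shift x x' y z : x <= x' -> x' < y ->
  ramp x' y z <= ramp x y z + (x' - x) / (y - x).
Proof.
move=> xx xy; have xy' : x < y by exact: le_lt_trans xx xy.
have d0 : 0 < y - x by rewrite subr_gt0.
have q0 : 0 <= (x' - x) / (y - x) by rewrite divr_ge0 ?(ltW d0)// subr_ge0.
have [zx|xz] := leP z x.
  by rewrite !ramp_left//; [rewrite lerDl|exact: le_trans xx].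
have [yz|zy] := leP y z; first by rewrite !ramp_right// add0r.
rewrite (ramp_mid xy'); last by apply/andP; split; lra.
rewrite -mulrDl ler_pdivlMr//.
have [zx'|xz'] := leP z x'; first by rewrite ramp_left//; lra.
rewrite ramp_mid//; last by apply/andP; split; lra.
by rewrite mulrAC ler_pdivrMr ?subr_gt0//; nra.
Qed.

Lemma poly_growth_bounded (f : R -> R) (B : R) : continuous f -> (forall x, `|f x| <= B) ->
  poly_growth f.
Proof.
move=> cf fB; split => //; exists B, 0%N; split; first exact: le_trans (fB 0).
by move=> x; rewrite expr0 mulr1.
Qed.

Lemma ramp_continuous x y : continuous (ramp x y).
Proof.
move=> z; apply: (@continuous_max _ _ (fun=> 0) (fun z : R => Num.min 1 ((y - z) / (y - x)))).
  exact: cst_continuous.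
apply: (@continuous_min _ _ (fun=> 1) (fun z : R => (y - z) / (y - x))).
  exact: cst_continuous.
apply: cvgM; last exact: cvg_cst.
by apply: cvgB; [exact: cvg_cst|exact: cvg_id].
Qed.

Lemma ramp_growth x y : poly_growth (ramp x y).
Proof.
apply: (@poly_growth_bounded _ 1); first exact: ramp_continuous.
by move=> z; have /andP[r0 r1] := ramp01 x y z; rewrite ger0_norm.
Qed.

Section cdf_of_state.
Variable L : (R -> R) -> R.
Hypothesis sL : state L.

(** The indicator of ]-oo, x] lies outside the domain of L, so the mass of the
    half-line is approximated from above by ramps. *)
Definition state_cdf (x : R) : R := inf [set L (ramp x y) | y in [set y | x < y]].

Let ramp_ge0 x y : 0 <= L (ramp x y).
Proof.
rewrite -(state_zero sL); apply: state_le => //.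
- exact: poly_growth_cst.
- exact: ramp_growth.
- by move=> z; case/andP: (ramp01 x y z).
Qed.

Lemma state_cdf_has_inf x : has_inf [set L (ramp x y) | y in [set y | x < y]].
Proof.
split; first by exists (L (ramp x (x + 1))), (x + 1) => //=; rewrite ltrDl.
by exists 0 => _ [y _ <-].
Qed.

Lemma state_cdf_le x y : x < y -> state_cdf x <= L (ramp x y).
Proof.
by move=> xy; apply: ge_inf; [case: (state_cdf_has_inf x)|exists y].
Qed.

Lemma le_state_cdf x t : (forall y, x < y -> t <= L (ramp x y)) -> t <= state_cdf x.
Proof.
move=> h; apply: lb_le_inf; first by case: (state_cdf_has_inf x).
by move=> _ [y /= xy <-]; exact: h.
Qed.

Lemma state_cdf_ge x y : x < y -> L (ramp x y) <= state_cdf y.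
Proof.
move=> xy; apply: le_state_cdf => z yz; apply: state_le => //; try exact: ramp_growth.
by move=> t; apply: ramp_le => //; exact: ltW.
Qed.

Lemma state_cdf_nd : {homo state_cdf : x y / x <= y}.
Proof.
move=> x x' xx; apply: le_state_cdf => y xy; apply: le_trans (_ : L (ramp x y) <= _).
  by apply: state_cdf_le; exact: le_lt_trans xy.
apply: state_le => //; try exact: ramp_growth.
by move=> t; apply: ramp_le => //; exact: le_lt_trans xy.
Qed.

(** A ramp from x to y dominates a ramp that starts slightly to the right of x,
    up to a uniformly small shift. *)
Lemma state_cdf_rc : right_continuous state_cdf.
Proof.
move=> x; apply/cvgrPdist_le => e e0.
have e2 : 0 < e / 2 by rewrite divr_gt0.
have [_ [y /= xy <-] Hy] := inf_adherent e2 (state_cdf_has_inf x).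
have yx : 0 < y - x by rewrite subr_gt0.
near=> x'.
have xx' : x < x' by near: x'; exact: nbhs_right_gt.
have x'y : x' < y by near: x'; exact: nbhs_right_lt.
have x'e : x' < x + e / 2 * (y - x).
  by near: x'; apply: nbhs_right_lt; rewrite ltrDl mulr_gt0.
rewrite distrC ger0_norm ?subr_ge0 ?state_cdf_nd ?(ltW xx')//.
apply: le_trans (_ : L (ramp x' y) - state_cdf x <= _).
  by rewrite lerD2r; exact: state_cdf_le.
have : L (ramp x' y) <= L (ramp x y) + (x' - x) / (y - x).
  rewrite -[X in _ + X](state_cst sL) -stateD//; [|exact: ramp_growth|exact: poly_growth_cst].
  apply: state_le => //; [exact: ramp_growth| |].
    by apply: poly_growthD; [exact: ramp_growth|exact: poly_growth_cst].
  by move=> z; apply: ramp_shift => //; exact: ltW.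
have : (x' - x) / (y - x) <= e / 2 by rewrite ler_pdivrMr//; lra.
by move: Hy; rewrite -/(state_cdf x); lra.
Unshelve. all: by end_near. Qed.

Let M2 := L (fun x => x ^+ 2).

Let M2_ge0 : 0 <= M2.
Proof.
rewrite -(state_zero sL); apply: state_le => //; [exact: poly_growth_cst|exact: poly_growthX|].
by move=> x; rewrite sqr_ge0.
Qed.

Lemma state_cdf_le1 x : state_cdf x <= 1.
Proof.
apply: le_trans (state_cdf_le (_ : x < x + 1)) _; first by rewrite ltrDl.
rewrite -[leRHS](state_one sL); apply: state_le => //; [exact: ramp_growth|exact: poly_growth_cst|].
by move=> z; case/andP: (ramp01 x (x + 1) z).
Qed.

Lemma state_cdf_ge0 x : 0 <= state_cdf x.
Proof. by apply: le_state_cdf => y _. Qed.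

(** The complement of the ramp is dominated by x^2 over the square of its start,
    so that the second moment controls the tail. *)
Lemma state_cdf_y : state_cdf @ +oo --> (1 : R).
Proof.
apply/cvgrPdist_le => e e0; near=> x.
have x0 : 0 < x by near: x; exact: nbhs_pinfty_gt.
have xe : 1 + M2 / e <= x by near: x; apply: nbhs_pinfty_ge; exact: num_real.
rewrite ger0_norm ?subr_ge0 ?state_cdf_le1// lerBlDl -lerBlDr.
have q0 : 0 <= M2 / e by rewrite divr_ge0 ?(ltW e0).
apply: le_state_cdf => y xy; apply: le_trans (_ : 1 + - (x ^+ 2)^-1 * M2 <= _).
  rewrite lerD2l mulNr lerN2 mulrC ler_pdivrMr ?exprn_gt0//.
  by rewrite mulrC -ler_pdivrMr// expr2; nra.
rewrite -[X in X + _](state_one sL) -(stateZ sL)//; last exact: poly_growthX.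
rewrite -(stateD sL); [|exact: poly_growth_cst|by apply: poly_growthZ; exact: poly_growthX].
apply: state_le => //; [|exact: ramp_growth|move=> z].
  by apply: poly_growthD; [exact: poly_growth_cst|apply: poly_growthZ; exact: poly_growthX].
have x2 : 0 <= (x ^+ 2)^-1 by rewrite invr_ge0 sqr_ge0.
have [zx|xz] := leP z x.
  by rewrite ramp_left// mulNr gerBl mulr_ge0 ?sqr_ge0.
case/andP: (ramp01 x y z) => + _; apply: le_trans.
rewrite mulNr subr_le0 mulrC ler_pdivlMr ?exprn_gt0// mul1r.
by rewrite lerXn2r ?nnegrE ?(ltW x0)//; lra.
Unshelve. all: by end_near. Qed.

Lemma state_cdf_Ny : state_cdf @ -oo --> (0 : R).
Proof.
apply/cvgrPdist_le => e e0; near=> x.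
have x0 : x < 0 by near: x; exact: nbhs_ninfty_lt.
have xe : x <= - (2 * (1 + M2 / e)) by near: x; apply: nbhs_ninfty_le; exact: num_real.
rewrite sub0r normrN ger0_norm ?state_cdf_ge0//.
have q0 : 0 <= M2 / e by rewrite divr_ge0 ?(ltW e0).
have xx : x < x / 2 by lra.
apply: le_trans (state_cdf_le xx) _.
have h0 : 0 < (x / 2) ^+ 2 by rewrite exprn_even_gt0//=; lra.
apply: le_trans (_ : ((x / 2) ^+ 2)^-1 * M2 <= _); last first.
  rewrite mulrC ler_pdivrMr// mulrC -ler_pdivrMr// expr2.
  have : 1 + M2 / e <= - (x / 2) by lra.
  nra.
rewrite -(stateZ sL)//; last exact: poly_growthX.
apply: state_le => //; [exact: ramp_growth|by apply: poly_growthZ; exact: poly_growthX|].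
move=> z; have [zx|xz] := leP (x / 2) z.
  by rewrite ramp_right// mulr_ge0 ?invr_ge0 ?sqr_ge0.
case/andP: (ramp01 x (x / 2) z) => _ /le_trans; apply.
by rewrite mulrC ler_pdivlMr// mul1r !expr2; nra.
Unshelve. all: by end_near. Qed.

End cdf_of_state.
End representation.

(** * Integrals of Lipschitz functions *)

Section representation.
Context {R : realType}.

Definition bounded_continuous (f : R -> R) : Prop :=
  continuous f /\ exists B : R, forall x, `|f x| <= B.

Lemma bounded_continuous_growth f : bounded_continuous f -> poly_growth f.
Proof. by move=> [cf [B fB]]; exact: poly_growth_bounded fB. Qed.

Lemma bounded_continuous_cst a : bounded_continuous (fun=> a).
Proof. by split; [exact: cst_continuous|exists `|a|]. Qed.

Lemma bounded_continuous_ramp x y : bounded_continuous (ramp x y).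
Proof.
split; first exact: ramp_continuous.
by exists 1 => z; have /andP[r0 r1] := ramp01 x y z; rewrite ger0_norm.
Qed.

Lemma bounded_continuous_linear a f g : bounded_continuous f -> bounded_continuous g ->
  bounded_continuous (fun x => a * f x + g x).
Proof.
move=> [cf [B fB]] [cg [C gC]]; split.
  by move=> x; apply: cvgD; [apply: cvgM; [exact: cvg_cst|exact: cf]|exact: cg].
exists (`|a| * B + C) => x; rewrite (le_trans (ler_normD _ _))// lerD//.
by rewrite normrM ler_wpM2l.
Qed.

Section bounded_integral.
Variable mu : probability (measurableTypeR R) R.

Lemma bounded_continuous_integrable f : bounded_continuous f ->
  mu.-integrable [set: R] (EFin \o f).
Proof.
move=> [cf [B fB]]; apply: measurable_bounded_integrable => //.
- by rewrite (le_lt_trans (probability_le1 _ _))// ltry.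
- exact: continuous_measurable_fun.
- exists B; split; first exact: num_real.
  by move=> C BC x _; apply: le_trans (fB x) (ltW BC).
Qed.

Lemma Rintegral_linear a f g : bounded_continuous f -> bounded_continuous g ->
  (\int[mu]_x (a * f x + g x) = a * \int[mu]_x f x + \int[mu]_x g x)%R.
Proof.
move=> bf bg; rewrite RintegralD//.
- by rewrite RintegralZl//; exact: bounded_continuous_integrable.
- have := bounded_continuous_linear a bf (bounded_continuous_cst 0).
  move=> /bounded_continuous_integrable; apply: eq_integrable => // x _ /=.
  by rewrite addr0.
- exact: bounded_continuous_integrable.
Qed.

Lemma Rintegral_prob_cst a : (\int[mu]_(x in [set: R]) a = a)%R.
Proof.
have mu1 : mu [set: R] = 1%E := probability_setT mu.
rewrite Rintegral_cst//.
by rewrite -[RHS]mulr1; congr (_ * _); exact: (congr1 fine mu1).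
Qed.

Lemma ramp_integral_bounds x y : x < y ->
  (mu `]-oo, x]%classic <= (\int[mu]_z ramp x y z)%:E <= mu `]-oo, y]%classic)%E.
Proof.
move=> xy.
have E (t : R) : mu `]-oo, t]%classic = (\int[mu]_z (\1_(`]-oo, t]) z : R)%R)%:E.
  have mI : measurable (`]-oo, t]%classic : set (measurableTypeR R)) by exact: measurable_itv.
  rewrite /Rintegral fineK.
    by rewrite integral_indic//= setIT.
  by rewrite integral_indic//= setIT; apply: fin_num_measure.
have iI (t : R) : mu.-integrable [set: R] (EFin \o \1_(`]-oo, t])).
  exact: integrable_indic.
have ir := bounded_continuous_integrable (bounded_continuous_ramp x y).
have ind (t z : R) : \1_(`]-oo, t]) z = (z <= t)%R%:R :> R.
  by rewrite indicE mem_setE in_itv.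
rewrite !E !lee_fin; apply/andP; split; apply: le_Rintegral => // z _; rewrite ind.
- have [zx|xz] := leP z x; first by rewrite ramp_left.
  by case/andP: (ramp01 x y z).
- have [zx|xz] := leP z y; first by case/andP: (ramp01 x y z).
  by rewrite ramp_right// ltW.
Qed.

End bounded_integral.

(** The piecewise linear interpolation of g at the nodes x_0 < ... < x_n, written
    as a combination of ramps so that L and the integral can be compared term
    by term. *)
Fixpoint interpolation (g x : _) n (z : R) : R :=
  if n is j.+1 then
    (g (x j.+1) - g (x j)) * (1 - ramp (x j) (x j.+1) z) + interpolation g x j z
  else g (x 0%N).

Section interpolation.
Variables (g : R -> R) (x : nat -> R) (K d : R).
Hypothesis x_lt : forall j, x j < x j.+1.
Hypothesis g_osc : forall j z, x j <= z <= x j.+1 -> `|g z - g (x j)| <= K.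

Lemma interpolation_bounded n : bounded_continuous (interpolation g x n).
Proof.
elim: n => [|n IH]; first exact: bounded_continuous_cst.
apply: bounded_continuous_linear => //.
have := bounded_continuous_linear (-1) (bounded_continuous_ramp (x n) (x n.+1)) (bounded_continuous_cst 1).
by congr bounded_continuous; apply/funext => z; rewrite mulN1r addrC.
Qed.

Lemma interpolation_error n z : (forall t, t <= x 0%N -> g t = g (x 0%N)) ->
  (z <= x n -> `|g z - interpolation g x n z| <= 2 * K) /\
  (x n <= z -> interpolation g x n z = g (x n)).
Proof.
move=> gl.
have K0 : 0 <= K.
  have x00 : x 0%N <= x 0%N <= x 1%N by rewrite lexx ltW.
  exact: le_trans (g_osc x00).
elim: n => [|n [IH1 IH2]] /=.
  by split => // z0; rewrite gl// subrr normr0 mulr_ge0.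
split => [zx|xz]; last first.
  rewrite ramp_right// IH2; last exact: le_trans (ltW (x_lt n)) xz.
  by rewrite subr0 mulr1 subrK.
have [zxn|xnz] := leP z (x n).
  by rewrite ramp_left// subrr mulr0 add0r IH1.
rewrite IH2 ?(ltW xnz)// opprD addrCA addrC.
rewrite (le_trans (ler_normB _ _))// mulr_natl mulr2n lerD//.
  by apply: g_osc; rewrite ltW.
rewrite normrM -[leRHS]mulr1 ler_pM//.
  by apply: g_osc; rewrite lexx ltW.
have /andP[r0 r1] := ramp01 (x n) (x n.+1) z.
by rewrite ger0_norm; lra.
Qed.

End interpolation.

Section state_integral.
Variables (L : (R -> R) -> R) (mu : probability (measurableTypeR R) R).
Hypothesis sL : state L.
Hypothesis mu_cdf : forall x, mu `]-oo, x]%classic = (state_cdf L x)%:E.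

Lemma interpolation_integral g x K n : (forall j, x j < x j.+1) ->
  (forall j z, x j <= z <= x j.+1 -> `|g z - g (x j)| <= K) ->
  `|(\int[mu]_z interpolation g x n z)%R - L (interpolation g x n)| <=
  K * (state_cdf L (x n) - state_cdf L (x 0%N)).
Proof.
move=> xlt gK; elim: n => [|n IH] /=.
  by rewrite Rintegral_prob_cst state_cst// !subrr normr0 mulr0.
set f := interpolation g x n in IH *.
have bf : bounded_continuous f by exact: interpolation_bounded.
have br := bounded_continuous_ramp (x n) (x n.+1).
have b1 : bounded_continuous (fun z => 1 - ramp (x n) (x n.+1) z).
  have := bounded_continuous_linear (-1) br (bounded_continuous_cst 1).
  by congr bounded_continuous; apply/funext => z; rewrite mulN1r addrC.
rewrite Rintegral_linear// state_linear//; try exact: bounded_continuous_growth.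
have -> : (\int[mu]_z (1 - ramp (x n) (x n.+1) z))%R = 1 - (\int[mu]_z ramp (x n) (x n.+1) z)%R.
  under eq_Rintegral do rewrite addrC -mulN1r.
  by rewrite (Rintegral_linear _ _ br (bounded_continuous_cst 1)) Rintegral_prob_cst mulN1r addrC.
have -> : L (fun z => 1 - ramp (x n) (x n.+1) z) = 1 - L (ramp (x n) (x n.+1)).
  have -> : (fun z => 1 - ramp (x n) (x n.+1) z) = (fun z => -1 * ramp (x n) (x n.+1) z + 1).
    by apply/funext => z; rewrite mulN1r addrC.
  rewrite state_linear//; [|exact: ramp_growth|exact: poly_growth_cst].
  by rewrite mulN1r addrC state_one.
have := ramp_integral_bounds mu (xlt n); rewrite !mu_cdf !lee_fin => /andP[].
have := state_cdf_le sL (xlt n); have := state_cdf_ge sL (xlt n).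
set I := (\int[mu]_z _)%R; set J := L (ramp _ _) => J1 J2 I1 I2.
rewrite (_ : _ - _ = (g (x n.+1) - g (x n)) * (J - I) + ((\int[mu]_z f z)%R - L f)); last by ring.
rewrite (le_trans (ler_normD _ _))//.
have -> : K * (state_cdf L (x n.+1) - state_cdf L (x 0%N)) =
   K * (state_cdf L (x n.+1) - state_cdf L (x n)) +
   K * (state_cdf L (x n) - state_cdf L (x 0%N)) by ring.
rewrite lerD// normrM ler_pM//.
  by apply: gK; rewrite lexx ltW.
by rewrite ler_norml; apply/andP; split; lra.
Qed.

(** On ramps L and the integral are squeezed between values of the distribution
    function at the endpoints; summed over the nodes of a fine grid the errors
    are at most proportional to the mesh, by the Lipschitz bound. *)
Lemma lipschitz_integral g (a K : R) : 0 < a -> 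
  (forall u v, `|g u - g v| <= K * `|u - v|) ->
  (forall z, z <= - a -> g z = g (- a)) -> (forall z, a <= z -> g z = g a) ->
  bounded_continuous g -> (\int[mu]_z g z)%R = L g.
Proof.
move=> a0 gK gl gr bg.
have K0 : 0 <= K.
  have := gK 1 0; rewrite subr0 normr1 mulr1; exact: le_trans.
apply/eqP; rewrite -subr_eq0 -normr_le0; apply/ler_addgt0Pr => e e0; rewrite add0r.
pose n := (Num.truncn (10 * K * a / e)).+1; pose d := 2 * a / n%:R.
have n0 : 0 < n%:R :> R by rewrite ltr0n.
have d0 : 0 < d by rewrite !mulr_gt0 ?invr_gt0.
pose x (j : nat) : R := - a + j%:R * d.
have xlt j : x j < x j.+1 by rewrite /x ltrD2l ltr_pM2r// ltr_nat.
have osc j z : x j <= z <= x j.+1 -> `|g z - g (x j)| <= K * d.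
  move=> /andP[z1 z2]; rewrite (le_trans (gK _ _))// ler_wpM2l//.
  rewrite ger0_norm ?subr_ge0//; move: z2; rewrite /x -natr1 mulrDl; lra.
have x0 : x 0%N = - a by rewrite /x mul0r addr0.
have xn : x n = a by rewrite /x /d; field; rewrite gt_eqF.
set h := interpolation g x n.
have gh z : `|g z - h z| <= 2 * (K * d).
  have [] := @interpolation_error g x (K * d) xlt osc n z.
    by move=> t; rewrite x0 => /gl.
  rewrite -/h; have [zx|xz] := leP z (x n); first by move=> /(_ isT).
  move=> _ ->; last exact: ltW.
  by move: xz; rewrite xn => /ltW/gr ->; rewrite subrr normr0 !mulr_ge0// ltW.
have bh : bounded_continuous h by exact: interpolation_bounded.
have bc c := bounded_continuous_cst c.
have Lgh : `|L g - L h| <= 2 * (K * d).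
  rewrite -[leRHS](state_cst sL); apply: state_dist => //; [exact: bounded_continuous_growth bg|exact: bounded_continuous_growth bh|exact: poly_growth_cst].
have Igh : `|(\int[mu]_z g z)%R - (\int[mu]_z h z)%R| <= 2 * (K * d).
  have bgh : bounded_continuous (fun z => g z - h z).
    have := bounded_continuous_linear (-1) bh bg.
    by congr bounded_continuous; apply/funext => z; rewrite mulN1r addrC.
  rewrite -RintegralB//; try exact: bounded_continuous_integrable.
  rewrite (le_trans (le_normr_Rintegral _ _))//; first exact: bounded_continuous_integrable.
  rewrite -[leRHS](Rintegral_prob_cst mu); apply: le_Rintegral => //.
    have := bounded_continuous_integrable mu bgh => /integrable_abse.
    by apply: eq_integrable.
  exact: bounded_continuous_integrable.
have Ih : `|(\int[mu]_z h z)%R - L h| <= K * d.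
  rewrite (le_trans (interpolation_integral n xlt osc))//.
  apply: ler_piMr; first by rewrite mulr_ge0 ?(ltW d0).
  by have := state_cdf_le1 sL (x n); have := state_cdf_ge0 sL (x 0%N); lra.
have de : 5 * (K * d) <= e.
  have -> : 5 * (K * d) = 10 * K * a / n%:R by rewrite /d; field; rewrite gt_eqF.
  rewrite ler_pdivrMr// -ler_pdivrMl// [e^-1 * _]mulrC ltW//.
  exact: truncnS_gt.
rewrite (le_trans _ de)//; move: Lgh Igh Ih; rewrite !ler_norml.
by move=> /andP[? ?] /andP[? ?] /andP[? ?]; apply/andP; split; lra.
Qed.

(** Powers of the clamped variable are Lipschitz and constant outside an
    interval, and approximate powers with an error controlled by the next even
    moment. *)
Definition clamp (a x : R) : R := Num.max (- a) (Num.min a x).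

Lemma clamp_norm a x : 0 <= a -> `|clamp a x| = Num.min a `|x|.
Proof.
move=> a0; rewrite /clamp; have [xa|ax] := leP a x.
  rewrite max_r; last by lra.
  by rewrite (ger0_norm a0) min_l// (le_trans xa)// ler_norm.
have [xa|ax'] := leP (- a) x.
  rewrite min_r// ler_norml; apply/andP; split; lra.
rewrite normrN (ger0_norm a0) min_l// ltr0_norm; lra.
Qed.

Lemma clamp_id a x : `|x| <= a -> clamp a x = x.
Proof.
rewrite ler_norml => /andP[a1 a2]; rewrite /clamp min_r// max_r//.
Qed.

Lemma clamp_lipschitz a u v : 0 <= a -> `|clamp a u - clamp a v| <= `|u - v|.
Proof.
move=> a0; rewrite /clamp.
wlog uv : u v / u <= v.
  move=> h; have [/h//|/ltW/h] := leP u v.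
  by rewrite distrC [`|v - u|]distrC.
rewrite distrC [leRHS]distrC [leRHS]ger0_norm ?subr_ge0//.
by rewrite ger0_norm; move: uv; rewrite /Num.max /Num.min; do ![case: ifPn]; rewrite -?leNgt; lra.
Qed.

Lemma clamp_pow_lipschitz a p : 0 <= a ->
  exists K : R, forall u v, `|clamp a u ^+ p - clamp a v ^+ p| <= K * `|u - v|.
Proof.
move=> a0; elim: p => [|p [K IH]].
  by exists 0 => u v; rewrite !expr0 subrr normr0 mul0r.
have ca u : `|clamp a u| <= a by rewrite clamp_norm// ge_min lexx.
exists (a * K + a ^+ p) => u v.
rewrite (_ : _ - _ = clamp a u * (clamp a u ^+ p - clamp a v ^+ p) +
   clamp a v ^+ p * (clamp a u - clamp a v)); last by rewrite !exprS; ring.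
rewrite (le_trans (ler_normD _ _))// mulrDl lerD// normrM.
  by rewrite -mulrA ler_pM.
by rewrite normrX ler_pM ?exprn_ge0 ?lerXn2r ?nnegrE ?clamp_lipschitz.
Qed.

Lemma clamp_continuous a : continuous (clamp a).
Proof.
move=> z; apply: (@continuous_max _ _ (fun=> - a) (fun z : R => Num.min a z)).
  exact: cst_continuous.
apply: (@continuous_min _ _ (fun=> a) (fun z : R => z)).
  exact: cst_continuous.
exact: cvg_id.
Qed.

Lemma clamp_pow_bounded a p : 0 <= a -> bounded_continuous (fun z => clamp a z ^+ p).
Proof.
move=> a0; split.
  move=> z; apply: (@continuous_comp _ _ _ (clamp a) (fun z : R => z ^+ p)).
    exact: clamp_continuous.
  exact: exprn_continuous.
exists (a ^+ p) => z; rewrite normrX lerXn2r ?nnegrE//.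
by rewrite clamp_norm// ge_min lexx.
Qed.

Lemma clamp_pow_integral a p : 0 < a -> (\int[mu]_z (clamp a z ^+ p))%R = L (fun z => clamp a z ^+ p).
Proof.
move=> a0; have [K HK] := clamp_pow_lipschitz p (ltW a0).
apply: (lipschitz_integral a0 HK) => [z za|z za|].
- by rewrite /clamp !min_r ?max_l//; lra.
- by rewrite /clamp !min_l// lexx.
- exact: clamp_pow_bounded (ltW a0).
Qed.

End state_integral.
End representation.

(** * The measure with given limiting moments *)

Section representation.
Context {R : realType}.

Lemma clamp_pow_approx (a x : R) p : 0 < a ->
  `|x ^+ p - clamp a x ^+ p| <= 2 / a ^+ p * x ^+ (2 * p).
Proof.
move=> a0; have [xa|ax] := leP `|x| a.
  rewrite clamp_id// subrr normr0 mulr_ge0//; first by rewrite divr_ge0 ?exprn_ge0 ?(ltW a0).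
  by rewrite exprM exprn_ge0 ?sqr_ge0.
have cx : `|clamp a x| <= `|x| by rewrite clamp_norm ?(ltW a0)// ge_min lexx orbT.
rewrite (le_trans (ler_normB _ _))// !normrX.
apply: le_trans (_ : 2 * `|x| ^+ p <= _).
  by rewrite mulr_natl mulr2n lerD2l lerXn2r ?nnegrE.
rewrite -mulrA ler_pM2l// exprM -(real_normK (num_real x)) -exprM mulnC exprM expr2.
rewrite mulrA ler_peMl ?exprn_ge0//.
by rewrite mulrC ler_pdivlMr ?exprn_gt0// mul1r lerXn2r ?nnegrE ?(ltW a0)// ltW.
Qed.

Lemma clamp_pow_le (a x : R) q : 0 <= a -> clamp a x ^+ (2 * q) <= x ^+ (2 * q).
Proof.
move=> a0; rewrite !exprM -(real_normK (num_real x)) -(real_normK (num_real (clamp a x))).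
by rewrite -!exprM lerXn2r ?nnegrE// clamp_norm// ge_min lexx orbT.
Qed.

Lemma clamp_pow_homo (a b x : R) q : 0 <= a -> a <= b ->
  clamp a x ^+ (2 * q) <= clamp b x ^+ (2 * q).
Proof.
move=> a0 ab; rewrite !exprM -(real_normK (num_real (clamp b x))) -(real_normK (num_real (clamp a x))).
rewrite -!exprM lerXn2r ?nnegrE// !clamp_norm//; last exact: le_trans ab.
by rewrite le_min !ge_min ab lexx orbT.
Qed.

Lemma integral_Rintegral (mu : {measure set (measurableTypeR R) -> \bar R}) (f : R -> R) :
  mu.-integrable [set: R] (EFin \o f) ->
  (\int[mu]_x (f x)%:E)%E = ((\int[mu]_x f x)%R)%:E.
Proof. by move=> fi; rewrite /Rintegral fineK//; exact: integrable_fin_num. Qed.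

(** The equality of integrals of clamped powers passes to the limit a -> oo: even
    powers by monotone convergence, the others by comparison with them. *)
Theorem state_measure (L : (R -> R) -> R) : state L ->
  exists mu : probability (measurableTypeR R) R,
    forall p : nat, mu.-integrable [set: R] (fun x : R => (x ^+ p)%:E) /\
      (\int[mu]_x (x : R) ^+ p)%R = L (fun x => x ^+ p).
Proof.
move=> sL; have [mu Hmu] := cdf_measure (state_cdf_nd sL) (state_cdf_rc sL)
  (state_cdf_Ny sL) (state_cdf_y sL).
have even_int q : mu.-integrable [set: R] (fun x : R => (x ^+ (2 * q))%:E).
  have mX p : measurable_fun [set: R] (fun x : R => (x ^+ p)%:E).
    by apply/measurable_EFinP; apply: continuous_measurable_fun; exact: exprn_continuous.
  apply/integrableP; split; first exact: mX.
  pose g (n : nat) (x : measurableTypeR R) : \bar R := (clamp n.+1%:R (x : R) ^+ (2 * q))%:E.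
  have mg n : measurable_fun [set: R] (g n).
    apply/measurable_EFinP; apply: continuous_measurable_fun.
    by case: (clamp_pow_bounded (2 * q) (ler0n R n.+1)).
  have g0 n x : [set: R] x -> (0 <= g n x)%E.
    by move=> _; rewrite lee_fin exprM exprn_ge0 ?sqr_ge0.
  have gh x : [set: R] x -> {homo g^~ x : n m / (n <= m)%N >-> (n <= m)%E}.
    by move=> _ n m nm; rewrite lee_fin clamp_pow_homo ?ler_nat.
  have cv := @cvg_monotone_convergence _ (measurableTypeR R) R mu setT measurableT g mg g0 gh.
  have gl (x : measurableTypeR R) : limn (g^~ x) = ((x : R) ^+ (2 * q))%:E.
    apply/cvg_lim => //; apply: cvg_near_cst.
    exists (Num.truncn `|x : R|) => // n /= xn; rewrite /g clamp_id//.
    by rewrite (le_trans (ltW (truncnS_gt _)))// ler_nat ltnS.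
  have : (\int[mu]_x limn (g^~ x) <= (L (fun x => x ^+ (2 * q)))%:E)%E.
    apply: (cvge_to_le cv); apply: nearW => n.
    have n0 : 0 < n.+1%:R :> R by rewrite ltr0n.
    have bg := clamp_pow_bounded (2 * q) (ltW n0).
    rewrite integral_Rintegral; last exact: bounded_continuous_integrable.
    rewrite (clamp_pow_integral sL Hmu _ n0) lee_fin; apply: state_le => //.
    - exact: bounded_continuous_growth.
    - exact: poly_growthX.
    - by move=> x; exact: clamp_pow_le (ltW n0).
  under eq_integral do rewrite gl.
  move=> H; apply: le_lt_trans (ltry (L (fun x => x ^+ (2 * q)))); apply: le_trans H.
  rewrite le_eqVlt; apply/orP; left; apply/eqP; apply: eq_integral => x _.
  by rewrite abse_EFin ger0_norm// exprM exprn_ge0 ?sqr_ge0.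
have int_pow p : mu.-integrable [set: R] (fun x : R => (x ^+ p)%:E).
  apply: (@le_integrable _ _ _ mu _ measurableT _ (fun x : R => ((1 + x ^+ (2 * p))%R)%:E)).
  - by apply/measurable_EFinP; apply: continuous_measurable_fun; exact: exprn_continuous.
  - move=> x _; rewrite !abse_EFin lee_fin normrX (@ger0_norm _ (1 + _)).
      rewrite exprM -(real_normK (num_real x)) -exprM mulnC exprM.
      by have : 0 <= `|x| ^+ p by [rewrite exprn_ge0|]; nra.
    by rewrite addr_ge0// exprM exprn_ge0 ?sqr_ge0.
  - have i1 : mu.-integrable [set: R] (EFin \o (fun=> 1 : R)).
      exact: bounded_continuous_integrable (bounded_continuous_cst 1).
    by have := integrableD measurableT i1 (even_int p); apply: eq_integrable.
have mu1 : mu [set: R] = 1%E := probability_setT mu.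
have sI := measure_state mu1 int_pow.
exists mu => p; split; first exact: int_pow.
case: p => [|p]; first by rewrite (state_one sI) (state_one sL).
set I := fun f : R -> R => (\int[mu]_x f x)%R in sI *.
apply/eqP; rewrite -subr_eq0 -normr_le0; apply/ler_addgt0Pr => e e0; rewrite add0r.
pose S := I (fun x => x ^+ (2 * p.+1)) + L (fun x => x ^+ (2 * p.+1)).
have S0 : 0 <= S.
  have P2 (x : R) : 0 <= x ^+ (2 * p.+1) by rewrite exprM exprn_ge0 ?sqr_ge0.
  have ge0 (G : (R -> R) -> R) : state G -> 0 <= G (fun x => x ^+ (2 * p.+1)).
    move=> sG; rewrite -(state_zero sG).
    by apply: (state_le sG) => //; [exact: poly_growth_cst|exact: poly_growthX].
  by apply: addr_ge0; exact: ge0.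
pose a := 1 + 2 * S / e.
have a1 : 1 <= a by rewrite lerDl divr_ge0 ?mulr_ge0// ltW.
have a0 : 0 < a by exact: lt_le_trans a1.
pose f (x : R) := clamp a x ^+ p.+1.
have bf : bounded_continuous f by exact: clamp_pow_bounded (ltW a0).
have dist (G : (R -> R) -> R) : state G ->
    `|G (fun x => x ^+ p.+1) - G f| <= 2 / a ^+ p.+1 * G (fun x => x ^+ (2 * p.+1)).
  move=> sG; rewrite -(stateZ sG); last exact: poly_growthX.
  apply: state_dist => //; [exact: poly_growthX|exact: bounded_continuous_growth|by apply: poly_growthZ; exact: poly_growthX|].
  by move=> x; exact: clamp_pow_approx.
have fE : I f = L f by exact: clamp_pow_integral.
apply: le_trans (_ : 2 / a ^+ p.+1 * S <= _).
  rewrite mulrDr; apply: le_trans (lerD (dist I sI) (dist L sL)).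
  rewrite fE [in leRHS](distrC (L (fun x => _))); apply: le_trans (ler_normD _ _).
  by rewrite addrA subrK.
rewrite mulrAC ler_pdivrMr ?exprn_gt0// -ler_pdivrMl// [e^-1 * _]mulrC.
apply: le_trans (_ : a <= _); first by rewrite lerDr.
by rewrite exprS ler_peMr ?(ltW a0)// exprn_ege1.
Qed.

Theorem moment_limit_measure (Ln : nat -> (R -> R) -> R) (M : nat -> R) :
  (forall n, state (Ln n)) ->
  (forall p, Ln n (fun x => x ^+ p) @[n --> \oo] --> M p) ->
  exists mu : probability (measurableTypeR R) R,
    forall p : nat, mu.-integrable [set: R] (fun x : R => (x ^+ p)%:E) /\
      (\int[mu]_x ((x : R) ^+ p)%:E = (M p)%:E)%E.
Proof.
move=> sLn cM; have [L [sL LM]] := state_limit sLn cM.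
have [mu Hmu] := state_measure sL; exists mu => p; have [ip Ip] := Hmu p.
by split => //; rewrite integral_Rintegral// Ip LM.
Qed.

End representation.

(** * Mean and second moment of the traces *)

Section monomials.
Context {R : realType}.
Local Notation C := R[i].
Local Open Scope complex_scope.

Lemma monomial_cat (T : Type) (z : T -> C) (D D' U U' : seq T) :
  monomial z (D ++ D') (U ++ U') = monomial z D U * monomial z D' U'.
Proof. by rewrite /monomial !big_cat /= mulrACA. Qed.

Lemma monomial_map (T T' : Type) (f : T' -> T) (z : T -> C) (D U : seq T') :
  monomial z (map f D) (map f U) = monomial (fun q => z (f q)) D U.
Proof. by rewrite /monomial !big_map. Qed.

Lemma monomial_flatten (T L : Type) (z : T -> C) (A B : L -> seq T) (r : seq L) :
  monomial z (flatten [seq A l | l <- r]) (flatten [seq B l | l <- r]) =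
  \prod_(l <- r) monomial z (A l) (B l).
Proof.
elim: r => [|l r IH] /=; first by rewrite big_nil /monomial !big_nil mul1r.
by rewrite monomial_cat IH big_cons.
Qed.

Variable mu : nat -> nat -> C.
Hypothesis hmu : unimodular_moments mu.

(** Edges on different levels are distinct, so that the moment factorises. *)
Lemma edge_moment_flatten (T T' L : eqType) (h : L -> T -> T') (A B : L -> seq T) (r : seq L) :
  (forall l l' e e', h l e = h l' e' -> l = l' /\ e = e') -> uniq r ->
  edge_moment mu (flatten [seq map (h l) (A l) | l <- r])
     (flatten [seq map (h l) (B l) | l <- r]) =
  \prod_(l <- r) edge_moment mu (A l) (B l).
Proof.
move=> hinj; elim: r => [|l r IH] /=; first by rewrite big_nil edge_moment_nil.
move=> /andP[lr ur]; rewrite big_cons edge_moment_catM//.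
  rewrite IH// edge_moment_map//.
  by move=> e e' _ _ /hinj[].
move=> e; rewrite -map_cat => /mapP[t _ ->]; rewrite mem_cat.
by apply/negP => /orP[] /flattenP[s /mapP[l' l'r ->] /mapP[t' _ /hinj[ll' _]]];
  rewrite ll' l'r in lr.
Qed.

(** All that is used of a random model: the expectation E of linear combinations
    of monomials in the entries is that of independent unimodular variables.
    Independent random variables and uniform random signs both satisfy it. *)
Definition moment_model (I : eqType) (S : Type) (z : S -> I -> C) (E : (S -> C) -> C) : Prop :=
  forall (J : finType) (c : J -> C) (D U : J -> seq I),
    E (fun s => \sum_j c j * monomial (z s) (D j) (U j)) =
    \sum_j c j * edge_moment mu (D j) (U j).

Section model.
Context (n k m : nat) (S : Type) (z : S -> 'I_m * 'I_k * 'I_n -> C) (E : (S -> C) -> C).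
Hypothesis model : moment_model z E.

Lemma model_block (J K : finType) (c : J -> C) (A B : J -> K -> seq ('I_m * 'I_n)) :
  E (fun s => \sum_j c j * \prod_(l < k) \sum_(i : K)
        monomial (fun q => z s (q.1, l, q.2)) (A j i) (B j i)) =
  \sum_j c j * (\sum_(i : K) edge_moment mu (A j i) (B j i)) ^+ k.
Proof.
pose h (l : 'I_k) (e : 'I_m * 'I_n) := (e.1, l, e.2).
have hinj l l' e e' : h l e = h l' e' -> l = l' /\ e = e'.
  by case: e e' => [? ?] [? ?] [-> -> ->].
pose D (u : J * {ffun 'I_k -> K}) := flatten [seq map (h l) (A u.1 (u.2 l)) | l <- index_enum 'I_k].
pose U (u : J * {ffun 'I_k -> K}) := flatten [seq map (h l) (B u.1 (u.2 l)) | l <- index_enum 'I_k].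
have := model (fun u => c u.1) D U.
have -> : (fun s => \sum_u c u.1 * monomial (z s) (D u) (U u)) =
  (fun s => \sum_j c j * \prod_(l < k) \sum_(i : K)
        monomial (fun q => z s (q.1, l, q.2)) (A j i) (B j i)).
  apply/funext => s.
  rewrite -(pair_big predT predT (fun j f => c j * monomial (z s) (D (j, f)) (U (j, f)))) /=.
  apply: eq_bigr => j _; rewrite bigA_distr_bigA mulr_sumr; apply: eq_bigr => f _.
  rewrite /D /U monomial_flatten; congr (_ * _); apply: eq_bigr => l _.
  exact: monomial_map.
move=> ->; rewrite -(pair_big predT predT (fun j f => c j * edge_moment mu (D (j, f)) (U (j, f)))) /=.
apply: eq_bigr => j _; rewrite -[in RHS](card_ord k) -prodr_const.
rewrite [in RHS](eq_bigl predT)// bigA_distr_bigA mulr_sumr; apply: eq_bigr => f _.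
by congr (_ * _); apply: edge_moment_flatten => //; exact: index_enum_uniq.
Qed.

Definition word_weight (tau : nat -> R) (p : nat) (w : seq 'I_m) : C :=
  (\prod_(a <- w) tau a)%:C * ((n%:R)^-1 ^+ p) ^+ k.

Lemma trace_word_expansion (tau : nat -> R) p s : (0 < p)%N ->
  \tr (Mmx tau (fun a l j => z s (a, l, j)) ^+ p) =
  \sum_(w : p.-tuple 'I_m) word_weight tau p w * \prod_(l < k) \sum_(i : p.-tuple 'I_n)
    monomial (fun q => z s (q.1, l, q.2)) (downs w i) (ups w i).
Proof.
move=> p0; rewrite trace_Mmx//; apply: eq_bigr => w _.
by rewrite big_split /= prodr_const card_ord mulrA.
Qed.

(** The k levels carry the same walk sum, whence the k-th power. *)
Lemma mean_trace (tau : nat -> R) p : (0 < p)%N ->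
  E (fun s => \tr (Mmx tau (fun a l j => z s (a, l, j)) ^+ p)) =
  \sum_(w : p.-tuple 'I_m) word_weight tau p w * walk_sum mu n p w ^+ k.
Proof.
move=> p0; under eq_fun do rewrite trace_word_expansion//.
exact: (model_block (fun w : p.-tuple 'I_m => word_weight tau p w) (fun (w : p.-tuple 'I_m) (i : p.-tuple 'I_n) => downs w i)
  (fun w i => ups w i)).
Qed.

(** As for the mean, with pairs of words. *)
Lemma mean_trace_sqr (tau : nat -> R) p : (0 < p)%N ->
  E (fun s => \tr (Mmx tau (fun a l j => z s (a, l, j)) ^+ p) ^+ 2) =
  \sum_(w : p.-tuple 'I_m) \sum_(w' : p.-tuple 'I_m)
    word_weight tau p w * word_weight tau p w' * walk_pair_sum mu n p p w w' ^+ k.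
Proof.
move=> p0.
have -> : (fun s => \tr (Mmx tau (fun a l j => z s (a, l, j)) ^+ p) ^+ 2) =
  (fun s => \sum_(u : p.-tuple 'I_m * p.-tuple 'I_m)
     word_weight tau p u.1 * word_weight tau p u.2 *
     \prod_(l < k) \sum_(i : p.-tuple 'I_n * p.-tuple 'I_n)
       monomial (fun q => z s (q.1, l, q.2)) (downs u.1 i.1 ++ downs u.2 i.2)
         (ups u.1 i.1 ++ ups u.2 i.2)).
  apply/funext => s; rewrite trace_word_expansion// expr2 mulr_suml.
  under eq_bigr do rewrite mulr_sumr.
  rewrite (pair_big predT predT) /=; apply: eq_bigr => u _.
  rewrite mulrACA -big_split /=; congr (_ * _); apply: eq_bigr => l _.
  rewrite big_distrlr /= (pair_big predT predT) /=; apply: eq_bigr => i _.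
  by rewrite monomial_cat.
rewrite (model_block (fun u : p.-tuple 'I_m * p.-tuple 'I_m => word_weight tau p u.1 * word_weight tau p u.2)
  (fun u (i : p.-tuple 'I_n * p.-tuple 'I_n) => downs u.1 i.1 ++ downs u.2 i.2)
  (fun u i => ups u.1 i.1 ++ ups u.2 i.2)).
rewrite (pair_big predT predT) /=; apply: eq_bigr => u _; congr (_ * _ ^+ _).
by rewrite /walk_pair_sum (pair_big predT predT).
Qed.

End model.
End monomials.

(** * Limits of the means and bounds on the variances *)

Section norms.
Context {R : realType}.
Local Notation C := R[i].
Local Open Scope complex_scope.

Lemma Re_norm_le (z : C) (r : R) : `|z| <= r%:C -> `|complex.Re z| <= r.
Proof. by move=> zr; rewrite -lecR (le_trans (normc_ge_Re z)). Qed.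

Lemma ReM_real (r : R) (z : C) : complex.Re (r%:C * z) = r * complex.Re z.
Proof. by case: z => a b /=; rewrite mul0r subr0. Qed.

Lemma Re_sum (I : Type) (s : seq I) (P : pred I) (F : I -> C) :
  complex.Re (\sum_(i <- s | P i) F i) = \sum_(i <- s | P i) complex.Re (F i).
Proof. exact: (raddf_sum (@complex.Re R)). Qed.

Lemma natrC n : (n%:R : C) = (n%:R : R)%:C.
Proof. by rewrite rmorph_nat. Qed.

Lemma cvg_bigsum_seq (I : eqType) (r : seq I) (F : I -> nat -> R) (l : I -> R) :
  (forall i, i \in r -> F i n @[n --> \oo] --> l i) ->
  \sum_(i <- r) F i n @[n --> \oo] --> \sum_(i <- r) l i.
Proof.
move=> h; rewrite big_seq.
have -> : (fun n => \sum_(i <- r) F i n) = (fun n => \sum_(i <- r) if i \in r then F i n else 0).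
  by apply/funext => n; rewrite big_seq -big_mkcond.
rewrite big_mkcond; apply: cvg_bigsum => i.
by case: (boolP (i \in r)) => [/h//|_]; exact: cvg_cst.
Qed.

Lemma cvg_expr (u : nat -> R) (l : R) s :
  u n @[n --> \oo] --> l -> u n ^+ s @[n --> \oo] --> l ^+ s.
Proof.
move=> ul; elim: s => [|s IH]; first exact: cvg_cst.
by under eq_fun do rewrite exprS; rewrite exprS; exact: cvgM.
Qed.

Lemma cvg0_dominated (f g : nat -> R) : (\forall n \near \oo, `|f n| <= g n) ->
  g n @[n --> \oo] --> (0 : R) -> f n @[n --> \oo] --> (0 : R).
Proof.
move=> fg g0; apply/cvgrPdist_le => e e0; move/cvgrPdist_le: g0 => /(_ e e0) g0.
near=> n; rewrite sub0r normrN; apply: le_trans (_ : `|f n| <= g n) _.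
  by near: n.
have : `|0 - g n| <= e by near: n.
by rewrite sub0r normrN; apply: le_trans; exact: ler_norm.
Unshelve. all: by end_near. Qed.

End norms.

Section moment_limits.
Context {R : realType}.
Local Notation C := R[i].
Local Open Scope complex_scope.
Variables (mu : nat -> nat -> C) (tau mq : nat -> R) (c : R) (k m : nat -> nat).
Hypothesis hmu : unimodular_moments mu.
Hypothesis htau : forall q : nat, (0 < q)%N ->
  (j%:R)^-1 * power_sum tau j q @[j --> \oo] --> mq q.
Hypothesis hk : k n @[n --> \oo] --> \oo.
Hypothesis hm : m n @[n --> \oo] --> \oo.
Hypothesis hc : (m n)%:R / (n ^ k n)%N%:R @[n --> \oo] --> c.

Definition limit_moment (p : nat) : R :=
  \sum_(a <- canonical_words p | noncrossing a)
    c ^+ size (undup a) * \prod_(1 <= t < (size (undup a)).+1) mq (deg t a).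

(** The contribution of one tensor level, including the factor n^-p of the p
    inner products. *)
Definition normalized_walk (n p : nat) (L : eqType) (a : seq L) : C :=
  (n%:R)^-1 ^+ p * walk_sum mu n p a.

Lemma normalized_walk_canon n p (L : eqType) (w : seq L) : size w = p ->
  normalized_walk n p w = normalized_walk n p (canon w).
Proof.
move=> wp; rewrite /normalized_walk canonE walk_sum_map//; exact: canon_letter_inj.
Qed.

Lemma normalized_walk_noncrossing n (a : seq nat) : (0 < n)%N -> a != [::] -> noncrossing a ->
  normalized_walk n (size a) a = ((n%:R)^-1 ^+ size (undup a) * n%:R)%:C :> C.
Proof.
move=> n0 a0 na; have nC : (n%:R : C) != 0 by rewrite pnatr_eq0 -lt0n.
have := walk_sum_noncrossing hmu n a0 na => W.
apply: (mulIf (expf_neq0 (size (undup a)) nC)).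
rewrite /normalized_walk -mulrA W exprS mulrCA exprVn mulVf ?expf_neq0// mulr1.
rewrite rmorphM rmorphXn fmorphV !rmorph_nat mulrAC exprVn mulVf ?mul1r//.
by rewrite expf_neq0.
Qed.

Lemma normalized_walk_le n (L : eqType) (a : seq L) (B : nat) e : (0 < n)%N ->
  `|walk_sum mu n (size a) a| * n%:R ^+ size (undup a) <= B%:R * n%:R ^+ (size a + e) ->
  `|normalized_walk n (size a) a| <= (B%:R * (n%:R)^-1 ^+ size (undup a) * n%:R ^+ e)%:C.
Proof.
move=> n0 W; have nC : 0 < (n%:R : C) by rewrite ltr0n.
rewrite /normalized_walk normrM ger0_norm ?exprn_ge0 ?invr_ge0 ?ler0n//.
rewrite exprVn mulrC ler_pdivrMr ?exprn_gt0// -(ler_pM2r (exprn_gt0 (size (undup a)) nC)).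
apply: le_trans W _; rewrite !rmorphM !rmorphXn fmorphV !rmorph_nat exprD exprVn.
rewrite le_eqVlt; apply/orP; left; apply/eqP; field.
by rewrite expf_neq0// gt_eqF.
Qed.

(** The weights of all words with the same equality pattern. *)
Definition fiber_sum (j p : nat) (a : seq nat) : R :=
  \sum_(w : p.-tuple 'I_j | canon w == a) \prod_(x <- w) tau x.

Lemma mean_fibers n k' m' p : (0 < p)%N ->
  complex.Re (\sum_(w : p.-tuple 'I_m') word_weight n k' tau p w * walk_sum mu n p w ^+ k') =
  \sum_(a <- canonical_words p) fiber_sum m' p a * complex.Re (normalized_walk n p a ^+ k').
Proof.
move=> p0; rewrite sum_canonical// Re_sum; apply: eq_bigr => a _.
rewrite Re_sum mulr_suml; apply: eq_bigr => w /eqP wa.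
rewrite -wa -normalized_walk_canon ?size_tuple// -ReM_real /word_weight -mulrA.
by rewrite -exprMn.
Qed.

Lemma canonical_wordsP p a : (0 < p)%N -> a \in canonical_words p ->
  [/\ size a = p, canonical_seq a & a != [::]].
Proof.
move=> p0; rewrite mem_canonical_words => /andP[/eqP ap ca]; split => //.
by rewrite -size_eq0 ap -lt0n.
Qed.

Lemma fiber_sum_bound p : (0 < p)%N ->
  exists2 B : R, 0 <= B & forall a j, a \in canonical_words p ->
    \sum_(w : p.-tuple 'I_j | canon w == a) `|\prod_(x <- w) tau x| <= B * j%:R ^+ size (undup a).
Proof.
move=> p0.
suff [B B0 HB] : exists2 B : R, 0 <= B & forall a, a \in canonical_words p -> forall j,
    \sum_(w : p.-tuple 'I_j | canon w == a) `|\prod_(x <- w) tau x| <= B * j%:R ^+ size (undup a).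
  by exists B => // a j ain; exact: HB.
have : {subset canonical_words p <= canonical_words p} by [].
elim: {1 3}(canonical_words p) => [|b r IH] sub; first by exists 0.
have [|B B0 HB] := IH; first by move=> x xr; apply: sub; rewrite inE xr orbT.
have [sb cb _] := canonical_wordsP p0 (sub b (mem_head _ _)).
have [B' B'0 HB'] := sum_canon_fiber_abs_bound sb cb htau.
exists (B + B'); first exact: addr_ge0.
move=> a; rewrite inE => /orP[/eqP->|ar] j.
  by rewrite (le_trans (HB' j))// ler_wpM2r ?exprn_ge0// lerDr.
by rewrite (le_trans (HB a ar j))// ler_wpM2r ?exprn_ge0// lerDl.
Qed.

Lemma size_cvg (a : nat) : \forall n \near \oo, [/\ (a <= n)%N, (a <= k n)%N & (a <= m n)%N].
Proof.
have h1 := nbhs_infty_ge a.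
have h2 : \forall n \near \oo, (a <= k n)%N by move/cvgnyPge : hk; exact.
have h3 : \forall n \near \oo, (a <= m n)%N by move/cvgnyPge : hm; exact.
by near=> n; split; near: n.
Unshelve. all: by end_near. Qed.

(** The word a contributes its fiber sum, of order m^s, times the k-th power of
    its normalised walk. For noncrossing a the latter is n^((1-s) k), which
    together with N = n^k and m/N -> c gives the limit; for crossing a there
    is a further factor (C/n)^k. *)
Theorem mean_moment_cvg p : (0 < p)%N ->
  ((n ^ k n)%N%:R)^-1 * complex.Re (\sum_(w : p.-tuple 'I_(m n))
     word_weight n (k n) tau p w * walk_sum mu n p w ^+ k n) @[n --> \oo] --> limit_moment p.
Proof.
move=> p0.
under eq_fun do rewrite mean_fibers// mulr_sumr.
rewrite /limit_moment big_mkcond; apply: cvg_bigsum_seq => a ain.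
have [ap ca a0] := canonical_wordsP p0 ain; set s := size (undup a).
case: ifPn => [na|cra].
  have lim : ((m n)%:R ^+ s)^-1 * fiber_sum (m n) p a * ((m n)%:R / (n ^ k n)%N%:R) ^+ s
     @[n --> \oo] --> (\prod_(1 <= t < s.+1) mq (deg t a)) * c ^+ s.
    apply: cvgM.
      exact: (cvg_comp _ _ hm (sum_canon_fiber_cvg ap ca htau)).
    exact: cvg_expr.
  rewrite mulrC; apply: cvg_trans lim; apply: near_eq_cvg; near=> n.
  have [n1 k1 m1] : [/\ (1 <= n)%N, (1 <= k n)%N & (1 <= m n)%N] by near: n; exact: size_cvg.
  have m0 : (m n)%:R != 0 :> R by rewrite pnatr_eq0 -lt0n.
  have N0 : (n ^ k n)%N%:R != 0 :> R by rewrite pnatr_eq0 -lt0n expn_gt0 n1.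
  have := normalized_walk_noncrossing n1 a0 na; rewrite ap -/s => ->.
  have -> : complex.Re ((n%:R^-1 ^+ s * n%:R)%:C ^+ k n) =
      ((n ^ k n)%N%:R)^-1 ^+ s * (n ^ k n)%N%:R :> R.
    by rewrite -(rmorphXn (real_complex R)) /= exprMn natrX !exprVn -!exprM mulnC.
  by rewrite expr_div_n exprVn; field; rewrite !expf_neq0 ?N0 ?m0.
have [B B0 HB] := sum_canon_fiber_abs_bound ap ca htau.
apply: (@cvg0_dominated _ _ (fun n => B * ((m n)%:R / (n ^ k n)%N%:R) ^+ s * ((p ^ p)%N%:R * n%:R^-1))).
  near=> n.
  have [n1 k1 m1] : [/\ ((p ^ p).+1 <= n)%N, ((p ^ p).+1 <= k n)%N & ((p ^ p).+1 <= m n)%N].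
    by near: n; exact: size_cvg.
  have n0 : (0 < n)%N by exact: leq_trans n1.
  have N0 : 0 < (n ^ k n)%N%:R :> R by rewrite ltr0n expn_gt0 n0.
  have nR : 0 < n%:R :> R by rewrite ltr0n.
  have W : `|normalized_walk n p a| <= ((p ^ p)%N%:R * (n%:R)^-1 ^+ s)%:C.
    have := @normalized_walk_le n _ a (p ^ p) 0 n0.
    by rewrite addn0 ap mulr1; apply; rewrite -ap; exact: walk_sum_crossing.
  have Wk : `|complex.Re (normalized_walk n p a ^+ k n)| <= ((p ^ p)%N%:R * (n%:R)^-1 ^+ s) ^+ k n.
    apply: Re_norm_le; rewrite normrX rmorphXn lerXn2r// ?nnegrE//.
    by rewrite (le_trans _ W).
  have Tb : `|fiber_sum (m n) p a| <= B * (m n)%:R ^+ s.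
    exact: le_trans (ler_norm_sum _ _ _) (HB (m n)).
  rewrite normrM normrM ger0_norm ?invr_ge0 ?(ltW N0)//.
  apply: le_trans (_ : ((n ^ k n)%N%:R)^-1 * (B * (m n)%:R ^+ s) * ((p ^ p)%N%:R * (n%:R)^-1 ^+ s) ^+ k n <= _).
    rewrite -(mulrA (_^-1)); apply: ler_wpM2l; first by rewrite invr_ge0 ltW.
    exact: ler_pM.
  have -> : ((n ^ k n)%N%:R)^-1 * (B * (m n)%:R ^+ s) * ((p ^ p)%N%:R * (n%:R)^-1 ^+ s) ^+ k n =
     B * ((m n)%:R / (n ^ k n)%N%:R) ^+ s * ((p ^ p)%N%:R * (n%:R)^-1) ^+ k n :> R.
    rewrite !exprMn -!exprM [(s * _)%N]mulnC exprM !exprVn -(natrX _ n).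
    by field; rewrite ?expf_neq0 ?(gt_eqF N0).
  rewrite ler_wpM2l//.
    by rewrite mulr_ge0// exprn_ge0// divr_ge0// ler0n.
  have q1 : (p ^ p)%N%:R * (n%:R)^-1 <= 1 :> R.
    by rewrite ler_pdivrMr// mul1r ler_nat (leq_trans _ n1).
  have q0 : 0 <= (p ^ p)%N%:R * (n%:R)^-1 :> R by rewrite mulr_ge0// invr_ge0 ltW.
  rewrite -(prednK (leq_trans (ltn0Sn _) k1)) exprS ler_piMr//.
  by rewrite exprn_ile1.
rewrite -(mulr0 (B * c ^+ s)) -(mulr0 (p ^ p)%N%:R); apply: cvgM.
  apply: cvgM; first exact: cvg_cst.
  exact: cvg_expr.
by apply: cvgM; [exact: cvg_cst|exact: cvg_natV].
Unshelve. all: by end_near. Qed.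

Lemma size_undup_cat_lt (L : eqType) (w w' : seq L) x : x \in w -> x \in w' ->
  (size (undup (w ++ w')) < size (undup w) + size (undup w'))%N.
Proof.
move=> xw xw'; rewrite undup_cat size_cat ltn_add2r size_filter.
rewrite -(count_predC (fun y => y \notin w') (undup w)) -{1}[count _ _]addn0 ltn_add2l.
by rewrite -has_count; apply/hasP; exists x; rewrite ?mem_undup//= xw'.
Qed.

Definition normalized_pair (n p : nat) (L : eqType) (w w' : seq L) : C :=
  (n%:R)^-1 ^+ p * (n%:R)^-1 ^+ p * walk_pair_sum mu n p p w w'.

Definition pair_constant (p : nat) : nat := ((p + p) ^ (p + p))%N.

Lemma normalized_pair_le n p (L : eqType) (w w' : seq L) x : (0 < n)%N ->
  size w = p -> size w' = p -> x \in w -> x \in w' ->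
  `|normalized_pair n p w w'| <=
  ((pair_constant p)%:R * n%:R * (n%:R)^-1 ^+ size (undup (w ++ w')))%:C.
Proof.
move=> n0 wp wp' xw xw'; have nC : 0 < (n%:R : C) by rewrite ltr0n.
have W := walk_pair_sum_bound hmu n0 wp wp' xw xw'.
rewrite /normalized_pair -exprD normrM ger0_norm ?exprn_ge0 ?invr_ge0 ?ler0n//.
rewrite exprVn mulrC ler_pdivrMr ?exprn_gt0// -(ler_pM2r (exprn_gt0 (size (undup (w ++ w'))) nC)).
apply: le_trans W _; rewrite !rmorphM !rmorphXn fmorphV !rmorph_nat exprS exprVn.
rewrite le_eqVlt; apply/orP; left; apply/eqP; rewrite /pair_constant; field.
by rewrite expf_neq0// gt_eqF.
Qed.

Lemma normalized_product_le n p (L : eqType) (w w' : seq L) x : (0 < n)%N -> (0 < p)%N ->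
  size w = p -> size w' = p -> x \in w -> x \in w' ->
  `|normalized_walk n p w * normalized_walk n p w'| <=
  ((pair_constant p)%:R * n%:R * (n%:R)^-1 ^+ size (undup (w ++ w')))%:C.
Proof.
move=> n0 p0 wp wp' xw xw'.
have le (u : seq L) : size u = p ->
    `|normalized_walk n p u| <= ((p ^ p)%N%:R * (n%:R)^-1 ^+ size (undup u) * n%:R ^+ 1)%:C.
  move=> up; have u0 : u != [::] by rewrite -size_eq0 up -lt0n.
  have := @normalized_walk_le n _ u (p ^ p) 1 n0; rewrite up; apply.
  by rewrite -up addn1; exact: walk_sum_bound.
rewrite normrM; apply: le_trans (ler_pM (normr_ge0 _) (normr_ge0 _) (le w wp) (le w' wp')) _.
rewrite -rmorphM lecR expr1.
have lt := size_undup_cat_lt xw xw'; set s := size (undup (w ++ w')) in lt *.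
have n1 : 0 <= (n%:R : R)^-1 <= 1 by rewrite invr_ge0 ler0n invf_le1 ?ltr0n ?ler1n.
have nR : 0 < n%:R :> R by rewrite ltr0n.
apply: le_trans (_ : (p ^ p * p ^ p)%N%:R * (n%:R * n%:R) * n%:R^-1 ^+ s.+1 <= _).
  rewrite [leLHS](_ : _ = (p ^ p * p ^ p)%N%:R * (n%:R * n%:R) *
     n%:R^-1 ^+ (size (undup w) + size (undup w'))); last by rewrite exprD natrM; ring.
  case/andP: n1 => n1 n1'; rewrite ler_wpM2l ?mulr_ge0 ?ler0n//.
  by rewrite ler_wiXn2l.
rewrite [leLHS](_ : _ = (p ^ p * p ^ p)%N%:R * (n%:R * n%:R^-1 ^+ s)); last first.
  by rewrite exprS; field; rewrite gt_eqF.
rewrite -[leRHS]mulrA ler_wpM2r//.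
by rewrite ler_nat /pair_constant expnD leq_mul ?leq_exp2r ?leq_addr.
Qed.

(** Words without common letters cancel exactly. Words that share a letter have
    at most one power of n in excess of their number of letters, both in the
    joint walk and in the product of the two walks. *)
Lemma covariance_term_le n k' p (L : eqType) (w w' : seq L) : (0 < n)%N -> (0 < p)%N ->
  size w = p -> size w' = p ->
  `|normalized_pair n p w w' ^+ k' - (normalized_walk n p w * normalized_walk n p w') ^+ k'| <=
  (2 * ((pair_constant p)%:R * n%:R) ^+ k' * ((n ^ k')%N%:R)^-1 ^+ size (undup (w ++ w')))%:C.
Proof.
move=> n0 p0 wp wp'.
have nR : 0 < n%:R :> R by rewrite ltr0n.
have [/hasP[x xw' /= xw]|/hasPn dis] := boolP (has (mem w) w'); last first.
  rewrite /normalized_pair walk_pair_sum_disjoint//.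
    rewrite mulrACA subrr normr0 -(rmorph0 (real_complex R)) lecR.
    by rewrite !mulr_ge0 ?exprn_ge0 ?invr_ge0 ?mulr_ge0 ?ler0n.
  by move=> x xw; apply/negP => /dis; rewrite /= xw.
have h1 := normalized_pair_le n0 wp wp' xw xw'.
have h2 := normalized_product_le n0 p0 wp wp' xw xw'.
set r := (pair_constant p)%:R * n%:R * _ in h1 h2.
have rk (z : C) : `|z| <= r%:C -> `|z ^+ k'| <= (r ^+ k')%:C.
  move=> zr; rewrite normrX rmorphXn lerXn2r// ?nnegrE//.
  exact: le_trans zr.
apply: le_trans (ler_normB _ _) _; apply: le_trans (lerD (rk _ h1) (rk _ h2)) _.
rewrite -rmorphD lecR /r exprMn -exprM mulnC exprM natrX !exprVn.
by rewrite le_eqVlt; apply/orP; left; apply/eqP; ring.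
Qed.

Lemma sum_abs_words_le p : (0 < p)%N -> exists2 B : R, 0 <= B & \forall n \near \oo,
  \sum_(u : p.-tuple 'I_(m n)) `|\prod_(x <- u) tau x| * ((n ^ k n)%N%:R)^-1 ^+ size (undup u) <= B.
Proof.
move=> p0; have [B B0 HB] := fiber_sum_bound p0.
have c0 : 0 <= c.
  have h0 : (fun=> 0 : R) n @[n --> \oo] --> (0 : R) by exact: cvg_cst.
  by apply: (ler_cvg_to h0 hc); apply: nearW => n; rewrite divr_ge0 ?ler0n.
exists (\sum_(a <- canonical_words p) B * (c + 1) ^+ p).
  by apply: sumr_ge0 => a _; rewrite mulr_ge0 ?exprn_ge0 ?addr_ge0.
near=> n.
have [n1 k1 m1] : [/\ (1 <= n)%N, (1 <= k n)%N & (1 <= m n)%N] by near: n; exact: size_cvg.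
have mc : (m n)%:R / (n ^ k n)%N%:R <= c + 1.
  by near: n; apply: (cvgr_le c hc); rewrite ltrDl.
rewrite sum_canonical// big_seq [leRHS]big_seq; apply: ler_sum => a ain.
have [ap ca a0] := canonical_wordsP p0 ain.
under eq_bigr => u /eqP ua do rewrite -size_undup_canon ua.
rewrite -mulr_suml; apply: le_trans (ler_wpM2r _ (HB a (m n) ain)) _.
  by rewrite exprn_ge0// invr_ge0.
rewrite -mulrA ler_wpM2l// -exprMn.
apply: le_trans (_ : (c + 1) ^+ size (undup a) <= _).
  by rewrite lerXn2r// nnegrE ?addr_ge0// divr_ge0 ?ler0n.
rewrite ler_weXn2l ?lerDr//.
by rewrite -ap size_undup.
Unshelve. all: by end_near. Qed.

(** A pair of words with u letters in total has m^u labellings, so the covariance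
    is of order (C n)^k N^-2 = (C/n)^k, which is below n^-2 for k large. *)
Theorem variance_bound p : (0 < p)%N -> exists2 B : R, 0 <= B & \forall n \near \oo,
  `|\sum_(w : p.-tuple 'I_(m n)) \sum_(w' : p.-tuple 'I_(m n))
      word_weight n (k n) tau p w * word_weight n (k n) tau p w' *
        walk_pair_sum mu n p p w w' ^+ k n -
    (\sum_(w : p.-tuple 'I_(m n)) word_weight n (k n) tau p w * walk_sum mu n p w ^+ k n) ^+ 2|
  <= (B * (n%:R)^-1 ^+ 2 * ((n ^ k n)%N%:R) ^+ 2)%:C.
Proof.
move=> p0; have p20 : (0 < p + p)%N by rewrite addn_gt0 p0.
have [B B0 HB] := sum_abs_words_le p20.
pose K : R := (pair_constant p)%:R.
exists (2 * B * K ^+ 2); first by rewrite !mulr_ge0 ?exprn_ge0 ?ler0n.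
near=> n.
have [n1 k1 m1] : [/\ ((pair_constant p).+2 <= n)%N, ((pair_constant p).+2 <= k n)%N &
   ((pair_constant p).+2 <= m n)%N] by near: n; exact: size_cvg.
have n0 : (0 < n)%N by exact: leq_trans n1.
have nR : 0 < n%:R :> R by rewrite ltr0n.
have HBn : \sum_(u : (p + p).-tuple 'I_(m n)) `|\prod_(x <- u) tau x| *
    ((n ^ k n)%N%:R)^-1 ^+ size (undup u) <= B by near: n.
set t := fun w : seq 'I_(m n) => \prod_(x <- w) tau x.
have -> : \sum_(w : p.-tuple 'I_(m n)) \sum_(w' : p.-tuple 'I_(m n))
      word_weight n (k n) tau p w * word_weight n (k n) tau p w' *
        walk_pair_sum mu n p p w w' ^+ k n -
    (\sum_(w : p.-tuple 'I_(m n)) word_weight n (k n) tau p w * walk_sum mu n p w ^+ k n) ^+ 2 =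
  \sum_(w : p.-tuple 'I_(m n)) \sum_(w' : p.-tuple 'I_(m n)) (t (w ++ w'))%:C *
    (normalized_pair n p w w' ^+ k n -
     (normalized_walk n p w * normalized_walk n p w') ^+ k n).
  rewrite expr2 big_distrlr /= -sumrB; apply: eq_bigr => w _.
  rewrite -sumrB; apply: eq_bigr => w' _.
  rewrite /t big_cat /= rmorphM /word_weight /normalized_pair /normalized_walk !exprMn; ring.
apply: le_trans (_ : (\sum_(w : p.-tuple 'I_(m n)) \sum_(w' : p.-tuple 'I_(m n))
    `|t (w ++ w')| * (2 * (K * n%:R) ^+ k n * ((n ^ k n)%N%:R)^-1 ^+ size (undup (w ++ w'))))%:C <= _).
  rewrite rmorph_sum; apply: le_trans (ler_norm_sum _ _ _) _; apply: ler_sum => w _.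
  rewrite rmorph_sum; apply: le_trans (ler_norm_sum _ _ _) _; apply: ler_sum => w' _.
  rewrite normrM rmorphM; apply: ler_pM => //.
    by rewrite normc_def /= expr0n addr0 sqrtr_sqr.
  by apply: covariance_term_le; rewrite ?size_tuple.
rewrite lecR.
have -> : \sum_(w : p.-tuple 'I_(m n)) \sum_(w' : p.-tuple 'I_(m n))
    `|t (w ++ w')| * (2 * (K * n%:R) ^+ k n * ((n ^ k n)%N%:R)^-1 ^+ size (undup (w ++ w'))) =
  2 * (K * n%:R) ^+ k n * \sum_(u : (p + p).-tuple 'I_(m n))
     `|t u| * ((n ^ k n)%N%:R)^-1 ^+ size (undup u).
  rewrite (sum_tuple_cat p p (fun u : seq 'I_(m n) => `|t u| * ((n ^ k n)%N%:R)^-1 ^+ size (undup u))).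
  rewrite mulr_sumr; apply: eq_bigr => w _; rewrite mulr_sumr; apply: eq_bigr => w' _; ring.
apply: le_trans (_ : 2 * (K * n%:R) ^+ k n * B <= _).
  by rewrite ler_wpM2l ?mulr_ge0 ?exprn_ge0 ?mulr_ge0 ?ler0n.
have -> : (K * n%:R) ^+ k n = (K * n%:R^-1) ^+ k n * ((n ^ k n)%N%:R) ^+ 2 :> R.
  rewrite natrX -exprM mulnC exprM -exprMn; congr (_ ^+ _).
  by field; rewrite gt_eqF.
have q0 : 0 <= K * (n%:R)^-1 by rewrite mulr_ge0 ?ler0n// invr_ge0 ltW.
have q1 : K * (n%:R)^-1 <= 1.
  by rewrite ler_pdivrMr// mul1r ler_nat (leq_trans _ n1)// leqW.
have -> : 2 * B * K ^+ 2 * n%:R^-1 ^+ 2 * (n ^ k n)%N%:R ^+ 2 =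
   2 * ((K * n%:R^-1) ^+ 2 * (n ^ k n)%N%:R ^+ 2) * B :> R by rewrite exprMn; ring.
rewrite ler_wpM2r// ler_wpM2l// ler_wpM2r ?exprn_ge0 ?ler0n//.
by rewrite ler_wiXn2l// (leq_trans _ k1).
Unshelve. all: by end_near. Qed.

End moment_limits.

(** * The resolvent integral of a semicircle *)

Section resolvent_integral.
Context {R : realType}.
Local Notation leb := (@lebesgue_measure R).

Lemma FTC2_is_derive (f F : R -> R) (a b : R) : a < b ->
  {in `[a, b], continuous f} ->
  {in `[a, b], forall x : R, is_derive x 1 F (f x)} ->
  (\int[leb]_(x in `[a, b]) (f x)%:E = (F b)%:E - (F a)%:E)%E.
Proof.
move=> ab cf dF.
have cF (x : R) : x \in `[a, b] -> F z @[z --> x] --> F x.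
  move=> /dF dx; apply: differentiable_continuous; apply/derivable1_diffP.
  exact: ex_derive.
have sub (x : R) : x \in `]a, b[ -> x \in `[a, b].
  by rewrite !in_itv/= => /andP[/ltW -> /ltW ->].
apply: continuous_FTC2 => //.
- apply: continuous_in_subspaceT => x; rewrite inE/= => xab; exact: cf.
- split => [x /sub/dF dx||].
  + exact: ex_derive.
  + by apply: cvg_at_right_filter; apply: cF; rewrite in_itv/= lexx ltW.
  + by apply: cvg_at_left_filter; apply: cF; rewrite in_itv/= lexx ltW.
- by move=> x /sub/dF dx; rewrite derive1E derive_val.
Qed.

Lemma atan_inv (u v : R) : 0 < u -> u * v = 1 -> atan u + atan v = pi / 2.
Proof.
move=> u0 uv; have ul : atan u < pi / 2 := atan_ltpi2 u.
have u1 : 0 < atan u by rewrite -(atan0 R) lt_atan.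
have pi0 : 0 < pi :> R := pi_gt0 R.
have cu : cos (atan u) != 0.
  by rewrite gt_eqF// cos_gt0_pihalf//; apply/andP; split; lra.
have tu := atanK u.
have su : sin (atan u) != 0.
  by apply/eqP => s0; move: u0; rewrite -tu /tan s0 mul0r ltxx.
have -> : v = tan (pi / 2 - atan u).
  rewrite /tan sinB cosB sin_pihalf cos_pihalf !mul0r mul1r subr0 add0r mul1r.
  apply: (mulfI (_ : u != 0)); first by rewrite gt_eqF.
  by rewrite uv -{1}tu /tan; field; rewrite cu su.
rewrite tanK; first by rewrite addrC subrK.
by rewrite in_itv/=; apply/andP; split; lra.
Qed.

Section fixed.
Variables (m r s : R).
Hypotheses (r0 : 0 < r) (rm : r < m) (s0 : 0 < s) (sE : s ^+ 2 = m ^+ 2 - r ^+ 2).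

Lemma resolvent_den_gt0 (t : R) : 0 < m + r * sin t.
Proof. by have := sin_geN1 t; move: r0 rm; nra. Qed.

(** The primitive of m - r sin t - s^2 / (m + r sin t) for s^2 = m^2 - r^2, by
    the half-angle substitution. *)
Definition resolvent_primitive (t : R) : R :=
  m * t + r * cos t - 2 * s * atan ((m * tan (t / 2) + r) / s).

Lemma resolvent_primitiveP (t : R) : t \in `[(- (pi / 2)), (pi / 2)] ->
  is_derive t 1 resolvent_primitive (m - r * sin t - s ^+ 2 / (m + r * sin t)).
Proof.
rewrite in_itv/= => /andP[t1 t2]; have pi0 : 0 < pi :> R := pi_gt0 R.
have ct : cos (t / 2) != 0.
  by rewrite gt_eqF// cos_gt0_pihalf//; apply/andP; split; lra.
have dh : is_derive t 1 (fun x : R => x / 2) (1 / 2).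
  have -> : (fun x : R => x / 2) = (2^-1 *: (id : R -> R)).
    by apply/funext => x; rewrite mulrC.
  by apply: is_derive_eq; rewrite /GRing.scale /= mulr1 mul1r.
have dt : is_derive t 1 (fun x : R => tan (x / 2)) ((cos (t / 2)) ^- 2 * (1 / 2)).
  by apply: (@is_derive1_comp _ tan (fun x : R => x / 2)); exact: is_derive_tan.
have dy : is_derive t 1 (fun x : R => (m * tan (x / 2) + r) / s)
    (s^-1 * (m * ((cos (t / 2)) ^- 2 * (1 / 2)))).
  have -> : (fun x : R => (m * tan (x / 2) + r) / s) =
     s^-1 *: (m *: (fun x : R => tan (x / 2)) + cst r).
    by apply/funext => x; rewrite /= mulrC.
  by apply: is_derive_eq; rewrite addr0.
have da := @is_derive1_comp _ atan _ t _ _ (is_derive1_atan _) dy.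
have -> : resolvent_primitive = (m *: (id : R -> R) + r *: (cos : R -> R)) -
    (2 * s) *: (atan \o (fun x : R => (m * tan (x / 2) + r) / s)).
  by apply/funext => x; rewrite /resolvent_primitive.
move: da; set g := atan \o _; set y := _ * _ => da.
have D1 := is_deriveZ m (is_derive_id t (1 : R)).
have D2 := is_deriveZ r (is_derive_cos t).
have D3 := is_deriveB (is_deriveD D1 D2) (is_deriveZ (2 * s) da).
apply: (is_derive_eq D3).
rewrite -[m *: 1]/(m * 1) -[r *: - sin t]/(r * - sin t) -[(2 * s) *: y]/(2 * s * y).
rewrite mulr1 mulrN; congr (_ - _); rewrite /y {D3 D2 D1 da y g dy dt dh}.
have := resolvent_den_gt0 t; set h := t / 2.
have -> : t = h + h by rewrite /h; field.
rewrite sinD => D0.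
have c2 := cos2Dsin2 h; rewrite -/h in ct.
have E : 1 + ((m * tan h + r) / s) ^+ 2 = m * (m + r * (sin h * cos h + cos h * sin h)) / (s ^+ 2 * cos h ^+ 2).
  apply: (mulfI (_ : s ^+ 2 * cos h ^+ 2 != 0)); first by rewrite mulf_neq0 ?expf_neq0// gt_eqF.
  rewrite [RHS]mulrC mulfVK ?mulf_neq0 ?expf_neq0 ?(gt_eqF s0)//.
  have -> : s ^+ 2 * cos h ^+ 2 * (1 + ((m * tan h + r) / s) ^+ 2) =
     s ^+ 2 * cos h ^+ 2 + (m * sin h + r * cos h) ^+ 2.
    by rewrite /tan; field; rewrite (gt_eqF s0) ct.
  have e : sin h ^+ 2 = 1 - cos h ^+ 2 by rewrite -c2; ring.
  by rewrite sE; ring: e.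
have m0 : m != 0 by rewrite gt_eqF// (lt_trans r0).
rewrite E; field.
by rewrite m0 (gt_eqF s0) ct /= ?andbT; move: D0; rewrite lt_neqAle eq_sym => /andP[].
Qed.

(** The primitive is singular where tan (t/2) is, that is outside the interval. *)
Lemma resolvent_angle_integral :
  (\int[leb]_(t in `[(- (pi / 2))%R, (pi / 2)%R]) (m - r * sin t - s ^+ 2 / (m + r * sin t))%:E =
   (pi * (m - s))%:E)%E.
Proof.
have pi0 : 0 < pi :> R := pi_gt0 R.
rewrite (@FTC2_is_derive _ resolvent_primitive).
- rewrite -EFinB /resolvent_primitive; congr (_%:E).
  have p4 : pi / 2 / 2 = pi / 4 :> R by field.
  rewrite mulNr tanN cosN p4 tan_piquarter cos_pihalf mulrN1 !mulr1.
  (* the two tangents are inverse to each other as s^2 = m^2 - r^2 *)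
  have : atan ((m + r) / s) + atan ((m - r) / s) = pi / 2.
    apply: atan_inv; first by rewrite divr_gt0//; move: r0 rm; lra.
    have -> : (m + r) / s * ((m - r) / s) = (m ^+ 2 - r ^+ 2) / s ^+ 2.
      by field; rewrite gt_eqF.
    by rewrite -sE divff// expf_neq0// gt_eqF.
  have -> : (- m + r) / s = - ((m - r) / s) by field; rewrite gt_eqF.
  by rewrite atanN => h; nra.
- by lra.
- move=> t _; apply: cvgB.
    by apply: cvgB; [exact: cvg_cst|apply: cvgM; [exact: cvg_cst|exact: continuous_sin]].
  apply: cvgM; first exact: cvg_cst.
  apply: cvgV; first by rewrite gt_eqF// resolvent_den_gt0.
  by apply: cvgD; [exact: cvg_cst|apply: cvgM; [exact: cvg_cst|exact: continuous_sin]].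
- exact: resolvent_primitiveP.
Qed.

End fixed.

(** The substitution x = q + r sin t, with m = q + e: the numerator becomes
    r^2 cos^2 t, and division by m + r sin t leaves the previous integrand. *)
Lemma semicircle_resolvent (q r e : R) : 0 < r -> 0 < e -> r <= q ->
  (\int[leb]_(x in `[(q - r)%R, (q + r)%R])
     (Num.sqrt ((q + r - x) * (x - (q - r))) / (x + e))%:E =
  (pi * (q + e - Num.sqrt ((q + e) ^+ 2 - r ^+ 2)))%:E)%E.
Proof.
move=> r0 e0 rq; have pi0 : 0 < pi :> R := pi_gt0 R.
set m := q + e; have rm : r < m by rewrite /m; lra.
set s := Num.sqrt _.
have d0 : 0 < m ^+ 2 - r ^+ 2 by nra.
have s0 : 0 < s by rewrite sqrtr_gt0.
have sE : s ^+ 2 = m ^+ 2 - r ^+ 2 by rewrite sqr_sqrtr// ltW.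
rewrite -(resolvent_angle_integral r0 rm s0 sE).
pose F (t : R) : R := q + r * sin t.
have dF (t : R) : is_derive t 1 F (r * cos t).
  have -> : F = cst q + r *: (sin : R -> R) by apply/funext => u.
  apply: (is_derive_eq (is_deriveD (is_derive_cst q t (1 : R)) (is_deriveZ r (is_derive_sin t)))).
  by rewrite add0r.
have F'E : derive1 F = fun t => r * cos t.
  by apply/funext => t; rewrite derive1E derive_val.
have cF (t : R) : F z @[z --> t] --> F t.
  by apply: differentiable_continuous; apply/derivable1_diffP; exact: ex_derive.
have cF' (t : R) : derive1 F z @[z --> t] --> derive1 F t.
  by rewrite F'E; apply: cvgM; [exact: cvg_cst|exact: continuous_cos].
have Fl : F (- (pi / 2)) = q - r by rewrite /F sinN sin_pihalf; ring.
have Fr : F (pi / 2) = q + r by rewrite /F sin_pihalf mulr1.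
rewrite -Fl -Fr (@integration_by_substitution_increasing _ F).
- apply: eq_integral => t; rewrite inE/= => tI; congr (_%:E).
  rewrite F'E Fl Fr /= /F.
  transitivity (Num.sqrt ((q + r - (q + r * sin t)) * (q + r * sin t - (q - r))) /
    (q + r * sin t + e) * (r * cos t)); first by [].
  have ct : 0 <= cos t by apply: cos_ge0_pihalf; move: tI; rewrite in_itv.
  have -> : (q + r - (q + r * sin t)) * (q + r * sin t - (q - r)) = (r * cos t) ^+ 2.
    by rewrite exprMn cos2sin2; ring.
  rewrite sqrtr_sqr ger0_norm ?mulr_ge0 ?(ltW r0)//.
  have D0 := resolvent_den_gt0 r0 rm t.
  have -> : q + r * sin t + e = m + r * sin t by rewrite /m; ring.
  rewrite sE; have -> : r * cos t / (m + r * sin t) * (r * cos t) =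
     (r ^+ 2 * cos t ^+ 2) / (m + r * sin t) by ring.
  by rewrite cos2sin2; field; rewrite gt_eqF.
- by lra.
- by move=> x y xI yI xy; rewrite /F ltrD2l ltr_pM2l// ltr_sin.
- by move=> t _; exact: cF'.
- by apply/cvg_ex; eexists; apply: cvg_at_right_filter; exact: cF'.
- by apply/cvg_ex; eexists; apply: cvg_at_left_filter; exact: cF'.
- split; [by move=> t _; exact: ex_derive| |].
    by apply: cvg_at_right_filter; exact: cF.
  by apply: cvg_at_left_filter; exact: cF.
- apply: continuous_in_subspaceT => x; rewrite Fl Fr inE/= in_itv/= => /andP[x1 x2].
  apply: cvgM.
    apply: (@continuous_comp _ _ _ (fun x : R => (q + r - x) * (x - (q - r))) Num.sqrt).
      by apply: cvgM; apply: cvgB; (exact: cvg_cst || exact: cvg_id).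
    exact: sqrt_continuous.
  apply: cvgV; first by rewrite gt_eqF//; lra.
  by apply: cvgD; [exact: cvg_id|exact: cvg_cst].
Qed.

End resolvent_integral.

(** * Integration against a density *)

Section densities.
Context {d : measure_display} {T : measurableType d} {R : realType}.
Variables (la nu : {measure set T -> \bar R}) (g : T -> R).
Hypothesis g0 : forall x, 0 <= g x.
Hypothesis mg : measurable_fun [set: T] g.
Hypothesis nuE : forall A, measurable A -> nu A = (\int[la]_(x in A) (g x)%:E)%E.

Let density_indic E : measurable E ->
  (\int[nu]_x (\1_E x)%:E = \int[la]_x ((\1_E x)%:E * (g x)%:E))%E.
Proof.
move=> mE; rewrite integral_indic//= setIT nuE// [LHS]integral_mkcond/=.
apply: eq_integral => x _; rewrite patchE indicE; case: ifPn => xE.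
  by rewrite mul1e.
by rewrite mul0e.
Qed.

Import HBNNSimple.

Let density_nnsfun (f : {nnsfun T >-> R}) :
  (\int[nu]_x (f x)%:E = \int[la]_x ((f x)%:E * (g x)%:E))%E.
Proof.
have mgE : measurable_fun [set: T] (EFin \o g) by exact/measurable_EFinP.
under [LHS]eq_integral do rewrite fimfunE -fsumEFin//.
rewrite [LHS]ge0_integral_fsum//; last 2 first.
  - by move=> r; exact/measurable_EFinP/measurableT_comp.
  - by move=> n x _; rewrite EFinM nnfun_muleindic_ge0.
under [RHS]eq_integral.
  move=> x xD; rewrite fimfunE -fsumEFin// muleC ge0_mule_fsumr; last first.
    by move=> r; rewrite EFinM nnfun_muleindic_ge0.
  over.
rewrite [RHS]ge0_integral_fsum//; last 2 first.
  - move=> r; apply: emeasurable_funM => //.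
    by apply/measurable_EFinP; do 2 apply/measurableT_comp => //.
  - move=> n x _; rewrite EFinM mule_ge0//; last by rewrite nnfun_muleindic_ge0.
    by rewrite lee_fin.
apply: eq_fsbigr => r _.
under [RHS]eq_integral do rewrite EFinM muleCA.
rewrite integralZl_indic_nnsfun//= density_indic//.
have [r0|r0] := leP 0 r.
  rewrite -ge0_integralZl//.
  - by apply: eq_integral => x _; rewrite [in RHS](muleC (g x)%:E).
  - apply: emeasurable_funM => //; apply/measurable_EFinP; exact: measurable_indic.
  - by move=> x _; rewrite mule_ge0// lee_fin.
rewrite preimage_nnfun0//.
under eq_integral do rewrite indic0 /= mul0e.
under [RHS]eq_integral do rewrite indic0 /= mule0 mule0.
by rewrite !integral0 mule0.
Qed.

(** Indicators, simple functions and monotone limits. *)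
Lemma integral_density (f : T -> \bar R) : measurable_fun [set: T] f -> (forall x, 0 <= f x)%E ->
  (\int[nu]_x f x = \int[la]_x (f x * (g x)%:E))%E.
Proof.
move=> mf f0; pose f_ := nnsfun_approx measurableT mf.
have mgE : measurable_fun [set: T] (EFin \o g) by exact/measurable_EFinP.
transitivity (lim (\int[nu]_x (f_ n x)%:E @[n --> \oo])%E).
  rewrite -monotone_convergence//=.
  - apply: eq_integral => ? /[!inE] xD; apply/esym/cvg_lim => //=.
    exact: cvg_nnsfun_approx.
  - by move=> n; exact/measurable_EFinP/measurable_funTS.
  - by move=> n ? _; rewrite lee_fin.
  - by move=> ? _ ? ? mn; rewrite lee_fin; exact/lefP/nd_nnsfun_approx.
rewrite [RHS](_ : _ = lim (\int[la]_x ((f_ n x)%:E * (g x)%:E) @[n --> \oo])%E); last first.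
  rewrite -monotone_convergence//=.
  - apply: eq_integral => x /[!inE] xD; apply/esym/cvg_lim => //.
    apply: cvgeZr => //; exact: cvg_nnsfun_approx.
  - by move=> n; apply: emeasurable_funM => //; exact/measurable_EFinP/measurable_funTS.
  - by move=> n ? _; rewrite mule_ge0// lee_fin.
  - move=> x _ ? ? ?; rewrite lee_wpmul2r ?lee_fin//; exact/lefP/nd_nnsfun_approx.
by apply: congr_lim; apply/funext => n /=; exact: density_nnsfun.
Qed.

End densities.

(** * Uniqueness of asymptotic expansions *)

Section asymptotic_expansion.
Context {R : realType}.

(** The lowest nonzero coefficient would dominate near 0. *)
Lemma poly_vanishing (Q : {poly R}) (C : R) n :
  (forall z : R, 0 < z -> z <= 1 -> `|Q.[z]| <= C * z ^+ n) ->
  forall i, (i < n)%N -> Q`_i = 0.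
Proof.
elim: n Q => [//|n IH] Q HQ.
have C0 : 0 <= C by have := HQ 1 ltr01 (lexx 1); rewrite expr1n mulr1; exact: le_trans.
have [P [t E]] : exists P t, Q = P * 'X + t%:P.
  elim/poly_ind: Q {HQ} => [|p t _]; last by exists p, t.
  by exists 0, 0; rewrite mul0r addr0.
have t0 : t = 0.
  have : Q.[z] @[z --> (0 : R)^'+] --> Q.[0].
    by apply: cvg_at_right_filter; exact: continuous_horner.
  have Q0 : Q.[z] @[z --> (0 : R)^'+] --> (0 : R).
    apply/cvgrPdist_le => e e0; near=> z.
    have z0 : 0 < z by near: z; exact: nbhs_right_gt.
    have z1 : z <= 1 by near: z; exact: nbhs_right_le.
    have ze : z <= e / (C + 1) by near: z; apply: nbhs_right_le; rewrite divr_gt0// ltr_wpDl.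
    rewrite sub0r normrN (le_trans (HQ z z0 z1))// exprS mulrCA.
    apply: le_trans (_ : z * C <= _).
      by rewrite ler_wpM2l ?(ltW z0)// ler_piMr// exprn_ile1// ltW.
    apply: le_trans (ler_wpM2r C0 ze) _.
    rewrite mulrAC ler_pdivrMr ?ltr_wpDl// ler_wpM2l ?(ltW e0)//.
    by rewrite lerDl.
  move=> Qc; have := cvg_unique _ Qc Q0; rewrite E !hornerE => <-//; ring.
have EX : Q = P * 'X by rewrite E t0 addr0.
move=> [|i] iln; first by rewrite EX coefMX.
rewrite EX coefMX /=; apply: (IH P) iln => z z0 z1.
have := HQ z z0 z1; rewrite EX hornerMX normrM (gtr0_norm z0) exprSr mulrA.
by rewrite ler_pM2r.
Unshelve. all: by end_near. Qed.

(** Insert the expansion in the equation: the truncation satisfies it up to order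
    z^n, so its low coefficients obey the recursion of narayanaS. *)
Lemma expansion_unique (c : R) (a : nat -> R) (g : R -> R) :
  (forall n z, 0 < z -> `|g z - \sum_(q < n) a q * (- z) ^+ q| <= a n * z ^+ n) ->
  (forall z, 0 < z -> g z = c - (1 + c) * z * g z + z ^+ 2 * g z ^+ 2) ->
  forall n, a n = narayana c n.+1.
Proof.
move=> ga geq; pose b q : R := a q * (-1) ^+ q.
pose P n : {poly R} := \poly_(q < n) b q.
have PE n z : (P n).[z] = \sum_(q < n) a q * (- z) ^+ q.
  by rewrite horner_poly; apply: eq_bigr => q _; rewrite /b (exprNn z) mulrA.
have a0 n : 0 <= a n.
  have := ga n 1 ltr01; rewrite expr1n mulr1; exact: le_trans.
have rec n : (P n.+1 - c%:P + (1 + c) *: (P n * 'X) - P n ^+ 2 * 'X^2)`_n = 0.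
  pose C := a n.+1 + `|1 + c| * a n + a n * (2 * a 0%N + a n).
  apply: (@poly_vanishing _ C n.+1) => // z z0 z1.
  have zn k : 0 <= z ^+ k by rewrite exprn_ge0// ltW.
  rewrite !(hornerD, hornerN) hornerC hornerZ hornerMX hornerM hornerXn horner_exp PE; set S := \sum_(q < n.+1) _; set p := (P n).[z].
  have h1 : `|g z - S| <= a n.+1 * z ^+ n.+1 := ga n.+1 z z0.
  have h2 : `|g z - p| <= a n * z ^+ n by rewrite /p PE; exact: ga.
  have g0 : `|g z| <= a 0%N.
    by have := ga 0%N z z0; rewrite big_ord0 subr0 expr0 mulr1.
  have p0 : `|p| <= a 0%N + a n.
    rewrite -(subrK (g z) p) (le_trans (ler_normD _ _))// addrC lerD// distrC.
    by rewrite (le_trans h2)// ler_piMr// exprn_ile1// ltW.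
  have -> : S - c + (1 + c) * (p * z) - p ^+ 2 * z ^+ 2 =
     - (g z - S) - (1 + c) * ((g z - p) * z) + (g z - p) * (g z + p) * z ^+ 2.
    rewrite {1}(geq z z0); ring.
  rewrite [leRHS](_ : _ = a n.+1 * z ^+ n.+1 + `|1 + c| * a n * z ^+ n.+1 +
    a n * (2 * a 0%N + a n) * z ^+ n.+1); last by rewrite /C; ring.
  apply: le_trans (ler_normD _ _) _; apply: lerD.
    apply: le_trans (ler_normB _ _) _; rewrite normrN; apply: lerD => //.
    rewrite !normrM (gtr0_norm z0) -mulrA ler_wpM2l// exprSr mulrA.
    by rewrite ler_wpM2r// ltW.
  rewrite normrM normrM (ger0_norm (zn 2%N)) mulrAC.
  have gp : `|g z + p| <= 2 * a 0%N + a n.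
    apply: le_trans (ler_normD _ _) _; move: g0 p0; lra.
  have -> : z ^+ 2 = z * z by rewrite expr2.
  apply: le_trans (_ : a n * z ^+ n * (z * 1) * (2 * a 0%N + a n) <= _).
    apply: ler_pM => //; first by rewrite mulr_ge0// mulr_ge0// ltW.
    apply: ler_pM => //; first by rewrite mulr_ge0// ltW.
    by rewrite ler_wpM2l// ltW.
  by rewrite le_eqVlt exprSr; apply/orP; left; apply/eqP; ring.
have Pcoef n i : (P n)`_i = if (i < n)%N then b i else 0 by rewrite coef_poly.
have aS n : a n.+1 = (1 + c) * a n + \sum_(i < n) a i * a (n.-1 - i)%N.
  have := rec n.+1; rewrite !(coefD, coefN) coefZ coefMX coefMXn !coefC /= !Pcoef !ltnS !leqnn subr0.
  have -> : (if (n.+1 < 2)%N then 0 else (P n.+1 ^+ 2)`_(n.+1 - 2)) = \sum_(i < n) b i * b (n.-1 - i)%N.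
    case: n => [|n]; first by rewrite big_ord0.
    rewrite /= expr2 coefM subSS subSS subn0; apply: eq_bigr => i _.
    by rewrite !Pcoef !ltnS (leq_trans (ltnSE (ltn_ord i)))// (leq_trans (leq_subr _ _)).
  have -> : \sum_(i < n) b i * b (n.-1 - i)%N = (-1) ^+ n.+1 * \sum_(i < n) a i * a (n.-1 - i)%N.
    rewrite mulr_sumr; apply: eq_bigr => i _; rewrite /b mulrACA mulrC -exprD.
    rewrite subnKC; last by case: (n) i => [[]//|k i]; rewrite /= -ltnS.
    case: (n) i => [[]//|k i] /=; by rewrite !exprS; ring.
  rewrite /b !exprS => /eqP; rewrite (_ : _ - _ = (-1) * (-1) ^+ n *
    (a n.+1 - ((1 + c) * a n + \sum_(i < n) a i * a (n.-1 - i)%N))); last by ring.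
  by rewrite mulf_eq0 mulf_eq0 oppr_eq0 oner_eq0 signr_eq0 /= subr_eq0 => /eqP.
have a00 : a 0%N = c.
  have := rec 0%N; rewrite !(coefD, coefN) coefZ coefMX coefMXn !coefC /= Pcoef /= /b expr0 mulr1.
  by rewrite mulr0 addr0 subr0 => /eqP; rewrite subr_eq0 => /eqP.
move=> n; elim/ltn_ind: n => -[|n] IH.
  by rewrite a00 narayanaS narayana0 mulr1 big_ord0 addr0.
rewrite aS narayanaS big_ord_recl narayana0 mul1r subn0 (IH n)// mulrDl mul1r.
rewrite [in RHS]addrA [_ + c * _]addrC; congr (_ + _); apply: eq_bigr => i _.
rewrite lift0 subSS; have iln := ltn_ord i.
rewrite (IH i); last by rewrite ltnS ltnW.
rewrite (IH (n.-1 - i)%N); last by lia.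
by congr (_ * narayana c _); lia.
Qed.

End asymptotic_expansion.

(** * The Stieltjes transform of the Marchenko-Pastur law *)

Lemma measurable_fun_invr (R : realType) : measurable_fun [set: R] (fun x : R => x^-1).
Proof.
rewrite -(setUv [set (0 : R)]); apply/measurable_funU => //; first exact: measurableC.
split; first exact: measurable_fun_set1.
apply: open_continuous_measurable_fun; first exact/closed_openC/closed_eq.
by move=> x; rewrite inE/= => /eqP x0; exact: inv_continuous.
Qed.

Section marchenko_pastur_law.
Context {R : realType}.
Variable c : R.
Hypothesis c0 : 0 < c.
Local Notation leb := (@lebesgue_measure R).
Local Notation mp := (marchenko_pastur c).

Let sc2 : Num.sqrt c ^+ 2 = c. Proof. by rewrite sqr_sqrtr// ltW. Qed.
Let sc0 : 0 < Num.sqrt c. Proof. by rewrite sqrtr_gt0. Qed.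

Lemma mp_leftE : mp_left c = 1 + c - 2 * Num.sqrt c.
Proof. by rewrite /mp_left -{2}sc2; ring. Qed.

Lemma mp_rightE : mp_right c = 1 + c + 2 * Num.sqrt c.
Proof. by rewrite /mp_right -{2}sc2; ring. Qed.

Lemma mp_left_ge0 : 0 <= mp_left c. Proof. exact: sqr_ge0. Qed.

Lemma mp_right_ge1 : 1 <= mp_right c.
Proof. by rewrite mp_rightE; have := sc0; have := c0; lra. Qed.

Lemma mp_pdf_in x : mp_left c <= x <= mp_right c ->
  mp_pdf c x = Num.sqrt ((mp_right c - x) * (x - mp_left c)) / (2 * pi * x).
Proof. by move=> h; rewrite /mp_pdf indicE mem_setE in_itv/= h mulr1. Qed.

Lemma mp_pdf_out x : ~~ (mp_left c <= x <= mp_right c) -> mp_pdf c x = 0.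
Proof. by move=> h; rewrite /mp_pdf indicE mem_setE in_itv/= (negbTE h) mulr0. Qed.

Lemma mp_pdf_nonneg x : 0 <= mp_pdf c x.
Proof.
have [h|h] := boolP (mp_left c <= x <= mp_right c); last by rewrite mp_pdf_out.
rewrite mp_pdf_in// divr_ge0 ?sqrtr_ge0// !mulr_ge0 ?pi_ge0//.
by case/andP: h => h _; exact: le_trans mp_left_ge0 h.
Qed.

Lemma mp_pdf_neg x : x <= 0 -> mp_pdf c x = 0.
Proof.
move=> x0; have [h|h] := boolP (mp_left c <= x <= mp_right c); last by rewrite mp_pdf_out.
have xE : x = 0 by apply/eqP; rewrite eq_le x0 /= (le_trans mp_left_ge0)//; case/andP: h.
by rewrite mp_pdf_in// xE mulr0 invr0 mulr0.
Qed.

Lemma measurable_mp_density : measurable_fun [set: measurableTypeR R] (mp_pdf c : measurableTypeR R -> R).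
Proof.
apply: measurable_funM; last exact: measurable_indic.
apply: measurable_funM.
  apply: continuous_measurable_fun => x.
  apply: (@continuous_comp _ _ _ (fun x : R => (mp_right c - x) * (x - mp_left c)) Num.sqrt).
    by apply: cvgM; apply: cvgB; (exact: cvg_cst || exact: cvg_id).
  exact: sqrt_continuous.
apply: (@measurableT_comp _ _ _ _ _ _ (fun x : R => x^-1)) => //.
exact: measurable_fun_invr.
Qed.

Lemma mp_integral (f : measurableTypeR R -> \bar R) : measurable_fun setT f ->
  (forall x, 0 <= f x)%E ->
  (\int[mp]_x f x = \int[leb]_x (f x * (mp_pdf c x)%:E) + (mp_atom c)%:E * f 0%R)%E.
Proof.
move=> mf f0; rewrite /marchenko_pastur ge0_integral_measure_add//; congr (_ + _)%E.
  apply: integral_density => //; first exact: mp_pdf_nonneg.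
  exact: measurable_mp_density.
by rewrite ge0_integral_mscale// integral_dirac// diracT mul1e.
Qed.

(** The value at e of the integral of x / (x + e), in closed form; the constant
    2 sqrt c is half the length of the support. *)
Definition mp_stieltjes (e : R) : R :=
  (1 + c + e - Num.sqrt ((1 + c + e) ^+ 2 - (2 * Num.sqrt c) ^+ 2)) / 2.

(** The function x/(x + e) on the half-line that carries the law, extended by 0
    to be bounded and continuous. *)
Definition fraction_pos (e x : R) : R := Num.max x 0 / (Num.max x 0 + e).

Lemma fraction_pos_continuous e : 0 < e -> continuous (fraction_pos e).
Proof.
move=> e0 x; have cm : continuous (fun x : R => Num.max x 0).
  by move=> y; apply: (@continuous_max _ _ (fun y : R => y) (fun=> 0)); [exact: cvg_id|exact: cst_continuous].
apply: cvgM; first exact: cm.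
apply: cvgV; first by rewrite gt_eqF// ltr_wpDl// le_max lexx orbT.
by apply: cvgD; [exact: cm|exact: cvg_cst].
Qed.

Lemma fraction_pos01 e x : 0 < e -> 0 <= fraction_pos e x <= 1.
Proof.
move=> e0; have x0 : 0 <= Num.max x 0 by rewrite le_max lexx orbT.
have d0 : 0 < Num.max x 0 + e by rewrite ltr_wpDl.
by rewrite /fraction_pos divr_ge0 ?(ltW d0)//= ler_pdivrMr// mul1r lerDl ltW.
Qed.

Lemma mp_integral_fraction e : 0 < e ->
  (\int[mp]_x (fraction_pos e x)%:E = (mp_stieltjes e)%:E)%E.
Proof.
move=> e0; rewrite mp_integral; last 2 first.
- apply/measurable_EFinP; apply: continuous_measurable_fun; exact: fraction_pos_continuous.
- by move=> x; rewrite lee_fin; case/andP: (fraction_pos01 x e0).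
have -> : fraction_pos e 0 = 0 by rewrite /fraction_pos maxxx mul0r.
rewrite mule0 adde0.
have pi0 : 0 < pi :> R := pi_gt0 R.
have rq : 2 * Num.sqrt c <= 1 + c.
  by have := mp_left_ge0; rewrite mp_leftE subr_ge0.
have r0 : 0 < 2 * Num.sqrt c by rewrite mulr_gt0.
have S := semicircle_resolvent r0 e0 rq.
transitivity (((2 * pi)^-1)%:E * (pi * (1 + c + e - Num.sqrt ((1 + c + e) ^+ 2 - (2 * Num.sqrt c) ^+ 2)))%:E)%E; last first.
  by rewrite -EFinM /mp_stieltjes; congr (_%:E); rewrite invfM mulrA -(mulrA 2^-1) mulVf ?gt_eqF// mulr1 mulrC.
rewrite -S -mp_leftE -mp_rightE -ge0_integralZl//; last 3 first.
- apply/measurable_EFinP; apply: measurable_funTS; apply: measurable_funM.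
    apply: continuous_measurable_fun => x.
    apply: (@continuous_comp _ _ _ (fun x : R => (mp_right c - x) * (x - mp_left c)) Num.sqrt).
      by apply: cvgM; apply: cvgB; (exact: cvg_cst || exact: cvg_id).
    exact: sqrt_continuous.
  apply: (@measurableT_comp _ _ _ _ _ _ (fun x : R => x^-1)) => //.
    exact: measurable_fun_invr.
  exact: measurable_funD.
- move=> x /=; rewrite in_itv/= => /andP[x1 _]; rewrite lee_fin divr_ge0 ?sqrtr_ge0//.
  by rewrite addr_ge0 ?(ltW e0)// (le_trans mp_left_ge0).
- by rewrite lee_fin invr_ge0 mulr_ge0// ltW.
rewrite [RHS]integral_mkcond/=; apply: eq_integral => x _; rewrite patchE mem_setE in_itv/=.
case: ifPn => [h|h]; last by rewrite mp_pdf_out// mule0.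
rewrite -!EFinM; congr (_%:E); rewrite mp_pdf_in// /fraction_pos.
have x0 : 0 <= x by case/andP: h => h _; exact: le_trans mp_left_ge0 h.
rewrite max_l//; have [xE|xn] := eqVneq x 0.
  have lE : mp_left c = 0.
    by apply/eqP; rewrite eq_le mp_left_ge0 andbT; case/andP: h; rewrite xE.
  by rewrite xE lE subrr mulr0 sqrtr0 !mul0r mulr0.
rewrite !invfM; set w := Num.sqrt _; set p1 := pi^-1.
have xe : x + e != 0 by rewrite gt_eqF// ltr_wpDl.
by field; rewrite xn xe.
Qed.

End marchenko_pastur_law.

(** * Mass and moments of the Marchenko-Pastur law *)

Section marchenko_pastur_moments.
Context {R : realType}.
Variable c : R.
Hypothesis c0 : 0 < c.
Local Notation mp := (marchenko_pastur c).

Let sc2 : Num.sqrt c ^+ 2 = c. Proof. by rewrite sqr_sqrtr// ltW. Qed.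

Lemma mp_nonpositive : mp `]-oo, 0%R]%classic = (mp_atom c)%:E.
Proof.
have mI : measurable (`]-oo, 0%R]%classic : set (measurableTypeR R)) by exact: measurable_itv.
transitivity (\int[mp]_x (\1_(`]-oo, 0%R] : set R) x)%:E)%E.
  by rewrite integral_indic//= setIT.
rewrite mp_integral; last 2 first.
- by apply/measurable_EFinP; exact: measurable_indic.
- by move=> x; rewrite lee_fin.
rewrite indicE mem_setE in_itv/= lexx mule1 integral0_eq ?add0e// => x _.
rewrite indicE mem_setE in_itv/=; have [x0|x0] := leP x 0.
  by rewrite mp_pdf_neg// mule0.
by rewrite mul0e.
Qed.

Lemma mp_stieltjes_cvg : mp_stieltjes c n.+1%:R^-1 @[n --> \oo] --> (1 + c - `|1 - c|) / 2.
Proof.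
have h : (n.+1%:R^-1 : R) @[n --> \oo] --> (0 : R) by exact: cvg_harmonic.
have cs : Num.sqrt ((1 + c + n.+1%:R^-1) ^+ 2 - (2 * Num.sqrt c) ^+ 2) @[n --> \oo] --> `|1 - c|.
  have -> : `|1 - c| = Num.sqrt ((1 + c + 0) ^+ 2 - (2 * Num.sqrt c) ^+ 2).
    rewrite -sqrtr_sqr; congr Num.sqrt; rewrite exprMn sc2; ring.
  apply: (@cvg_comp _ _ _ (fun n : nat => (1 + c + n.+1%:R^-1) ^+ 2 - (2 * Num.sqrt c) ^+ 2 : R)
    Num.sqrt _ _ _ _ (@sqrt_continuous R _)).
  apply: cvgB; last exact: cvg_cst.
  by apply: cvg_expr; apply: cvgD; [exact: cvg_cst|exact: h].
apply: cvgM; last exact: cvg_cst.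
rewrite -[X in X - _]addr0; apply: cvgB; last exact: cs.
by apply: cvgD; [exact: cvg_cst|exact: h].
Qed.

(** The functions x/(x + e) increase to the indicator of x > 0 as e decreases
    to 0. *)
Lemma mp_positive : mp `]0%R, +oo[%classic = ((1 + c - `|1 - c|) / 2)%:E.
Proof.
have mI : measurable (`]0%R, +oo[%classic : set (measurableTypeR R)) by exact: measurable_itv.
transitivity (\int[mp]_x (\1_(`]0%R, +oo[ : set R) x)%:E)%E.
  by rewrite integral_indic//= setIT.
pose g (n : nat) (x : measurableTypeR R) : \bar R := (fraction_pos n.+1%:R^-1 x)%:E.
have ge0 n : 0 < (n.+1%:R^-1 : R) by rewrite invr_gt0 ltr0n.
have mg n : measurable_fun [set: measurableTypeR R] (g n).
  by apply/measurable_EFinP; apply: continuous_measurable_fun; exact: fraction_pos_continuous.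
have g0 n x : [set: measurableTypeR R] x -> (0 <= g n x)%E.
  by move=> _; rewrite lee_fin; case/andP: (fraction_pos01 x (ge0 n)).
have gh x : [set: measurableTypeR R] x -> {homo g^~ x : n m / (n <= m)%N >-> (n <= m)%E}.
  move=> _ n m nm; rewrite lee_fin /fraction_pos.
  have x0 : 0 <= Num.max (x : R) 0 by rewrite le_max lexx orbT.
  apply: ler_wpM2l => //; rewrite lef_pV2 ?posrE ?ltr_wpDl//.
  by rewrite lerD2l lef_pV2 ?posrE ?ltr0n// ler_nat ltnS.
have cv := @cvg_monotone_convergence _ (measurableTypeR R) R mp setT measurableT g mg g0 gh.
have gl (x : measurableTypeR R) : limn (g^~ x) = (\1_(`]0%R, +oo[ : set R) x)%:E.
  apply/cvg_lim => //; rewrite indicE mem_setE in_itv/= andbT.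
  apply/fine_cvgP; split; first exact: nearW.
  have [x0|x0] := ltP 0 (x : R); last first.
    by apply: cvg_near_cst; apply: nearW => n; rewrite /= /fraction_pos max_r// mul0r.
  have -> : fine \o g^~ x = (fun n => (x : R) / ((x : R) + n.+1%:R^-1)).
    by apply/funext => n; rewrite /= /fraction_pos max_l// ltW.
  have -> : 1%:R = (x : R) / ((x : R) + 0) by rewrite addr0 divff// gt_eqF.
  apply: cvgM; first exact: cvg_cst.
  apply: cvgV; first by rewrite addr0 gt_eqF.
  by apply: cvgD; [exact: cvg_cst|exact: cvg_harmonic].
have cv2 : (\int[mp]_x g n x)%E @[n --> \oo] --> ((1 + c - `|1 - c|) / 2)%:E.
  under eq_fun do rewrite (mp_integral_fraction c0)//.
  by apply/fine_cvgP; split; [exact: nearW|exact: mp_stieltjes_cvg].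
rewrite -(cvg_unique _ cv cv2)//; apply: eq_integral => x _.
by rewrite gl.
Qed.

(** The atom at 0 completes the mass (1 + c - |1 - c|)/2 = min(1, c) of the
    absolutely continuous part. *)
Lemma mp_mass : mp [set: measurableTypeR R] = 1%E.
Proof.
have -> : [set: measurableTypeR R] = (`]-oo, 0%R] : set R) `|` (`]0%R, +oo[ : set R).
  apply/seteqP; split => x _ //=; rewrite !in_itv/= andbT.
  by have [h|h] := leP (x : R) 0; [left|right].
rewrite measureU//; last first.
  apply/seteqP; split => x //= []; rewrite !in_itv/= andbT => h1 h2.
  by move: (le_lt_trans h1 h2); rewrite ltxx.
transitivity ((mp_atom c)%:E + ((1 + c - `|1 - c|) / 2)%:E)%E.
  by congr (_ + _)%E; [exact: mp_nonpositive|exact: mp_positive].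
rewrite -EFinD; congr (_%:E).
rewrite /mp_atom c0 /=; have [c1|c1] := ltP c 1.
  by rewrite ger0_norm ?subr_ge0 ?(ltW c1)//; field.
by rewrite ler0_norm ?subr_le0//; field.
Qed.

Lemma mp_power_le p : (\int[mp]_x `|(x : R) ^+ p|%:E <= (mp_right c ^+ p)%:E)%E.
Proof.
have b0 : 0 <= mp_right c := le_trans ler01 (mp_right_ge1 c0).
apply: le_trans (_ : (\int[mp]_x (mp_right c ^+ p)%:E <= _)%E); last first.
  by rewrite integral_cst// mp_mass mule1.
have mf : measurable_fun [set: measurableTypeR R] (fun x => (`|(x : R) ^+ p|)%:E).
  apply/measurable_EFinP; apply: continuous_measurable_fun => x.
  apply: (@continuous_comp _ _ _ (fun x : R => x ^+ p) Num.norm); first exact: exprn_continuous.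
  exact: norm_continuous.
rewrite !mp_integral//; last by move=> _; rewrite lee_fin exprn_ge0.
apply: leeD.
  apply: ge0_le_integral => //.
  - by move=> x _; rewrite -EFinM lee_fin mulr_ge0// mp_pdf_nonneg.
  - apply: emeasurable_funM => //; apply/measurable_EFinP; exact: measurable_mp_density.
  - apply: emeasurable_funM => //; apply/measurable_EFinP; exact: measurable_mp_density.
  - move=> x _; rewrite -!EFinM lee_fin.
    have [h|h] := boolP (mp_left c <= (x : R) <= mp_right c); last by rewrite mp_pdf_out// !mulr0.
    apply: ler_wpM2r; first exact: mp_pdf_nonneg.
    case/andP: h => h1 h2; have x0 : 0 <= (x : R) := le_trans (mp_left_ge0 c) h1.
    by rewrite ger0_norm ?exprn_ge0// lerXn2r// nnegrE.
rewrite -!EFinM lee_fin ler_wpM2l ?mp_atom_ge0//.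
case: p {mf} => [|p]; first by rewrite !expr0 normr1.
by rewrite expr0n normr0 exprn_ge0.
Qed.

Lemma mp_integrable p : mp.-integrable [set: measurableTypeR R] (fun x => ((x : R) ^+ p)%:E).
Proof.
apply/integrableP; split.
  apply/measurable_EFinP; apply: continuous_measurable_fun; exact: exprn_continuous.
under eq_integral do rewrite abse_EFin.
by apply: le_lt_trans (mp_power_le p) (ltry _).
Qed.

Definition mp_moment p : R := (\int[mp]_x (x : R) ^+ p)%R.

Lemma mp_moment_le p : `|mp_moment p| <= mp_right c ^+ p.
Proof.
rewrite /mp_moment (le_trans (le_normr_Rintegral _ (mp_integrable p)))//.
rewrite -lee_fin -integral_Rintegral; first exact: mp_power_le.
have /integrable_abse := mp_integrable p; apply: eq_integrable => //.
Qed.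

Lemma mp_state : state (fun f => \int[mp]_x f x)%R.
Proof. by apply: measure_state; [exact: mp_mass|exact: mp_integrable]. Qed.

Lemma poly_growth_max0 f : poly_growth f -> poly_growth (fun x : R => f (Num.max x 0)).
Proof.
move=> [cf [C [k [C0 fC]]]]; split.
  move=> x; apply: (@continuous_comp _ _ _ (fun x : R => Num.max x 0) f); last exact: cf.
  by apply: (@continuous_max _ _ (fun y : R => y) (fun=> 0)); [exact: cvg_id|exact: cst_continuous].
exists C, k; split => // x; rewrite (le_trans (fC _))// ler_wpM2l//.
rewrite lerXn2r ?nnegrE ?addr_ge0// lerD2l.
by have [x0|x0] := leP x 0; rewrite ?normr0.
Qed.

Lemma mp_integral_max0 f : poly_growth f ->
  (\int[mp]_x f x = \int[mp]_x f (Num.max (x : R) 0))%R.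
Proof.
move=> pf; have pf' := poly_growth_max0 pf.
have int g := poly_growth_integrable mp_integrable (f := g).
have pd : poly_growth (fun x => f x - f (Num.max x 0)).
  have -> : (fun x => f x - f (Num.max x 0)) = (fun x => f x + -1 * f (Num.max x 0)).
    by apply/funext => x; rewrite mulN1r.
  by apply: poly_growthD => //; exact: poly_growthZ.
apply/eqP; rewrite -subr_eq0 -normr_le0 -RintegralB//; [|exact: int|exact: int].
apply: le_trans (le_normr_Rintegral _ (int _ pd)) _ => //.
rewrite -lee_fin -integral_Rintegral; last exact: (int _ (poly_growth_norm pd)).
rewrite mp_integral//; last first.
  by apply/measurable_EFinP; apply: continuous_measurable_fun; case: (poly_growth_norm pd).
rewrite maxxx subrr normr0 mule0 adde0 integral0_eq// => x _.
have [x0|x0] := leP (x : R) 0; first by rewrite mp_pdf_neg// mule0.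
by rewrite subrr normr0 mul0e.
Qed.

Lemma mp_integral_le f g : poly_growth f -> poly_growth g -> (forall x, 0 <= x -> f x <= g x) ->
  (\int[mp]_x f x <= \int[mp]_x g x)%R.
Proof.
move=> pf pg fg; rewrite (mp_integral_max0 pf) (mp_integral_max0 pg).
apply: (state_le mp_state); [exact: poly_growth_max0|exact: poly_growth_max0|].
by move=> x; apply: fg; rewrite le_max lexx orbT.
Qed.

(** Remainder of an alternating geometric series. *)
Lemma geometric_remainder (y : R) n : 0 <= y ->
  `|y / (1 + y) - \sum_(q < n) (-1) ^+ q * y ^+ q.+1| <= y ^+ n.+1.
Proof.
move=> y0; have y1 : 0 < 1 + y by rewrite ltr_wpDr.
have -> : \sum_(q < n) (-1) ^+ q * y ^+ q.+1 = y * ((1 - (- y) ^+ n) / (1 + y)).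
  have := subrX1 (- y) n => E.
  have -> : \sum_(q < n) (-1) ^+ q * y ^+ q.+1 = y * \sum_(i < n) (- y) ^+ i.
    by rewrite mulr_sumr; apply: eq_bigr => i _; rewrite (exprNn y) exprS mulrCA.
  congr (_ * _); apply: (mulfI (_ : - (1 + y) != 0)); first by rewrite oppr_eq0 gt_eqF.
  rewrite [LHS](_ : _ = (- y) ^+ n - 1); last by rewrite E; congr (_ * _); ring.
  by field; rewrite gt_eqF.
have -> : y / (1 + y) - y * ((1 - (- y) ^+ n) / (1 + y)) = y * (- y) ^+ n / (1 + y).
  by field; rewrite gt_eqF.
rewrite !normrM normrX normrN normfV (ger0_norm y0) (gtr0_norm y1) -exprS.
by rewrite ler_pdivrMr// ler_peMr ?exprn_ge0// lerDl.
Qed.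

(** The geometric series of x/(x + e) with z = 1/e, integrated term by term. *)
Lemma mp_fraction_expansion n z : 0 < z ->
  `|mp_stieltjes c z^-1 - \sum_(q < n) (-1) ^+ q * z ^+ q.+1 * mp_moment q.+1| <=
  mp_moment n.+1 * z ^+ n.+1.
Proof.
move=> z0; have zi : 0 < z^-1 by rewrite invr_gt0.
have bf : bounded_continuous (fraction_pos z^-1).
  split; first exact: fraction_pos_continuous.
  by exists 1 => x; have /andP[? ?] := fraction_pos01 x zi; rewrite ger0_norm.
have pf := bounded_continuous_growth bf.
have -> : mp_stieltjes c z^-1 = (\int[mp]_x fraction_pos z^-1 x)%R.
  by rewrite /Rintegral mp_integral_fraction.
pose S (x : R) := \sum_(q < n) (-1) ^+ q * z ^+ q.+1 * x ^+ q.+1.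
have pS : poly_growth S.
  by apply: poly_growth_sum => q; apply: poly_growthZ; exact: poly_growthX.
have -> : \sum_(q < n) (-1) ^+ q * z ^+ q.+1 * mp_moment q.+1 = (\int[mp]_x S x)%R.
  rewrite (state_sum mp_state) => [|q]; last by apply: poly_growthZ; exact: poly_growthX.
  by apply: eq_bigr => q _; rewrite (stateZ mp_state)//; exact: poly_growthX.
have -> : mp_moment n.+1 * z ^+ n.+1 = (\int[mp]_x (z ^+ n.+1 * (x : R) ^+ n.+1))%R.
  by rewrite (stateZ mp_state) 1?mulrC//; exact: poly_growthX.
have pm : poly_growth (fun x : R => z ^+ n.+1 * x ^+ n.+1) by apply: poly_growthZ; exact: poly_growthX.
rewrite mp_integral_max0// (mp_integral_max0 pS) (mp_integral_max0 pm).
apply: (state_dist mp_state); [exact: poly_growth_max0 pf|exact: poly_growth_max0 pS|exact: poly_growth_max0 pm|].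
move=> x; set t := Num.max x 0; have t0 : 0 <= t by rewrite le_max lexx orbT.
have -> : fraction_pos z^-1 t = (z * t) / (1 + z * t).
  rewrite /fraction_pos max_l//; field.
  by rewrite (gt_eqF z0) andbT gt_eqF// ltr_wpDr// mulr_ge0// ltW.
have -> : S t = \sum_(q < n) (-1) ^+ q * (z * t) ^+ q.+1.
  by apply: eq_bigr => q _; rewrite exprMn mulrA.
by rewrite -exprMn; apply: geometric_remainder; rewrite mulr_ge0// ltW.
Qed.

(** The closed form is a root of this equation. *)
Lemma mp_stieltjes_quadratic e : 0 < e ->
  mp_stieltjes c e ^+ 2 - (1 + c + e) * mp_stieltjes c e + c = 0.
Proof.
move=> e0; rewrite /mp_stieltjes; set M := 1 + c + e; set s := Num.sqrt (M ^+ 2 - _).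
have s2 : s ^+ 2 = M ^+ 2 - 4 * c.
  rewrite sqr_sqrtr; first by rewrite exprMn sc2; ring.
  rewrite exprMn sc2 /M; have := sqr_ge0 (1 - c); have := c0; nra.
have -> : ((M - s) / 2) ^+ 2 - M * ((M - s) / 2) + c = (s ^+ 2 - M ^+ 2 + 4 * c) / 4 by field.
by rewrite s2; ring.
Qed.

(** The transform as a function of z = 1/e has the moments as asymptotic
    coefficients at 0 and satisfies the quadratic equation, so uniqueness of
    the expansion identifies them. *)
Theorem mp_moment_narayana p : mp_moment p = narayana c p.
Proof.
case: p => [|p].
  by rewrite narayana0 /mp_moment (state_one mp_state).
apply: (@expansion_unique _ c (fun q => mp_moment q.+1) (fun z => mp_stieltjes c z^-1 / z)).
- move=> n z z0; have h := mp_fraction_expansion n z0.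
  have -> : mp_stieltjes c z^-1 / z - \sum_(q < n) mp_moment q.+1 * (- z) ^+ q =
     (mp_stieltjes c z^-1 - \sum_(q < n) (-1) ^+ q * z ^+ q.+1 * mp_moment q.+1) / z.
    rewrite mulrBl; congr (_ - _); rewrite mulr_suml; apply: eq_bigr => q _.
    by rewrite (exprNn z) exprS; field; rewrite gt_eqF.
  rewrite normrM normfV (gtr0_norm z0) ler_pdivrMr// -mulrA -exprSr.
  exact: h.
- move=> z z0; have zi : 0 < z^-1 by rewrite invr_gt0.
  have := mp_stieltjes_quadratic zi; set s := mp_stieltjes _ _ => E.
  have {E} E : s ^+ 2 = (1 + c + z^-1) * s - c by apply/eqP; rewrite -subr_eq0 -E; apply/eqP; ring.
  rewrite expr_div_n E; field; rewrite gt_eqF//.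
Qed.

End marchenko_pastur_moments.

(** * Products of bounded independent variables *)

Section bounded_expectation.
Context {d : measure_display} {T : measurableType d} {R : realType}.
Variable P : probability T R.

Definition bounded_measurable (f : T -> R) : Prop :=
  measurable_fun [set: T] f /\ exists B : R, forall w, `|f w| <= B.

Definition mean (f : T -> R) : R := (\int[P]_w f w)%R.

Lemma bounded_measurable_integrable f : bounded_measurable f ->
  P.-integrable [set: T] (EFin \o f).
Proof.
move=> [mf [B fB]]; apply: measurable_bounded_integrable => //.
  by rewrite (le_lt_trans (probability_le1 _ _))// ltry.
exists B; split; first exact: num_real.
by move=> C BC x _; apply: le_trans (fB x) (ltW BC).
Qed.

Lemma bounded_measurable_cst a : bounded_measurable (fun=> a).
Proof. by split; [exact: measurable_cst|exists `|a|]. Qed.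

Lemma bounded_measurable_linear a f g : bounded_measurable f -> bounded_measurable g ->
  bounded_measurable (fun w => a * f w + g w).
Proof.
move=> [mf [B fB]] [mg [C gC]]; split.
  by apply: measurable_funD => //; apply: measurable_funM => //; exact: measurable_cst.
exists (`|a| * B + C) => x; rewrite (le_trans (ler_normD _ _))// lerD//.
by rewrite normrM ler_wpM2l.
Qed.

Lemma bounded_measurableM f g : bounded_measurable f -> bounded_measurable g ->
  bounded_measurable (fun w => f w * g w).
Proof.
move=> [mf [B fB]] [mg [C gC]]; split; first exact: measurable_funM.
by exists (B * C) => x; rewrite normrM ler_pM.
Qed.

Lemma bounded_measurable_sum (I : Type) (r : seq I) (F : I -> T -> R) :
  (forall i, bounded_measurable (F i)) -> bounded_measurable (fun w => \sum_(i <- r) F i w).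
Proof.
move=> h; elim: r => [|i r IH].
  by under eq_fun do rewrite big_nil; exact: bounded_measurable_cst.
under eq_fun do rewrite big_cons -[F i _]mul1r; exact: bounded_measurable_linear.
Qed.

Lemma bounded_measurable_prod (I : Type) (r : seq I) (F : I -> T -> R) :
  (forall i, bounded_measurable (F i)) -> bounded_measurable (fun w => \prod_(i <- r) F i w).
Proof.
move=> h; elim: r => [|i r IH].
  by under eq_fun do rewrite big_nil; exact: bounded_measurable_cst.
by under eq_fun do rewrite big_cons; exact: bounded_measurableM.
Qed.

Lemma mean_cst a : mean (fun=> a) = a.
Proof.
rewrite /mean Rintegral_cst// -[RHS]mulr1; congr (_ * _).
exact: (congr1 fine (probability_setT P)).
Qed.

Lemma mean_linear a f g : bounded_measurable f -> bounded_measurable g ->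
  mean (fun w => a * f w + g w) = a * mean f + mean g.
Proof.
move=> bf bg; rewrite /mean RintegralD//.
- by rewrite RintegralZl//; exact: bounded_measurable_integrable.
- have := bounded_measurable_linear a bf (bounded_measurable_cst 0).
  move=> /bounded_measurable_integrable; apply: eq_integrable => // x _ /=.
  by rewrite addr0.
- exact: bounded_measurable_integrable.
Qed.

Lemma mean_sum (I : Type) (r : seq I) (a : I -> R) (F : I -> T -> R) :
  (forall i, bounded_measurable (F i)) ->
  mean (fun w => \sum_(i <- r) a i * F i w) = \sum_(i <- r) a i * mean (F i).
Proof.
move=> h; elim: r => [|i r IH].
  by under eq_fun do rewrite big_nil; rewrite big_nil mean_cst.
under eq_fun do rewrite big_cons; rewrite big_cons mean_linear ?IH//.
apply: bounded_measurable_sum => j.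
have := bounded_measurable_linear (a j) (h j) (bounded_measurable_cst 0).
by congr bounded_measurable; apply/funext => w; rewrite addr0.
Qed.

Lemma mean_dist f g e : bounded_measurable f -> bounded_measurable g ->
  (forall w, `|f w - g w| <= e) -> `|mean f - mean g| <= e.
Proof.
move=> bf bg fg.
have bd : bounded_measurable (fun w => f w - g w).
  have := bounded_measurable_linear (-1) bg bf.
  by congr bounded_measurable; apply/funext => w; rewrite mulN1r addrC.
rewrite /mean -RintegralB//; try exact: bounded_measurable_integrable.
rewrite (le_trans (le_normr_Rintegral _ _))//; first exact: bounded_measurable_integrable.
rewrite -[leRHS]mean_cst; apply: le_Rintegral => //.
  by have := bounded_measurable_integrable bd => /integrable_abse; apply: eq_integrable.
exact: bounded_measurable_integrable (bounded_measurable_cst e).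
Qed.

Lemma mean_indic A : measurable A -> mean (\1_A : T -> R) = fine (P A).
Proof. by move=> mA; rewrite /mean /Rintegral integral_indic// setIT. Qed.

Lemma bounded_measurable_indic A : measurable A -> bounded_measurable (\1_A : T -> R).
Proof.
move=> mA; split; first exact: measurable_indic.
by exists 1 => w; rewrite indicE; case: (_ \in _); rewrite ?normr1 ?normr0.
Qed.

End bounded_expectation.

(** Telescoping; the factors h_i are at most 1 + e <= 2. *)
Lemma prod_dist (R : realType) (I : Type) (r : seq I) (f h : I -> R) (e : R) : 0 <= e -> e <= 1 ->
  (forall i, `|f i| <= 1) -> (forall i, `|f i - h i| <= e) ->
  `|\prod_(i <- r) f i - \prod_(i <- r) h i| <= (size r)%:R * 2 ^+ size r * e.
Proof.
move=> e0 e1 f1 fh; elim: r => [|i r IH].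
  by rewrite !big_nil subrr normr0 !mul0r.
rewrite !big_cons /=; set F := \prod_(j <- r) f j in IH *; set H := \prod_(j <- r) h j in IH *.
have F1 : `|F| <= 1.
  rewrite /F normr_prod; elim: (r) => [|j s IHs]; first by rewrite big_nil.
  by rewrite big_cons mulr_ile1// ?prodr_ge0.
have h2 : `|h i| <= 2.
  rewrite -(subrK (f i) (h i)) (le_trans (ler_normD _ _))// distrC.
  by have := fh i; have := f1 i; lra.
rewrite (_ : _ - _ = (f i - h i) * F + h i * (F - H)); last by ring.
apply: le_trans (ler_normD _ _) _; rewrite !normrM.
apply: le_trans (lerD (ler_pM _ _ (fh i) F1) (ler_pM _ _ h2 IH)) _ => //.
have p1 : 1 <= 2 ^+ size r :> R by rewrite exprn_ege1// ler1n.
rewrite mulr1 -[(size r).+1%:R]natr1 exprS.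
have -> : ((size r)%:R + 1) * (2 * 2 ^+ size r) * e =
  2 * ((size r)%:R * 2 ^+ size r * e) + 2 * (2 ^+ size r * e) by ring.
rewrite addrC lerD2l; move: e0 p1; set q := 2 ^+ _; nra.
Qed.

Section independence.
Context {d : measure_display} {T : measurableType d} {R : realType}.
Variable P : probability T R.
Variables (I : finType) (X : I -> {RV P >-> R[i]}).
Hypothesis indX : mutually_independent X.

Lemma independent_indic (E : I -> set R[i]) : (forall i, measurable (E i)) ->
  mean P (fun w => \prod_i (\1_(E i) (X i w) : R)) = \prod_i mean P (fun w => \1_(E i) (X i w)).
Proof.
move=> mE; have mX i : measurable (X i @^-1` E i) by exact: measurable_funPTI.
have -> : (fun w => \prod_i (\1_(E i) (X i w) : R)) = \1_[set w | forall i, E i (X i w)].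
  apply/funext => w; rewrite indicE.
  have [h|h] := pselect (forall i, E i (X i w)).
    by rewrite mem_set// big1// => i _; rewrite indicE mem_set.
  rewrite memNset//; have [i hi] : exists i, ~ E i (X i w) by apply/existsNP.
  by rewrite (bigD1 i)//= indicE memNset ?mul0r.
have -> : \prod_i mean P (fun w => \1_(E i) (X i w)) = \prod_i fine (P (X i @^-1` E i)).
  by apply: eq_bigr => i _; rewrite -mean_indic.
rewrite mean_indic; last first.
  have -> : [set w | forall i, E i (X i w)] = \bigcap_(i in [set: I]) (X i @^-1` E i).
    by apply/seteqP; split => w /= h i; [move=> _; exact: h|exact: h].
  by apply: fin_bigcap_measurable => //; exact: finite_finset.
rewrite indX// -[RHS]/(fine (\prod_i fine (P (X i @^-1` E i)))%:E).
congr fine; rewrite -prodEFin.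
by apply: eq_bigr => i _; rewrite fineK// fin_num_measure.
Qed.

(** Both sides are continuous under uniform approximation of the f_i by step
    functions, and for step functions the product expands into probabilities
    of independent events. *)
Lemma independent_real (f : I -> R[i] -> R) :
  (forall i, measurable_fun [set: R[i]] (f i)) -> (forall i z, `|f i z| <= 1) ->
  mean P (fun w => \prod_i f i (X i w)) = \prod_i mean P (fun w => f i (X i w)).
Proof.
move=> mf f1.
have bf i : bounded_measurable (fun w => f i (X i w)).
  by split; [exact: measurableT_comp|exists 1].
apply/eqP; rewrite -subr_eq0 -normr_le0; apply/ler_addgt0Pr => e e0; rewrite add0r.
set r := index_enum I; pose A : R := 2 * ((size r)%:R * 2 ^+ size r).
have A0 : 0 <= A by rewrite mulr_ge0// mulr_ge0// exprn_ge0.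
pose N := (Num.truncn (A / e)).+1.
have N0 : 0 < N%:R :> R by rewrite ltr0n.
have N0' := gt_eqF N0.
pose c (k : 'I_(2 * N).+1) : R := (k%:R - N%:R) / N%:R.
pose E (i : I) (k : 'I_(2 * N).+1) : set R[i] := f i @^-1` `[c k, c k + N%:R^-1[.
have mE i k : measurable (E i k).
  by rewrite -[E i k]setTI; apply: mf => //; exact: measurable_itv.
pose h (i : I) (z : R[i]) : R := \sum_k c k * \1_(E i k) z.
have EE i k z : (z \in E i k) = (c k <= f i z < c k + N%:R^-1).
  by rewrite /E; apply/idP/idP => [|h1]; rewrite inE /= in_itv.
have fh i z : `|f i z - h i z| <= N%:R^-1.
  have := f1 i z; rewrite ler_norml => /andP[fl fr].
  have y0 : 0 <= (f i z + 1) * N%:R by rewrite mulr_ge0 ?(ltW N0)//; lra.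
  have := truncn_itv y0; set k := Num.truncn _ => /andP[k1 k2].
  have kN : (k < (2 * N).+1)%N.
    rewrite ltnS -(ler_nat R) (le_trans k1)// natrM ler_wpM2r ?(ltW N0)//; lra.
  have inE k' : (z \in E i k') = (k' == Ordinal kN).
    rewrite EE -[X in _ + X]mul1r -mulrDl ler_pdivrMr// ltr_pdivlMr//.
    apply/andP/eqP => [[h1 h2]|->]; last first.
      by split; move: k1 k2; rewrite /= -natr1 mulrDl mul1r; lra.
    move: k1 k2; rewrite -natr1 mulrDl mul1r => k1 k2.
    have a1 : (k < k'.+1)%N by rewrite -(ltr_nat R) -natr1; lra.
    have a2 : (k' < k.+1)%N by rewrite -(ltr_nat R) -natr1; lra.
    by apply/val_inj/eqP; rewrite /= eqn_leq -ltnS a2 -ltnS a1.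
  have -> : h i z = c (Ordinal kN).
    rewrite /h (bigD1 (Ordinal kN))//= big1 ?addr0.
      by rewrite indicE inE eqxx mulr1.
    by move=> k' /negbTE kk; rewrite indicE inE kk mulr0.
  have := inE (Ordinal kN); rewrite eqxx EE => /andP[h1 h2].
  by rewrite ger0_norm; move: h1 h2; set q := c _; lra.
have bh i : bounded_measurable (fun w => h i (X i w)).
  apply: bounded_measurable_sum => k.
  apply: bounded_measurableM; first exact: bounded_measurable_cst.
  have := @bounded_measurable_indic _ _ R (X i @^-1` E i k) (measurable_funPTI (X i) (mE i k)).
  by congr bounded_measurable.
have e1 : N%:R^-1 <= 1 :> R by rewrite invf_le1// ler1n.
have Ni : 0 <= N%:R^-1 :> R by rewrite invr_ge0 ltW.
have mh : mean P (fun w => \prod_i h i (X i w)) = \prod_i mean P (fun w => h i (X i w)).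
  have hE i : mean P (fun w => h i (X i w)) = \sum_k c k * mean P (fun w => \1_(E i k) (X i w)).
    rewrite (@mean_sum _ _ _ P _ _ c (fun k w => \1_(E i k) (X i w)))// => k.
    have := @bounded_measurable_indic _ _ R (X i @^-1` E i k) (measurable_funPTI (X i) (mE i k)).
    by congr bounded_measurable.
  under [RHS]eq_bigr do rewrite hE.
  rewrite bigA_distr_bigA /=.
  have -> : (fun w => \prod_i h i (X i w)) = (fun w => \sum_(phi : {ffun I -> 'I_(2 * N).+1})
      (\prod_i c (phi i)) * \prod_i (\1_(E i (phi i)) (X i w) : R)).
    apply/funext => w; rewrite bigA_distr_bigA; apply: eq_bigr => phi _.
    by rewrite big_split.
  rewrite (@mean_sum _ _ _ P _ _ (fun phi : {ffun I -> 'I_(2 * N).+1} => \prod_i c (phi i))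
    (fun phi w => \prod_i (\1_(E i (phi i)) (X i w) : R))).
    apply: eq_bigr => phi _.
    by rewrite (independent_indic (fun i => mE i (phi i))) -big_split.
  move=> phi; apply: bounded_measurable_prod => i.
  have := @bounded_measurable_indic _ _ R (X i @^-1` E i (phi i)) (measurable_funPTI (X i) (mE i (phi i))).
  by congr bounded_measurable.
have d1 : `|mean P (fun w => \prod_i f i (X i w)) - mean P (fun w => \prod_i h i (X i w))| <=
    (size r)%:R * 2 ^+ size r * N%:R^-1.
  apply: mean_dist; [exact: bounded_measurable_prod|exact: bounded_measurable_prod|].
  by move=> w; apply: prod_dist.
have d2 : `|\prod_i mean P (fun w => f i (X i w)) - \prod_i mean P (fun w => h i (X i w))| <=
    (size r)%:R * 2 ^+ size r * N%:R^-1.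
  apply: prod_dist => // i; last by apply: mean_dist.
  rewrite -[mean P _]subr0 -(mean_cst P 0); apply: mean_dist => //.
    exact: bounded_measurable_cst.
  by move=> w; rewrite subr0.
have Ae : A * N%:R^-1 <= e.
  by rewrite ler_pdivrMr// -ler_pdivrMl// mulrC ltW// truncnS_gt.
rewrite (le_trans _ Ae)// /A -mulrA mulr_natl mulr2n.
rewrite mh in d1; rewrite distrC in d2; apply: le_trans (lerD d1 d2).
apply: le_trans (ler_normD _ _).
by rewrite addrA subrK.
Qed.

End independence.

(** * Complex expectations and independence *)

Section complex_expectation.
Context {R : realType}.
Local Notation C := R[i].
Local Open Scope complex_scope.

Lemma measurable_Re : measurable_fun [set: C] (@complex.Re R).
Proof.
move=> _ A mA; rewrite setTI; exists (A `*` [set: R]); first exact: measurableX.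
by apply/seteqP; split => z //= [_ []].
Qed.

Lemma measurable_Im : measurable_fun [set: C] (@complex.Im R).
Proof.
move=> _ A mA; rewrite setTI; exists ([set: R] `*` A); first exact: measurableX.
by apply/seteqP; split => z //= [_ []].
Qed.

Context {d : measure_display} {T : measurableType d}.
Variable P : probability T R.

Definition complex_bounded (f : T -> C) : Prop :=
  bounded_measurable (fun w => complex.Re (f w)) /\ bounded_measurable (fun w => complex.Im (f w)).

Definition complex_mean (f : T -> C) : C :=
  (mean P (fun w => complex.Re (f w))) +i* (mean P (fun w => complex.Im (f w))).

Lemma complex_bounded_cst a : complex_bounded (fun=> a).
Proof. by split; exact: bounded_measurable_cst. Qed.

Lemma complex_boundedD f g : complex_bounded f -> complex_bounded g ->
  complex_bounded (fun w => f w + g w).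
Proof.
move=> [f1 f2] [g1 g2]; split.
  have := bounded_measurable_linear 1 f1 g1; congr bounded_measurable.
  by apply/funext => w; rewrite mul1r raddfD.
have := bounded_measurable_linear 1 f2 g2; congr bounded_measurable.
by apply/funext => w; rewrite mul1r raddfD.
Qed.

Lemma complex_boundedM f g : complex_bounded f -> complex_bounded g ->
  complex_bounded (fun w => f w * g w).
Proof.
move=> [f1 f2] [g1 g2]; split.
  have := bounded_measurable_linear (-1) (bounded_measurableM f2 g2) (bounded_measurableM f1 g1).
  congr bounded_measurable; apply/funext => w.
  by case: (f w) => a b; case: (g w) => x y /=; rewrite mulN1r addrC.
have := bounded_measurable_linear 1 (bounded_measurableM f2 g1) (bounded_measurableM f1 g2).
congr bounded_measurable; apply/funext => w.
by case: (f w) => a b; case: (g w) => x y /=; rewrite mul1r addrC.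
Qed.

Lemma complex_bounded_sum (I : Type) (r : seq I) (F : I -> T -> C) :
  (forall i, complex_bounded (F i)) -> complex_bounded (fun w => \sum_(i <- r) F i w).
Proof.
move=> h; elim: r => [|i r IH].
  by under eq_fun do rewrite big_nil; exact: complex_bounded_cst.
by under eq_fun do rewrite big_cons; exact: complex_boundedD.
Qed.

Lemma complex_bounded_prod (I : Type) (r : seq I) (F : I -> T -> C) :
  (forall i, complex_bounded (F i)) -> complex_bounded (fun w => \prod_(i <- r) F i w).
Proof.
move=> h; elim: r => [|i r IH].
  by under eq_fun do rewrite big_nil; exact: complex_bounded_cst.
by under eq_fun do rewrite big_cons; exact: complex_boundedM.
Qed.

Lemma complex_mean_cst a : complex_mean (fun=> a) = a.
Proof. by rewrite /complex_mean !mean_cst; case: a. Qed.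

Lemma complex_mean_linear a f g : complex_bounded f -> complex_bounded g ->
  complex_mean (fun w => a * f w + g w) = a * complex_mean f + complex_mean g.
Proof.
move=> [f1 f2] [g1 g2]; case: a => x y; rewrite /complex_mean.
have -> : (fun w => complex.Re ((x +i* y) * f w + g w)) =
   (fun w => x * complex.Re (f w) + (- y * complex.Im (f w) + complex.Re (g w))).
  by apply/funext => w; case: (f w) => a b; case: (g w) => u v /=; ring.
have -> : (fun w => complex.Im ((x +i* y) * f w + g w)) =
   (fun w => x * complex.Im (f w) + (y * complex.Re (f w) + complex.Im (g w))).
  by apply/funext => w; case: (f w) => a b; case: (g w) => u v /=; ring.
rewrite !mean_linear//; try exact: bounded_measurable_linear.
by apply/eqP; rewrite eq_complex /=; apply/andP; split; apply/eqP; ring.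
Qed.

Lemma complex_mean_sum (I : Type) (r : seq I) (a : I -> C) (F : I -> T -> C) :
  (forall i, complex_bounded (F i)) ->
  complex_mean (fun w => \sum_(i <- r) a i * F i w) = \sum_(i <- r) a i * complex_mean (F i).
Proof.
move=> h; elim: r => [|i r IH].
  by under eq_fun do rewrite big_nil; rewrite big_nil complex_mean_cst.
under eq_fun do rewrite big_cons; rewrite big_cons complex_mean_linear ?IH//.
apply: complex_bounded_sum => j; apply: complex_boundedM => //.
exact: complex_bounded_cst.
Qed.

Lemma complex_mean_real f : complex_mean (fun w => (f w)%:C) = (mean P f)%:C.
Proof. by rewrite /complex_mean /= mean_cst. Qed.

Lemma complex_mean_conj f : complex_bounded f ->
  complex_mean (fun w => Num.conj (f w)) = Num.conj (complex_mean f).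
Proof.
move=> [f1 f2]; rewrite /complex_mean; congr (_ +i* _).
  by congr mean; apply/funext => w; case: (f w).
have -> : (fun w => complex.Im (Num.conj (f w))) = (fun w => -1 * complex.Im (f w) + 0).
  by apply/funext => w; rewrite mulN1r addr0; case: (f w).
by rewrite mean_linear ?mean_cst ?mulN1r ?addr0//; exact: bounded_measurable_cst.
Qed.

(** Rotate the mean to the positive axis by a constant of modulus 1 and take the
    real part. *)
Lemma complex_mean_le1 f : complex_bounded f -> (forall w, `|f w| <= 1) -> `|complex_mean f| <= 1.
Proof.
move=> bf f1; set m := complex_mean f; have [->|m0] := eqVneq m 0; first by rewrite normr0 ler01.
have n0 : `|m| != 0 by rewrite normr_eq0.
pose u := Num.conj m / `|m|.
have um : u * m = `|m| by rewrite /u mulrAC [_ * m]mulrC -normCK expr2 mulfK.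
have u1 : `|u| = 1 by rewrite normrM norm_conjC normfV normr_id divff.
have E : complex_mean (fun w => u * f w) = `|m|.
  have := complex_mean_linear u bf (complex_bounded_cst 0).
  rewrite complex_mean_cst addr0 -/m um => <-; congr complex_mean.
  by apply/funext => w; rewrite addr0.
have bu : complex_bounded (fun w => u * f w).
  by apply: complex_boundedM => //; exact: complex_bounded_cst.
have Re1 : complex.Re `|m| <= 1.
  rewrite -E /= -[leRHS](mean_cst P); apply: le_Rintegral => //.
  - exact: (bounded_measurable_integrable P bu.1).
  - exact: (bounded_measurable_integrable P (bounded_measurable_cst 1)).
  - move=> w _; apply: le_trans (ler_norm _) _; apply: Re_norm_le.
    by rewrite normrM u1 mul1r.
have -> : `|m| = (complex.Re `|m|)%:C by rewrite normc_def.
by rewrite -[leRHS]/((1 : R)%:C) lecR.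
Qed.

End complex_expectation.

Section complex_independence.
Context {R : realType} {d : measure_display} {T : measurableType d}.
Local Notation C := R[i].
Local Open Scope complex_scope.
Variable P : probability T R.
Variables (I : finType) (X : I -> {RV P >-> R[i]}).
Hypothesis indX : mutually_independent X.

(** The binary sum prepares the expansion of a product over real or imaginary
    parts. *)
Lemma complex_split (z : C) :
  z = \sum_(b : bool) (if b then 'i%C else 1) * (if b then complex.Im z else complex.Re z)%:C.
Proof.
rewrite big_bool; case: z => x y.
by apply/eqP; rewrite eq_complex /=; apply/andP; split; apply/eqP; ring.
Qed.

(** Expand each factor into its real and imaginary part and apply the real case
    to each choice. *)
Lemma independent_complex (h : I -> C -> C) :
  (forall i, measurable_fun [set: C] (fun z => complex.Re (h i z))) ->
  (forall i, measurable_fun [set: C] (fun z => complex.Im (h i z))) ->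
  (forall i z, `|h i z| <= 1) ->
  complex_mean P (fun w => \prod_i h i (X i w)) = \prod_i complex_mean P (fun w => h i (X i w)).
Proof.
move=> mr mi h1.
pose part (b : bool) (z : C) : R := if b then complex.Im z else complex.Re z.
pose s (b : bool) : C := if b then 'i%C else 1.
have mpart i b : measurable_fun [set: C] (fun z => part b (h i z)).
  by case: b; [exact: mi|exact: mr].
have part1 i b z : `|part b (h i z)| <= 1.
  case: b => /=; last by apply: Re_norm_le; exact: h1.
  have -> : complex.Im (h i z) = - complex.Re ('i%C * h i z).
    by case: (h i z) => x y /=; ring.
  rewrite normrN; apply: Re_norm_le; rewrite normrM.
  have -> : `|'i%C : C| = 1 by rewrite normc_def /= expr0n expr1n add0r sqrtr1.
  by rewrite mul1r; exact: h1.
have bp i b : bounded_measurable (fun w => part b (h i (X i w))).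
  by split; [exact: (measurableT_comp (mpart i b))|exists 1].
have hm i : complex_mean P (fun w => h i (X i w)) =
   \sum_(b : bool) s b * (mean P (fun w => part b (h i (X i w))))%:C.
  by rewrite [LHS]complex_split !big_bool.
under [RHS]eq_bigr do rewrite hm.
rewrite bigA_distr_bigA /=.
have -> : (fun w => \prod_i h i (X i w)) = (fun w => \sum_(phi : {ffun I -> bool})
    (\prod_i s (phi i)) * (\prod_i part (phi i) (h i (X i w)))%:C).
  apply/funext => w; under eq_bigr do rewrite [h _ _]complex_split.
  rewrite bigA_distr_bigA; apply: eq_bigr => phi _.
  by rewrite big_split /= rmorph_prod.
rewrite (@complex_mean_sum _ _ _ P _ _ (fun phi : {ffun I -> bool} => \prod_i s (phi i))
  (fun phi w => (\prod_i part (phi i) (h i (X i w)))%:C)).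
  apply: eq_bigr => phi _.
  rewrite complex_mean_real (independent_real indX (f := fun i z => part (phi i) (h i z)))//.
  by rewrite rmorph_prod -big_split.
move=> phi; split => /=; last exact: bounded_measurable_cst.
by apply: bounded_measurable_prod => i; exact: bp.
Qed.

End complex_independence.

(** * Joint moments of unimodular entries *)

Section unimodular_model.
Context {R : realType} {d : measure_display} {T : measurableType d}.
Local Notation C := R[i].
Local Open Scope complex_scope.
Variable P : probability T R.

Definition circle : set C := [set z | complex.Re z ^+ 2 + complex.Im z ^+ 2 = 1].

(** Values outside the unit circle are replaced by 1, which changes a unimodular
    variable on a null set only and makes all monomials bounded. *)
Definition unimod (z : C) : C :=
  ((complex.Re z - 1) * \1_circle z + 1) +i* (complex.Im z * \1_circle z).

Lemma circleP (z : C) : circle z <-> `|z| = 1.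
Proof.
rewrite normc_def /circle /=; split => [->|]; first by rewrite sqrtr1.
move=> /eqP; rewrite eq_complex /= => /andP[/eqP h _].
have := sqr_sqrtr (addr_ge0 (sqr_ge0 (complex.Re z)) (sqr_ge0 (complex.Im z))).
by rewrite h expr1n.
Qed.

Lemma unimod_id z : `|z| = 1 -> unimod z = z.
Proof.
move=> /circleP h; rewrite /unimod indicE mem_set// !mulr1 subrK.
by case: z {h}.
Qed.

Lemma unimod_norm z : `|unimod z| = 1.
Proof.
have [h|h] := pselect (circle z); first by rewrite unimod_id; exact/circleP.
by rewrite /unimod indicE memNset// !mulr0 add0r normr1.
Qed.

Lemma measurable_circle : measurable circle.
Proof.
have mf : measurable_fun [set: C] (fun z : C => complex.Re z ^+ 2 + complex.Im z ^+ 2).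
  by apply: measurable_funD; apply: measurable_funX; [exact: measurable_Re|exact: measurable_Im].
have := mf measurableT [set 1] (measurable_set1 1); rewrite setTI.
by congr measurable.
Qed.

Lemma measurable_unimod_Re : measurable_fun [set: C] (fun z => complex.Re (unimod z)).
Proof.
apply: measurable_funD; last exact: measurable_cst.
apply: measurable_funM; last exact: measurable_indic measurable_circle.
by apply: measurable_funB; [exact: measurable_Re|exact: measurable_cst].
Qed.

Lemma measurable_unimod_Im : measurable_fun [set: C] (fun z => complex.Im (unimod z)).
Proof. by apply: measurable_funM; [exact: measurable_Im|exact: measurable_indic measurable_circle]. Qed.

(** The monomial whose mean is the joint moment of order (p, q). *)
Definition phase (p q : nat) (z : C) : C := Num.conj (unimod z) ^+ p * unimod z ^+ q.

Lemma phase_norm p q z : `|phase p q z| = 1.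
Proof. by rewrite normrM !normrX norm_conjC unimod_norm !expr1n mulr1. Qed.

Lemma measurable_phase p q :
  measurable_fun [set: C] (fun z => complex.Re (phase p q z)) /\
  measurable_fun [set: C] (fun z => complex.Im (phase p q z)).
Proof.
pose cm (f : C -> C) := measurable_fun [set: C] (fun z => complex.Re (f z)) /\
  measurable_fun [set: C] (fun z => complex.Im (f z)).
have cmM f g : cm f -> cm g -> cm (fun z => f z * g z).
  move=> [f1 f2] [g1 g2]; split.
    have -> : (fun z => complex.Re (f z * g z)) =
       (fun z => complex.Re (f z) * complex.Re (g z) - complex.Im (f z) * complex.Im (g z)).
      by apply/funext => z; case: (f z); case: (g z).
    by apply: measurable_funB; exact: measurable_funM.
  have -> : (fun z => complex.Im (f z * g z)) =
     (fun z => complex.Re (f z) * complex.Im (g z) + complex.Im (f z) * complex.Re (g z)).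
    by apply/funext => z; case: (f z); case: (g z).
  by apply: measurable_funD; exact: measurable_funM.
have cmX f k : cm f -> cm (fun z => f z ^+ k).
  move=> cf; elim: k => [|k IH]; first by split; exact: measurable_cst.
  by under eq_fun do rewrite exprS; exact: cmM.
have cu : cm unimod by split; [exact: measurable_unimod_Re|exact: measurable_unimod_Im].
have cc : cm (fun z => Num.conj (unimod z)).
  split; first exact: measurable_unimod_Re.
  have -> : (fun z => complex.Im (Num.conj (unimod z))) = (fun z => 0 - complex.Im (unimod z)).
    by apply/funext => z; rewrite sub0r.
  by apply: measurable_funB; [exact: measurable_cst|exact: measurable_unimod_Im].
by apply: cmM; exact: cmX.
Qed.

Lemma phase_bounded (x : {RV P >-> C}) p q : complex_bounded (fun w => phase p q (x w)).
Proof.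
have [m1 m2] := measurable_phase p q; split; split.
- exact: (measurableT_comp m1).
- by exists 1 => w; apply: Re_norm_le; rewrite phase_norm.
- exact: (measurableT_comp m2).
- exists 1 => w; have -> : complex.Im (phase p q (x w)) = - complex.Re ('i%C * phase p q (x w)).
    by case: (phase _ _ _) => u v /=; ring.
  rewrite normrN; apply: Re_norm_le; rewrite normrM phase_norm mulr1.
  by rewrite normc_def /= expr0n expr1n add0r sqrtr1.
Qed.

Definition joint_moment (x : {RV P >-> C}) (p q : nat) : C := complex_mean P (fun w => phase p q (x w)).

Lemma joint_moment_same_law (x y : {RV P >-> C}) p q : same_law x y ->
  joint_moment x p q = joint_moment y p q.
Proof.
move=> xy; have [m1 m2] := measurable_phase p q.
have key (f : C -> R) : measurable_fun [set: C] f ->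
    bounded_measurable (fun w => f (x w)) -> bounded_measurable (fun w => f (y w)) ->
    mean P (fun w => f (x w)) = mean P (fun w => f (y w)).
  move=> mf bx yb; rewrite /mean /Rintegral; congr fine.
  have mF : measurable_fun [set: C] (EFin \o f) by exact/measurable_EFinP.
  rewrite -(integral_distribution mF (bounded_measurable_integrable P bx)).
  rewrite -(integral_distribution mF (bounded_measurable_integrable P yb)).
  by apply: eq_measure_integral => A mA _; exact: xy.
have [x1 x2] := phase_bounded x p q; have [y1 y2] := phase_bounded y p q.
have E1 := key (fun z => complex.Re (phase p q z)) m1 x1 y1.
have E2 := key (fun z => complex.Im (phase p q z)) m2 x2 y2.
rewrite /joint_moment /complex_mean.
by move: E1 E2 => /= -> ->.
Qed.

Lemma mean_ae (f g : T -> R) : measurable_fun [set: T] f -> measurable_fun [set: T] g ->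
  {ae P, forall w, f w = g w} -> mean P f = mean P g.
Proof.
move=> mf mg fg; rewrite /mean /Rintegral; congr fine; apply: ae_eq_integral => //.
- exact/measurable_EFinP.
- exact/measurable_EFinP.
- by apply: filterS fg => w E _; rewrite E.
Qed.

(** Cancellation conj(z) z = 1 holds after projection to the circle; the first
    moments vanish by centring, up to a null set. *)
Lemma unimodular_joint_moments (xi : {RV P >-> C}) : centered_unit_variance xi ->
  {ae P, forall w, `|xi w| = 1} -> unimodular_moments (joint_moment xi).
Proof.
move=> [re0 im0 _] ae1.
have mre : measurable_fun [set: T] (fun w => complex.Re (xi w)).
  by apply: measurableT_comp => //; exact: measurable_Re.
have mim : measurable_fun [set: T] (fun w => complex.Im (xi w)).
  by apply: measurableT_comp => //; exact: measurable_Im.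
have e01 : joint_moment xi 0 1 = 0.
  have [m1 m2] := measurable_phase 0 1.
  have pE w : `|xi w| = 1 -> phase 0 1 (xi w) = xi w.
    by move=> h; rewrite /phase expr0 mul1r expr1 unimod_id.
  have r0 : mean P (fun w => complex.Re (xi w)) = 0.
    by rewrite /mean /Rintegral; move: re0; rewrite unlock => ->.
  have i0 : mean P (fun w => complex.Im (xi w)) = 0.
    by rewrite /mean /Rintegral; move: im0; rewrite unlock => ->.
  have r1 : mean P (fun w => complex.Re (phase 0 1 (xi w))) = 0.
    rewrite -r0; apply: mean_ae => //; first exact: (measurableT_comp m1).
    by apply: filterS ae1 => w /pE ->.
  have i1 : mean P (fun w => complex.Im (phase 0 1 (xi w))) = 0.
    rewrite -i0; apply: mean_ae => //; first exact: (measurableT_comp m2).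
    by apply: filterS ae1 => w /pE ->.
  by rewrite /joint_moment /complex_mean r1 i1.
have bp p q := phase_bounded xi p q.
split.
- rewrite /joint_moment -[RHS](complex_mean_cst P); congr complex_mean.
  by apply/funext => w; rewrite /phase !expr0 mulr1.
- move=> p q; congr complex_mean; apply/funext => w.
  rewrite /phase !exprSr -mulrA (mulrC (Num.conj (unimod _))) -!mulrA.
  by rewrite -[unimod _ * Num.conj _]normCK unimod_norm expr1n mulr1.
- transitivity (Num.conj (joint_moment xi 0 1)); last by rewrite e01 rmorph0.
  rewrite /joint_moment -complex_mean_conj//; congr complex_mean.
  by apply/funext => w; rewrite /phase !expr0 !expr1 mul1r mulr1.
- exact: e01.
- by move=> p q; apply: complex_mean_le1 => // w; rewrite phase_norm.
Qed.

Lemma monomial_count (I : finType) (z : I -> C) (D U : seq I) :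
  monomial z D U = \prod_i (Num.conj (z i) ^+ count_mem i D * z i ^+ count_mem i U).
Proof.
have key (F : I -> C) (s : seq I) : \prod_(i <- s) F i = \prod_i F i ^+ count_mem i s.
  elim: s => [|x s IH]; first by rewrite big_nil big1// => i _; rewrite expr0.
  rewrite big_cons IH [RHS](eq_bigr (fun i => F i ^+ (x == i) * F i ^+ count_mem i s)).
    rewrite big_split /=; congr (_ * _); rewrite (bigD1 x)//= eqxx expr1 big1 ?mulr1// => i.
    by rewrite eq_sym => /negbTE ->.
  by move=> i _; rewrite -exprD.
by rewrite /monomial (key _ D) (key _ U) -big_split.
Qed.

Lemma iid_ae_unimodular (xi : {RV P >-> C}) (I : finType) (X : I -> {RV P >-> C}) :
  {ae P, forall w, `|xi w| = 1} -> iid_copies xi X ->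
  {ae P, forall w, forall i, `|X i w| = 1}.
Proof.
move=> ae1 [_ law]; apply: filter_forall => i.
exists (~` (X i @^-1` circle)); split.
- by apply: measurableC; apply: measurable_funPTI; exact: measurable_circle.
- have mC : measurable (~` circle) by apply: measurableC; exact: measurable_circle.
  have := law i _ mC; rewrite /distribution /pushforward => E.
  transitivity (P (xi @^-1` (~` circle))); first exact: E.
  case: ae1 => B [mB PB sB]; apply/eqP; rewrite eq_le measure_ge0 andbT -PB.
  apply: le_measure; rewrite ?inE//; first exact: measurable_funPTI.
  by move=> w h; apply: sB => /= h1; apply: h; exact/circleP.
- by move=> w /= h1 h2; apply: h1; exact/circleP.
Qed.

Lemma unimod_monomial_bounded (I : finType) (X : I -> {RV P >-> C}) D U :
  complex_bounded (fun w => monomial (fun i => unimod (X i w)) D U).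
Proof.
have -> : (fun w => monomial (fun i => unimod (X i w)) D U) =
    (fun w => \prod_i phase (count_mem i D) (count_mem i U) (X i w)).
  by apply/funext => w; rewrite monomial_count.
by apply: complex_bounded_prod => i; exact: phase_bounded.
Qed.

(** Group the factors of a monomial by entry and use independence. *)
Theorem iid_moment_model (xi : {RV P >-> C}) (I : finType) (X : I -> {RV P >-> C}) :
  iid_copies xi X -> unimodular_moments (joint_moment xi) ->
  moment_model (joint_moment xi) (fun w i => unimod (X i w)) (complex_mean P).
Proof.
move=> [indX law] hmu J c D U.
rewrite (complex_mean_sum P); last by move=> j; exact: unimod_monomial_bounded.
apply: eq_bigr => j _; congr (_ * _).
have -> : (fun w => monomial (fun i => unimod (X i w)) (D j) (U j)) =
    (fun w => \prod_i phase (count_mem i (D j)) (count_mem i (U j)) (X i w)).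
  by apply/funext => w; rewrite monomial_count.
rewrite (independent_complex indX (h := fun i => phase (count_mem i (D j)) (count_mem i (U j)))).
- rewrite (edge_moment_sup hmu (index_enum_uniq I)) => [|e _]; last exact: mem_index_enum.
  by apply: eq_bigr => i _; exact: joint_moment_same_law.
- by move=> i; case: (measurable_phase (count_mem i (D j)) (count_mem i (U j))).
- by move=> i; case: (measurable_phase (count_mem i (D j)) (count_mem i (U j))).
- by move=> i z; rewrite phase_norm.
Qed.

End unimodular_model.

Section summable_variance.
Context {R : realType} {d : measure_display} {T : measurableType d}.
Variable P : probability T R.

Lemma inverse_square_sum (m : nat) : \sum_(j < m) (j.+1%:R^-1 : R) ^+ 2 <= 2 - 2 * m.+1%:R^-1.
Proof.
elim: m => [|m IH]; first by rewrite big_ord0 invr1; lra.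
rewrite big_ord_recr /=; apply: le_trans (lerD IH (lexx _)) _.
have h : 0 < m.+1%:R :> R by rewrite ltr0n.
have h1 : 1 <= m.+1%:R :> R by rewrite ler1n.
rewrite -[m.+2%:R]natr1; set x := m.+1%:R in h h1 *; clearbody x.
rewrite -subr_ge0 (_ : _ - _ = (x - 1) / (x ^+ 2 * (x + 1))); last first.
  have x1 : x + 1 != 0 by rewrite gt_eqF//; lra.
  by field; rewrite ?x1 ?(gt_eqF h).
rewrite divr_ge0 ?subr_ge0// mulr_ge0 ?sqr_ge0//; lra.
Qed.

(** The second moments are summable, so the sum of the V_n^2 is integrable, hence
    finite almost everywhere. *)
Lemma ae_cvg0 (V : nat -> T -> R) (B : R) : 0 <= B -> (forall n, bounded_measurable (V n)) ->
  (\forall n \near \oo, mean P (fun w => V n w ^+ 2) <= B * n%:R^-1 ^+ 2) ->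
  {ae P, forall w, V n w @[n --> \oo] --> (0 : R)}.
Proof.
(* the bound holds from n0 on, whence the shifted index *)
move=> B0 bV [n0 _ HV]; pose f (j : nat) (w : T) : \bar R := (V (j + n0.+1)%N w ^+ 2)%:E.
have bV2 n : bounded_measurable (fun w => V n w ^+ 2).
  by under eq_fun do rewrite expr2; exact: bounded_measurableM.
have mf j : measurable_fun [set: T] (f j).
  by apply/measurable_EFinP; case: (bV2 (j + n0.+1)%N).
have f0 j w : [set: T] w -> (0 <= f j w)%E by move=> _; rewrite lee_fin sqr_ge0.
have fB j : (\int[P]_w f j w <= (B * j.+1%:R^-1 ^+ 2)%:E)%E.
  have -> : (\int[P]_w f j w)%E = (mean P (fun w => V (j + n0.+1)%N w ^+ 2))%:E.
    rewrite /mean /Rintegral fineK//; apply: integrable_fin_num => //.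
    exact: (bounded_measurable_integrable P (bV2 _)).
  rewrite lee_fin; apply: le_trans (HV _ _) _; first by rewrite /= addnS ltnW// ltnS leq_addl.
  rewrite ler_wpM2l// lerXn2r ?nnegrE ?invr_ge0//.
  by rewrite lef_pV2 ?posrE ?ltr0n ?addnS// ler_nat ltnS leq_addr.
have IF : (\int[P]_w (\sum_(j <oo) f j w) <= (B * 2)%:E)%E.
  rewrite integral_nneseries//; apply: lime_le.
    by apply: is_cvg_nneseries => j _ _; apply: integral_ge0 => w; exact: f0.
  apply: nearW => m; rewrite big_mkord.
  apply: le_trans (_ : (\sum_(j < m) (B * j.+1%:R^-1 ^+ 2)%:E <= _)%E); first exact: lee_sum.
  rewrite sumEFin lee_fin -mulr_sumr ler_wpM2l//.
  apply: le_trans (inverse_square_sum m) _; by rewrite gerBl mulr_ge0// invr_ge0.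
have mF : measurable_fun [set: T] (fun w => \sum_(j <oo) f j w)%E.
  by apply: ge0_emeasurable_sum => // j w _ _; rewrite lee_fin sqr_ge0.
have F0 w : (0 <= \sum_(j <oo) f j w)%E by apply: nneseries_ge0 => j _ _; rewrite lee_fin sqr_ge0.
have iF : P.-integrable [set: T] (fun w => \sum_(j <oo) f j w)%E.
  apply/integrableP; split => //; under eq_integral do rewrite gee0_abs//.
  by apply: le_lt_trans IF (ltry _).
have := integrable_ae measurableT iF; apply: filterS => w /(_ I) fin.
pose s := series (fun j => V (j + n0.+1)%N w ^+ 2).
have cs : cvgn s.
  apply: nondecreasing_is_cvgn.
    by apply: nondecreasing_series => n _ _; exact: sqr_ge0.
  exists (fine (\sum_(j <oo) f j w)%E) => _ [m _ <-].
  rewrite -lee_fin fineK// /s /series /= -sumEFin; apply: nneseries_lim_ge => j _ _.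
  by rewrite lee_fin sqr_ge0.
have := cvg_series_cvg_0 cs; move=> c2.
rewrite -(cvg_shiftn n0.+1); apply/cvgrPdist_le => e e0.
have e2 : 0 < e ^+ 2 by rewrite exprn_gt0.
move/cvgrPdist_le: c2 => /(_ _ e2); apply: filterS => n.
rewrite !sub0r !normrN normrX => h.
by rewrite -(@ler_pXn2r _ 2) ?nnegrE ?(ltW e0).
Qed.

End summable_variance.

(** * Spectra, random signs and moment growth *)

Section spectra.
Context {R : realType}.
Local Notation C := R[i].
Local Open Scope complex_scope.

Definition spectrum (N : nat) (A : 'M[C]_N) : seq R := map (@complex.Re R) (eigenvalues A).

Lemma size_spectrum N (A : 'M[C]_N) : size (spectrum A) = N.
Proof. by rewrite size_map; case: (eigenvaluesP A). Qed.

Lemma spectrum_sum N (A : 'M[C]_N) (f : R -> R) :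
  \sum_(x <- spectrum A) f x = \sum_(j < N) f (complex.Re (eigenvalues A)`_j).
Proof.
rewrite (big_nth 0) size_spectrum big_mkord; apply: eq_bigr => j _.
by rewrite (nth_map 0)//; case: (eigenvaluesP A) => ->.
Qed.

Lemma spectrum_moment n k m (tau : nat -> R) (x : 'I_m -> 'I_k -> 'I_n -> C) p :
  avg (spectrum (Mmx tau x)) (fun t => t ^+ p) =
  ((n ^ k)%N%:R)^-1 * complex.Re (\tr (Mmx tau x ^+ p)).
Proof. by rewrite /avg size_spectrum spectrum_sum -esd_moment. Qed.

Lemma integral_esd N (A : 'M[C]_N) (f : R -> R) : continuous f ->
  (\int[esd A]_x (f x)%:E = (avg (spectrum A) f)%:E)%E.
Proof.
move=> cf; have mf : measurable_fun [set: measurableTypeR R] (EFin \o f).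
  by apply/measurable_EFinP; exact: continuous_measurable_fun.
have ge0 (g : R -> R) : (forall x, 0 <= g x) ->
    measurable_fun [set: measurableTypeR R] (EFin \o g) ->
    (\int[esd A]_x (g x)%:E = (avg (spectrum A) g)%:E)%E.
  move=> g0 mg; rewrite /esd ge0_integral_mscale//; last by move=> x _; rewrite lee_fin.
  rewrite ge0_integral_measure_sum//; last by move=> x _; rewrite lee_fin.
  under eq_bigr do rewrite integral_dirac// diracT mul1e.
  by rewrite sumEFin -EFinM /avg size_spectrum spectrum_sum.
pose fp (x : R) := Num.max (f x) 0; pose fn (x : R) := Num.max (- f x) 0.
have fpE : (EFin \o f)^\+%E = EFin \o fp by apply/funext => x; rewrite /= EFin_max unlock.
have fnE : (EFin \o f)^\-%E = EFin \o fn by apply/funext => x; rewrite /= EFin_max unlock.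
transitivity (\int[esd A]_x (EFin \o f) x)%E; first by [].
rewrite integralE fpE fnE.
rewrite (ge0 fp); last 2 first.
- by move=> x; rewrite le_max lexx orbT.
- by rewrite -fpE; exact: measurable_funepos.
rewrite (ge0 fn); last 2 first.
- by move=> x; rewrite le_max lexx orbT.
- by rewrite -fnE; exact: measurable_funeneg.
rewrite -EFinB /avg -mulrBr -sumrB; congr ((_ * _)%:E); apply: eq_bigr => x _.
by rewrite /fp /fn /Num.max; do 2 case: ifPn; rewrite -?leNgt; lra.
Qed.

End spectra.

Section sign_model.
Context {R : realType} (I : finType).
Local Notation C := R[i].

Definition sign_moment (p q : nat) : C := (~~ odd (p + q))%:R.

Lemma unimodular_sign_moments : unimodular_moments sign_moment.
Proof.
split; rewrite /sign_moment //=.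
- by move=> p q; rewrite addnS /= negbK.
- by move=> p q; case: odd; rewrite ?normr0 ?normr1.
Qed.

(** Random signs are a finite model of a centred unimodular variable. *)
Definition sign_entry (s : {ffun I -> bool}) (i : I) : C := if s i then 1 else -1.

Definition sign_mean (f : {ffun I -> bool} -> C) : C := (2 ^ #|I|)%:R^-1 * \sum_s f s.

(** Uniform signs are independent: the mean over all sign functions is a product
    of means over single signs. *)
Lemma sign_moment_model : moment_model sign_moment sign_entry sign_mean.
Proof.
move=> J c D U; rewrite /sign_mean exchange_big mulr_sumr; apply: eq_bigr => j _.
rewrite -mulr_sumr mulrCA; congr (_ * _).
rewrite (edge_moment_sup unimodular_sign_moments (index_enum_uniq I)) => [|e _];
  last exact: mem_index_enum.
pose g i (b : bool) : C := (if b then 1 else -1) ^+ (count_mem i (D j) + count_mem i (U j)).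
have -> : \sum_s monomial (sign_entry s) (D j) (U j) = \prod_i \sum_(b : bool) g i b.
  rewrite bigA_distr_bigA; apply: eq_bigr => s _; rewrite monomial_count.
  apply: eq_bigr => i _; rewrite /g /sign_entry exprD; congr (_ ^+ _ * _).
  by case: (s i); rewrite ?rmorphN rmorph1.
have -> : ((2 ^ #|I|)%:R : C)^-1 = \prod_(i : I) 2^-1.
  by rewrite prodr_const natrX exprVn.
rewrite -big_split /=; apply: eq_bigr => i _.
rewrite big_bool /g /sign_moment expr1n -signr_odd; case: odd => /=.
  by rewrite expr1 subrr mulr0.
by rewrite expr0 -mulr2n -[1 *+ 2]/(2%:R) mulVf// pnatr_eq0.
Qed.

End sign_model.

Section growth.
Context {R : realType}.

Lemma expn_le_fact p : (p%:R ^+ p : R) <= expR 1 ^+ p * p`!%:R.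
Proof.
elim: p => [|p IH]; first by rewrite !expr0 mul1r.
rewrite factS natrM exprS exprS.
have [->|p0] := posnP p; first by rewrite fact0 !expr0 !mulr1; have := expR_ge1Dx (1 : R); lra.
have pR : 0 < p%:R :> R by rewrite ltr0n.
have h : p.+1%:R ^+ p <= expR 1 * p%:R ^+ p :> R.
  have -> : p.+1%:R ^+ p = (1 + p%:R^-1) ^+ p * p%:R ^+ p :> R.
    by rewrite -exprMn mulrDl mul1r mulVf ?gt_eqF// -natr1 addrC.
  rewrite ler_wpM2r ?exprn_ge0//.
  have -> : expR 1 = expR (p%:R^-1) ^+ p :> R by rewrite -expRM_natl mulfV ?gt_eqF.
  by rewrite lerXn2r ?nnegrE ?addr_ge0 ?expR_ge0 ?invr_ge0// expR_ge1Dx.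
rewrite [leRHS]mulrACA [expR 1 * _]mulrC -[leRHS]mulrA ler_wpM2l//.
by rewrite (le_trans h)// ler_wpM2l ?expR_ge0.
Qed.

(** The degrees add up to the length p and each is at most p. *)
Lemma prod_degree_le (mq : nat -> R) (A : R) a : 0 < A -> canonical_seq a ->
  (forall q : nat, (0 < q)%N -> `|mq q| <= A ^+ q * q%:R ^+ q) ->
  `|\prod_(1 <= t < (size (undup a)).+1) mq (deg t a)| <= (A * (size a)%:R) ^+ size a.
Proof.
move=> A0 ca hmq.
have pE : perm_eq (undup a) (index_iota 1 (size (undup a)).+1).
  apply: uniq_perm; rewrite ?undup_uniq ?iota_uniq// => x.
  by rewrite mem_undup /index_iota subSS subn0 -canonical_max// -canonical_firsts// mem_firsts.
rewrite -(perm_big _ pE) /= normr_prod.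
rewrite [leRHS](_ : _ = \prod_(t <- undup a) (A * (size a)%:R) ^+ count_mem t a); last first.
  rewrite (prodr_undup_exp_count a xpredT (fun=> A * (size a)%:R)).
  by rewrite big_const_seq count_predT -Monoid.iteropE.
rewrite [leLHS]big_seq [leRHS]big_seq; apply: ler_prod => t; rewrite mem_undup => ta.
rewrite normr_ge0 /=; have t0 : (0 < deg t a)%N by rewrite /deg -has_count has_pred1.
rewrite (le_trans (hmq _ t0))// exprMn ler_wpM2l ?exprn_ge0 ?(ltW A0)//.
by rewrite lerXn2r ?nnegrE// ler_nat count_size.
Qed.

(** There are as many terms as in narayana, whose value is the moment of a law
    on [0, b]; each is at most (A p)^p, and p^p <= e^p p!. *)
Lemma limit_moment_growth (mq : nat -> R) (c A : R) p : 0 < c -> 0 < A -> (0 < p)%N ->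
  (forall q : nat, (0 < q)%N -> `|mq q| <= A ^+ q * q%:R ^+ q) ->
  `|limit_moment mq c p| <= (A * expR 1 * mp_right c) ^+ p * p`!%:R.
Proof.
move=> c0 A0 p0 hmq; rewrite /limit_moment.
have nE : narayana c p = \sum_(a <- canonical_words p | noncrossing a) c ^+ size (undup a).
  by rewrite /narayana /noncrossing_words -(prednK p0) big_filter.
have nb : narayana c p <= mp_right c ^+ p.
  by rewrite -mp_moment_narayana// (le_trans (ler_norm _))// mp_moment_le.
apply: le_trans (ler_norm_sum _ _ _) _.
apply: le_trans (_ : \sum_(a <- canonical_words p | noncrossing a) c ^+ size (undup a) * (A * p%:R) ^+ p <= _).
  rewrite big_seq_cond [leRHS]big_seq_cond; apply: ler_sum => a /andP[ain _].
  have [ap ca _] := canonical_wordsP p0 ain.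
  rewrite normrM ger0_norm ?exprn_ge0 ?(ltW c0)// ler_wpM2l ?exprn_ge0 ?(ltW c0)//.
  by have := prod_degree_le A0 ca hmq; rewrite ap.
rewrite -mulr_suml -nE exprMn.
have -> : (A * expR 1 * mp_right c) ^+ p * p`!%:R = mp_right c ^+ p * (A ^+ p * (expR 1 ^+ p * p`!%:R)).
  by rewrite !exprMn; ring.
have b0 : 0 <= mp_right c by exact: sqr_ge0.
apply: le_trans (ler_wpM2r _ nb) _; first by rewrite mulr_ge0 ?exprn_ge0 ?(ltW A0).
by rewrite ler_wpM2l ?exprn_ge0// ler_wpM2l ?exprn_ge0 ?(ltW A0)// expn_le_fact.
Qed.

End growth.

(** * Existence of the limit law and almost sure convergence *)

Section limit_law.
Context {R : realType}.
Local Notation C := R[i].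
Local Open Scope complex_scope.

(** The value at 0 makes this the moment sequence of a probability measure. *)
Definition law_moment (mq : nat -> R) (c : R) (p : nat) : R :=
  if p is 0 then 1 else limit_moment mq c p.

Lemma law_moment_growth (mq : nat -> R) (c A : R) : 0 < c -> 0 < A ->
  (forall q : nat, (0 < q)%N -> `|mq q| <= A ^+ q * q%:R ^+ q) ->
  exists2 K : R, 1 <= K & forall p, `|law_moment mq c p| <= K ^+ p * p`!%:R.
Proof.
move=> c0 A0 hmq; pose B := A * expR 1 * mp_right c.
have B0 : 0 <= B by rewrite !mulr_ge0 ?expR_ge0 ?(ltW A0)//; exact: sqr_ge0.
exists (1 + B); first by rewrite lerDl.
case=> [|p] /=; first by rewrite expr0 fact0 mulr1 normr1.
apply: le_trans (limit_moment_growth c0 A0 (ltn0Sn p) hmq) _.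
by rewrite ler_wpM2r ?ler0n// lerXn2r ?nnegrE ?addr_ge0 ?lerDr.
Qed.

Lemma state_average (S : finType) (L : S -> (R -> R) -> R) (N : nat) : #|S| = N -> (0 < N)%N ->
  (forall s, state (L s)) -> state (fun f => N%:R^-1 * \sum_s L s f).
Proof.
move=> SN N0 sL; have NR : 0 < N%:R :> R by rewrite ltr0n.
split => [a f g pf pg|f g pf pg fg|].
- under eq_bigr do rewrite (state_linear (sL _))//.
  by rewrite big_split /= -mulr_sumr; ring.
- rewrite ler_wpM2l ?invr_ge0 ?(ltW NR)//; apply: ler_sum => s _.
  exact: (state_le (sL s)).
- under eq_bigr do rewrite (state_one (sL _)).
  by rewrite sumr_const SN mulVf// gt_eqF.
Qed.

Lemma spectrum_state n k m (tau : nat -> R) (x : 'I_m -> 'I_k -> 'I_n -> C) : (0 < n ^ k)%N ->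
  state (avg (spectrum (Mmx tau x))).
Proof. by move=> N0; apply: avg_state; rewrite -size_eq0 size_spectrum -lt0n. Qed.

(** The matrices with k = n levels, m the integer part of c n^n terms and random
    signs as entries have averaged spectra with the right limiting moments. *)
Theorem law_exists (tau mq : nat -> R) (c : R) : 0 < c ->
  (forall q : nat, (0 < q)%N -> j%:R^-1 * power_sum tau j q @[j --> \oo] --> mq q) ->
  exists mu : probability (measurableTypeR R) R,
    forall p : nat, mu.-integrable [set: R] (fun x : R => (x ^+ p)%:E) /\
      (\int[mu]_x ((x : R) ^+ p)%:E = (law_moment mq c p)%:E)%E.
Proof.
move=> c0 htau; pose m n := Num.truncn (c * (n ^ n)%N%:R).
have N0 n : (0 < n ^ n)%N by case: n => // n; rewrite expn_gt0.
have Nge n : (n <= n ^ n)%N by case: n => // n; rewrite -{1}[n.+1]expn1 leq_pexp2l.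
have mB n : c * (n ^ n)%N%:R - 1 <= (m n)%:R <= c * (n ^ n)%N%:R.
  have := truncn_itv (_ : 0 <= c * (n ^ n)%N%:R); rewrite -/(m n) => /(_ _)/andP[].
    by rewrite mulr_ge0 ?ler0n ?(ltW c0).
  by rewrite -natr1 => h1 h2; apply/andP; split; lra.
have hk : (fun n : nat => n) n @[n --> \oo] --> \oo by exact: cvg_id.
have hm : m n @[n --> \oo] --> \oo.
  apply/cvgnyPge => a; exists (Num.truncn ((a%:R + 1) / c)).+1 => // n /= an.
  rewrite -(ler_nat R); have /andP[h _] := mB n; apply: le_trans h.
  rewrite lerBrDr -ler_pdivrMl// mulrC (le_trans (ltW (truncnS_gt _)))// ler_nat.
  exact: leq_trans an (Nge n).
have hc : (m n)%:R / (n ^ n)%N%:R @[n --> \oo] --> c.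
  rewrite -[X in _ --> X]subr0; have -> : (fun n => (m n)%:R / (n ^ n)%N%:R) =
     (fun n => c - (c - (m n)%:R / (n ^ n)%N%:R)) by apply/funext => n; rewrite subKr.
  apply: cvgB; first exact: cvg_cst.
  apply: (@cvg0_dominated _ _ (fun n => n%:R^-1)); last exact: cvg_natV.
  exists 1%N => // n /= n1; have NR : 0 < (n ^ n)%N%:R :> R by rewrite ltr0n.
  have nR : 0 < n%:R :> R by rewrite ltr0n.
  have /andP[h1 h2] := mB n.
  have -> : c - (m n)%:R / (n ^ n)%N%:R = (c * (n ^ n)%N%:R - (m n)%:R) / (n ^ n)%N%:R.
    by field; rewrite gt_eqF.
  rewrite ger0_norm; last by rewrite divr_ge0 ?(ltW NR)// subr_ge0.
  apply: le_trans (_ : 1 / (n ^ n)%N%:R <= _).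
    by rewrite ler_wpM2r ?invr_ge0 ?(ltW NR)//; lra.
  by rewrite mul1r lef_pV2 ?posrE// ler_nat.
pose I n := ('I_(m n) * 'I_n * 'I_n)%type.
pose A n (s : {ffun I n -> bool}) := Mmx tau (fun a l j => sign_entry (R := R) s (a, l, j)).
pose Ln n f : R := (2 ^ #|{: I n}|)%:R^-1 * \sum_(s : {ffun I n -> bool}) avg (spectrum (A n s)) f.
have sLn n : state (Ln n).
  apply: state_average; [by rewrite card_ffun card_bool|by rewrite expn_gt0|].
  by move=> s; exact: spectrum_state.
apply: (@moment_limit_measure _ Ln) => // -[|p].
  have -> : (fun n => Ln n (fun x => x ^+ 0)) = (fun=> 1).
    by apply/funext => n; rewrite -(state_one (sLn n)).
  exact: cvg_cst.
have := mean_moment_cvg (unimodular_sign_moments (R := R)) htau hk hm hc (ltn0Sn p).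
apply: cvg_trans; apply: near_eq_cvg; apply: nearW => n.
rewrite -(mean_trace (unimodular_sign_moments (R := R)) (@sign_moment_model R (I n)) tau (ltn0Sn p)).
rewrite /Ln /sign_mean natrC -fmorphV ReM_real Re_sum mulrCA mulr_sumr; congr (_ * _).
by apply: eq_bigr => s _; rewrite spectrum_moment.
Qed.

(** A deterministic statement, applied to almost every realisation. *)
Lemma esd_weak_cvg (nu : {measure set (measurableTypeR R) -> \bar R}) (M : nat -> R) (K : R)
    (k m : nat -> nat) (tau : nat -> R) (x : forall n, 'I_(m n) -> 'I_(k n) -> 'I_n -> C) :
  nu [set: R] = 1%E ->
  (forall p : nat, nu.-integrable [set: R] (fun x : R => (x ^+ p)%:E)) ->
  (forall p : nat, (\int[nu]_x (x : R) ^+ p)%R = M p) ->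
  1 <= K -> (forall p, `|M p| <= K ^+ p * p`!%:R) ->
  (forall p, (0 < p)%N -> avg (spectrum (Mmx tau (x n))) (fun t => t ^+ p) @[n --> \oo] --> M p) ->
  weak_cvg (fun n => esd (Mmx tau (x n))) nu.
Proof.
move=> nu1 inu nuM K1 MK cM f cf [B fB].
have sL := measure_state nu1 inu.
have pf := poly_growth_bounded cf fB.
pose Ln n := avg (spectrum (Mmx tau (x n.+1))).
have sLn n : state (Ln n) by apply: spectrum_state; rewrite expn_gt0.
under eq_fun do rewrite integral_esd//.
rewrite integral_Rintegral; last exact: poly_growth_integrable.
apply: cvg_EFin; first exact: nearW.
rewrite -cvg_shiftS.
apply: (moment_cvg_weak sLn sL _ _ K1 cf fB) => p; last by rewrite nuM.
rewrite nuM; case: p => [|p].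
  have -> : (fun n => Ln n (fun x => x ^+ 0)) = (fun=> 1).
    by apply/funext => n; rewrite -(state_one (sLn n)).
  by rewrite -(nuM 0%N) -(state_one sL); exact: cvg_cst.
have := cM p.+1 (ltn0Sn p); rewrite -cvg_shiftS; exact.
Qed.

End limit_law.

Section almost_sure.
Context {R : realType} {d : measure_display} {T : measurableType d}.
Local Notation C := R[i].
Local Open Scope complex_scope.
Variables (P : probability T R) (tau mq : nat -> R) (c : R).
Variables (xi : {RV P >-> C}) (k m : nat -> nat).
Variable X : forall n : nat, 'I_(m n) * 'I_(k n) * 'I_n -> {RV P >-> C}.
Arguments X : clear implicits.
Hypothesis htau : forall q : nat, (0 < q)%N ->
  j%:R^-1 * power_sum tau j q @[j --> \oo] --> mq q.
Hypothesis hxi : centered_unit_variance xi.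
Hypothesis hxi1 : {ae P, forall w, `|xi w| = 1}.
Hypothesis hX : forall n, iid_copies xi (X n).
Hypothesis hk : k n @[n --> \oo] --> \oo.
Hypothesis hm : m n @[n --> \oo] --> \oo.
Hypothesis hc : (m n)%:R / (n ^ k n)%N%:R @[n --> \oo] --> c.

Definition unimodular_matrix n w := Mmx tau (fun a l j => unimod (X n (a, l, j) w)).

Let hmu := unimodular_joint_moments hxi hxi1.
Let model n := iid_moment_model (hX n) hmu.

Lemma trace_bounded n p : (0 < p)%N -> complex_bounded (fun w => \tr (unimodular_matrix n w ^+ p)).
Proof.
move=> p0.
have E w := trace_word_expansion (fun w i => unimod (X n i w)) tau w p0.
rewrite (_ : (fun w => _) = (fun w => \sum_(u : p.-tuple 'I_(m n)) word_weight n (k n) tau p u *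
   \prod_(l < k n) \sum_(i : p.-tuple 'I_n)
    monomial (fun q => unimod (X n (q.1, l, q.2) w)) (downs u i) (ups u i))); last exact/funext.
apply: complex_bounded_sum => u; apply: complex_boundedM; first exact: complex_bounded_cst.
apply: complex_bounded_prod => l; apply: complex_bounded_sum => i.
have := unimod_monomial_bounded (X n) (map (fun q : 'I_(m n) * 'I_n => (q.1, l, q.2)) (downs u i))
  (map (fun q : 'I_(m n) * 'I_n => (q.1, l, q.2)) (ups u i)).
by congr complex_bounded; apply/funext => w; rewrite monomial_map.
Qed.

(** The mean converges and the deviation from it has summable variance. *)
Lemma spectral_moment_ae p : (0 < p)%N ->
  {ae P, forall w, avg (spectrum (unimodular_matrix n w)) (fun t => t ^+ p)
    @[n --> \oo] --> limit_moment mq c p}.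
Proof.
move=> p0; pose Z n w : R := complex.Re (\tr (unimodular_matrix n w ^+ p)).
pose N n : R := (n ^ k n)%N%:R.
have bZ n : bounded_measurable (Z n) by case: (trace_bounded n p0).
have trZ n w : \tr (unimodular_matrix n w ^+ p) = (Z n w)%:C.
  by rewrite /Z -esd_moment.
have mZ n : (mean P (Z n))%:C = \sum_(w : p.-tuple 'I_(m n)) word_weight n (k n) tau p w *
    walk_sum (joint_moment xi) n p w ^+ k n.
  rewrite -(mean_trace hmu (@model n) tau p0) -complex_mean_real; congr complex_mean.
  by apply/funext => w; rewrite -trZ.
have mZ2 n : (mean P (fun w => Z n w ^+ 2))%:C =
    \sum_(w : p.-tuple 'I_(m n)) \sum_(w' : p.-tuple 'I_(m n))
    word_weight n (k n) tau p w * word_weight n (k n) tau p w' *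
    walk_pair_sum (joint_moment xi) n p p w w' ^+ k n.
  rewrite -(mean_trace_sqr hmu (@model n) tau p0) -complex_mean_real; congr complex_mean.
  apply/funext => w; have E := trZ n w; rewrite /unimodular_matrix in E.
  by rewrite E; exact: (rmorphXn (real_complex R)).
pose V n w : R := (N n)^-1 * Z n w + - ((N n)^-1 * mean P (Z n)).
have bV n : bounded_measurable (V n).
  by apply: bounded_measurable_linear => //; exact: bounded_measurable_cst.
have cm : (N n)^-1 * mean P (Z n) @[n --> \oo] --> limit_moment mq c p.
  have := mean_moment_cvg hmu htau hk hm hc p0; apply: cvg_trans; apply: near_eq_cvg.
  by apply: nearW => n; rewrite -mZ.
have [B B0 HB] := variance_bound hmu htau hk hm hc p0.
have vV : \forall n \near \oo, mean P (fun w => V n w ^+ 2) <= B * n%:R^-1 ^+ 2.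
  near=> n; have n1 : (1 <= n)%N by near: n; exact: nbhs_infty_ge.
  have NR : 0 < N n by rewrite ltr0n expn_gt0 n1.
  have h : `|mean P (fun w => Z n w ^+ 2) - mean P (Z n) ^+ 2| <= B * n%:R^-1 ^+ 2 * N n ^+ 2.
    have : `|(mean P (fun w => Z n w ^+ 2))%:C - (mean P (Z n))%:C ^+ 2| <=
       (B * (n%:R)^-1 ^+ 2 * N n ^+ 2)%:C by rewrite mZ mZ2; near: n; exact: HB.
    by rewrite -(rmorphXn (real_complex R)) -(rmorphB (real_complex R)) => /Re_norm_le.
  have bZ2 : bounded_measurable (fun w => Z n w ^+ 2).
    by under eq_fun do rewrite expr2; exact: bounded_measurableM.
  have -> : mean P (fun w => V n w ^+ 2) =
     ((N n)^-1) ^+ 2 * (mean P (fun w => Z n w ^+ 2) - mean P (Z n) ^+ 2).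
    set e := mean P (Z n).
    have -> : (fun w => V n w ^+ 2) = (fun w => ((N n)^-1) ^+ 2 * Z n w ^+ 2 +
       (- (2 * ((N n)^-1) ^+ 2 * e) * Z n w + ((N n)^-1) ^+ 2 * e ^+ 2)).
      by apply/funext => w; rewrite /V -/e; ring.
    rewrite !mean_linear ?mean_cst//; first by rewrite -/e; ring.
    - exact: bounded_measurable_cst.
    - by apply: bounded_measurable_linear => //; exact: bounded_measurable_cst.
  rewrite exprVn mulrC ler_pdivrMr ?exprn_gt0//.
  exact: le_trans (ler_norm _) h.
have := ae_cvg0 B0 bV vV; apply: filterS => w Vw.
have -> : (fun n => avg (spectrum (unimodular_matrix n w)) (fun t => t ^+ p)) =
   (fun n => V n w + (N n)^-1 * mean P (Z n)).
  by apply/funext => n; rewrite spectrum_moment /V subrK.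
by rewrite -[X in _ --> X]add0r; exact: cvgD.
Unshelve. all: by end_near. Qed.

(** Countably many null sets are discarded: those where some moment fails to
    converge and those where some entry is not unimodular. *)
Lemma esd_ae_weak_cvg (nu : {measure set (measurableTypeR R) -> \bar R}) (K : R) :
  nu [set: R] = 1%E ->
  (forall p : nat, nu.-integrable [set: R] (fun x : R => (x ^+ p)%:E)) ->
  (forall p : nat, (\int[nu]_x (x : R) ^+ p)%R = law_moment mq c p) ->
  1 <= K -> (forall p, `|law_moment mq c p| <= K ^+ p * p`!%:R) ->
  {ae P, forall w, weak_cvg (fun n => esd (Mmx tau (fun a l j => X n (a, l, j) w))) nu}.
Proof.
move=> nu1 inu nuM K1 MK.
have h1 : {ae P, forall w, forall n i, `|X n i w| = 1}.
  by apply: ae_foralln => n; exact: (iid_ae_unimodular hxi1 (hX n)).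
have h2 : {ae P, forall w, forall p, avg (spectrum (unimodular_matrix n w)) (fun t => t ^+ p.+1)
    @[n --> \oo] --> limit_moment mq c p.+1}.
  by apply: ae_foralln => p; exact: spectral_moment_ae.
apply: filterS2 h1 h2 => w X1 Zp.
pose x n (a : 'I_(m n)) (l : 'I_(k n)) (j : 'I_n) := X n (a, l, j) w.
refine (@esd_weak_cvg R nu (law_moment mq c) K k m tau x nu1 inu nuM K1 MK _).
have xE n : Mmx tau (x n) = unimodular_matrix n w.
  congr Mmx; apply/funext => a; apply/funext => l; apply/funext => j.
  by rewrite /x unimod_id.
move=> p p0; have -> : law_moment mq c p = limit_moment mq c p by case: (p) p0.
have := Zp p.-1; rewrite (prednK p0).
move=> h; apply: cvg_trans h; apply: near_eq_cvg; apply: nearW => n.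
by rewrite xE.
Qed.

End almost_sure.

(** All limits m_q are 1, so each noncrossing word with s letters has weight c^s. *)
Lemma constant_weights_law (R : realType) (tau mq : nat -> R) (c : R) :
  (forall a, tau a = 1) ->
  (forall q : nat, (0 < q)%N -> j%:R^-1 * power_sum tau j q @[j --> \oo] --> mq q) ->
  forall p, law_moment mq c p = narayana c p.
Proof.
move=> tau1 htau.
have mq1 q : (0 < q)%N -> mq q = 1.
  move=> q0; have one : j%:R^-1 * power_sum tau j q @[j --> \oo] --> (1 : R).
    apply: cvg_near_cst; exists 1%N => // j /= j1.
    rewrite /power_sum; under eq_bigr do rewrite tau1 expr1n.
    by rewrite sumr_const card_ord mulVf// pnatr_eq0 -lt0n.
  exact: (cvg_unique _ (htau q q0) one).
case=> [|p]; first by rewrite narayana0.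
rewrite /law_moment /limit_moment /narayana /noncrossing_words big_filter.
rewrite big_seq_cond [RHS]big_seq_cond; apply: eq_bigr => a /andP[ain _].
have [ap ca _] := canonical_wordsP (ltn0Sn p) ain.
rewrite big_nat_cond big1 ?mulr1// => t /andP[/andP[t1 t2] _]; apply: mq1.
by rewrite /deg -has_count has_pred1 -mem_firsts canonical_firsts// mem_iota t1 canonical_max.
Qed.

(** * The limiting spectral distribution *)

Theorem corollary1p1 (R : realType) (tau mq : nat -> R) (c A : R)
  (hc : 0 < c) (hA : 0 < A)
  (htau : forall q : nat, (0 < q)%N ->
     (m%:R)^-1 * (\sum_(j < m) tau j ^+ q) @[m --> \oo] --> mq q)
  (hmq : forall q : nat, (0 < q)%N -> `|mq q| <= A ^+ q * q%:R ^+ q) :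
  exists mu : probability (measurableTypeR R) R,
    (forall p : nat, (0 < p)%N ->
       mu.-integrable [set: R] (fun x : R => (x ^+ p)%:E) /\
       (\int[mu]_x ((x : R) ^+ p)%:E =
          (\sum_(1 <= s < p.+1) c ^+ s *
             \sum_(a in Cseq1 s p)
               \prod_(1 <= t < s.+1) mq (deg t (vals a)))%:E)%E) /\
    (forall (d : measure_display) (T : measurableType d) (P : probability T R)
       (xi : {RV P >-> R[i]}) (k m : nat -> nat)
       (X : forall n : nat, 'I_(m n) * 'I_(k n) * 'I_n -> {RV P >-> R[i]}),
       centered_unit_variance xi ->
       {ae P, forall w, `|xi w| = 1} ->
       (forall n : nat, iid_copies xi (X n)) ->
       k n @[n --> \oo] --> \oo ->
       m n @[n --> \oo] --> \oo ->
       (m n)%:R / (n ^ k n)%N%:R @[n --> \oo] --> c ->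
       let M (n : nat) (w : T) :=
         Mmx tau (fun a l j => X n (a, l, j) w) in
       {ae P, forall w, weak_cvg (fun n => esd (M n w)) mu} /\
       ((forall n a : nat, (a < m n)%N -> tau a = 1) ->
        {ae P, forall w,
           weak_cvg (fun n => esd (M n w)) (marchenko_pastur c)})).
Proof.
have [mu Hmu] := law_exists hc htau.
have [K K1 HK] := law_moment_growth hc hA hmq.
have mu1 : mu [set: R] = 1%E := probability_setT mu.
have int_mu p : mu.-integrable [set: R] (fun x : R => (x ^+ p)%:E) by case: (Hmu p).
have muM p : (\int[mu]_x (x : R) ^+ p)%R = law_moment mq c p.
  by rewrite /Rintegral; have [_ ->] := Hmu p.
exists mu; split.
  move=> [//|p] _; split; first exact: int_mu.
  have [_ ->] := Hmu p.+1; congr (_%:E); rewrite /= /limit_moment.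
  rewrite -(sum_Cseq1 (fun s a => c ^+ s * \prod_(1 <= t < s.+1) mq (deg t a)))//.
  by apply: eq_bigr => s _; rewrite mulr_sumr.
move=> d T P xi k m X hxi hxi1 hX hk hm hcv M; split.
  exact: (esd_ae_weak_cvg htau hxi hxi1 hX hk hm hcv mu1 int_mu muM K1 HK).
move=> tau1.
(* m is unbounded, so each index a is below some m n *)
have tau1' a : tau a = 1.
  move/cvgnyPgt : hm => /(_ a)[n0 _ h].
  exact: (tau1 n0 a (h n0 (leqnn n0))).
apply: (esd_ae_weak_cvg htau hxi hxi1 hX hk hm hcv (mp_mass hc) (mp_integrable hc) _ K1 HK) => p.
by rewrite (constant_weights_law c tau1' htau) -(mp_moment_narayana hc).
Qed.
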